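(* Let $\Sigma(A,B,C,\mathbf{G})$ be a system node on $(U,X,Y)$ with finite-dimensional input space $U$ and finite-dimensional output space $Y$. Then $\Sigma(A,B,C,\mathbf{G})$ is $C^\infty$-BIBO stable if and only if there exists a measure of bounded total variation $h\in\mathcal{M}([0,\infty),\mathbb{C}^{d_Y\times d_U})$ such that $\mathcal{L}\{h\}=\mathbf{G}$ on the half-plane $\mathbb{C}_{\omega(\mathbb{T})}$.
   Context: All Banach spaces are complex. $\mathbb{C}_\alpha=\{z\in\mathbb{C}:\operatorname{Re}z>\alpha\}$. For the generator $A$ of a strongly continuous semigroup $\mathbb{T}=(\mathbb{T}(t))_{t\ge0}$ on a Banach space $X$, $\omega(\mathbb{T})=\inf\{\omega\in\mathbb{R}:\sup_{t>0}e^{-t\omega}\|\mathbb{T}(t)\|<\infty\}$ is its growth bound. $X_1$ is $D(A)$ with norm $\|(\beta I-A)x\|_X$ and $X_{-1}$ is the completion of $X$ with respect to $\|(\beta I-A)^{-1}x\|_X$, for a fixed $\beta\in\rho(A)$. The semigroup extends uniquely to a strongly continuous semigroup on $X_{-1}$ whose generator $X\to X_{-1}$ extends $A$; the extensions are again denoted $\mathbb{T}$ and $A$. System node: for Banach spaces $U,X,Y$, a system node on $(U,X,Y)$ is a collection $\Sigma(A,B,C,\mathbf{G})$ where $A:D(A)\subset X\to X$ generates a strongly continuous semigroup $\mathbb{T}$ on $X$, $B\in\mathcal{L}(U,X_{-1})$, $C\in\mathcal{L}(X_1,Y)$, and $\mathbf{G}:\mathbb{C}_{\omega(\mathbb{T})}\to\mathcal{L}(U,Y)$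 is analytic with $\mathbf{G}(\alpha)-\mathbf{G}(\beta)=C[(\alpha I-A)^{-1}-(\beta I-A)^{-1}]B$ for all $\alpha,\beta\in\mathbb{C}_{\omega(\mathbb{T})}$. Combined observation/feedthrough operator: $C\&D\begin{bmatrix}x\\ u\end{bmatrix}=C[x-(\beta I-A)^{-1}Bu]+\mathbf{G}(\beta)u$ with $\beta\in\mathbb{C}_{\omega(\mathbb{T})}$ (independent of the choice of $\beta$) and domain $D(C\&D)=\{\begin{bmatrix}x\\ u\end{bmatrix}\in X\times U: Ax+Bu\in X\}$. Classical solution: a triple $(u,x,y)$ with $u\in C([0,\infty),U)$, $x\in C^1([0,\infty),X)$, $y\in C([0,\infty),Y)$, $\begin{bmatrix}x(t)\\ u(t)\end{bmatrix}\in D(C\&D)$ for all $t\ge0$, and $\dot x(t)=Ax(t)+Bu(t)$, $y(t)=C\&D\begin{bmatrix}x(t)\\ u(t)\end{bmatrix}$ for all $t\ge0$. $C^\infty$-BIBO stability: there exists $c>0$ such that for all classical solutions $(u,x,y)$ with $x(0)=0$ and $u\in C_c^\infty((0,\infty),U)$ one has $y\in C_b([0,\infty),Y)$ and $\|y\|_{L^\infty([0,\infty),Y)}\le c\|u\|_{L^\infty([0,\infty),U)}$. $d_U=\dim U$, $d_Y=\dim Y$, and $U,Y$ are identified with $\mathbb{C}^{d_U},\mathbb{C}^{d_Y}$. $\mathcal{M}([0,\infty),\mathbb{C}^{d_Y\times d_U})$ is the set of $\mathbb{C}^{d_Y\times d_U}$-valued Borel measures of bounded total variation on $[0,\infty)$.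 $\mathcal{L}\{h\}$ is the Laplace transform $s\mapsto\int_{[0,\infty)}e^{-st}\,h(\mathrm{d}t)$. In general it exists only on $\mathbb{C}_0$; the equality $\mathcal{L}\{h\}=\mathbf{G}$ on $\mathbb{C}_{\omega(\mathbb{T})}$ means equality on $\mathbb{C}_0\cap\mathbb{C}_{\omega(\mathbb{T})}$, with $\mathcal{L}\{h\}$ identified with its resulting analytic continuation to $\mathbb{C}_{\omega(\mathbb{T})}$. *)

(* Defs.v *)
From HB Require Import structures.
From mathcomp Require Import all_boot all_order all_algebra.
From mathcomp Require Import complex.
From mathcomp Require Import all_classical all_reals all_analysis.
From mathcomp Require Import ess_sup_inf charge.

Set Implicit Arguments.
Unset Strict Implicit.
Unset Printing Implicit Defensive.

Import Order.TTheory GRing.Theory Num.Theory.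
Import numFieldNormedType.Exports.

Local Open Scope classical_set_scope.
Local Open Scope ring_scope.
Local Open Scope complex_scope.

(* Complex Banach spaces are [completeNormedModType R[i]].  Functions on
   [0, oo) are total functions on R of which only the values at t >= 0 matter;
   likewise, only the values of G on the half-plane C_omega(T) and those of C
   on D(A) matter. *)

(* The norm of a normed module over R[i] takes its values in R[i]. *)
Definition rnorm (R : realType) (E : normedModType R[i]) (x : E) : R :=
  complex.Re `|x|.

Definition op_norm (R : realType) (E F : normedModType R[i]) (f : E -> F) : R :=
  sup [set rnorm (f x) | x in [set x : E | rnorm x <= 1]].

Definition half_line (R : realType) : set R := [set t | 0 <= t].

(* C_a; the abscissa may be -oo because the growth bound may be -oo. *)
Definition half_plane (R : realType) (a : \bar R) : set R[i] :=
  [set z | (a < (complex.Re z)%:E)%E].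

(* One-sided at t = 0. *)
Definition has_derivative (R : realType) (E : normedModType R[i])
    (f : R -> E) (t : R) (l : E) : Prop :=
  ((s - t)^-1)%:C *: (f s - f t) @[s --> within (@half_line R) t^'] --> l.

Record semigroup (R : realType) (X : completeNormedModType R[i]) := {
  sg_op :> R -> {linear X -> X};
  sg_continuous : forall t, 0 <= t -> continuous (sg_op t);
  sg_0 : forall x, sg_op 0 x = x;
  sg_D : forall s t x, 0 <= s -> 0 <= t ->
    sg_op (s + t) x = sg_op s (sg_op t x);
  sg_strongly_continuous : forall x, sg_op t x @[t --> 0^'+] --> x
}.

(* The graph of the generator of T. *)
Definition generator_graph (R : realType) (X : completeNormedModType R[i])
    (T : semigroup X) (x y : X) : Prop :=
  (t^-1)%:C *: (T t x - x) @[t --> 0^'+] --> y.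

Record partial_operator (X : Type) := {
  dom : set X;
  op_fun :> X -> X
}.

Definition generates (R : realType) (X : completeNormedModType R[i])
    (A : partial_operator X) (T : semigroup X) : Prop :=
  forall x y, (dom A x /\ A x = y) <-> generator_graph T x y.

Definition growth_bound (R : realType) (X : completeNormedModType R[i])
    (T : semigroup X) : \bar R :=
  ereal_inf [set w%:E | w in [set w : R |
    has_ubound [set expR (- (t * w)) * op_norm (T t) | t in [set t | 0 < t]]]].

Definition resolvent_set (R : realType) (X : completeNormedModType R[i])
    (A : partial_operator X) : set R[i] :=
  [set z | exists Q : {linear X -> X}, [/\ continuous Q,
    forall y, dom A (Q y) /\ z *: Q y - A (Q y) = y &
    forall x, dom A x -> Q (z *: x - A x) = x]].

(* (z I - A)^-1; meaningful for z in the resolvent set. *)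
Definition resolvent (R : realType) (X : completeNormedModType R[i])
    (A : partial_operator X) (z : R[i]) (y : X) : X :=
  xget 0 [set x | dom A x /\ z *: x - A x = y].

(* X_{-1}: a completion of X for the norm |(beta I - A)^-1 x|, with the
   extension of the semigroup and its generator X -> X_{-1}.  The inclusion of
   X in X_{-1} is the isometry [ext_emb].  A completion is unique up to a
   unique isometric isomorphism, and the extensions are determined by it. *)
Record extrapolation (R : realType) (X : completeNormedModType R[i])
    (A : partial_operator X) (T : semigroup X) (beta : R[i]) := {
  ext_space : completeNormedModType R[i];
  ext_emb : {linear X -> ext_space};
  ext_emb_norm : forall x, rnorm (ext_emb x) = rnorm (resolvent A beta x);
  ext_emb_dense : dense (range ext_emb);
  ext_sg : semigroup ext_space;
  ext_sgE : forall t x, 0 <= t -> ext_sg t (ext_emb x) = ext_emb (T t x);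
  ext_op : {linear X -> ext_space};
  ext_opE : forall x, dom A x -> ext_op x = ext_emb (A x);
  ext_op_generates : forall z w,
    (exists2 x, ext_emb x = z & ext_op x = w) <-> generator_graph ext_sg z w
}.

(* (z I - A)^-1 : X_{-1} -> X for the extended operator. *)
Definition ext_resolvent (R : realType) (X : completeNormedModType R[i])
    (A : partial_operator X) (T : semigroup X) (beta : R[i])
    (E : extrapolation A T beta) (z : R[i]) (v : ext_space E) : X :=
  xget 0 [set x | z *: ext_emb E x - ext_op E x = v].

(* Holomorphy in the operator norm. *)
Definition analytic_on (R : realType) (U Y : normedModType R[i])
    (Omega : set R[i]) (G : R[i] -> {linear U -> Y}) : Prop :=
  forall s, Omega s -> exists2 D : {linear U -> Y}, continuous D &
    op_norm (fun u => (z - s)^-1 *: (G z u - G s u) - D u)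
      @[z --> (s : R[i]^o)^'] --> (0 : R).

Record system_node (R : realType) (U X Y : completeNormedModType R[i]) := {
  sn_A : partial_operator X;
  sn_T : semigroup X;
  sn_generates : generates sn_A sn_T;
  sn_beta : R[i];
  sn_beta_resolvent : resolvent_set sn_A sn_beta;
  sn_ext : extrapolation sn_A sn_T sn_beta;
  sn_B : {linear U -> ext_space sn_ext};
  sn_B_continuous : continuous sn_B;
  sn_C : X -> Y;
  sn_C_linear : forall (a : R[i]) x z, dom sn_A x -> dom sn_A z ->
    sn_C (a *: x + z) = a *: sn_C x + sn_C z;
  (* boundedness for the norm of X_1 *)
  sn_C_bounded : exists M : R, forall x, dom sn_A x ->
    rnorm (sn_C x) <= M * rnorm (sn_beta *: x - sn_A x);
  sn_G : R[i] -> {linear U -> Y};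
  sn_G_continuous : forall s, half_plane (growth_bound sn_T) s ->
    continuous (sn_G s);
  sn_G_analytic : analytic_on (half_plane (growth_bound sn_T)) sn_G;
  sn_GB : forall a b u,
    half_plane (growth_bound sn_T) a -> half_plane (growth_bound sn_T) b ->
    sn_G a u - sn_G b u =
      sn_C (ext_resolvent a (sn_B u) - ext_resolvent b (sn_B u))
}.

Definition CD_domain (R : realType) (U X Y : completeNormedModType R[i])
    (S : system_node U X Y) (x : X) (u : U) : Prop :=
  range (ext_emb (sn_ext S)) (ext_op (sn_ext S) x + sn_B S u).

Definition CD (R : realType) (U X Y : completeNormedModType R[i])
    (S : system_node U X Y) (b : R[i]) (x : X) (u : U) : Y :=
  sn_C S (x - ext_resolvent b (sn_B S u)) + sn_G S b u.

(* [CD] does not depend on b in C_omega(T). *)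
Definition classical_solution (R : realType)
    (U X Y : completeNormedModType R[i]) (S : system_node U X Y)
    (u : R -> U) (x : R -> X) (y : R -> Y) : Prop :=
  [/\ {within @half_line R, continuous u},
      {within @half_line R, continuous y} &
      exists dx : R -> X,
      [/\ {within @half_line R, continuous dx},
          forall t, 0 <= t -> has_derivative x t (dx t),
          forall t, 0 <= t -> CD_domain S (x t) (u t),
          forall t, 0 <= t ->
            ext_emb (sn_ext S) (dx t) = ext_op (sn_ext S) (x t) + sn_B S (u t) &
          forall t, 0 <= t -> forall b, half_plane (growth_bound (sn_T S)) b ->
            y t = CD S b (x t) (u t)]].

(* F n is the n-th derivative of f. *)
Definition smooth_on_pos (R : realType) (E : normedModType R[i])
    (f : R -> E) : Prop :=
  exists2 F : nat -> R -> E, F 0 = f &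
    forall n t, 0 < t -> has_derivative (F n) t (F n.+1 t).

Definition test_function (R : realType) (E : normedModType R[i])
    (f : R -> E) : Prop :=
  let supp := closure [set t : R | 0 <= t /\ f t <> 0] in
  [/\ smooth_on_pos f, compact supp & supp `<=` [set t | 0 < t]].

Lemma half_line_measurable (R : realType) :
  @measurable _ (measurableTypeR R) `[0, +oo[%classic.
Proof. exact: measurable_itv. Qed.

Definition Linfty_norm (R : realType) (E : normedModType R[i])
    (f : R -> E) : \bar R :=
  ess_sup (mrestr (@lebesgue_measure R) (@half_line_measurable R))
    (fun t => (rnorm (f t))%:E).

Definition BIBO_stable (R : realType) (U X Y : completeNormedModType R[i])
    (S : system_node U X Y) : Prop :=
  exists2 c : R, 0 < c & forall u x y,
    classical_solution S u x y -> x 0 = 0 -> test_function u ->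
    [/\ {within @half_line R, continuous y},
        exists M : R, forall t, 0 <= t -> rnorm (y t) <= M &
        (Linfty_norm y <= c%:E * Linfty_norm u)%E].

(* A complex Borel measure with values in matrices is given by the real and
   imaginary parts of its entries, which are (finite) signed measures.  A
   measure on [0, oo) is a measure on R for which the Borel subsets of
   (-oo, 0) are null. *)
Record matrix_measure (R : realType) (m n : nat) := {
  mm_re : 'I_m -> 'I_n -> {charge set (measurableTypeR R) -> \bar R};
  mm_im : 'I_m -> 'I_n -> {charge set (measurableTypeR R) -> \bar R};
  mm_half_line : forall i j (A : set (measurableTypeR R)), measurable A ->
    A `<=` `]-oo, 0[%classic -> mm_re i j A = 0%E /\ mm_im i j A = 0%E
}.

Definition mm_val (R : realType) (m n : nat) (h : matrix_measure R m n)
    (A : set (measurableTypeR R)) : 'M[R[i]]_(m, n) :=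
  \matrix_(i, j) (fine (mm_re h i j A) +i* fine (mm_im h i j A)).

Definition mm_total_variation (R : realType) (m n : nat)
    (h : matrix_measure R m n) : \bar R :=
  ereal_sup [set v | exists N (E : 'I_N -> set (measurableTypeR R)),
    [/\ forall k, measurable (E k), trivIset setT E &
        v = (\sum_(k < N) complex.Re (mx_norm (mm_val h (E k))))%:E]].

(* The integral against a signed measure, through its Jordan decomposition. *)
Definition charge_integral (d : measure_display) (T : measurableType d)
    (R : realType) (nu : {charge set T -> \bar R}) (D : set T) (f : T -> R) : R :=
  let hP := cid (Hahn_decomposition nu) in
  let hN := cid (projT2 hP) in
  \int[jordan_pos (projT2 hN)]_(t in D) f t
    - \int[jordan_neg (projT2 hN)]_(t in D) f t.

(* exp (- s t) = [laplace_re s t] + i [laplace_im s t] *)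
Definition laplace_re (R : realType) (s : R[i]) (t : R) : R :=
  expR (- (complex.Re s * t)) * cos (complex.Im s * t).
Definition laplace_im (R : realType) (s : R[i]) (t : R) : R :=
  - (expR (- (complex.Re s * t)) * sin (complex.Im s * t)).

Definition laplace (R : realType) (m n : nat) (h : matrix_measure R m n)
    (s : R[i]) : 'M[R[i]]_(m, n) :=
  let D := `[0, +oo[%classic : set (measurableTypeR R) in
  \matrix_(i, j)
    ((charge_integral (mm_re h i j) D (laplace_re s)
        - charge_integral (mm_im h i j) D (laplace_im s))
     +i* (charge_integral (mm_re h i j) D (laplace_im s)
        + charge_integral (mm_im h i j) D (laplace_re s))).

(* Main.v *)
Require Import Defs.
From HB Require Import structures.
From mathcomp Require Import all_boot all_order all_algebra.
From mathcomp Require Import complex.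
From mathcomp Require Import all_classical all_reals all_analysis.
From mathcomp Require Import measurable_realfun ess_sup_inf charge.
From mathcomp Require Import ring lra.

Set Implicit Arguments.
Unset Strict Implicit.
Unset Printing Implicit Defensive.

Import Order.TTheory GRing.Theory Num.Theory.
Import numFieldNormedType.Exports.

Local Open Scope classical_set_scope.
Local Open Scope ring_scope.
Local Open Scope complex_scope.

(** The output of a classical solution that starts at zero is, coordinate by
    coordinate, the convolution of the second derivative of the input with a
    continuous kernel [P], the response to the ramp [t |-> t]
    ([output_formula]).  This costs two derivatives of a smooth input, but it
    uses only a bounded part of the system: with [b] to the right of the growth
    bound and [r = (b - A)^-1 B e], which lies in [X], the kernel [P] is built
    from [k(t) = C (b - A)^-1 T(t) r] and two primitives of it ([ramp]).  The
    transfer function is [s^2] times the Laplace transform of [P]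
    ([transfer_formula]).  Everything is tested against real functionals of the
    output, the real and imaginary parts of its coordinates; linear functionals
    of a finite-dimensional space are bounded by compactness
    ([coordinates_bounded]).

    In these terms a representing measure [h] is the second derivative of [P],
    that is, [P t] is the integral of [max (t - r) 0] against [h]
    ([hinge_int]).  If [P] has this form, two integrations by parts show that
    the convolution of [v''] with [P] is that of [v] with [h], which is bounded
    by the total mass of [h] times the supremum of [v] ([hinge_conv_bound]),
    and that [s^2] times the Laplace transform of [P] is that of [h]
    ([hinge_laplace]).  Both are proved by differentiating in the upper end of
    the integral, the kernel being uniformly differentiable
    ([hinge_kernel_taylor], [rint_hinge]).

    Stability implies the existence of [h].  Stability bounds the convolution of
    [v''] with [P] by a multiple of the supremum of [v]
    ([kernel_of_BIBO]).  Inserting steps [stp n] for [v], the functions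
    [F_n = (stp n)'' * P], which are the derivatives of regularisations of [P],
    have uniformly bounded variation, because a sum of signed differences of
    translates of a monotone step is bounded by one ([conv_stp_variation]).
    They converge pointwise, because [stp n] is monotone in [n] as well
    ([conv_stp_increments]).  The limit [slope] is thus of bounded variation and
    [P] is its integral ([slope_integral]).  Splitting [slope] into monotone
    parts, it remains to see that the integral of a monotone function [g] is a
    [hinge_int]: the image of the Lebesgue measure under the generalised inverse
    of [g] ([monotone_measure_exists]) gives a function whose difference
    quotients have the same bounds, and two functions with this property agree
    ([zero_of_increments], [hinge_representation]).

    Conversely, if [h] is given, the Laplace transforms of [P] and of the
    [hinge_int] of [h] agree at large real points, so that the functions agree
    ([lerch_exp], [pfun_hinge]) and the bound for convolutions applies.

    The remaining parts prove what this needs about semigroups: growth bounds,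
    the resolvent to the right of the growth bound and its extension to the
    extrapolation space, the existence of classical solutions for smooth inputs
    ([classical_solution_exists]) and Duhamel's formula ([duhamel]). *)

(** * Real-valued norms *)

Definition cabs (R : realType) (z : R[i]) : R := complex.Re `|z|.

Section Rnorm.
Context {R : realType}.
Implicit Types E F : normedModType R[i].

Lemma cabsE (z : R[i]) : `|z| = (cabs z)%:C.
Proof. by rewrite /cabs normc_def. Qed.

Lemma rnormE E (x : E) : `|x| = (rnorm x)%:C.
Proof.
rewrite /rnorm; have := normr_ge0 x; case: `|x| => a b.
by rewrite lecE /= => /andP[/eqP -> _].
Qed.

Lemma rnorm_ge0 E (x : E) : 0 <= rnorm x.
Proof. by have := normr_ge0 x; rewrite rnormE -[0]/(0%:C) lecR. Qed.

Lemma rnorm0 E : rnorm (0 : E) = 0.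
Proof. by rewrite /rnorm normr0. Qed.

Lemma rnorm_eq0 E (x : E) : rnorm x = 0 -> x = 0.
Proof. by move=> h; apply/eqP; rewrite -normr_eq0 rnormE h. Qed.

Lemma rnormD E (x y : E) : rnorm (x + y) <= rnorm x + rnorm y.
Proof. by have := ler_normD x y; rewrite !rnormE -rmorphD lecR. Qed.

Lemma rnormN E (x : E) : rnorm (- x) = rnorm x.
Proof. by rewrite /rnorm normrN. Qed.

Lemma rnormC E (x y : E) : rnorm (x - y) = rnorm (y - x).
Proof. by rewrite -rnormN opprB. Qed.

Lemma rnormB E (x y : E) : rnorm (x - y) <= rnorm x + rnorm y.
Proof. by rewrite -(rnormN y) rnormD. Qed.

Lemma rnorm_distD E (z x y : E) : rnorm (x - y) <= rnorm (x - z) + rnorm (z - y).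
Proof. by rewrite (le_trans _ (rnormD _ _))// addrA subrK. Qed.

Lemma cabsM (a b : R[i]) : cabs (a * b) = cabs a * cabs b.
Proof. by rewrite /cabs normrM !cabsE -rmorphM. Qed.

Lemma rnormZ E (a : R[i]) (x : E) : rnorm (a *: x) = cabs a * rnorm x.
Proof. by apply: (@complexI R); rewrite rmorphM/= -rnormE normrZ cabsE rnormE. Qed.

Lemma cabs_ge0 (z : R[i]) : 0 <= cabs z.
Proof. by have := normr_ge0 z; rewrite cabsE -[0]/(0%:C) lecR. Qed.

Lemma cabsr (r : R) : cabs (r%:C) = `|r|.
Proof. by rewrite /cabs normc_def /= expr0n/= addr0 sqrtr_sqr. Qed.

Lemma rnormZr E (r : R) (x : E) : rnorm (r%:C *: x) = `|r| * rnorm x.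
Proof. by rewrite rnormZ cabsr. Qed.

Lemma rnorm_sum E (I : Type) (s : seq I) (P : pred I) (f : I -> E) :
  rnorm (\sum_(i <- s | P i) f i) <= \sum_(i <- s | P i) rnorm (f i).
Proof.
elim/big_ind2 : _ => //; first by rewrite rnorm0.
by move=> a b c d ab cd; apply: (le_trans (rnormD _ _)); exact: lerD.
Qed.

Lemma cabsD (a b : R[i]) : cabs (a + b) <= cabs a + cabs b.
Proof. by have := ler_normD a b; rewrite !cabsE -rmorphD lecR. Qed.

Lemma cabs_Re (z : R[i]) : `|complex.Re z| <= cabs z.
Proof.
rewrite /cabs normc_def /= -[leLHS]sqrtr_sqr ler_sqrt ?addr_ge0 ?sqr_ge0//.
by rewrite lerDl sqr_ge0.
Qed.

Lemma cabs_Im (z : R[i]) : `|complex.Im z| <= cabs z.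
Proof.
rewrite /cabs normc_def /= -[leLHS]sqrtr_sqr ler_sqrt ?addr_ge0 ?sqr_ge0//.
by rewrite lerDr sqr_ge0.
Qed.

Lemma cabs_le (z : R[i]) : cabs z <= `|complex.Re z| + `|complex.Im z|.
Proof.
have ci : cabs ('i%C : R[i]) = 1.
  by rewrite /cabs normc_def /= expr0n/= add0r expr1n sqrtr1.
by rewrite [z in leLHS]complexE (le_trans (cabsD _ _))// cabsM !cabsr ci mul1r.
Qed.

Lemma cvg_rnormP (T : Type) (Fl : set_system T) {FF : Filter Fl} E (f : T -> E) (l : E) :
  f @ Fl --> l <-> forall e : R, 0 < e -> \forall t \near Fl, rnorm (f t - l) < e.
Proof.
split => [/cvgrPdist_lt h e e0|h].
  have e0' : 0 < e%:C by rewrite -[0]/(0%:C) ltcR.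
  by have := h _ e0'; apply: filterS => t; rewrite rnormE ltcR rnormC.
apply/cvgrPdist_lt => e e0.
have eE : e = (complex.Re e)%:C.
  by case: e e0 => a b; rewrite ltcE /= => /andP[/eqP ->].
have re0 : 0 < complex.Re e by move: e0; rewrite eE -[0]/(0%:C) ltcR.
by have := h _ re0; apply: filterS => t tl; rewrite eE rnormE ltcR rnormC.
Qed.

Lemma cvg_rnorm0 (T : Type) (Fl : set_system T) {FF : Filter Fl} E (f : T -> E) (l : E) :
  f @ Fl --> l <-> rnorm (f t - l) @[t --> Fl] --> (0 : R).
Proof.
split => [/cvg_rnormP h|h].
  apply/cvgrPdist_lt => e e0; have := h _ e0; apply: filterS => t.
  by rewrite sub0r normrN ger0_norm// rnorm_ge0.
apply/cvg_rnormP => e e0; move/cvgrPdist_lt: h => /(_ _ e0); apply: filterS => t.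
by rewrite sub0r normrN ger0_norm// rnorm_ge0.
Qed.

Lemma cvg_cst_eq E (x l : E) : (fun=> x) @ \oo --> l -> l = x.
Proof. by move=> h; apply: (cvg_unique (@norm_hausdorff _ E) h (cvg_cst x)). Qed.

Lemma squeeze_rnorm (T : Type) (Fl : set_system T) {FF : Filter Fl} E (f : T -> E) (l : E)
  (g : T -> R) : (\forall t \near Fl, rnorm (f t - l) <= g t) ->
  g @ Fl --> (0 : R) -> f @ Fl --> l.
Proof.
move=> fg g0; apply/cvg_rnormP => e e0.
move/cvgrPdist_lt: g0 => /(_ _ e0); apply: filterS2 fg => t fg.
rewrite sub0r normrN; apply: le_lt_trans; apply: (le_trans fg); exact: ler_norm.
Qed.

Lemma cvg_rnorm (T : Type) (Fl : set_system T) {FF : Filter Fl} E (f : T -> E) (l : E) :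
  f @ Fl --> l -> rnorm (f t) @[t --> Fl] --> rnorm l.
Proof.
move=> /cvg_rnormP h; apply/cvgrPdist_lt => e e0; have := h _ e0; apply: filterS => t.
apply: le_lt_trans; rewrite ler_norml; apply/andP; split.
  rewrite lerBrDr addrC lerBlDr addrC.
  by rewrite -[in leLHS](subrK l (f t)) (le_trans (rnormD _ _))// addrC.
rewrite lerBlDr rnormC -[in leLHS](subrK (f t) l); exact: rnormD.
Qed.

Lemma continuous_linear_bound E F (f : {linear E -> F}) : continuous f ->
  exists2 M : R, 0 < M & forall x, rnorm (f x) <= M * rnorm x.
Proof.
move=> fc; have /linear_boundedP : bounded_near f (nbhs (0 : E)).
  by apply/linear_bounded_continuous.
move=> /pinfty_ex_gt0[r r0 h].
have rE : r = (complex.Re r)%:C.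
  by case: r r0 {h} => a b; rewrite ltcE /= => /andP[/eqP ->].
exists (complex.Re r); first by move: r0; rewrite rE -[0]/(0%:C) ltcR.
by move=> x; have := h x; rewrite !rnormE rE -rmorphM lecR.
Qed.

Lemma op_norm_bound E F (f : {linear E -> F}) (M : R) :
  (forall x, rnorm (f x) <= M * rnorm x) ->
  forall x, rnorm (f x) <= op_norm f * rnorm x.
Proof.
move=> h x; have [x0|x0] := eqVneq (rnorm x) 0.
  by rewrite (rnorm_eq0 x0) linear0 !rnorm0 mulr0.
have x1 : 0 < rnorm x by rewrite lt_neqAle eq_sym x0 rnorm_ge0.
rewrite -ler_pdivrMr//.
have -> : rnorm (f x) / rnorm x = rnorm (f (((rnorm x)^-1)%:C *: x)).
  by rewrite linearZ/= rnormZr ger0_norm 1?mulrC// invr_ge0 ltW.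
apply: ub_le_sup; last first.
  exists (((rnorm x)^-1)%:C *: x) => //=.
  by rewrite rnormZr ger0_norm ?mulVf// invr_ge0 ltW.
exists (`|M|) => _ [y /= y1 <-]; apply: (le_trans (h y)).
rewrite (le_trans (ler_wpM2r _ (ler_norm M))) ?rnorm_ge0//.
by rewrite ler_piMr.
Qed.

Lemma op_norm_le E F (f : {linear E -> F}) (M : R) : 0 <= M ->
  (forall x, rnorm (f x) <= M * rnorm x) -> op_norm f <= M.
Proof.
move=> M0 h; apply: ge_sup.
  by exists (rnorm (f 0)); exists 0 => //=; rewrite rnorm0 ler01.
move=> _ [y /= y1 <-]; apply: (le_trans (h y)); by rewrite ler_piMr.
Qed.

Lemma rnorm_cauchy_cvg (E : completeNormedModType R[i]) (u : nat -> E) :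
  (forall e : R, 0 < e -> exists N, forall m n, (N <= m)%N -> (N <= n)%N ->
     rnorm (u m - u n) < e) -> cvgn u.
Proof.
move=> h; apply: cauchy_cvg; apply/cauchy_ballP => e e0.
have eE : e = (complex.Re e)%:C.
  by case: e e0 => a b; rewrite ltcE /= => /andP[/eqP ->].
have re0 : 0 < complex.Re e by move: e0; rewrite eE -[0]/(0%:C) ltcR.
have [N hN] := h _ re0.
near_simpl.
exists ([set n | (N <= n)%N], [set n | (N <= n)%N]); first by split; exists N.
move=> [a b] [/= Na Nb]; rewrite -ball_normE /ball_ /= rnormE eE ltcR.
exact: hN.
Qed.

End Rnorm.

(** * Uniform boundedness and growth of semigroups *)

Section UniformBoundedness.
Context {R : realType} {E : completeNormedModType R[i]} {F : normedModType R[i]}.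

Lemma rnorm_lim_le (u : nat -> E) (l a : E) (c : R) :
  u @ \oo --> l -> (\forall n \near \oo, rnorm (u n - a) <= c) -> rnorm (l - a) <= c.
Proof.
move=> ul uc; apply: (@cvgr_to_le _ _ _ _ (fun n => rnorm (u n - a))) uc.
by apply: cvg_rnorm; apply: cvgB => //; exact: cvg_cst.
Qed.

(** One of [x + z], [x - z] is moved far away, because their images differ by
    twice the image of [z]. *)
Lemma hump (g : {linear E -> F}) (K : R) (y : E) : K * rnorm y < rnorm (g y) ->
  forall x (r : R), 0 < r -> exists2 x', rnorm (x' - x) <= r & K * r <= rnorm (g x').
Proof.
move=> hy x r r0.
have y0 : 0 < rnorm y.
  rewrite lt_neqAle rnorm_ge0 andbT eq_sym; apply/eqP => y0.
  by move: hy; rewrite (rnorm_eq0 y0) linear0 !rnorm0 mulr0 ltxx.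
pose z := (r / rnorm y)%:C *: y.
have zr : rnorm z = r.
  by rewrite rnormZr ger0_norm ?divfK// ?gt_eqF// divr_ge0// ltW.
have gz : K * r < rnorm (g z).
  rewrite linearZ/= rnormZr ger0_norm; last by rewrite divr_ge0// ltW.
  by rewrite mulrAC ltr_pdivlMr// (mulrC r) mulrAC ltr_pM2r.
have [h|h] := leP (K * r) (rnorm (g (x + z))).
  by exists (x + z) => //; rewrite addrC addKr zr.
exists (x - z); first by rewrite addrC addKr rnormN zr.
have : rnorm (g z) *+ 2 <= rnorm (g (x + z)) + rnorm (g (x - z)).
  have -> : rnorm (g z) *+ 2 = rnorm (g (x + z) - g (x - z)).
    rewrite -linearB/= opprB addrC addrA subrK -mulr2n linearMn.
    by apply: (@complexI R); rewrite -rnormE normrMn rnormE rmorphMn.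
  exact: rnormB.
by move: h gz; lra.
Qed.

(** Gliding hump: otherwise choose successive humps, each so small that it spoils
    none of the values that the previous ones have made large; their sum is a point
    at which the family is unbounded. *)
Lemma uniform_boundedness (f : nat -> {linear E -> F}) :
  (forall n, continuous (f n)) ->
  (forall x, exists M : R, forall n, rnorm (f n x) <= M) ->
  exists M : R, forall n x, rnorm (f n x) <= M * rnorm x.
Proof.
move=> fc fb; apply: contrapT => /forallNP nb.
have step (n : nat) : exists kK : nat * R,
    [/\ 6 * 3 ^+ n * n.+1%:R <= kK.2,
        forall x, rnorm (f kK.1 x) <= kK.2 * rnorm x &
        exists y, 2 / 3 * kK.2 * rnorm y < rnorm (f kK.1 y)].
  set c : R := 6 * 3 ^+ n * n.+1%:R.
  have c0 : 0 < c by rewrite !mulr_gt0// exprn_gt0.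
  have /existsNP[k /existsNP[x /negP]] := nb c; rewrite -ltNge => hx.
  have [M M0 hM] := continuous_linear_bound (fc k).
  have hK := op_norm_bound hM.
  have cK : c < op_norm (f k).
    rewrite ltNge; apply/negP => Kc.
    have := lt_le_trans hx (hK x); rewrite ltNge ler_wpM2r//; exact: rnorm_ge0.
  exists (k, op_norm (f k)); split => //=; first exact: ltW.
  have K0 : 0 < op_norm (f k) by exact: lt_trans cK.
  have hs : has_sup [set rnorm (f k x) | x in [set x : E | rnorm x <= 1]].
    split; first by exists (rnorm (f k 0)); exists 0 => //=; rewrite rnorm0 ler01.
    exists M => _ [y /= y1 <-]; apply: (le_trans (hM y)); by rewrite ler_piMr// ltW.
  have e0 : 0 < op_norm (f k) / 3 by lra.
  have [_ [y /= y1 <-]] := sup_adherent e0 hs.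
  rewrite -/(op_norm (f k)) => hy; exists y.
  apply: le_lt_trans hy; rewrite (le_trans (ler_wpM2l _ y1)) ?mulr1//; lra.
have [kK hkK] := choice step.
have step2 (nx : nat * E) : exists x' : E,
    rnorm (x' - nx.2) <= (3^-1) ^+ nx.1 /\
    2 / 3 * (kK nx.1).2 * (3^-1) ^+ nx.1 <= rnorm (f (kK nx.1).1 x').
  have [_ _ [y hy]] := hkK nx.1.
  have r0 : 0 < (3^-1 : R) ^+ nx.1 by rewrite exprn_gt0.
  by have [x' ? ?] := hump hy nx.2 r0; exists x'.
have [nxt hnxt] := choice step2.
pose u := fix u n := if n is m.+1 then nxt (m, u m) else 0.
have du n p : rnorm (u (n.+1 + p)%N - u n.+1) <= 2^-1 * (3^-1) ^+ n * (1 - (3^-1) ^+ p).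
  elim: p => [|p ih]; first by rewrite addn0 subrr rnorm0 expr0 subrr mulr0.
  rewrite addnS; apply: (le_trans (rnorm_distD (u (n.+1 + p)%N) _ _)).
  have [h _] := hnxt ((n.+1 + p)%N, u (n.+1 + p)%N).
  apply: (le_trans (lerD h ih)) => /=.
  rewrite exprS exprD exprS; lra.
have du' n p : rnorm (u (n.+1 + p)%N - u n.+1) <= 2^-1 * (3^-1) ^+ n.
  apply: (le_trans (du n p)); by rewrite ler_piMr ?gerBl ?mulr_ge0 ?exprn_ge0 ?invr_ge0.
have ucv : cvgn u.
  apply: rnorm_cauchy_cvg => e e0.
  have /cvgrPdist_lt /(_ _ e0) [N _ hN] := @cvg_geometric R 1 3^-1 ltac:(rewrite ger0_norm; lra).
  have := hN N (leqnn N); rewrite /geometric /= mul1r sub0r normrN ger0_norm ?exprn_ge0// => he.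
  exists N.+1 => m n Nm Nn.
  apply: le_lt_trans he; apply: (le_trans (rnorm_distD (u N.+1) _ _)).
  rewrite -(subnKC Nm) -(subnKC Nn) (rnormC (u N.+1)).
  by apply: (le_trans (lerD (du' _ _) (du' _ _))); lra.
set x := lim (u @ \oo).
have ux : u @ \oo --> x by [].
have hx n : rnorm (x - u n.+1) <= 2^-1 * (3^-1) ^+ n.
  apply: (rnorm_lim_le ux); exists n.+1 => // m /= nm.
  by rewrite -(subnKC nm); exact: du'.
have [M hM] := fb x.
have := truncnS_gt M; set n := Num.truncn M => Mn.
have [hK1 hK2 _] := hkK n; have [_ h3] := hnxt (n, u n); rewrite /= -/(u n.+1) in h3.
have h4 : rnorm (f (kK n).1 (u n.+1)) <= rnorm (f (kK n).1 x) + (kK n).2 * (2^-1 * 3^-1 ^+ n).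
  have -> : u n.+1 = x - (x - u n.+1) by rewrite opprB addrC subrK.
  rewrite linearB/=; apply: (le_trans (rnormB _ _)); rewrite lerD2l.
  apply: (le_trans (hK2 _)); rewrite ler_wpM2l ?hx//.
  by apply: le_trans hK1; rewrite !mulr_ge0// exprn_ge0.
have := hM (kK n).1.
have t0 : 0 < (3^-1 : R) ^+ n by rewrite exprn_gt0.
have : n.+1%:R <= (kK n).2 * 3^-1 ^+ n * 6^-1.
  have -> : n.+1%:R = (6 * 3 ^+ n * n.+1%:R) * 3^-1 ^+ n * 6^-1 :> R.
    rewrite exprVn; field; by rewrite expf_neq0.
  by rewrite ler_wpM2r// ler_wpM2r// ltW.
move: h3 h4 Mn; lra.
Qed.

End UniformBoundedness.

Section Growth.
Context {R : realType} {X : completeNormedModType R[i]} (T : semigroup X).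

Lemma sg_near0 (x : X) (e : R) : 0 < e ->
  exists2 d : R, 0 < d & forall t, 0 <= t -> t <= d -> rnorm (T t x - x) < e.
Proof.
move=> e0; have /cvg_rnormP/(_ _ e0) := sg_strongly_continuous T (x := x).
rewrite near_withinE => -[d /= d0 hd]; exists (d / 2); first by rewrite divr_gt0.
move=> t t0 td; move: t0; rewrite le_eqVlt => /orP[/eqP <-|t0].
  by rewrite sg_0 subrr rnorm0.
apply: hd => //=; rewrite sub0r normrN gtr0_norm//; apply: (le_lt_trans td); lra.
Qed.

Lemma sg_bounded_near0 : exists2 d : R, 0 < d & exists2 M : R, 1 <= M &
  forall t x, 0 <= t -> t <= d -> rnorm (T t x) <= M * rnorm x.
Proof.
apply: contrapT => nb.
have step (n : nat) : exists t : R, [/\ 0 <= t, t <= n.+1%:R^-1 &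
    exists x, n.+1%:R * rnorm x < rnorm (T t x)].
  apply: contrapT => h; apply: nb; exists (n.+1%:R^-1) => //.
  exists n.+1%:R; first by rewrite ler1n.
  move=> t x t0 td; rewrite leNgt; apply/negP => hx; apply: h.
  by exists t; split => //; exists x.
have [t ht] := choice step.
have [||M hM] := @uniform_boundedness R X X (fun n => T (t n)).
- by move=> n; apply: sg_continuous; have [] := ht n.
- move=> x; have [d d0 hd] := sg_near0 x (ltr01).
  have [N hN] : exists N, forall n, (N <= n)%N -> t n <= d.
    exists (Num.truncn d^-1) => n Nn; have [_ + _] := ht n => /le_trans; apply.
    rewrite invf_ple ?posrE//; apply/ltW/(lt_le_trans (truncnS_gt _)).
    by rewrite ler_nat ltnS.
  exists ((rnorm x + 1) + \sum_(n < N) rnorm (T (t n) x)) => n.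
  have [Nn|nN] := leqP N n.
    have [t0 _ _] := ht n.
    have := hd _ t0 (hN _ Nn); move=> h.
    rewrite ler_wpDr ?sumr_ge0//; first by move=> *; exact: rnorm_ge0.
    rewrite -[in leLHS](subrK x (T (t n) x)).
    by rewrite (le_trans (rnormD _ _))// addrC lerD2l ltW.
  rewrite (bigD1 (Ordinal nN))//= addrCA ler_wpDr// addr_ge0//.
    by rewrite addr_ge0 ?rnorm_ge0.
  by apply: sumr_ge0 => *; exact: rnorm_ge0.
have := truncnS_gt M; set n := Num.truncn M => Mn.
have [_ _ [x hx]] := ht n.
have := lt_le_trans hx (hM n x); rewrite ltNge ler_wpM2r// ?rnorm_ge0//; exact: ltW.
Qed.

Lemma sg_exp_bound : exists2 w : R, 0 <= w & exists2 M : R, 1 <= M &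
  forall t x, 0 <= t -> rnorm (T t x) <= M * expR (w * t) * rnorm x.
Proof.
have [d d0 [M M1 hM]] := sg_bounded_near0.
have M0 : 0 < M by lra.
have hn (n : nat) t x : 0 <= t -> t <= n.+1%:R * d -> rnorm (T t x) <= M ^+ n.+1 * rnorm x.
  elim: n t x => [|n ih] t x t0 td; first by rewrite expr1 hM// -[d]mul1r.
  have [td'|td'] := leP t d.
    apply: (le_trans (hM _ _ t0 td')); rewrite ler_wpM2r ?rnorm_ge0//.
    by rewrite exprS ler_peMr ?exprn_ege1// ltW.
  rewrite -(subrK d t) sg_D ?(ltW d0)//; last by rewrite subr_ge0 ltW.
  apply: (le_trans (ih _ _ _ _)).
  - by rewrite subr_ge0 ltW.
  - by rewrite lerBlDr (le_trans td)// [n.+2%:R]mulrS mulrDl mul1r addrC.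
  - rewrite [M ^+ n.+2]exprSr -mulrA ler_wpM2l ?exprn_ge0 ?(ltW M0)//.
    by apply: hM => //; exact: ltW.
exists (ln M / d); first by rewrite divr_ge0 ?ln_ge0// ltW.
exists M => // t x t0.
have td0 : 0 <= t / d by rewrite divr_ge0// ltW.
have /andP[h1 h2] := truncn_itv td0.
apply: (le_trans (hn (Num.truncn (t / d)) t x t0 _)).
  by rewrite -ler_pdivrMr// ltW.
rewrite ler_wpM2r ?rnorm_ge0// exprS ler_wpM2l ?(ltW M0)//.
rewrite -[in leLHS](lnK (x := M)) ?posrE// -expRM_natl ler_expR.
by rewrite mulrAC -mulrA [leRHS]mulrC ler_wpM2r ?ln_ge0.
Qed.

Lemma sg_local_bound (tau : R) : exists2 M : R, 1 <= M &
  forall t x, 0 <= t -> t <= tau -> rnorm (T t x) <= M * rnorm x.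
Proof.
have [w w0 [M M1 hM]] := sg_exp_bound.
exists (M * expR (w * `|tau|)).
  by rewrite -[1]mulr1 ler_pM// -expR0 ler_expR mulr_ge0.
move=> t x t0 tt; apply: (le_trans (hM t x t0)); rewrite ler_wpM2r ?rnorm_ge0//.
rewrite ler_wpM2l ?ler_expR ?ler_wpM2l//; first by lra.
exact: le_trans (ler_norm _).
Qed.

Lemma growth_bound_lty : exists w : R, (growth_bound T < w%:E)%E.
Proof.
have [w w0 [M M1 hM]] := sg_exp_bound.
exists (w + 1); apply: (@le_lt_trans _ _ w%:E); last by rewrite lte_fin ltrDl.
apply: ereal_inf_lbound; exists w => //; exists M => _ [t /= t0 <-].
rewrite expRN ler_pdivrMl ?expR_gt0// mulrC.
apply: op_norm_le => [|x]; first by rewrite mulr_ge0 ?expR_ge0//; lra.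
by rewrite [t * w]mulrC; apply: hM; exact: ltW.
Qed.

Lemma growth_bound_exp (r : R) : (growth_bound T < r%:E)%E ->
  exists2 w : R, w < r & exists2 M : R, 1 <= M &
    forall t x, 0 <= t -> rnorm (T t x) <= M * expR (w * t) * rnorm x.
Proof.
move=> /ereal_inf_lt[_ [w /= [M hM] <-]]; rewrite lte_fin => wr.
exists w => //; exists (Num.max M 1); first by rewrite le_max lexx orbT.
move=> t x; rewrite le_eqVlt => /orP[/eqP <-|t0].
  by rewrite sg_0 mulr0 expR0 mulr1 ler_peMl ?rnorm_ge0// le_max lexx orbT.
have [M' M'1 hM'] := sg_local_bound t.
have hb := op_norm_bound (fun x => hM' t x (ltW t0) (lexx t)).
apply: (le_trans (hb x)); rewrite ler_wpM2r ?rnorm_ge0//.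
have := hM _ (ex_intro2 _ _ t t0 erefl).
rewrite expRN ler_pdivrMl ?expR_gt0// => /le_trans; apply.
by rewrite [leRHS]mulrC (mulrC w) ler_wpM2l ?expR_ge0// le_max lexx.
Qed.

End Growth.

(** * The Riemann integral of a uniformly continuous vector-valued function *)

Section VectorIntegral.
Context {R : realType}.
Implicit Types X Y : completeNormedModType R[i].

Definition ucont X (tau : R) (g : R -> X) := forall e : R, 0 < e ->
  exists2 d : R, 0 < d & forall s t, 0 <= s -> s <= tau -> 0 <= t -> t <= tau ->
    `|s - t| <= d -> rnorm (g s - g t) <= e.

Definition riemann_sum X (tau : R) (g : R -> X) (n : nat) : X :=
  (tau / 2 ^+ n)%:C *: \sum_(k < 2 ^ n) g (k%:R * (tau / 2 ^+ n)).

Definition vint X (tau : R) (g : R -> X) : X := lim (riemann_sum tau g @ \oo).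

Lemma sum_evenodd X (a : nat -> X) N :
  \sum_(k < N.*2) a k = \sum_(k < N) a k.*2 + \sum_(k < N) a k.*2.+1.
Proof.
elim: N => [|N ih]; first by rewrite !big_ord0 addr0.
by rewrite doubleS !big_ord_recr /= ih -!addrA; congr (_ + _); rewrite addrCA addrA.
Qed.

Lemma half_scale X (z : X) : (2^-1)%:C *: (z + z) = z.
Proof.
rewrite scalerDr -scalerDl -rmorphD (_ : 2^-1 + 2^-1 = 1 :> R) ?scale1r//.
by field.
Qed.

Lemma riemann_sumS X tau (g : R -> X) n : riemann_sum tau g n.+1 =
  (2^-1)%:C *: (riemann_sum tau g n +
    riemann_sum tau (fun s => g (s + tau / 2 ^+ n.+1)) n).
Proof.
rewrite /riemann_sum; set c := (X in _ = _ *: (X *: _ + _)).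
rewrite -[X in _ = _ *: X]scalerDr scalerA -rmorphM.
congr (_ *: _); first by congr (_%:C); rewrite exprS; field; rewrite expf_neq0.
rewrite expnS mul2n (sum_evenodd (fun k => g (k%:R * (tau / 2 ^+ n.+1)))).
have p0 : (2 : R) ^+ n != 0 by rewrite expf_neq0.
by congr (_ + _); apply: eq_bigr => k _; congr g;
  rewrite ?[_.*2.+1%:R]mulrSr -mul2n natrM exprS; field.
Qed.

Lemma riemann_sum_le X tau (g : R -> X) n K : 0 <= tau ->
  (forall k : nat, (k < 2 ^ n)%N -> rnorm (g (k%:R * (tau / 2 ^+ n))) <= K) ->
  rnorm (riemann_sum tau g n) <= tau * K.
Proof.
move=> tau0 h; rewrite /riemann_sum rnormZr ger0_norm ?divr_ge0 ?exprn_ge0//.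
have p0 : (2 : R) ^+ n != 0 by rewrite expf_neq0.
have -> : tau * K = tau / 2 ^+ n * (\sum_(k < 2 ^ n) K).
  rewrite sumr_const card_ord -[K *+ _]mulr_natl natrX; by field.
rewrite ler_wpM2l ?divr_ge0 ?exprn_ge0//.
by apply: (le_trans (rnorm_sum _ _ _)); apply: ler_sum => k _; exact: h.
Qed.

Lemma riemann_sumD X tau (g h : R -> X) (a : R[i]) n :
  riemann_sum tau (fun s => a *: g s + h s) n =
  a *: riemann_sum tau g n + riemann_sum tau h n.
Proof.
rewrite /riemann_sum scalerA [a * _]mulrC -scalerA -[RHS]scalerDr; congr (_ *: _).
by rewrite scaler_sumr -big_split.
Qed.

Lemma riemann_sumB X tau (g h : R -> X) n :
  riemann_sum tau g n - riemann_sum tau h n = riemann_sum tau (fun s => g s - h s) n.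
Proof. by rewrite /riemann_sum -[LHS]scalerBr -sumrB. Qed.

(** Refining a grid [p] times changes the sum by at most the oscillation over
    a cell; stated for two functions so that the induction can translate one. *)
Lemma riemann_sum_refine X tau (n p : nat) (g0 g : R -> X) (K : R) : 0 <= tau ->
  (forall (k : nat) d, (k < 2 ^ n)%N -> 0 <= d -> d <= tau / 2 ^+ n * (1 - 2^-1 ^+ p) ->
    rnorm (g (k%:R * (tau / 2 ^+ n) + d) - g0 (k%:R * (tau / 2 ^+ n))) <= K) ->
  rnorm (riemann_sum tau g (n + p) - riemann_sum tau g0 n) <= tau * K.
Proof.
move=> tau0; elim: p g => [|p ih] g h.
  rewrite addn0 riemann_sumB; apply: riemann_sum_le => // k k2.
  by have := h k 0 k2; rewrite addr0 expr0 subrr mulr0; apply.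
rewrite addnS riemann_sumS.
have p1 : (2 : R) ^+ n != 0 by rewrite expf_neq0.
have p2 : (2 : R) ^+ p != 0 by rewrite expf_neq0.
have t0 : 0 <= tau / 2 ^+ n by rewrite divr_ge0// exprn_ge0.
set h2 := riemann_sum tau g0 n.
rewrite -[h2]half_scale.
rewrite -scalerBr opprD addrACA rnormZr ger0_norm//.
rewrite (_ : tau * K = 2^-1 * (tau * K + tau * K)); last by field.
rewrite ler_wpM2l//; apply: (le_trans (rnormD _ _)); apply: lerD.
  apply: ih => k d k2 d0 hd; apply: h => //; apply: (le_trans hd).
  rewrite ler_wpM2l// lerD2l lerN2 exprS ler_piMl ?exprn_ge0//; lra.
apply: ih => k d k2 d0 hd; rewrite -addrA; apply: h => //.
  by rewrite addr_ge0// divr_ge0// exprn_ge0.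
apply: (le_trans (lerD hd (lexx _))).
by rewrite le_eqVlt; apply/orP; left; apply/eqP; rewrite !exprVn !exprS exprD; field; rewrite p1 p2.
Qed.

Lemma grid_bounds (tau : R) (n k : nat) : 0 <= tau -> (k < 2 ^ n)%N ->
  0 <= k%:R * (tau / 2 ^+ n) /\ k%:R * (tau / 2 ^+ n) + tau / 2 ^+ n <= tau.
Proof.
move=> tau0 k2; have t0 : 0 <= tau / 2 ^+ n by rewrite divr_ge0// exprn_ge0.
split; first by rewrite mulr_ge0.
rewrite -[X in _ + X]mul1r -mulrDl -natr1 -[leRHS]mul1r.
have p1 : (2 : R) ^+ n != 0 by rewrite expf_neq0.
rewrite (_ : 1 * tau = (2 ^ n)%N%:R * (tau / 2 ^+ n)); last by rewrite natrX; field.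
by rewrite ler_wpM2r// natr1 ler_nat.
Qed.

Lemma pow2_small (tau d : R) : 0 < d -> exists N, forall n, (N <= n)%N -> tau / 2 ^+ n <= d.
Proof.
move=> d0; have /cvgrPdist_lt/(_ _ d0) [N _ hN] :=
  @cvg_geometric R tau 2^-1 ltac:(rewrite ger0_norm; lra).
exists N => n Nn; have := hN n Nn; rewrite /geometric /= sub0r normrN exprVn => /ltW.
exact: le_trans (ler_norm _).
Qed.

Lemma cvg_riemann_sum X tau (g : R -> X) : 0 <= tau -> ucont tau g ->
  riemann_sum tau g @ \oo --> vint tau g.
Proof.
move=> tau0 gu; apply: rnorm_cauchy_cvg => e e0.
have e1 : 0 < e / (4 * (tau + 1)) by rewrite divr_gt0// mulr_gt0//; lra.
have [d d0 hd] := gu _ e1; have [N hN] := pow2_small tau d0.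
suff h p : rnorm (riemann_sum tau g (N + p) - riemann_sum tau g N) <= e / 4.
  exists N => m n Nm Nn; apply: (le_lt_trans (rnorm_distD (riemann_sum tau g N) _ _)).
  rewrite -(subnKC Nm) -(subnKC Nn) (rnormC (riemann_sum tau g N)).
  by have := h (m - N)%N; have := h (n - N)%N; lra.
apply: (@le_trans _ _ (tau * (e / (4 * (tau + 1))))); last first.
  rewrite mulrA ler_pdivrMr ?mulr_gt0//; last lra.
  rewrite (_ : e / 4 * (4 * (tau + 1)) = tau * e + e); last by field.
  by rewrite lerDl ltW.
apply: riemann_sum_refine => // k de k2 de0 hde.
have [g1 g2] := grid_bounds tau0 k2.
have t0 : 0 <= tau / 2 ^+ N by rewrite divr_ge0// exprn_ge0.
have hde' : de <= tau / 2 ^+ N.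
  by apply: (le_trans hde); rewrite ler_piMr// gerBl exprn_ge0// invr_ge0.
apply: hd => //.
- by rewrite addr_ge0.
- by apply: le_trans g2; rewrite lerD2l.
- by apply: le_trans g2; rewrite lerDl.
- rewrite addrC addKr ger0_norm//; exact: (le_trans hde' (hN _ (leqnn _))).
Qed.

Lemma ucontD X tau (g h : R -> X) (a : R[i]) : ucont tau g -> ucont tau h ->
  ucont tau (fun s => a *: g s + h s).
Proof.
move=> gu hu e e0.
have c0 : 0 < cabs a + 1 by have := cabs_ge0 a; lra.
have e1 : 0 < e / 2 / (cabs a + 1) by rewrite divr_gt0// divr_gt0.
have e2 : 0 < e / 2 by rewrite divr_gt0.
have [d d0 hd] := gu _ e1; have [d' d0' hd'] := hu _ e2.
exists (Num.min d d'); first by rewrite lt_min d0.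
move=> s t s0 st t0 tt; rewrite le_min => /andP[h1 h2].
rewrite opprD addrACA -scalerBr (le_trans (rnormD _ _))// rnormZ.
rewrite (splitr e) lerD//; last exact: hd'.
rewrite (le_trans (ler_wpM2l (cabs_ge0 a) (hd s t s0 st t0 tt h1)))//.
rewrite mulrA ler_pdivrMr// mulrC ler_wpM2l ?(ltW e2)// lerDl//.
Qed.

Lemma ucont_cst X tau (x : X) : ucont tau (fun=> x).
Proof. by move=> e e0; exists 1 => // *; rewrite subrr rnorm0 ltW. Qed.

Lemma vintD X tau (g h : R -> X) (a : R[i]) : 0 <= tau -> ucont tau g -> ucont tau h ->
  vint tau (fun s => a *: g s + h s) = a *: vint tau g + vint tau h.
Proof.
move=> tau0 gu hu; apply: cvg_lim => //.
have -> : riemann_sum tau (fun s => a *: g s + h s) =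
    (fun n => a *: riemann_sum tau g n + riemann_sum tau h n).
  by apply/funext => n; exact: riemann_sumD.
apply: cvgD; last exact: cvg_riemann_sum.
by apply: cvgZr; exact: cvg_riemann_sum.
Qed.

Lemma eq_vint X tau (g h : R -> X) : 0 <= tau ->
  (forall s, 0 <= s -> s <= tau -> g s = h s) -> vint tau g = vint tau h.
Proof.
move=> tau0 gh; rewrite /vint; congr (lim (_ @ \oo)); apply/funext => n.
rewrite /riemann_sum; congr (_ *: _); apply: eq_bigr => k _.
have [g1 g2] := grid_bounds tau0 (ltn_ord k); apply: gh => //.
by apply: le_trans g2; rewrite lerDl divr_ge0// exprn_ge0.
Qed.

Lemma vint_le X tau (g : R -> X) (K : R) : 0 <= tau -> ucont tau g ->
  (forall s, 0 <= s -> s <= tau -> rnorm (g s) <= K) ->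
  rnorm (vint tau g) <= tau * K.
Proof.
move=> tau0 gu h; rewrite -[vint _ _]subr0.
apply: (rnorm_lim_le (cvg_riemann_sum tau0 gu)); near=> n; rewrite subr0.
apply: riemann_sum_le => // k k2; have [g1 g2] := grid_bounds tau0 k2.
apply: h => //; apply: le_trans g2; rewrite lerDl divr_ge0// exprn_ge0//.
Unshelve. all: by end_near. Qed.

Lemma vint_cst X tau (x : X) : vint tau (fun=> x) = tau%:C *: x.
Proof.
apply: cvg_lim => //; rewrite (_ : riemann_sum _ _ = cst (tau%:C *: x)); first exact: cvg_cst.
apply/funext => n; rewrite /riemann_sum sumr_const card_ord -scalerMnr scalerMnl -rmorphMn/=.
by rewrite -[_ *+ _]mulr_natr natrX divfK// expf_neq0.
Qed.

Lemma vintZ X tau (g : R -> X) (a : R[i]) : 0 <= tau -> ucont tau g ->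
  vint tau (fun s => a *: g s) = a *: vint tau g.
Proof.
move=> tau0 gu; have := @vintD _ tau g (fun=> 0) a tau0 gu (ucont_cst _ _).
rewrite vint_cst scaler0 addr0 => <-.
by apply: eq_vint => // s _ _; rewrite addr0.
Qed.

Lemma vint_dist X tau (g : R -> X) (x : X) (K : R) : 0 <= tau -> ucont tau g ->
  (forall s, 0 <= s -> s <= tau -> rnorm (g s - x) <= K) ->
  rnorm (vint tau g - tau%:C *: x) <= tau * K.
Proof.
move=> tau0 gu h; have := @vint_le _ tau (fun s => 1 *: g s + (- x)) K tau0.
rewrite vintD// ?scale1r; last exact: ucont_cst.
rewrite vint_cst scalerN; apply; first by apply: ucontD => //; exact: ucont_cst.
by move=> s s0 st; rewrite scale1r; exact: h.
Qed.

Lemma vint_linear X Y tau (f : {linear X -> Y}) (g : R -> X) : 0 <= tau ->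
  continuous f -> ucont tau g -> vint tau (f \o g) = f (vint tau g).
Proof.
move=> tau0 fc gu; apply: cvg_lim => //.
have -> : riemann_sum tau (f \o g) = f \o riemann_sum tau g.
  by apply/funext => n; rewrite /riemann_sum /= linearZ/=; congr (_ *: _); rewrite linear_sum.
exact: (cvg_comp _ _ (cvg_riemann_sum tau0 gu) (fc _)).
Qed.

Lemma vint_ftc X tau (g G : R -> X) : 0 <= tau -> ucont tau g ->
  (forall e : R, 0 < e -> exists2 d : R, 0 < d & forall s h, 0 <= s -> 0 <= h ->
     s + h <= tau -> h <= d -> rnorm (G (s + h) - G s - h%:C *: g s) <= e * h) ->
  vint tau g = G tau - G 0.
Proof.
move=> tau0 gu hG; apply: cvg_lim => //; apply/cvg_rnormP => e e0.
have e1 : 0 < e / (tau + 1) by rewrite divr_gt0//; lra.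
have [d d0 hd] := hG _ e1; have [N hN] := pow2_small tau d0.
exists N => // n /= Nn; set h := tau / 2 ^+ n.
have p1 : (2 : R) ^+ n != 0 by rewrite expf_neq0.
have -> : G tau - G 0 = \sum_(k < 2 ^ n) (G (k.+1%:R * h) - G (k%:R * h)).
  rewrite -(big_mkord xpredT (fun k => G (k.+1%:R * h) - G (k%:R * h))).
  by rewrite (telescope_sumr (fun k => G (k%:R * h)))// mul0r natrX /h mulrC divfK.
rewrite /riemann_sum -/h scaler_sumr -sumrB (le_lt_trans (rnorm_sum _ _ _))//.
apply: (@le_lt_trans _ _ (\sum_(k < 2 ^ n) e / (tau + 1) * h)).
  apply: ler_sum => k _; rewrite rnormC -natr1 mulrDl mul1r.
  have [g1 g2] := grid_bounds tau0 (ltn_ord k).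
  by apply: hd => //; rewrite ?divr_ge0 ?exprn_ge0//; exact: hN.
rewrite sumr_const card_ord -[X in X < _]mulr_natl natrX /h.
rewrite (_ : _ * _ = e * (tau / (tau + 1))); last by field; rewrite p1 gt_eqF//; lra.
by rewrite gtr_pMr// ltr_pdivrMr; lra.
Qed.

Lemma vint_double X tau (g : R -> X) : 0 <= tau -> ucont (2 * tau) g ->
  (forall s, tau <= s -> g s = 0) -> vint (2 * tau) g = vint tau g.
Proof.
move=> tau0 gu g0; have tau2 : 0 <= 2 * tau by rewrite mulr_ge0.
have c := cvg_riemann_sum tau2 gu.
symmetry; apply: cvg_lim => //.
rewrite (_ : riemann_sum tau g = (fun n => riemann_sum (2 * tau) g n.+1)).
  by rewrite -(cvg_shiftS (riemann_sum (2 * tau) g)) in c.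
apply/funext => n; rewrite /riemann_sum.
have p1 : (2 : R) ^+ n != 0 by rewrite expf_neq0.
have -> : 2 * tau / 2 ^+ n.+1 = tau / 2 ^+ n by rewrite exprS; field.
congr (_ *: _); rewrite expnS mul2n -addnn big_split_ord /=.
rewrite [X in _ + X]big1 ?addr0// => k _; apply: g0.
rewrite natrD mulrDl natrX mulrA mulrAC mulfV// mul1r lerDl.
by rewrite mulr_ge0// divr_ge0// exprn_ge0.
Qed.

End VectorIntegral.

(** * Generators, orbits and resolvents *)

Section Kernels.
Context {R : realType}.

Definition klip (tau : R) (phi : R -> R[i]) := exists2 K : R, 0 <= K &
  (forall s, 0 <= s -> s <= tau -> cabs (phi s) <= K) /\
  (forall s t, 0 <= s -> s <= tau -> 0 <= t -> t <= tau ->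
     cabs (phi s - phi t) <= K * `|s - t|).

Definition kder (tau : R) (phi dphi : R -> R[i]) := exists2 K : R, 0 <= K &
  forall s h, 0 <= s -> 0 <= h -> s + h <= tau ->
    cabs (phi (s + h) - phi s - h%:C * dphi s) <= K * h ^+ 2.

End Kernels.

Lemma leibniz_remainder (K : comNzRingType) (V : lmodType K) (p q r h : K) (a b c : V) :
  p *: a - q *: b - h *: (r *: b + q *: c) =
  (p - q - h * r) *: a + (h * r) *: (a - b) + q *: (a - b - h *: c).
Proof.
have {1}-> : p = (p - q - h * r) + h * r + q by ring.
rewrite 2!scalerDl !scalerBr !scalerDr !scalerA [q * h]mulrC opprD !addrA.
by congr (_ - _); rewrite [LHS]addrAC; congr (_ - _); rewrite addrAC.
Qed.

Section Generator.
Context {R : realType} {X : completeNormedModType R[i]}.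
Context {A : partial_operator X} {T : semigroup X} (hA : generates A T).

Lemma gen_graph x : dom A x -> generator_graph T x (A x).
Proof. by move=> dx; apply/hA. Qed.

Lemma gen_eq x y : generator_graph T x y -> dom A x /\ A x = y.
Proof. by move/hA. Qed.

Lemma gen_lin (a : R[i]) x z : dom A x -> dom A z ->
  dom A (a *: x + z) /\ A (a *: x + z) = a *: A x + A z.
Proof.
move=> /gen_graph dx /gen_graph dz; apply: gen_eq; rewrite /generator_graph.
have -> : (fun t : R => (t^-1)%:C *: (T t (a *: x + z) - (a *: x + z))) =
   (fun t => a *: ((t^-1)%:C *: (T t x - x)) + (t^-1)%:C *: (T t z - z)).
  apply/funext => t; rewrite linearP opprD addrACA scalerDr -scalerBr; congr (_ + _).
  by rewrite !scalerA mulrC.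
by apply: cvgD => //; apply: cvgZr.
Qed.

Lemma gen_near y (e : R) : dom A y -> 0 < e ->
  exists2 d : R, 0 < d & forall h, 0 <= h -> h <= d ->
    rnorm (T h y - y - h%:C *: A y) <= e * h.
Proof.
move=> /gen_graph /cvg_rnormP dy /dy; rewrite near_withinE => -[d /= d0 hd].
exists (d / 2); first by rewrite divr_gt0.
move=> h; rewrite le_eqVlt => /orP[/eqP <- _|h0 hd2].
  by rewrite sg_0 subrr sub0r scale0r oppr0 rnorm0 mulr0.
have /hd : ball 0 d h.
  rewrite /ball /= sub0r normrN gtr0_norm//; apply: (le_lt_trans hd2); lra.
move=> /(_ h0) /ltW; rewrite -(ler_pM2r h0) => h1; apply: le_trans h1.
have -> : T h y - y - h%:C *: A y = h%:C *: ((h^-1)%:C *: (T h y - y) - A y).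
  by rewrite scalerBr scalerA -rmorphM mulfV ?scale1r// gt_eqF.
by rewrite rnormZr gtr0_norm// mulrC.
Qed.

Lemma sg_comm t h x : 0 <= t -> 0 <= h -> T t (T h x) = T h (T t x).
Proof. by move=> t0 h0; rewrite -!sg_D// addrC. Qed.

Lemma sg_dom t x : 0 <= t -> dom A x -> dom A (T t x) /\ A (T t x) = T t (A x).
Proof.
move=> t0 /gen_graph dx; apply: gen_eq; rewrite /generator_graph.
have [M M1 hM] := sg_local_bound T t.
apply: (@squeeze_rnorm _ _ _ _ _ _ _ (fun h : R => M * rnorm ((h^-1)%:C *: (T h x - x) - A x))).
  near=> h; have h0 : 0 <= h by near: h; exact: nbhs_right_ge.
  by rewrite sg_comm// -linearB -linearZ/= -linearB/=; exact: hM.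
rewrite -[X in _ --> X](mulr0 M); apply: cvgM; first exact: cvg_cst.
by apply/cvg_rnorm0.
Unshelve. all: by end_near. Qed.

Lemma ucont_orbit tau (x : X) : ucont tau (fun s => T s x).
Proof.
have [M M1 hM] := sg_local_bound T tau.
move=> e e0; have M0 : 0 < M by lra.
have e1 : 0 < e / M by rewrite divr_gt0.
have [d d0 hd] := sg_near0 T x e1; exists d => //.
suff h s t : 0 <= s -> s <= t -> t <= tau -> t - s <= d -> rnorm (T s x - T t x) <= e.
  move=> s t s0 st t0 tt std; have [h1|h1] := leP s t.
    by apply: h => //; apply: le_trans std; rewrite distrC ler_norm.
  by rewrite rnormC; apply: h => //; rewrite ?(ltW h1)//; apply: le_trans std; rewrite ler_norm.
move=> s0 st tt std; have ts : 0 <= t - s by rewrite subr_ge0.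
have -> : T t x = T s (T (t - s) x) by rewrite -sg_D// addrC subrK.
rewrite rnormC -linearB.
apply: (le_trans (hM _ _ s0 (le_trans st tt))).
by rewrite mulrC -ler_pdivlMr//; apply/ltW/hd.
Qed.

Lemma ucont_kernel tau phi (x : X) : 0 <= tau -> klip tau phi ->
  ucont tau (fun s => phi s *: T s x).
Proof.
move=> tau0 [K K0 [hK hK']] e e0; have [M M1 hM] := sg_local_bound T tau.
have K1 : 0 < K + 1 by lra.
have Mx : 0 < M * rnorm x + 1 by rewrite ltr_wpDl// mulr_ge0 ?rnorm_ge0//; lra.
have e1 : 0 < e / 2 / (K + 1) by rewrite !divr_gt0.
have [d d0 hd] := ucont_orbit tau x e1.
have d1 : 0 < e / 2 / ((K + 1) * (M * rnorm x + 1)).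
  by rewrite !divr_gt0// mulr_gt0.
exists (Num.min d (e / 2 / ((K + 1) * (M * rnorm x + 1)))); first by rewrite lt_min d0.
move=> s t s0 st t0 tt; rewrite le_min => /andP[h1 h2].
have -> : phi s *: T s x - phi t *: T t x =
    phi s *: (T s x - T t x) + (phi s - phi t) *: T t x.
  by rewrite scalerBr scalerBl addrA subrK.
apply: (le_trans (rnormD _ _)); rewrite !rnormZ (splitr e) lerD//.
  have := ler_pM (cabs_ge0 _) (rnorm_ge0 _) (hK _ s0 st) (hd _ _ s0 st t0 tt h1).
  move/le_trans; apply; rewrite mulrA ler_pdivrMr// mulrC ler_wpM2l//; lra.
have := ler_pM (cabs_ge0 _) (rnorm_ge0 _) (hK' _ _ s0 st t0 tt) (hM _ x t0 tt).
move/le_trans; apply.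
apply: (@le_trans _ _ (((K + 1) * (M * rnorm x + 1)) * `|s - t|)).
  rewrite mulrAC ler_wpM2r// ler_pM ?mulr_ge0 ?rnorm_ge0//; lra.
by rewrite mulrC -ler_pdivlMr// mulr_gt0.
Qed.

Lemma orbit_ftc tau phi dphi y : 0 <= tau -> klip tau phi -> klip tau dphi ->
  kder tau phi dphi -> dom A y ->
  vint tau (fun s => dphi s *: T s y) + vint tau (fun s => phi s *: T s (A y)) =
  phi tau *: T tau y - phi 0 *: y.
Proof.
move=> tau0 lphi ldphi [L L0 hL] dy.
have u1 := ucont_kernel y tau0 ldphi; have u2 := ucont_kernel (A y) tau0 lphi.
rewrite -[vint tau (fun s => dphi s *: T s y)]scale1r -vintD//.
rewrite -[X in _ = _ - phi 0 *: X](sg_0 T).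
apply: (@vint_ftc _ _ tau _ (fun s => phi s *: T s y)) => //; first exact: ucontD.
move=> e e0; have [M M1 hM] := sg_local_bound T tau.
have [[K K0 [hK _]] [K' K'0 [hK' _]]] := (lphi, ldphi).
have M0 : 0 < M by lra.
set N := M * (L * (M * rnorm y) + K' + K + 1).
have LM : 0 <= L * (M * rnorm y) by rewrite !mulr_ge0 ?rnorm_ge0// ltW.
have N0 : 0 < N by rewrite mulr_gt0//; lra.
have e1 : 0 < e / N by rewrite divr_gt0.
have [d1 d10 hd1] := gen_near dy e1.
have [d2 d20 hd2] := sg_near0 T y e1.
exists (Num.min (e / N) (Num.min d1 d2)); first by rewrite !lt_min e1 d10.
move=> s h s0 h0 sh; rewrite !le_min => /and3P[he h1 h2].
have st : s <= tau by apply: le_trans sh; rewrite lerDl.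
have ht : h <= tau by apply: le_trans sh; rewrite lerDr.
have -> : phi (s + h) *: T (s + h) y - phi s *: T s y
    - h%:C *: (1 *: (dphi s *: T s y) + phi s *: T s (A y)) =
  T s ((phi (s + h) - phi s - h%:C * dphi s) *: T h y
       + (h%:C * dphi s) *: (T h y - y) + phi s *: (T h y - y - h%:C *: A y)).
  have TD a b : T s (a + b) = T s a + T s b by rewrite linearD.
  have TB a b : T s (a - b) = T s a - T s b by rewrite linearB.
  have TZ c a : T s (c *: a) = c *: T s a by rewrite linearZ.
  rewrite sg_D// !TD !TZ !TB TZ scale1r.
  exact: leibniz_remainder.
apply: (le_trans (hM _ _ s0 st)).
have b1 : rnorm ((phi (s + h) - phi s - h%:C * dphi s) *: T h y)
    <= e / N * h * (L * (M * rnorm y)).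
  rewrite rnormZ; have := ler_pM (cabs_ge0 _) (rnorm_ge0 _) (hL _ _ s0 h0 sh) (hM _ y h0 ht).
  move/le_trans; apply.
  rewrite (_ : L * h ^+ 2 * (M * rnorm y) = h * h * (L * (M * rnorm y))); last by ring.
  by rewrite ler_wpM2r// ler_wpM2r.
have b2 : rnorm ((h%:C * dphi s) *: (T h y - y)) <= e / N * h * K'.
  rewrite rnormZ cabsM cabsr ger0_norm// -mulrA.
  rewrite (_ : e / N * h * K' = h * (K' * (e / N))); last by ring.
  rewrite ler_wpM2l//; apply: ler_pM; rewrite ?cabs_ge0 ?rnorm_ge0//.
    exact: hK'.
  exact/ltW/hd2.
have b3 : rnorm (phi s *: (T h y - y - h%:C *: A y)) <= e / N * h * K.
  rewrite rnormZ [leRHS]mulrC.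
  apply: ler_pM; rewrite ?cabs_ge0 ?rnorm_ge0//.
    exact: hK.
  exact: hd1.
apply: (@le_trans _ _ (M * (e / N * h * (L * (M * rnorm y) + K' + K)))).
  rewrite ler_wpM2l ?(ltW M0)// !mulrDr.
  apply: (le_trans (rnormD _ _)); rewrite lerD//.
  by apply: (le_trans (rnormD _ _)); rewrite lerD.
apply: (@le_trans _ _ (e / N * h * N)).
  have eh : 0 <= e / N * h by rewrite mulr_ge0// ltW.
  rewrite [leLHS]mulrCA (ler_wpM2l eh)//.
  by rewrite /N ler_wpM2l ?(ltW M0)//; lra.
by rewrite mulrAC divfK ?gt_eqF.
Qed.

Lemma klip1 tau : klip tau (fun=> 1 : R[i]).
Proof.
exists 1 => //; split => *; last by rewrite subrr mul1r -[0]/(0%:C) cabsr normr0.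
by rewrite -[1]/(1%:C) cabsr normr1.
Qed.

Lemma klip0 tau : klip tau (fun=> 0 : R[i]).
Proof.
by exists 0 => //; split => *; rewrite ?subrr -[0]/(0%:C) cabsr normr0// mul0r.
Qed.

Lemma kder10 tau : kder tau (fun=> 1 : R[i]) (fun=> 0).
Proof. by exists 0 => // *; rewrite subrr mulr0 subrr -[0]/(0%:C) cabsr normr0 mul0r. Qed.

Lemma orbit_ftc1 tau y : 0 <= tau -> dom A y ->
  vint tau (fun s => T s (A y)) = T tau y - y.
Proof.
move=> tau0 dy; have := orbit_ftc tau0 (klip1 tau) (klip0 tau) (kder10 tau) dy.
rewrite !scale1r => <-.
have -> : (fun s => (0 : R[i]) *: T s y) = fun=> 0 by apply/funext => s; rewrite scale0r.
rewrite vint_cst scaler0 add0r; congr vint; apply/funext => s; by rewrite scale1r.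
Qed.

Lemma vint_orbit_near z (e : R) : 0 < e -> exists2 d : R, 0 < d & forall t, 0 <= t -> t <= d ->
  rnorm (vint t (fun s => T s z) - t%:C *: z) <= t * e.
Proof.
move=> e0; have [d d0 hd] := sg_near0 T z e0; exists d => // t t0 td.
apply: vint_dist => //; first exact: ucont_orbit.
by move=> s s0 st; apply/ltW/hd => //; exact: le_trans td.
Qed.

(** Integrate [A] along the orbits and pass to the limit under the integral. *)
Lemma gen_closed (u : nat -> X) y z : (forall n, dom A (u n)) ->
  u @ \oo --> y -> (fun n => A (u n)) @ \oo --> z -> dom A y /\ A y = z.
Proof.
move=> du uy Auz; apply: gen_eq.
have key t : 0 <= t -> vint t (fun s => T s z) = T t y - y.
  move=> t0; have [M M1 hM] := sg_local_bound T t.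
  apply/eqP; rewrite eq_sym -subr_eq0; apply/eqP/rnorm_eq0.
  have : (fun n => T t (u n) - u n - vint t (fun s => T s (A (u n)))) @ \oo -->
      T t y - y - vint t (fun s => T s z).
    apply: cvgB.
      apply: cvgB => //; apply: (cvg_comp u (T t) uy); exact: sg_continuous.
    apply: (@squeeze_rnorm _ _ _ _ _ _ _ (fun n => t * (M * rnorm (A (u n) - z)))).
      near=> n; rewrite -[in leLHS]scaleN1r addrC.
      rewrite -vintD//; try exact: ucont_orbit.
      apply: vint_le => //; first by apply: ucontD; exact: ucont_orbit.
      by move=> s s0 st; rewrite scaleN1r addrC -linearB/=; exact: hM.
    rewrite -[X in _ --> X](mulr0 t); apply: cvgM; first exact: cvg_cst.
    rewrite -[X in _ --> X](mulr0 M); apply: cvgM; first exact: cvg_cst.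
    exact/cvg_rnorm0.
  have -> : (fun n => T t (u n) - u n - vint t (fun s => T s (A (u n)))) = fun=> 0.
    by apply/funext => n; rewrite orbit_ftc1// subrr.
  move=> /cvg_rnorm; rewrite rnorm0 => h.
  exact: (cvg_unique (@Rhausdorff R) h (cvg_cst 0)).
apply/cvg_rnormP => e e0; have e2 : 0 < e / 2 by lra.
have [d d0 hd] := vint_orbit_near z e2.
near=> t; have t0 : 0 < t by near: t; exact: nbhs_right_gt.
rewrite -key ?ltW// -(ltr_pM2l t0) -{1}(gtr0_norm t0) -rnormZr scalerBr scalerA.
rewrite -rmorphM mulfV ?gt_eqF// scale1r.
apply: (@le_lt_trans _ _ (t * (e / 2))); last by rewrite ltr_pM2l//; lra.
apply: hd; first exact: ltW.
by near: t; exact: nbhs_right_le.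
Unshelve. all: by end_near. Qed.

End Generator.

(** * Scalar kernels *)

Section SmoothKernels.
Context {R : realType}.

Lemma is_derive_continuous (a a1 : R -> R) :
  (forall t, is_derive t (1 : R) a (a1 t)) -> continuous a.
Proof. by move=> h t; apply/differentiable_continuous/derivable1_diffP; have [] := h t. Qed.

Lemma continuous_bounded (a : R -> R) (l r : R) : {within `[l, r], continuous a} ->
  exists2 K : R, 0 <= K & forall s, l <= s -> s <= r -> `|a s| <= K.
Proof.
move=> ca; have [lr|rl] := leP l r; last first.
  by exists 0 => // s ls sr; have := le_lt_trans (le_trans ls sr) rl; rewrite ltxx.
have [|c _ hc] := @EVT_max R (fun s => `|a s|) l r lr; last first.
- exists `|a c| => // s ls sr; apply: hc; by rewrite in_itv/= ls.
- move=> s; apply: (continuous_comp (ca s)); exact: norm_continuous.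
Qed.

Lemma lipschitz_of_derive (a a1 : R -> R) (l r K : R) :
  (forall t, is_derive t (1 : R) a (a1 t)) ->
  (forall s, l <= s -> s <= r -> `|a1 s| <= K) ->
  forall s t, l <= s -> s <= r -> l <= t -> t <= r -> `|a s - a t| <= K * `|s - t|.
Proof.
move=> da ba.
suff h s t : l <= s -> s <= t -> t <= r -> `|a t - a s| <= K * `|t - s|.
  move=> s t ls sr lt tr; have [st|ts] := leP s t; first by rewrite distrC (distrC s) h.
  by rewrite h// ltW.
move=> ls st tr.
have [c + ->] := MVT_segment st (fun x _ => da x)
  (continuous_subspaceT (is_derive_continuous da)).
rewrite in_itv/= => /andP[sc ct]; rewrite normrM ler_wpM2r//.
by apply: ba; [exact: le_trans sc|exact: le_trans ct _].
Qed.

Lemma taylor_of_derive (a a1 : R -> R) (l r K : R) :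
  (forall t, is_derive t (1 : R) a (a1 t)) ->
  (forall s t, l <= s -> s <= r -> l <= t -> t <= r -> `|a1 s - a1 t| <= K * `|s - t|) ->
  forall s t, l <= s -> s <= r -> l <= t -> t <= r ->
    `|a t - a s - (t - s) * a1 s| <= K * (t - s) ^+ 2.
Proof.
move=> da la s t ls sr lt tr.
have key c : (c - s) ^+ 2 <= (t - s) ^+ 2 -> l <= c -> c <= r ->
    a t - a s = a1 c * (t - s) -> `|a t - a s - (t - s) * a1 s| <= K * (t - s) ^+ 2.
  move=> cs lc cr ->; rewrite mulrC -mulrBr normrM.
  apply: (le_trans (ler_wpM2l (normr_ge0 _) (la _ _ lc cr ls sr))).
  have [->|ts] := eqVneq t s; first by rewrite subrr normr0 mul0r expr0n mulr0.
  have K0 : 0 <= K.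
    have := la _ _ lt tr ls sr; have tspos : 0 < `|t - s| by rewrite normr_gt0 subr_eq0.
    by move=> /(le_trans (normr_ge0 _)); rewrite pmulr_lge0.
  rewrite mulrCA ler_wpM2l// -[leRHS]real_normK ?num_real// expr2 ler_wpM2l//.
  by rewrite -ler_sqr ?nnegrE ?normr_ge0// !real_normK ?num_real.
have cont l' r' := continuous_subspaceT (A := `[l', r']) (is_derive_continuous da).
have [st|/ltW ts] := leP s t.
  have [c + h] := MVT_segment st (fun x _ => da x) (cont s t).
  rewrite in_itv/= => /andP[sc ct]; apply: (key c) => //.
  - by rewrite ler_sqr ?nnegrE ?subr_ge0// lerD2r.
  - exact: le_trans sc.
  - exact: le_trans tr.
have [c + h] := MVT_segment ts (fun x _ => da x) (cont t s).
rewrite in_itv/= => /andP[tc cs]; apply: (key c) => //.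
- by rewrite -[leLHS]sqrrN -[leRHS]sqrrN !opprB ler_sqr ?nnegrE ?subr_ge0// lerD2l lerN2.
- exact: le_trans tc.
- exact: le_trans sr.
- by rewrite -opprB h -mulrN opprB.
Qed.

Definition is_cderive (f : R -> R[i]) (t : R) (l : R[i]) :=
  is_derive t (1 : R) (fun s => complex.Re (f s)) (complex.Re l) /\
  is_derive t (1 : R) (fun s => complex.Im (f s)) (complex.Im l).

Lemma cReD (x y : R[i]) : complex.Re (x + y) = complex.Re x + complex.Re y.
Proof. by case: x y => ? ? []. Qed.
Lemma cImD (x y : R[i]) : complex.Im (x + y) = complex.Im x + complex.Im y.
Proof. by case: x y => ? ? []. Qed.
Lemma cReN (x : R[i]) : complex.Re (- x) = - complex.Re x.
Proof. by case: x. Qed.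
Lemma cImN (x : R[i]) : complex.Im (- x) = - complex.Im x.
Proof. by case: x. Qed.
Lemma cReM (x y : R[i]) : complex.Re (x * y) =
  complex.Re x * complex.Re y - complex.Im x * complex.Im y.
Proof. by case: x y => ? ? []. Qed.
Lemma cImM (x y : R[i]) : complex.Im (x * y) =
  complex.Re x * complex.Im y + complex.Im x * complex.Re y.
Proof. by case: x y => ? ? []. Qed.

Lemma kernel_C2 (f f1 f2 : R -> R[i]) (tau : R) :
  (forall t, is_cderive f t (f1 t)) -> (forall t, is_cderive f1 t (f2 t)) ->
  continuous (fun t => complex.Re (f2 t)) -> continuous (fun t => complex.Im (f2 t)) ->
  [/\ klip tau f, klip tau f1 & kder tau f f1].
Proof.
move=> df df1 cr ci.
have dr t := proj1 (df t); have di t := proj2 (df t).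
have dr1 t := proj1 (df1 t); have di1 t := proj2 (df1 t).
have bnd (a : R -> R) : continuous a -> exists2 K : R, 0 <= K &
    forall s, 0 <= s -> s <= tau -> `|a s| <= K.
  by move=> ca; apply: continuous_bounded; exact: continuous_subspaceT.
have [B0 B00 b0] := bnd _ (is_derive_continuous dr).
have [C0 C00 c0] := bnd _ (is_derive_continuous di).
have [B1 B10 b1] := bnd _ (is_derive_continuous dr1).
have [C1 C10 c1] := bnd _ (is_derive_continuous di1).
have [B2 B20 b2] := bnd _ cr; have [C2 C20 c2] := bnd _ ci.
have lr := lipschitz_of_derive dr b1; have li := lipschitz_of_derive di c1.
have lr1 := lipschitz_of_derive dr1 b2; have li1 := lipschitz_of_derive di1 c2.
have kl (g : R -> R[i]) (K K' L L' : R) : 0 <= K -> 0 <= K' -> 0 <= L -> 0 <= L' ->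
    (forall s, 0 <= s -> s <= tau -> `|complex.Re (g s)| <= K) ->
    (forall s, 0 <= s -> s <= tau -> `|complex.Im (g s)| <= K') ->
    (forall s t, 0 <= s -> s <= tau -> 0 <= t -> t <= tau ->
      `|complex.Re (g s) - complex.Re (g t)| <= L * `|s - t|) ->
    (forall s t, 0 <= s -> s <= tau -> 0 <= t -> t <= tau ->
      `|complex.Im (g s) - complex.Im (g t)| <= L' * `|s - t|) -> klip tau g.
  move=> K0 K'0 L0 L'0 h1 h2 h3 h4; exists (K + K' + L + L'); first by rewrite !addr_ge0.
  split=> [s s0 st|s t s0 st t0 tt]; apply: (le_trans (cabs_le _)).
    by have := h1 _ s0 st; have := h2 _ s0 st; lra.
  rewrite !cReD !cImD cReN cImN.
  have := h3 _ _ s0 st t0 tt; have := h4 _ _ s0 st t0 tt; have := normr_ge0 (s - t).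
  move=> n0 h5 h6; apply: (le_trans (lerD h6 h5)); rewrite -mulrDl ler_wpM2r//; lra.
split.
- exact: (kl f B0 C0 B1 C1).
- exact: (kl f1 B1 C1 B2 C2).
- exists (B2 + C2); first exact: addr_ge0.
  move=> s h s0 h0 sh; apply: (le_trans (cabs_le _)).
  have st : s <= tau by apply: le_trans sh; rewrite lerDl.
  have sh0 : 0 <= s + h by rewrite addr_ge0.
  have := taylor_of_derive dr lr1 s0 st sh0 sh.
  have := taylor_of_derive di li1 s0 st sh0 sh.
  have -> : s + h - s = h by rewrite addrC addKr.
  move=> h1 h2; rewrite !cReD !cImD !cReN !cImN cReM cImM /= !mul0r subr0 addr0.
  by rewrite mulrDl lerD.
Qed.

Definition cexp (s : R[i]) (t : R) : R[i] := laplace_re s t +i* laplace_im s t.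

Lemma is_derive_laplace_re (s : R[i]) (t : R) : is_derive t (1 : R) (laplace_re s)
  (- complex.Re s * laplace_re s t + complex.Im s * laplace_im s t).
Proof.
rewrite /laplace_re /laplace_im; apply: is_derive_eq.
by rewrite !scaler1 /GRing.scale /=; ring.
Qed.

Lemma is_derive_laplace_im (s : R[i]) (t : R) : is_derive t (1 : R) (laplace_im s)
  (- complex.Re s * laplace_im s t - complex.Im s * laplace_re s t).
Proof.
rewrite /laplace_re /laplace_im; apply: is_derive_eq.
by rewrite !scaler1 /GRing.scale /=; ring.
Qed.

Lemma is_cderive_cexp s t : is_cderive (cexp s) t (- s * cexp s t).
Proof.
split.
  by apply: (is_derive_eq (is_derive_laplace_re s t)); rewrite cReM cReN cImN /=; ring.
by apply: (is_derive_eq (is_derive_laplace_im s t)); rewrite cImM cReN cImN /=; ring.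
Qed.

Lemma is_cderiveZ (c : R[i]) (f : R -> R[i]) t l : is_cderive f t l ->
  is_cderive (fun t => c * f t) t (c * l).
Proof.
move=> [h1 h2]; split.
  have -> : (fun s => complex.Re (c * f s)) =
    (fun s => complex.Re c * complex.Re (f s) - complex.Im c * complex.Im (f s)).
    by apply/funext => s; rewrite cReM.
  apply: is_derive_eq; rewrite cReM /GRing.scale /=; ring.
have -> : (fun s => complex.Im (c * f s)) =
    (fun s => complex.Re c * complex.Im (f s) + complex.Im c * complex.Re (f s)).
  by apply/funext => s; rewrite cImM.
apply: is_derive_eq; rewrite cImM /GRing.scale /=; ring.
Qed.

Lemma cexp0 s : cexp s 0 = 1.
Proof. by rewrite /cexp /laplace_re /laplace_im !mulr0 oppr0 expR0 cos0 sin0 mulr1 mulr0 oppr0. Qed.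

Lemma cabs_cexp s t : cabs (cexp s t) = expR (- (complex.Re s * t)).
Proof.
rewrite /cabs normc_def /= /laplace_re /laplace_im sqrrN !exprMn -mulrDr cos2Dsin2 mulr1.
by rewrite sqrtr_sqr ger0_norm// expR_ge0.
Qed.

Lemma kernel_cexp s tau :
  [/\ klip tau (cexp s), klip tau (fun t => - s * cexp s t) &
      kder tau (cexp s) (fun t => - s * cexp s t)].
Proof.
have dc2 t : is_cderive (fun t => - s * (- s * cexp s t)) t (- s * (- s * (- s * cexp s t))).
  by do 2 apply: is_cderiveZ; exact: is_cderive_cexp.
apply: (@kernel_C2 _ _ (fun t => - s * (- s * cexp s t))).
- exact: is_cderive_cexp.
- by move=> t; apply: is_cderiveZ; exact: is_cderive_cexp.
- by apply: is_derive_continuous => t; exact: (proj1 (dc2 t)).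
- by apply: is_derive_continuous => t; exact: (proj2 (dc2 t)).
Qed.

End SmoothKernels.

(** * Resolvents to the right of the growth bound *)

Section HalfPlane.
Context {R : realType} {X : completeNormedModType R[i]}.

Lemma neumann (K : X -> X) : (forall u v, K (u - v) = K u - K v) ->
  (forall z, rnorm (K z) <= 2^-1 * rnorm z) -> forall x, exists z, z - K z = x.
Proof.
move=> KB hK x.
pose z := fix z n := if n is m.+1 then x + K (z m) else 0.
have K0 : K 0 = 0 by have := KB 0 0; rewrite !subrr.
have dz n : rnorm (z n.+1 - z n) <= 2^-1 ^+ n * rnorm x.
  elim: n => [|n ih]; first by rewrite /= K0 addr0 subr0 expr0 mul1r.
  rewrite -/(z n.+1) [z n.+2]/(x + K (z n.+1)) [X in _ - X]/(x + K (z n)).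
  rewrite opprD addrACA subrr add0r -KB exprS -mulrA.
  by apply: (le_trans (hK _)); rewrite ler_wpM2l.
have dz2 n p : rnorm (z (n + p)%N - z n) <= 2 * 2^-1 ^+ n * (1 - 2^-1 ^+ p) * rnorm x.
  elim: p => [|p ih]; first by rewrite addn0 subrr rnorm0 expr0 subrr mulr0 mul0r.
  rewrite addnS; apply: (le_trans (rnorm_distD (z (n + p)%N) _ _)).
  apply: (le_trans (lerD (dz _) ih)); rewrite -mulrDl ler_wpM2r ?rnorm_ge0//.
  rewrite exprD exprS; lra.
have dz3 n p : rnorm (z (n + p)%N - z n) <= 2 * 2^-1 ^+ n * rnorm x.
  apply: (le_trans (dz2 n p)); rewrite ler_wpM2r ?rnorm_ge0//.
  by rewrite ler_piMr ?gerBl ?mulr_ge0 ?exprn_ge0 ?invr_ge0.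
have zc : cvgn z.
  apply: rnorm_cauchy_cvg => e e0.
  have x1 : 0 < 4 * rnorm x + 1 by have := rnorm_ge0 x; lra.
  have e1 : 0 < e / (4 * rnorm x + 1) by rewrite divr_gt0.
  have /cvgrPdist_lt /(_ _ e1) [N _ hN] := @cvg_geometric R 1 2^-1 ltac:(rewrite ger0_norm; lra).
  have := hN N (leqnn N); rewrite /geometric /= mul1r sub0r normrN ger0_norm ?exprn_ge0//.
  rewrite ltr_pdivlMr// => he; exists N => m n Nm Nn.
  apply: le_lt_trans he; apply: (le_trans (rnorm_distD (z N) _ _)).
  rewrite -(subnKC Nm) -(subnKC Nn) (rnormC (z N)).
  apply: (le_trans (lerD (dz3 _ _) (dz3 _ _))).
  by have := exprn_ge0 N (ltW (_ : 0 < 2^-1 :> R)); lra.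
exists (lim (z @ \oo)); set l := lim _.
have zl : z @ \oo --> l by [].
have h1 : (fun n => z n.+1 - K (z n)) @ \oo --> l - K l.
  apply: cvgB; first by rewrite (cvg_shiftS z).
  apply: (@squeeze_rnorm _ _ _ _ _ _ _ (fun n => 2^-1 * rnorm (z n - l))).
    by near=> n; rewrite -KB; exact: hK.
  rewrite -[X in _ --> X](mulr0 (2^-1)); apply: cvgM; first exact: cvg_cst.
  exact/cvg_rnorm0.
have e : (fun n => z n.+1 - K (z n)) = fun=> x.
  by apply/funext => n /=; rewrite addrK.
by rewrite e in h1; exact: cvg_cst_eq h1.
Unshelve. all: by end_near. Qed.

Context {A : partial_operator X} {T : semigroup X} (hA : generates A T).

Lemma cexp_contraction b : half_plane (growth_bound T) b ->
  exists2 tau : R, 0 <= tau & forall z, rnorm (cexp b tau *: T tau z) <= 2^-1 * rnorm z.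
Proof.
move=> /growth_bound_exp[w wb [M M1 hM]].
have d0 : 0 < complex.Re b - w by rewrite subr_gt0.
have M2 : 0 < 2 * M by lra.
exists (ln (2 * M) / (complex.Re b - w)).
  by rewrite divr_ge0 ?(ltW d0)// ln_ge0//; lra.
set tau := _ / _ => z.
have tau0 : 0 <= tau by rewrite divr_ge0 ?(ltW d0)// ln_ge0//; lra.
rewrite rnormZ cabs_cexp; apply: (le_trans (ler_wpM2l (expR_ge0 _) (hM _ _ tau0))).
rewrite mulrA ler_wpM2r ?rnorm_ge0// mulrCA -expRD.
rewrite (_ : - _ + _ = - ((complex.Re b - w) * tau)); last by ring.
rewrite [(_ - _) * tau]mulrC divfK ?gt_eqF// expRN lnK ?posrE//.
by rewrite invfM mulrCA mulfV ?mulr1// gt_eqF//; lra.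
Qed.

Lemma gen_inj b y : half_plane (growth_bound T) b -> dom A y -> b *: y = A y -> y = 0.
Proof.
move=> hb dy byAy; have [tau tau0 htau] := cexp_contraction hb.
have [k1 k2 k3] := kernel_cexp b tau.
have := orbit_ftc hA tau0 k1 k2 k3 dy; rewrite -byAy.
set v1 := vint _ _; set v2 := vint _ _.
have -> : v1 = - v2.
  rewrite -scaleN1r /v2 -vintZ//; last exact: ucont_kernel.
  apply: eq_vint => // s _ _; rewrite [T s (b *: y)]linearZ/= !scalerA; congr (_ *: _).
  by ring.
rewrite addNr cexp0 scale1r => /eqP; rewrite eq_sym subr_eq0 => /eqP h.
have := htau y; rewrite h => h2; apply: rnorm_eq0; apply/eqP; rewrite eq_le rnorm_ge0 andbT.
by have := rnorm_ge0 y; lra.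
Qed.

Context {beta : R[i]} {Q : {linear X -> X}} (Qc : continuous Q).
Hypothesis Q1 : forall y, dom A (Q y) /\ beta *: Q y - A (Q y) = y.
Hypothesis Q2 : forall x, dom A x -> Q (beta *: x - A x) = x.

Lemma AQ y : A (Q y) = beta *: Q y - y.
Proof. by have [_ h] := Q1 y; rewrite -[X in _ = _ - X]h opprB addrC subrK. Qed.

Lemma sgQ t x : 0 <= t -> T t (Q x) = Q (T t x).
Proof.
move=> t0; have [d h] := Q1 x; have [d' h'] := sg_dom hA t0 d.
by rewrite -(Q2 d') h' -linearZ/= -linearB/= h.
Qed.

(** Integrating an orbit against a smooth kernel gives an element of the domain:
    this is integration by parts, after regularising the orbit by [Q]. *)
Lemma orbit_dom tau phi dphi x : 0 <= tau -> klip tau phi -> klip tau dphi ->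
  kder tau phi dphi ->
  dom A (vint tau (fun s => phi s *: T s x)) /\
  A (vint tau (fun s => phi s *: T s x)) =
    phi tau *: T tau x - phi 0 *: x - vint tau (fun s => dphi s *: T s x).
Proof.
move=> tau0 k1 k2 k3; set V := vint _ _; set W := vint _ _.
have vQ (psi : R -> R[i]) z : klip tau psi ->
    vint tau (fun s => psi s *: T s (Q z)) = Q (vint tau (fun s => psi s *: T s z)).
  move=> kp; rewrite -vint_linear//; last exact: ucont_kernel.
  by apply: eq_vint => // s s0 _ /=; rewrite sgQ// linearZ.
have [dQx _] := Q1 x.
have := orbit_ftc hA tau0 k1 k2 k3 dQx; rewrite sgQ//.
have -> : vint tau (fun s => phi s *: T s (A (Q x))) = beta *: Q V - V.
  have -> : beta *: Q V = vint tau (fun s => phi s *: T s (beta *: Q x)).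
    rewrite -vQ// -vintZ//; last exact: ucont_kernel.
    by apply: eq_vint => // s _ _; rewrite [T s (beta *: _)]linearZ/= !scalerA mulrC.
  rewrite addrC -scaleN1r -vintD//; try exact: ucont_kernel.
  apply: eq_vint => // s s0 _; rewrite AQ linearB/= scalerBr.
  by rewrite scaleN1r addrC.
rewrite vQ// -/W => h.
have hV : V = Q (W + beta *: V - (phi tau *: T tau x - phi 0 *: x)).
  rewrite linearB/= linearD/= [Q (beta *: V)]linearZ/= [Q (_ - phi 0 *: x)]linearB/=.
  rewrite ![Q (_ *: _)]linearZ/= -h.
  by rewrite [Q W + (_ - V)]addrA opprB [RHS]addrC subrK.
have [d e] := Q1 (W + beta *: V - (phi tau *: T tau x - phi 0 *: x)).
rewrite -hV in d e; split => //.
have -> : A V = beta *: V - (beta *: V - A V) by rewrite opprB addrC subrK.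
by rewrite e opprB [W + _]addrC opprD addrCA [beta *: V + _]addrA subrr add0r.
Qed.

Lemma dom_dense (x : X) : exists u : nat -> X, (forall n, dom A (u n)) /\ u @ \oo --> x.
Proof.
have step (n : nat) : exists y, dom A y /\ rnorm (y - x) <= n.+1%:R^-1.
  have e0 : 0 < (n.+1%:R^-1 : R) by rewrite invr_gt0.
  have [d d0 hd] := @vint_orbit_near _ _ T x _ e0.
  have [dV _] := orbit_dom x (ltW d0) (klip1 d) (klip0 d) (kder10 d).
  set V := vint _ _ in dV.
  have VE : V = vint d (fun s => T s x).
    by apply: eq_vint => [|s _ _]; [exact: ltW|rewrite scale1r].
  exists ((d^-1)%:C *: V); split.
    have [+ _] := gen_lin hA (d^-1)%:C dV (proj1 (Q1 0)).
    by rewrite linear0 addr0.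
  have := hd d (ltW d0) (lexx d); rewrite -VE.
  have -> : V - d%:C *: x = d%:C *: ((d^-1)%:C *: V - x).
    by rewrite scalerBr scalerA -rmorphM mulfV ?gt_eqF// scale1r.
  by rewrite rnormZr gtr0_norm// ler_pM2l.
have [u hu] := choice step; exists u; split; first by move=> n; have [] := hu n.
apply: (@squeeze_rnorm _ _ _ _ _ _ _ (fun n => n.+1%:R^-1)); last exact: cvg_harmonic.
by near=> n; have [] := hu n.
Unshelve. all: by end_near. Qed.

Lemma resolvent_half_plane_bound b : half_plane (growth_bound T) b ->
  exists2 N : R, 0 <= N & forall x, exists y,
    [/\ dom A y, b *: y - A y = x & rnorm y <= N * rnorm x].
Proof.
move=> hb; have [tau tau0 htau] := cexp_contraction hb.
have [k1 k2 k3] := kernel_cexp b tau.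
have [K K0 [hK _]] := k1; have [M M1 hM] := sg_local_bound T tau.
exists (tau * (K * (M * 2))); first by rewrite !mulr_ge0//; lra.
move=> x; have [|z hz] := @neumann (fun z => cexp b tau *: T tau z) _ htau x.
  by move=> u v; rewrite linearB/= scalerBr.
have zx : rnorm z <= 2 * rnorm x.
  have := rnormD x (cexp b tau *: T tau z); rewrite -{1}hz subrK.
  by have := htau z; lra.
have [d e] := orbit_dom z tau0 k1 k2 k3.
set V := vint _ _ in d e; exists V; split => //; last first.
  rewrite -!mulrA; apply: vint_le => //; first exact: ucont_kernel.
  move=> s s0 st; rewrite rnormZ; apply: ler_pM; rewrite ?cabs_ge0 ?rnorm_ge0//.
    exact: hK.
  by apply: (le_trans (hM _ _ s0 st)); rewrite ler_wpM2l//; lra.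
rewrite e cexp0 scale1r.
have -> : vint tau (fun s => (- b * cexp b s) *: T s z) = - (b *: V).
  rewrite -scaleNr -vintZ//; last exact: ucont_kernel.
  by apply: eq_vint => // s _ _; rewrite scalerA.
by rewrite opprK opprD opprB addrC subrK.
Qed.

Lemma resolvent_half_plane b x : half_plane (growth_bound T) b ->
  exists2 y, dom A y & b *: y - A y = x.
Proof. by move=> /resolvent_half_plane_bound[N _ h]; have [y [? ? _]] := h x; exists y. Qed.

End HalfPlane.

(** * The extrapolation space *)

Section Extrapolation.
Context {R : realType} {X : completeNormedModType R[i]}.
Context {A : partial_operator X} {T : semigroup X} (hA : generates A T).
Context {beta : R[i]} {Q : {linear X -> X}} (Qc : continuous Q).
Hypothesis Q1 : forall y, dom A (Q y) /\ beta *: Q y - A (Q y) = y.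
Hypothesis Q2 : forall x, dom A x -> Q (beta *: x - A x) = x.
Context (E : extrapolation A T beta).

Local Notation emb := (ext_emb E).
Local Notation op := (ext_op E).

Lemma emb_norm x : rnorm (emb x) = rnorm (Q x).
Proof.
rewrite ext_emb_norm /resolvent.
by rewrite (xget_unique 0 (Q1 x))// => y [dy <-]; rewrite Q2.
Qed.

Lemma A0 : A 0 = 0.
Proof. by have [_] := Q1 0; rewrite linear0 scaler0 sub0r => /eqP; rewrite oppr_eq0 => /eqP. Qed.

Lemma Q_inj x : Q x = 0 -> x = 0.
Proof. by move=> Qx; have [_] := Q1 x; rewrite Qx scaler0 A0 subr0. Qed.

Lemma emb_inj : injective emb.
Proof.
move=> x y xy; apply/eqP; rewrite -subr_eq0; apply/eqP; apply: Q_inj; apply: rnorm_eq0.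
by rewrite -emb_norm linearB/= xy subrr rnorm0.
Qed.

Lemma cvg_emb (u : nat -> X) (x : X) : u @ \oo --> x -> (emb \o u) @ \oo --> emb x.
Proof.
move=> ux; have [M M0 hM] := continuous_linear_bound Qc.
apply: (@squeeze_rnorm _ _ _ _ _ _ _ (fun n => M * rnorm (u n - x))).
  by near=> n; rewrite /= -linearB/= emb_norm.
rewrite -[X in _ --> X](mulr0 M); apply: cvgM; first exact: cvg_cst.
exact/cvg_rnorm0.
Unshelve. all: by end_near. Qed.

Definition ext_gen : partial_operator (ext_space E) :=
  {| dom := range emb; op_fun := fun z => op (xget 0 [set x | emb x = z]) |}.

Lemma ext_gen_emb x : ext_gen (emb x) = op x.
Proof.
by rewrite /ext_gen /= (@xget_unique _ _ _ x)// => y /emb_inj.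
Qed.

Lemma ext_generates : generates ext_gen (ext_sg E).
Proof.
move=> z w; rewrite -ext_op_generates; split => [[[x _ <-] <-]|[x <- <-]].
  by exists x; rewrite ?ext_gen_emb.
by rewrite ext_gen_emb; split => //; exists x.
Qed.

Definition extJ (x : X) : ext_space E := beta *: emb x - op x.

Lemma extJ_lin a x y : extJ (a *: x + y) = a *: extJ x + extJ y.
Proof.
rewrite /extJ [emb _]linearP [op _]linearP/= scalerBr scalerDr opprD addrACA !scalerA.
by rewrite [a * _]mulrC.
Qed.

Lemma extJB x y : extJ (x - y) = extJ x - extJ y.
Proof. by rewrite -[x - y]addrC -scaleN1r extJ_lin scaleN1r addrC. Qed.

Lemma extJ_dom x : dom A x -> extJ x = emb (beta *: x - A x).
Proof. by move=> dx; rewrite /extJ ext_opE// linearB/= linearZ. Qed.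

(** [beta - A] maps [D(A)], which is dense, isometrically into the completion;
    closedness of the extended generator carries this over to all of [X]. *)
Lemma extJ_norm x : rnorm (extJ x) = rnorm x.
Proof.
have [u [du ux]] := dom_dense hA Qc Q1 Q2 x.
have Jn n m : rnorm (extJ (u n) - extJ (u m)) = rnorm (u n - u m).
  by rewrite !extJ_dom// -linearB/= emb_norm linearB/= !Q2.
have uc : cvgn (extJ \o u).
  apply: rnorm_cauchy_cvg => e e0; have e2 : 0 < e / 2 by lra.
  move/cvg_rnormP: (ux) => /(_ _ e2)[N _ hN]; exists N => m n Nm Nn /=.
  rewrite Jn; apply: (le_lt_trans (rnorm_distD x _ _)).
  by have := hN _ Nm; have := hN _ Nn => /=; rewrite (rnormC x); lra.
have uv : (extJ \o u) @ \oo --> lim ((extJ \o u) @ \oo) by [].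
have [|||] := @gen_closed _ _ _ _ ext_generates (emb \o u) (emb x)
    (beta *: emb x - lim ((extJ \o u) @ \oo)).
- by move=> n; exists (u n).
- exact: cvg_emb.
- have -> : (fun n => ext_gen ((emb \o u) n)) = (fun n => beta *: emb (u n) - extJ (u n)).
    by apply/funext => n; rewrite [(_ \o _) n]/(emb (u n)) ext_gen_emb /extJ opprB addrC subrK.
  by apply: cvgB => //; apply: cvgZr; exact: cvg_emb.
move=> _; rewrite ext_gen_emb => opx.
have Jx : extJ x = lim ((extJ \o u) @ \oo) by rewrite /extJ opx opprB addrC subrK.
have h1 := cvg_rnorm uv; rewrite -Jx in h1.
have h2 := cvg_rnorm ux.
have e : (fun n => rnorm ((extJ \o u) n)) = (fun n => rnorm (u n)).
  by apply/funext => n /=; rewrite extJ_dom// emb_norm Q2.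
by rewrite e in h1; exact: (cvg_unique (@Rhausdorff R) (h1 _) (h2 _)).
Qed.

Lemma extJ_surj v : exists x, extJ x = v.
Proof.
have step (n : nat) : exists z, rnorm (emb z - v) < n.+1%:R^-1.
  have e0 : 0 < (n.+1%:R^-1 : R) by rewrite invr_gt0.
  have e0' : 0 < (n.+1%:R^-1 : R)%:C by rewrite -[0]/(0%:C) ltcR.
  have [||w [h [z _ zw]]] :=
    @ext_emb_dense _ _ _ _ _ E (interior (ball v (n.+1%:R^-1 : R)%:C)).
  - by exists v; exact: nbhsx_ballx.
  - exact: open_interior.
  exists z; rewrite zw; move/interior_subset: h.
  by rewrite -ball_normE /ball_ /= rnormE ltcR rnormC.
have [z hz] := choice step.
have zv : (emb \o z) @ \oo --> v.
  apply: (@squeeze_rnorm _ _ _ _ _ _ _ (fun n => n.+1%:R^-1)); last exact: cvg_harmonic.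
  by near=> n; apply/ltW/hz.
have [dQ _] : dom A (Q (z 0)) /\ True by have [] := Q1 (z 0).
have Jz n : extJ (Q (z n)) = emb (z n).
  by have [d e] := Q1 (z n); rewrite extJ_dom// e.
have uc : cvgn (Q \o z).
  apply: rnorm_cauchy_cvg => e e0; have e2 : 0 < e / 2 by lra.
  move/cvg_rnormP: (zv) => /(_ _ e2)[N _ hN]; exists N => m n Nm Nn /=.
  rewrite -linearB/= -emb_norm linearB/=; apply: (le_lt_trans (rnorm_distD v _ _)).
  by have := hN _ Nm; have := hN _ Nn => /=; rewrite (rnormC v); lra.
set x := lim ((Q \o z) @ \oo); exists x.
have xx : (Q \o z) @ \oo --> x by [].
apply: (cvg_unique (@norm_hausdorff _ (ext_space E)) _ zv).
apply: (@squeeze_rnorm _ _ _ _ _ _ _ (fun n => rnorm (Q (z n) - x))); last exact/cvg_rnorm0.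
by near=> n; rewrite /= -Jz -extJB extJ_norm.
Unshelve. all: by end_near. Qed.

Lemma extJ_inj x : extJ x = 0 -> x = 0.
Proof. by move=> h; apply: rnorm_eq0; rewrite -extJ_norm h rnorm0. Qed.

Lemma ext_op_part x z : op x = emb z -> dom A x /\ A x = z.
Proof.
move=> opx; have [d e] := Q1 (beta *: x - z).
suff xE : x = Q (beta *: x - z).
  by rewrite -xE in d e; split => //; move/addrI/oppr_inj: e.
apply/eqP; rewrite -subr_eq0; apply/eqP; apply: extJ_inj.
by rewrite extJB (extJ_dom d) e /extJ opx linearB/= linearZ/= subrr.
Qed.

Lemma ext_solve b v : half_plane (growth_bound T) b ->
  exists x, b *: emb x - op x = v.
Proof.
move=> hb; have [x0 <-] := extJ_surj v.
have [y dy hy] := resolvent_half_plane hA Qc Q1 Q2 x0 hb.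
pose x := (beta - b) *: y + x0; exists x.
have Jy : extJ y = emb x.
  by rewrite extJ_dom// /x -hy scalerBl addrA subrK.
have -> : b *: emb x - op x = extJ x - (beta - b) *: emb x.
  by rewrite /extJ scalerBl opprB [RHS]addrC addrA subrK.
by rewrite -Jy extJ_lin addrC addKr.
Qed.

Lemma ext_solve_inj b x : half_plane (growth_bound T) b ->
  b *: emb x = op x -> x = 0.
Proof.
move=> hb bx.
have Jx : extJ x = (beta - b) *: emb x by rewrite /extJ -bx scalerBl.
have [d e] := Q1 x.
have xE : x = (beta - b) *: Q x.
  apply/eqP; rewrite -subr_eq0; apply/eqP; apply: extJ_inj.
  rewrite extJB Jx -[_ *: Q x]addr0 extJ_lin (extJ_dom d) e.
  have J0 : extJ 0 = 0 by have := extJB 0 0; rewrite !subrr.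
  by rewrite J0 addr0 subrr.
have dx' : dom A x.
  by have [+ _] := gen_lin hA (beta - b) d (proj1 (Q1 0)); rewrite linear0 addr0 -xE.
apply: (gen_inj hA hb dx'); apply: emb_inj.
by rewrite -ext_opE// -bx linearZ.
Qed.

Lemma ext_resolventP b v : half_plane (growth_bound T) b ->
  b *: emb (ext_resolvent b v) - op (ext_resolvent b v) = v.
Proof.
move=> hb; have [x hx] := ext_solve v hb; rewrite /ext_resolvent.
by apply: (@xgetPex _ 0 [set x | b *: emb x - op x = v]); exists x.
Qed.

Lemma ext_resolvent_unique b v x : half_plane (growth_bound T) b ->
  b *: emb x - op x = v -> ext_resolvent b v = x.
Proof.
move=> hb hx; apply/eqP; rewrite -subr_eq0; apply/eqP; apply: (ext_solve_inj hb).
apply/eqP; rewrite -subr_eq0; apply/eqP.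
rewrite [emb _]linearB [op _]linearB/= scalerBr.
transitivity (b *: emb (ext_resolvent b v) - op (ext_resolvent b v) - (b *: emb x - op x)).
  by rewrite !opprB addrACA [RHS]addrACA; congr (_ + _); rewrite addrC.
by rewrite ext_resolventP// hx subrr.
Qed.

Lemma ext_resolvent_lin b (a : R[i]) v w : half_plane (growth_bound T) b ->
  ext_resolvent b (a *: v + w) = a *: ext_resolvent (E := E) b v + ext_resolvent b w.
Proof.
move=> hb; apply: ext_resolvent_unique => //.
rewrite [emb _]linearP [op _]linearP/= scalerDr opprD addrACA.
rewrite ext_resolventP//; congr (_ + _).
by rewrite scalerA mulrC -scalerA -scalerBr ext_resolventP.
Qed.

(** Two solutions of the extended resolvent equation differ by an element of
    the domain, computed from the first resolvent identity. *)
Lemma ext_resolvent_shift a b v : half_plane (growth_bound T) a ->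
  half_plane (growth_bound T) b ->
  exists x, [/\ dom A x, a *: x - A x = ext_resolvent (E := E) b v &
    ext_resolvent a v = ext_resolvent b v + (b - a) *: x].
Proof.
move=> ha hb; set r := ext_resolvent b v.
have [x dx hx] := resolvent_half_plane hA Qc Q1 Q2 r ha.
exists x; split => //; apply: ext_resolvent_unique => //.
rewrite [r + _]addrC [emb _]linearP [op _]linearP/= scalerDr opprD addrACA.
rewrite scalerA [a * _]mulrC -scalerA -scalerBr ext_opE// -[a *: emb x]linearZ -linearB/= hx.
by rewrite -[RHS](ext_resolventP v hb) -/r scalerBl addrA subrK.
Qed.

End Extrapolation.

(** * Smooth inputs and the solutions they generate *)

Section OneSided.
Context {R : realType} {E : normedModType R[i]}.

Lemma within_half_lineP (f : R -> E) :
  {within @half_line R, continuous f} <->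
  forall (t e : R), 0 <= t -> 0 < e -> exists2 d : R, 0 < d &
    forall s, 0 <= s -> `|s - t| < d -> rnorm (f s - f t) < e.
Proof.
split => [/subspace_continuousP h t e t0 e0|h].
  have /cvg_rnormP/(_ _ e0) := h t t0; rewrite near_withinE => -[d /= d0 hd].
  by exists d => // s s0 sd; apply: hd => //=; rewrite distrC.
apply/subspace_continuousP => t t0; apply/cvg_rnormP => e e0.
have [d d0 hd] := h t e t0 e0; rewrite near_withinE; exists d => //= s /= sd s0.
by apply: hd => //; rewrite distrC.
Qed.

Lemma has_derivativeP (f : R -> E) (t : R) (l : E) :
  has_derivative f t l <->
  forall e : R, 0 < e -> exists2 d : R, 0 < d & forall s, 0 <= s -> `|s - t| < d ->
    rnorm (f s - f t - (s - t)%:C *: l) <= e * `|s - t|.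
Proof.
have key s : s != t -> rnorm (f s - f t - (s - t)%:C *: l) =
    `|s - t| * rnorm (((s - t)^-1)%:C *: (f s - f t) - l).
  move=> st; rewrite -rnormZr scalerBr scalerA -rmorphM mulfV ?scale1r// subr_eq0//.
split => [/cvg_rnormP h e e0|h].
  have := h _ e0; rewrite near_withinE /dnbhs near_withinE => -[d /= d0 hd].
  exists d => // s s0 sd; have [->|st] := eqVneq s t.
    by rewrite !subrr scale0r subr0 rnorm0 normr0 mulr0.
  rewrite key// mulrC ler_wpM2r//; apply/ltW/hd => //=; rewrite distrC//.
apply/cvg_rnormP => e e0; have e2 : 0 < e / 2 by lra.
have [d d0 hd] := h _ e2; rewrite near_withinE /dnbhs near_withinE; exists d => //= s /= sd st s0.
have := hd s s0; rewrite distrC => /(_ sd); rewrite key//.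
have sp : 0 < `|s - t| by rewrite normr_gt0 subr_eq0.
by rewrite distrC mulrC ler_pM2r// => h1; apply: (le_lt_trans h1); lra.
Qed.

Lemma has_derivative_continuous (f df : R -> E) :
  (forall t, 0 <= t -> has_derivative f t (df t)) -> {within @half_line R, continuous f}.
Proof.
move=> h; apply/within_half_lineP => t e t0 e0.
have /has_derivativeP/(_ _ ltr01)[d d0 hd] := h t t0.
have c0 : 0 < 1 + rnorm (df t) by have := rnorm_ge0 (df t); lra.
exists (Num.min d (e / (1 + rnorm (df t)))); first by rewrite lt_min d0 divr_gt0.
move=> s s0; rewrite lt_min => /andP[sd se].
rewrite -(subrK ((s - t)%:C *: df t) (f s - f t)).
apply: (le_lt_trans (rnormD _ _)); rewrite rnormZr.
apply: (@le_lt_trans _ _ (`|s - t| * (1 + rnorm (df t)))).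
  by rewrite mulrDr mulr1 lerD2r -[leRHS]mul1r hd.
by rewrite -ltr_pdivlMr.
Qed.

Lemma half_line_continuousD (a : R[i]) (f g : R -> E) :
  {within @half_line R, continuous f} -> {within @half_line R, continuous g} ->
  {within @half_line R, continuous (fun t => a *: f t + g t)}.
Proof.
by move=> cf cg t; apply: cvgD; [apply: cvgZr; exact: cf|exact: cg].
Qed.

Lemma has_derivativeD (f g : R -> E) (t : R) (lf lg : E) :
  has_derivative f t lf -> has_derivative g t lg ->
  has_derivative (fun t => f t + g t) t (lf + lg).
Proof.
move=> /has_derivativeP hf /has_derivativeP hg; apply/has_derivativeP => e e0.
have e2 : 0 < e / 2 by lra.
have [d d0 hd] := hf _ e2; have [d' d'0 hd'] := hg _ e2.
exists (Num.min d d'); first by rewrite lt_min d0.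
move=> s s0; rewrite lt_min => /andP[h1 h2].
have -> : f s + g s - (f t + g t) - (s - t)%:C *: (lf + lg) =
    (f s - f t - (s - t)%:C *: lf) + (g s - g t - (s - t)%:C *: lg).
  by rewrite [RHS]addrACA scalerDr -opprD; congr (_ - _); rewrite opprD addrACA.
apply: (le_trans (rnormD _ _)); rewrite (splitr e) mulrDl lerD//; [exact: hd|exact: hd'].
Qed.

End OneSided.

(** Inputs are carried together with all their derivatives. *)
Section Bumps.
Context {R : realType}.
Implicit Types v : nat -> R -> R.

Definition smooth_chain v := forall n t, is_derive t (1 : R) (v n) (v n.+1 t).

Definition bump_chain v := smooth_chain v /\ exists eta T0 : R, 0 < eta /\
  forall n t, t <= eta \/ T0 <= t -> v n t = 0.

Lemma bump_neg v n t : bump_chain v -> t <= 0 -> v n t = 0.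
Proof. by move=> [_ [eta [T0 [e0 h]]]] t0; apply: h; left; rewrite (le_trans t0)// ltW. Qed.

Lemma bump_bounded v n : bump_chain v -> exists2 B : R, 0 <= B & forall t, `|v n t| <= B.
Proof.
move=> [cv [eta [T0 [e0 h]]]].
have [B B0 hB] := @continuous_bounded R (v n) eta T0
  (continuous_subspaceT (is_derive_continuous (cv n))).
exists B => // t; have [te|te] := leP t eta; first by rewrite h ?normr0//; left.
have [Tt|tT] := leP T0 t; first by rewrite h ?normr0//; right.
by apply: hB; exact: ltW.
Qed.

Lemma bump_lipschitz v n : bump_chain v -> exists2 B : R, 0 <= B &
  forall s t, `|v n s - v n t| <= B * `|s - t|.
Proof.
move=> bv; have [B B0 hB] := bump_bounded n.+1 bv; exists B => // s t.
apply: (@lipschitz_of_derive _ (v n) (v n.+1) (Num.min s t) (Num.max s t) B) => //.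
- exact: (proj1 bv).
- by rewrite ge_min lexx.
- by rewrite le_max lexx.
- by rewrite ge_min lexx orbT.
- by rewrite le_max lexx orbT.
Qed.

Lemma bump_taylor v n : bump_chain v -> exists2 B : R, 0 <= B &
  forall s t, `|v n t - v n s - (t - s) * v n.+1 s| <= B * (t - s) ^+ 2.
Proof.
move=> bv; have [B B0 hB] := bump_lipschitz n.+1 bv; exists B => // s t.
apply: (@taylor_of_derive _ (v n) (v n.+1) (Num.min s t) (Num.max s t) B) => //.
- exact: (proj1 bv).
- by rewrite ge_min lexx.
- by rewrite le_max lexx.
- by rewrite ge_min lexx orbT.
- by rewrite le_max lexx orbT.
Qed.

(** [a - D] applied to a chain. *)
Lemma bump_shift v (a : R) : bump_chain v -> bump_chain (fun n t => a * v n t - v n.+1 t).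
Proof.
move=> [cv [eta [T0 [e0 h]]]]; split.
  move=> n t; have h1 := cv n t; have h2 := cv n.+1 t.
  by apply: is_derive_eq; rewrite /GRing.scale /=; ring.
by exists eta, T0; split => // n t ht; rewrite !h// mulr0 subrr.
Qed.

Lemma bump_kernel v n (t tau : R) : bump_chain v ->
  [/\ klip tau (fun s => (v n (t - s))%:C), klip tau (fun s => (- v n.+1 (t - s))%:C) &
      kder tau (fun s => (v n (t - s))%:C) (fun s => (- v n.+1 (t - s))%:C)].
Proof.
move=> [cv _].
have dv m s : is_derive s (1 : R) (fun s => v m (t - s)) (- v m.+1 (t - s)).
  have h1 := cv m (t - s).
  by apply: is_derive_eq; rewrite /GRing.scale /=; ring.
apply: (@kernel_C2 _ _ _ (fun s => (v n.+2 (t - s))%:C)).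
- move=> s; split; [exact: dv|exact: is_derive_cst].
- move=> s; split; last exact: is_derive_cst.
  rewrite /= -[v n.+2 _]opprK; apply: (@is_deriveN _ _ _ (fun s => v n.+1 (t - s))).
- by apply: is_derive_continuous => s /=; exact: dv.
- by move=> s; exact: cvg_cst.
Qed.

End Bumps.

Section Convolution.
Context {R : realType} {X : completeNormedModType R[i]}.
Context {A : partial_operator X} {T : semigroup X} (hA : generates A T).
Context {beta : R[i]} {Q : {linear X -> X}} (Qc : continuous Q).
Hypothesis Q1 : forall y, dom A (Q y) /\ beta *: Q y - A (Q y) = y.
Hypothesis Q2 : forall x, dom A x -> Q (beta *: x - A x) = x.
Context (v : nat -> R -> R) (bv : bump_chain v) (r : X).

Definition orbit_conv_upto (m n : nat) (t : R) : X :=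
  vint (2 ^+ m) (fun s => (v n (t - s))%:C *: T s r).

(** The convolution of [v n] with the orbit of [r].  The upper end of the
    integral is a power of 2 beyond [t], where the integrand vanishes, so that
    the dyadic grids for different [t] are compatible. *)
Definition orbit_conv (n : nat) (t : R) : X := orbit_conv_upto (Num.truncn t).+1 n t.

Lemma orbit_conv_upto_add (m j n : nat) (t : R) : t <= 2 ^+ m ->
  orbit_conv_upto (m + j) n t = orbit_conv_upto m n t.
Proof.
move=> tm; elim: j => [|j ih]; first by rewrite addn0.
have p0 : (0 : R) <= 2 ^+ (m + j) by rewrite exprn_ge0.
rewrite addnS -ih /orbit_conv_upto exprS vint_double//.
  have [k _ _] := bump_kernel n t (2 * 2 ^+ (m + j)) bv.
  by apply: ucont_kernel => //; rewrite mulr_ge0.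
move=> s ms; rewrite (bump_neg n bv) ?scale0r// subr_le0; apply: (le_trans tm).
by apply: le_trans ms; rewrite exprD ler_peMr ?exprn_ge0// exprn_ege1// ler1n.
Qed.

Lemma orbit_convE m n t : t <= 2 ^+ m -> orbit_conv n t = orbit_conv_upto m n t.
Proof.
move=> tm; rewrite /orbit_conv; set k := (Num.truncn t).+1.
have tk : t <= 2 ^+ k.
  apply/ltW/(lt_le_trans (truncnS_gt t)).
  by rewrite -natrX ler_nat; apply: ltnW; exact: ltn_expl.
have [mk|km] := leqP m k; first by rewrite -(subnKC mk) orbit_conv_upto_add.
by rewrite -(subnKC (ltnW km)) orbit_conv_upto_add.
Qed.

Lemma orbit_conv0 n : orbit_conv n 0 = 0.
Proof.
rewrite /orbit_conv /orbit_conv_upto; have p0 : (0 : R) <= 2 ^+ (Num.truncn (0:R)).+1 by rewrite exprn_ge0.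
rewrite (@eq_vint _ _ _ _ (fun=> 0)) ?vint_cst ?scaler0// => s s0 _.
by rewrite (bump_neg n bv) ?scale0r// sub0r oppr_le0.
Qed.

Lemma orbit_conv_derivative n t : 0 <= t -> has_derivative (orbit_conv n) t (orbit_conv n.+1 t).
Proof.
move=> t0; pose m := (Num.truncn (t + 1)).+1; pose tau : R := 2 ^+ m.
have tau0 : 0 <= tau by rewrite exprn_ge0.
have ttau : t + 1 <= tau.
  apply/ltW/(lt_le_trans (truncnS_gt (t + 1))).
  by rewrite /tau -natrX ler_nat; apply: ltnW; exact: ltn_expl.
have [B B0 hB] := bump_taylor n bv.
have [M M1 hM] := sg_local_bound T tau.
have u k t' : ucont tau (fun s => (v k (t' - s))%:C *: T s r).
  by have [? _ _] := bump_kernel k t' tau bv; exact: ucont_kernel.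
have C0 : 0 < tau * (B * (M * rnorm r)) + 1.
  by rewrite ltr_wpDl// !mulr_ge0 ?rnorm_ge0//; lra.
apply/has_derivativeP => e e0.
exists (Num.min 1 (e / (tau * (B * (M * rnorm r)) + 1))); first by rewrite lt_min ltr01 divr_gt0.
move=> s s0; rewrite lt_min => /andP[s1 se].
have stau : s <= tau.
  by apply: le_trans ttau; rewrite -lerBlDl; apply: le_trans (ltW s1); exact: ler_norm.
have ttau' : t <= tau by apply: le_trans ttau; rewrite lerDl.
rewrite !(@orbit_convE m)//.
pose g q := - (s - t)%:C *: ((v n.+1 (t - q))%:C *: T q r) +
  (-1 *: ((v n (t - q))%:C *: T q r) + (v n (s - q))%:C *: T q r).
have eqg q : (v n (s - q) - v n (t - q) - (s - t) * v n.+1 (t - q))%:C *: T q r = g q.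
  by rewrite /g !scalerA -!scalerDl; congr (_ *: _); rewrite !rmorphB rmorphM/=; ring.
have ug : ucont tau g by do 2 apply: ucontD => //.
have eqv : vint tau (fun q => (v n (s - q) - v n (t - q) - (s - t) * v n.+1 (t - q))%:C *: T q r)
    = vint tau g by apply: eq_vint.
have -> : orbit_conv_upto m n s - orbit_conv_upto m n t - (s - t)%:C *: orbit_conv_upto m n.+1 t =
    vint tau (fun q => (v n (s - q) - v n (t - q) - (s - t) * v n.+1 (t - q))%:C *: T q r).
  rewrite eqv vintD//; last exact: ucontD.
  by rewrite vintD// scaleNr scaleN1r [RHS]addrC; congr (_ - _); rewrite addrC.
apply: (@le_trans _ _ (tau * (B * (s - t) ^+ 2 * (M * rnorm r)))).
  rewrite eqv; apply: vint_le => // q q0 qt; rewrite -eqg rnormZr; apply: ler_pM; rewrite ?rnorm_ge0//; last exact: hM.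
  have := hB (t - q) (s - q); rewrite opprB addrA subrK; exact.
rewrite (_ : tau * _ = tau * (B * (M * rnorm r)) * `|s - t| * `|s - t|); last first.
  by rewrite -[(s - t) ^+ 2]real_normK ?num_real// expr2; ring.
rewrite ler_wpM2r//; apply: (@le_trans _ _ ((tau * (B * (M * rnorm r)) + 1) * `|s - t|)).
  by rewrite ler_wpM2r// lerDl.
by rewrite mulrC -ler_pdivlMr// ltW.
Qed.

Lemma orbit_conv_dom n t : 0 <= t ->
  dom A (orbit_conv n t) /\ A (orbit_conv n t) = orbit_conv n.+1 t - (v n t)%:C *: r.
Proof.
move=> t0; pose m := (Num.truncn t).+1; pose tau : R := 2 ^+ m.
have tau0 : 0 <= tau by rewrite exprn_ge0.
have ttau : t <= tau.
  apply/ltW/(lt_le_trans (truncnS_gt t)).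
  by rewrite /tau -natrX ler_nat; apply: ltnW; exact: ltn_expl.
have [k1 k2 k3] := bump_kernel n t tau bv.
have [d e] := orbit_dom hA Qc Q1 Q2 r tau0 k1 k2 k3.
split; first exact: d.
rewrite /orbit_conv -/m /orbit_conv_upto -/tau e subr0 (bump_neg n bv) ?subr_le0// scale0r sub0r addrC.
congr (_ - _).
have [k4 _ _] := bump_kernel n.+1 t tau bv.
rewrite -scaleN1r -vintZ//; last exact: ucont_kernel.
by apply: eq_vint => // s _ _; rewrite scalerA mulN1r rmorphN opprK.
Qed.

End Convolution.

Section RealTimesVector.
Context {R : realType} {E : normedModType R[i]}.

Lemma has_derivative_bump (v : nat -> R -> R) (e : E) n t : bump_chain v ->
  has_derivative (fun s => (v n s)%:C *: e) t ((v n.+1 t)%:C *: e).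
Proof.
move=> bv; have [B B0 hB] := bump_taylor n bv.
apply/has_derivativeP => eps eps0.
have C0 : 0 < B * rnorm e + 1 by rewrite ltr_wpDl// mulr_ge0 ?rnorm_ge0.
exists (eps / (B * rnorm e + 1)); first by rewrite divr_gt0.
move=> s s0; rewrite ltr_pdivlMr// => sd.
have -> : (v n s)%:C *: e - (v n t)%:C *: e - (s - t)%:C *: ((v n.+1 t)%:C *: e) =
    (v n s - v n t - (s - t) * v n.+1 t)%:C *: e.
  by rewrite scalerA -rmorphM [in RHS]rmorphB/= [in RHS]rmorphB/= !scalerBl.
rewrite rnormZr; apply: (le_trans (ler_wpM2r (rnorm_ge0 _) (hB _ _))).
rewrite -[(s - t) ^+ 2]real_normK ?num_real// expr2.
rewrite (_ : _ * rnorm e = B * rnorm e * `|s - t| * `|s - t|); last by ring.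
rewrite ler_wpM2r// (le_trans _ (ltW sd))// mulrC ler_wpM2l// lerDl//.
Qed.

Lemma bump_within_continuous (v : nat -> R -> R) (e : E) n : bump_chain v ->
  {within @half_line R, continuous (fun s => (v n s)%:C *: e)}.
Proof.
by move=> bv; apply: has_derivative_continuous => t _; exact: has_derivative_bump.
Qed.

Lemma bump_test_function (v : nat -> R -> R) (e : E) : bump_chain v ->
  test_function (fun t => (v 0%N t)%:C *: e).
Proof.
move=> bv; have [_ [eta [T0 [eta0 hv]]]] := bv.
have sub : closure [set t : R | 0 <= t /\ (v 0%N t)%:C *: e <> 0] `<=` `[eta, T0]%classic.
  have /closure_id -> : closed (`[eta, T0]%classic : set R) by exact: interval_closed.
  apply: closureS => t /= [t0 ht]; rewrite in_itv/=; apply/andP; split.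
    rewrite leNgt; apply/negP => te; apply: ht; rewrite hv ?scale0r//; left; exact: ltW.
  rewrite leNgt; apply/negP => te; apply: ht; rewrite hv ?scale0r//; right; exact: ltW.
split.
- exists (fun n t => (v n t)%:C *: e) => // n t _; exact: has_derivative_bump.
- apply: subclosed_compact sub; [exact: closed_closure|exact: segment_compact].
- move=> t /sub /=; rewrite in_itv/= => /andP[h _]; exact: lt_le_trans h.
Qed.

End RealTimesVector.

Section Existence.
Context {R : realType} {U X Y : completeNormedModType R[i]} (S : system_node U X Y).

Local Notation A := (sn_A S).
Local Notation T := (sn_T S).
Local Notation E := (sn_ext S).

(** The observation [C] is applied after subtracting [(b - A)^-1 B u]; by the
    compatibility between [C], [B] and [G], the choice of [b] does not matter. *)
Lemma CD_independent a b x u : half_plane (growth_bound T) a ->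
  half_plane (growth_bound T) b ->
  dom A (x - ext_resolvent b (sn_B S u)) -> CD S a x u = CD S b x u.
Proof.
move=> ha hb dx; have [Q [Qc Q1 Q2]] := sn_beta_resolvent S.
have hA := sn_generates S.
have [z [dz _ hz]] := ext_resolvent_shift hA Qc Q1 Q2 (E := E) (sn_B S u) ha hb.
set ra := ext_resolvent a _ in hz *; set rb := ext_resolvent b _ in dx hz *.
have d0 : dom A 0 by have := proj1 (Q1 0); rewrite linear0.
have dab : dom A (ra - rb).
  by have [+ _] := gen_lin hA (b - a) dz d0; rewrite addr0 hz addrAC subrr add0r.
rewrite /CD -/ra -/rb; have := sn_GB u ha hb; rewrite -/ra -/rb => /eqP.
rewrite subr_eq => /eqP ->; rewrite addrA; congr (_ + _).
have -> : x - ra = -1 *: (ra - rb) + (x - rb).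
  by rewrite scaleN1r opprB [RHS]addrC addrA subrK.
by rewrite sn_C_linear// scaleN1r addrAC addNr add0r.
Qed.

(** The state driven by [v 0 *: e] is [v 0 *: r] with [r = (b - A)^-1 B e], plus
    the mild solution of the Cauchy problem with forcing [(b v - v') *: r]; the
    latter takes values in the domain of [A]. *)
Lemma classical_solution_exists (v : nat -> R -> R) (e : U) : bump_chain v ->
  exists x y, classical_solution S (fun t => (v 0%N t)%:C *: e) x y /\ x 0 = 0.
Proof.
move=> bv; have [Q [Qc Q1 Q2]] := sn_beta_resolvent S.
have hA := sn_generates S.
have [b hb] := growth_bound_lty T.
have hb' : half_plane (growth_bound T) b%:C by [].
pose r := ext_resolvent (E := E) b%:C (sn_B S e).
pose phi n t := b * v n t - v n.+1 t.
have bphi : bump_chain phi by exact: bump_shift.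
pose w := orbit_conv (T := T) phi r 0.
pose x t := w t + (v 0%N t)%:C *: r.
pose dx t := orbit_conv (T := T) phi r 1 t + (v 1%N t)%:C *: r.
have hr t : ext_resolvent (E := E) b%:C (sn_B S ((v 0%N t)%:C *: e)) = (v 0%N t)%:C *: r.
  have := ext_resolvent_lin hA Qc Q1 Q2 (E := E) (v 0%N t)%:C (sn_B S e) 0 hb'.
  have -> : ext_resolvent (E := E) b%:C 0 = 0.
    by apply: (ext_resolvent_unique hA Qc Q1 Q2) => //; rewrite [ext_emb _ 0]linear0 [ext_op _ 0]linear0 scaler0 subrr.
  by rewrite !addr0 linearZ.
have xr t : x t - ext_resolvent (E := E) b%:C (sn_B S ((v 0%N t)%:C *: e)) = w t.
  by rewrite hr /x addrK.
have hw t : 0 <= t -> dom A (w t) /\ A (w t) = orbit_conv (T := T) phi r 1 t - (phi 0%N t)%:C *: r.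
  by move=> t0; exact: (orbit_conv_dom hA Qc Q1 Q2).
have key t : 0 <= t -> ext_op E (x t) + sn_B S ((v 0%N t)%:C *: e) = ext_emb E (dx t).
  move=> t0; have [dw Aw] := hw t t0.
  have rE := ext_resolventP hA Qc Q1 Q2 (E := E) (sn_B S e) hb'.
  rewrite -/r in rE.
  have -> : ext_op E (x t) = ext_emb E (orbit_conv (T := T) phi r 1 t) -
      (phi 0%N t)%:C *: ext_emb E r + (v 0%N t)%:C *: ext_op E r.
    by rewrite /x [LHS]linearD/= ext_opE// Aw linearB/= [ext_emb E (_ *: r)]linearZ [ext_op E (_ *: r)]linearZ.
  have -> : ext_op E r = b%:C *: ext_emb E r - sn_B S e by rewrite -rE opprB addrC subrK.
  rewrite [sn_B S (_ *: _)]linearZ/= /dx [RHS]linearD/= [ext_emb E (_ *: r)]linearZ/=.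
  rewrite scalerBr addrA subrK -addrA; congr (_ + _).
  rewrite addrC scalerA -scalerBl; congr (_ *: _).
  by rewrite /phi rmorphB rmorphM/=; ring.
have cw n : {within @half_line R, continuous (orbit_conv (T := T) phi r n)}.
  by apply: has_derivative_continuous => t t0; exact: orbit_conv_derivative.
pose y t := CD S b%:C (x t) ((v 0%N t)%:C *: e).
exists x, y; split; last first.
  by rewrite /x /w orbit_conv0// (bump_neg 0 bv)// scale0r addr0.
split.
- exact: bump_within_continuous.
- have yE t : 0 <= t -> y t = sn_C S (w t) + (v 0%N t)%:C *: sn_G S b%:C e.
    by move=> t0; rewrite /y /CD xr linearZ.
  apply/within_half_lineP => t eps t0 eps0.
  have [M hM] := sn_C_bounded S.
  have M0 : 0 < `|M| + 1 by rewrite ltr_wpDl.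
  pose q t := sn_beta S *: w t +
    (-1 *: orbit_conv (T := T) phi r 1 t + (phi 0%N t)%:C *: r).
  have qE s : 0 <= s -> q s = sn_beta S *: w s - A (w s).
    by move=> s0; have [_ ->] := hw s s0; rewrite /q scaleN1r opprB [- _ + _]addrC.
  have cq : {within @half_line R, continuous q}.
    have h1 := half_line_continuousD (a := -1) (cw 1%N) (bump_within_continuous (e := r) (n := 0) bphi).
    by have h2 := half_line_continuousD (a := sn_beta S) (cw 0%N) h1; move=> s; exact: h2.
  have e1 : 0 < eps / 2 / (`|M| + 1) by rewrite !divr_gt0.
  have e2 : 0 < eps / 2 by rewrite divr_gt0.
  have [d d0 hd] := (within_half_lineP q).1 cq t _ t0 e1.
  have [d' d'0 hd'] := (within_half_lineP _).1
    (bump_within_continuous (e := sn_G S b%:C e) (n := 0) bv) t _ t0 e2.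
  exists (Num.min d d'); first by rewrite lt_min d0.
  move=> s s0; rewrite lt_min => /andP[sd sd'].
  have [dws Aws] := hw s s0; have [dwt Awt] := hw t t0.
  rewrite !yE// opprD addrACA (splitr eps).
  apply: (le_lt_trans (rnormD _ _)); apply: ltrD; last exact: hd'.
  have [dwst Awst] := gen_lin hA (-1) dwt dws.
  have -> : sn_C S (w s) - sn_C S (w t) = sn_C S (-1 *: w t + w s).
    by rewrite sn_C_linear// scaleN1r addrC.
  apply: (le_lt_trans (hM _ dwst)); rewrite Awst.
  have -> : sn_beta S *: (-1 *: w t + w s) - (-1 *: A (w t) + A (w s)) = q s - q t.
    rewrite !qE// !scaleN1r scalerDr scalerN opprB [- A _ + _]addrC opprB addrACA.
    by rewrite [LHS]addrC; congr (_ + _); rewrite addrC.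
  apply: (@le_lt_trans _ _ ((`|M| + 1) * rnorm (q s - q t))).
    by rewrite ler_wpM2r ?rnorm_ge0// (le_trans (ler_norm _))// lerDl.
  by rewrite mulrC -ltr_pdivlMr//; exact: hd.
- exists dx; split.
  + move=> t; have := half_line_continuousD (a := 1) (cw 1%N) (bump_within_continuous (e := r) (n := 1) bv).
    have -> : dx = (fun t => 1 *: orbit_conv (T := T) phi r 1 t + (v 1%N t)%:C *: r); last by apply.
    by apply/funext => s; rewrite scale1r.
  + move=> t t0; apply: has_derivativeD; first exact: orbit_conv_derivative.
    exact: has_derivative_bump.
  + by move=> t t0; rewrite /CD_domain key//; exists (dx t).
  + by move=> t t0; rewrite key.
  + move=> t t0 a ha; rewrite /y; apply/esym/CD_independent => //.
    by rewrite xr; have [] := hw t t0.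
Qed.

End Existence.

(** * Integrals of continuous real functions *)

Section RealIntegral.
Context {R : realType}.
Implicit Types (f g F : R -> R).

Local Notation mu := (@lebesgue_measure R).

Definition rint (t : R) (f : R -> R) : R := \int[mu]_(s in `[0, t]) f s.

Lemma is_derive_for (f : R -> R) (t l : R) : is_derive t (1 : R) f l -> {for t, continuous f}.
Proof. by move=> [h _]; exact/differentiable_continuous/derivable1_diffP. Qed.

Lemma ccontD f g : continuous f -> continuous g -> continuous (fun t => f t + g t).
Proof. by move=> cf cg t; apply: cvgD; [exact: cf|exact: cg]. Qed.

Lemma ccontM f g : continuous f -> continuous g -> continuous (fun t => f t * g t).
Proof. by move=> cf cg t; apply: cvgM; [exact: cf|exact: cg]. Qed.

Lemma ccontZ (a : R) f : continuous f -> continuous (fun t => a * f t).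
Proof. by move=> cf; apply: ccontM => // t; exact: cvg_cst. Qed.

Lemma ccont_rev f (t : R) : continuous f -> continuous (fun s => f (t - s)).
Proof.
move=> cf s; apply: (continuous_comp (f := fun s => t - s) (g := f)); last exact: cf.
by apply: cvgB; [exact: cvg_cst|exact: cvg_id].
Qed.

Lemma ccont_integrable f (l t : R) : continuous f -> mu.-integrable `[l, t] (EFin \o f).
Proof.
move=> cf; apply: continuous_compact_integrable; first exact: segment_compact.
exact: continuous_subspaceT.
Qed.

Lemma rintD t f g : continuous f -> continuous g -> rint t (fun s => f s + g s) = rint t f + rint t g.
Proof. by move=> cf cg; apply: RintegralD => //; exact: ccont_integrable. Qed.

Lemma rintZ t (a : R) f : continuous f -> rint t (fun s => a * f s) = a * rint t f.
Proof. by move=> cf; apply: RintegralZl => //; exact: ccont_integrable. Qed.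

Lemma eq_rint t f g : (forall s, 0 <= s -> s <= t -> f s = g s) -> rint t f = rint t g.
Proof.
by move=> fg; apply: eq_Rintegral => s; rewrite inE/= in_itv/= => /andP[? ?]; exact: fg.
Qed.

Lemma rint_sum t (I : Type) (r : seq I) (f : I -> R -> R) : (forall i, continuous (f i)) ->
  rint t (fun s => \sum_(i <- r) f i s) = \sum_(i <- r) rint t (f i).
Proof.
move=> cf; elim: r => [|i r ih].
  rewrite big_nil (_ : (fun _ => _) = fun=> 0); last first.
    by apply/funext => s; rewrite big_nil.
  by rewrite /rint Rintegral_cst ?mul0r//; exact: measurable_itv.
rewrite big_cons -ih -rintD//; last first.
  elim: r {ih} => [|j r ih]; last first.
    rewrite (_ : (fun _ => _) = fun s => f j s + \sum_(i <- r) f i s); first exact: ccontD.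
    by apply/funext => s; rewrite big_cons.
  rewrite (_ : (fun _ => _) = fun=> 0); first by move=> ?; exact: cvg_cst.
  by apply/funext => s; rewrite big_nil.
by apply: eq_rint => s _ _; rewrite big_cons.
Qed.

Lemma rint_cst t (c : R) : 0 <= t -> rint t (fun=> c) = t * c.
Proof.
rewrite le_eqVlt => /orP[/eqP <-|t0].
  by rewrite mul0r /rint set_itv1 Rintegral_set1.
rewrite /rint Rintegral_cst; last exact: measurable_itv.
by rewrite /= lebesgue_measure_itv/= lte_fin t0 -EFinB subr0 mulrC.
Qed.

Lemma le_rint t f g : continuous f -> continuous g -> (forall s, 0 <= s -> s <= t -> f s <= g s) ->
  rint t f <= rint t g.
Proof.
move=> cf cg fg; apply: le_Rintegral => //; try exact: ccont_integrable.
by move=> s; rewrite /= in_itv/= => /andP[? ?]; exact: fg.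
Qed.

Lemma rint_norm_le t f (K : R) : 0 <= t -> continuous f ->
  (forall s, 0 <= s -> s <= t -> `|f s| <= K) -> `|rint t f| <= t * K.
Proof.
move=> t0 cf fK; rewrite ler_norml -mulrN -!rint_cst//; apply/andP; split; apply: le_rint => //;
  do ?[by move=> ?; exact: cvg_cst]; move=> s s0 st; have := fK s s0 st;
  by rewrite ler_norml => /andP[].
Qed.

Lemma rint_ftc t f F : 0 <= t -> {within `[0, t], continuous f} ->
  {within `[0, t], continuous F} ->
  (forall s, 0 < s -> s < t -> is_derive s (1 : R) F (f s)) -> rint t f = F t - F 0.
Proof.
rewrite le_eqVlt => /orP[/eqP <-|t0] cf cF dF.
  by rewrite subrr /rint set_itv1 Rintegral_set1.
rewrite /rint /Rintegral (@continuous_FTC2 _ f F)//.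
  have [_ hl hr] := (continuous_within_itvP F t0).1 cF.
  split => //.
  by move=> s; rewrite in_itv/= => /andP[s0 st]; have [] := dF s s0 st.
move=> s; rewrite in_itv/= => /andP[s0 st]; have := dF s s0 st.
by rewrite derive1E => d; exact: derive_val.
Qed.

Lemma rint_ftc1 t f F : 0 <= t -> continuous f ->
  (forall s : R, - 2^-1 < s -> is_derive s (1 : R) F (f s)) -> rint t f = F t - F 0.
Proof.
move=> t0 cf dF; apply: rint_ftc => //.
- exact: continuous_subspaceT.
- apply: continuous_in_subspaceT => s; rewrite inE/= in_itv/= => /andP[s0 _].
  by apply: (@is_derive_for F s (f s)); apply: dF; lra.
- by move=> s s0 _; apply: dF; lra.
Qed.

(** The primitive of [f] that vanishes at 0.  It is started at [-1] and frozen
    before [-1/2], which makes it continuous on the whole line, and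
    differentiable on both sides at every point of [[0, oo)]. *)
Definition prim f (t : R) : R :=
  \int[mu]_(s in `[-1, Num.max t (- 2^-1)]) f s - \int[mu]_(s in `[-1, 0]) f s.

Lemma prim0 f : prim f 0 = 0.
Proof. by rewrite /prim (max_idPl _) ?subrr//; lra. Qed.

Lemma is_derive_int f (t : R) : continuous f -> -1 < t ->
  is_derive t (1 : R) (fun x => \int[mu]_(s in `[-1, x]) f s) (f t).
Proof.
move=> cf t1; have tt : t < t + 1 by rewrite ltrDl.
have [d e] := continuous_FTC1_closed tt (ccont_integrable (-1) (t + 1) cf) t1 (cf t).
by rewrite derive1E in e; split.
Qed.

Lemma is_derive_prim f (t : R) : continuous f -> - 2^-1 < t -> is_derive t (1 : R) (prim f) (f t).
Proof.
move=> cf t1.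
have h : is_derive t (1 : R) (fun x => \int[mu]_(s in `[-1, x]) f s) (f t).
  by apply: is_derive_int => //; lra.
have h2 : is_derive t (1 : R) (fun x => \int[mu]_(s in `[-1, x]) f s -
    \int[mu]_(s in `[-1, 0]) f s) (f t).
  by rewrite -[f t]subr0; apply: is_deriveB.
apply: near_eq_is_derive h2.
- near=> s; rewrite /prim (max_idPl _)//; apply: ltW; near: s; exact: lt_nbhsr.
Unshelve. all: by end_near. Qed.

Lemma continuous_prim f : continuous f -> continuous (prim f).
Proof.
move=> cf t; apply: cvgB; last exact: cvg_cst.
have hm : (fun t : R => Num.max t (- 2^-1)) @ t --> Num.max t (- 2^-1).
  exact: (@continuous_max R R (fun t => t) (fun=> - 2^-1) t (@cvg_id _ _) (cvg_cst _)).
apply: (@cvg_comp _ _ _ (fun t : R => Num.max t (- 2^-1))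
  (fun x => \int[mu]_(s in `[-1, x]) f s) _ _ _ hm).
apply: (@is_derive_for _ _ (f (Num.max t (- 2^-1)))).
apply: is_derive_int => //; by rewrite lt_max; apply/orP; right; lra.
Qed.

Lemma rint_prim f t : 0 <= t -> continuous f -> rint t f = prim f t.
Proof.
move=> t0 cf.
by have -> := rint_ftc1 t0 cf (fun s s1 => is_derive_prim cf s1); rewrite prim0 subr0.
Qed.

(** Integration by parts moves a derivative across a convolution. *)
Lemma rint_conv_parts (v v1 a F : R -> R) t : 0 <= t ->
  (forall s, is_derive s (1 : R) v (v1 s)) -> continuous v1 -> v 0 = 0 ->
  (forall s : R, - 2^-1 < s -> is_derive s (1 : R) F (a s)) -> continuous F -> continuous a ->
  F 0 = 0 ->
  rint t (fun s => v1 (t - s) * F s) = rint t (fun s => v (t - s) * a s).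
Proof.
move=> t0 dv cv1 v0 dF cF ca F0.
have cv := is_derive_continuous dv.
have c1 : continuous (fun s => v1 (t - s) * F s) by apply: ccontM => //; exact: ccont_rev.
have c2 : continuous (fun s => v (t - s) * a s) by apply: ccontM => //; exact: ccont_rev.
apply/eqP; rewrite -subr_eq0; apply/eqP.
have -> : rint t (fun s => v1 (t - s) * F s) - rint t (fun s => v (t - s) * a s) =
    rint t (fun s => v1 (t - s) * F s + -1 * (v (t - s) * a s)).
  by rewrite rintD ?rintZ ?mulN1r//; exact: ccontZ.
apply: (etrans (@rint_ftc1 _ _ (fun s => - (v (t - s) * F s)) t0 _ _)).
- by apply: ccontD => //; exact: ccontZ.
- move=> s s1; have h1 := dv (t - s); have h2 := dF s s1.
  by apply: is_derive_eq; rewrite /GRing.scale /=; ring.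
- by rewrite subrr v0 F0 mul0r mulr0 subrr.
Qed.

Lemma rint_parts (f f1 a F : R -> R) t : 0 <= t ->
  (forall s, is_derive s (1 : R) f (f1 s)) -> continuous f1 ->
  (forall s : R, - 2^-1 < s -> is_derive s (1 : R) F (a s)) -> continuous F -> continuous a ->
  F 0 = 0 ->
  rint t (fun s => f1 s * F s) = f t * F t - rint t (fun s => f s * a s).
Proof.
move=> t0 dv cv1 dF cF ca F0.
have cv := is_derive_continuous dv.
have c1 : continuous (fun s => f1 s * F s) by apply: ccontM.
have c2 : continuous (fun s => f s * a s) by apply: ccontM.
apply/eqP; rewrite eq_sym subr_eq eq_sym; apply/eqP.
rewrite -rintD//; apply: (etrans (@rint_ftc1 _ _ (fun s => f s * F s) t0 _ _)).
- exact: ccontD.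
- move=> s s1; have h1 := dv s; have h2 := dF s s1.
  by apply: is_derive_eq; rewrite /GRing.scale /=; ring.
- by rewrite F0 mulr0 subr0.
Qed.

End RealIntegral.

(** * Duhamel's formula seen through a functional *)

Section EpsilonDerivative.
Context {R : realType}.

Lemma is_derive_eps (F : R -> R) (s l : R) :
  (forall e : R, 0 < e -> exists2 d : R, 0 < d & forall t, `|t - s| < d ->
     `|F t - F s - (t - s) * l| <= e * `|t - s|) -> is_derive s (1 : R) F l.
Proof.
move=> h.
have key : h^-1 *: (F (h *: 1 + s) - F s) @[h --> (0 : R)^'] --> l.
  apply/cvgrPdist_le => e e0; have [d d0 hd] := h e e0.
  rewrite near_withinE; exists d => //= x /= xd x0.
  have xp : 0 < `|x| by rewrite normr_gt0.
  have := hd (x *: 1 + s); rewrite addrK /GRing.scale /= mulr1.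
  rewrite sub0r normrN in xd => /(_ xd) h1.
  rewrite -(ler_pM2r xp) -normrM; apply: le_trans h1.
  rewrite -normrN /GRing.scale /= le_eqVlt; apply/orP; left; apply/eqP; congr `|_|.
  by field.
split; first by apply/cvg_ex; exists l.
exact: cvg_lim key.
Qed.

Lemma deriv_unique (F : R -> R) (t l l' : R) : 0 <= t ->
  (forall e : R, 0 < e -> exists2 d : R, 0 < d & forall s, 0 <= s -> `|s - t| < d ->
     `|F s - F t - (s - t) * l| <= e * `|s - t|) ->
  (forall e : R, 0 < e -> exists2 d : R, 0 < d & forall s, 0 <= s -> `|s - t| < d ->
     `|F s - F t - (s - t) * l'| <= e * `|s - t|) -> l = l'.
Proof.
move=> t0 h h'; apply/eqP; rewrite -subr_eq0 -normr_le0.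
apply/ler_addgt0Pl => e e0; rewrite addr0; have e2 : 0 < e / 2 by lra.
have [d d0 hd] := h _ e2; have [d' d'0 hd'] := h' _ e2.
pose m := Num.min d d' / 2; have m0 : 0 < m by rewrite divr_gt0// lt_min d0.
have tm : t + m - t = m by rewrite addrC addKr.
have md : m < d by rewrite ltr_pdivrMr// (le_lt_trans (_ : _ <= d)) ?ge_min ?lexx//; lra.
have md' : m < d' by rewrite ltr_pdivrMr// (le_lt_trans (_ : _ <= d')) ?ge_min ?lexx ?orbT//; lra.
have := hd (t + m) (addr_ge0 t0 (ltW m0)); have := hd' (t + m) (addr_ge0 t0 (ltW m0)).
rewrite tm gtr0_norm// => /(_ md') h1 /(_ md) h2.
rewrite -(ler_pM2l m0) -{1}(gtr0_norm m0) -normrM.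
have -> : m * (l - l') = (F (t + m) - F t - m * l') - (F (t + m) - F t - m * l) by ring.
by apply: (le_trans (ler_normB _ _)); lra.
Qed.

End EpsilonDerivative.

Section BumpConvolution.
Context {R : realType}.
Context (v : nat -> R -> R) (bv : bump_chain v) (a : R -> R) (ca : continuous a).

Definition bconv n (t : R) : R := rint t (fun s => v n (t - s) * a s).

Lemma bump_continuous n : continuous (v n).
Proof. exact: is_derive_continuous (proj1 bv n). Qed.

Lemma bconv_integrand n t : continuous (fun s => v n (t - s) * a s).
Proof. by apply: ccontM => //; apply: ccont_rev; exact: bump_continuous. Qed.

Lemma bconvE n (t tau : R) : 0 <= t -> t <= tau -> bconv n t = rint tau (fun s => v n (t - s) * a s).
Proof.
move=> t0 tt; rewrite /bconv; set f := (fun s => _).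
have cf : continuous f by exact: bconv_integrand.
rewrite !rint_prim ?(le_trans t0 tt)//.
have dF x : x \in `]t, tau[ -> is_derive x (1 : R) (prim f) (f x).
  rewrite in_itv/= => /andP[tx _]; apply: is_derive_prim => //.
  by apply: lt_trans (le_lt_trans t0 tx); lra.
have [c + h] := MVT_segment tt dF (continuous_subspaceT (continuous_prim cf)).
rewrite in_itv/= => /andP[tc _].
move/eqP: h; rewrite /f (bump_neg n bv) ?subr_le0// mul0r mul0r subr_eq0 => /eqP ->//.
Qed.

Lemma bconv_taylor n tau : 0 <= tau -> exists2 K : R, 0 <= K &
  forall s t, 0 <= s -> s <= tau -> 0 <= t -> t <= tau ->
    `|bconv n s - bconv n t - (s - t) * bconv n.+1 t| <= K * (s - t) ^+ 2.
Proof.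
move=> tau0; have [B B0 hB] := bump_taylor n bv.
have [K K0 hK] := @continuous_bounded R a 0 tau (continuous_subspaceT ca).
exists (tau * (B * K)); first by rewrite !mulr_ge0.
move=> s t s0 st t0 tt; rewrite !(@bconvE _ _ tau)//.
have c n' t' := @bconv_integrand n' t'.
pose g q := (v n (s - q) - v n (t - q) - (s - t) * v n.+1 (t - q)) * a q.
have -> : rint tau (fun q => v n (s - q) * a q) - rint tau (fun q => v n (t - q) * a q) -
    (s - t) * rint tau (fun q => v n.+1 (t - q) * a q) = rint tau g.
  transitivity (rint tau (fun q => v n (s - q) * a q +
      (-1 * (v n (t - q) * a q) + - (s - t) * (v n.+1 (t - q) * a q)))).
    rewrite !rintD ?rintZ//; try (by ring); try exact: ccontZ.
    by apply: ccontD; exact: ccontZ.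
  by apply: eq_rint => q _ _; rewrite /g; ring.
rewrite (_ : tau * (B * K) * (s - t) ^+ 2 = tau * (B * (s - t) ^+ 2 * K)); last by ring.
apply: rint_norm_le => //.
  have cr n' t' : continuous (fun q => v n' (t' - q)).
    by apply: ccont_rev; exact: bump_continuous.
  apply: ccontM => //; move=> q; apply: cvgB; first by apply: cvgB; exact: cr.
  by apply: cvgM; [exact: cvg_cst|exact: cr].
move=> q q0 qt; rewrite normrM; apply: ler_pM => //; last exact: hK.
by have := hB (t - q) (s - q); rewrite opprB addrA subrK; exact.
Qed.

Lemma taylor_deriv (F : R -> R) (t l K : R) : 0 <= K ->
  (forall s, 0 <= s -> s <= t + 1 -> `|F s - F t - (s - t) * l| <= K * (s - t) ^+ 2) ->
  forall e : R, 0 < e -> exists2 d : R, 0 < d & forall s, 0 <= s -> `|s - t| < d ->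
     `|F s - F t - (s - t) * l| <= e * `|s - t|.
Proof.
move=> K0 h e e0; have K1 : 0 < K + 1 by lra.
exists (Num.min 1 (e / (K + 1))); first by rewrite lt_min ltr01 divr_gt0.
move=> s s0; rewrite lt_min ltr_pdivlMr// => /andP[s1 se].
have st : s <= t + 1 by rewrite -lerBlDl; apply: le_trans (ltW s1); exact: ler_norm.
apply: (le_trans (h s s0 st)); rewrite -[(s - t) ^+ 2]real_normK ?num_real// expr2 mulrA.
rewrite ler_wpM2r// (le_trans _ (ltW se))// mulrC ler_wpM2l//; lra.
Qed.

Lemma bconv_deriv n t : 0 <= t ->
  forall e : R, 0 < e -> exists2 d : R, 0 < d & forall s, 0 <= s -> `|s - t| < d ->
     `|bconv n s - bconv n t - (s - t) * bconv n.+1 t| <= e * `|s - t|.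
Proof.
move=> t0; have t1 : 0 <= t + 1 by lra.
have [K K0 hK] := bconv_taylor n t1.
by apply: (taylor_deriv K0) => s s0 st; apply: hK => //; lra.
Qed.

End BumpConvolution.

Lemma duhamel_remainder (V : zmodType) (a b d p q g : V) :
  a - d + g = (a - b + p) + (b - d - (q - g)) - (p - q).
Proof.
rewrite [in RHS]addrACA [a - b + _]addrA subrK -[RHS]addrA; congr (_ + _).
by rewrite !opprB -[RHS]addrA [g - q + _]addrA subrK addrC subrK.
Qed.

Section Duhamel.
Context {R : realType}.

Definition rfunctional (E : normedModType R[i]) (l : E -> R) :=
  [/\ forall x y, l (x + y) = l x + l y, forall (r : R) x, l (r%:C *: x) = r * l x &
      exists2 K : R, 0 <= K & forall x, `|l x| <= K * rnorm x].

Lemma rfB (E : normedModType R[i]) (l : E -> R) (hl : rfunctional l) x y :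
  l (x - y) = l x - l y.
Proof.
have [lD lZ _] := hl; rewrite lD; congr (_ + _).
by have := lZ (-1) y; rewrite rmorphN scaleN1r mulN1r.
Qed.

Context {X : completeNormedModType R[i]}.
Context {A : partial_operator X} {T : semigroup X} (hA : generates A T).
Context (l : X -> R) (hl : rfunctional l).


Lemma orbit_derive y s : dom A y -> 0 <= s ->
  has_derivative (fun s => T s y) s (T s (A y)).
Proof.
move=> dy s0; apply/has_derivativeP => e e0.
have [M M1 hM] := sg_local_bound T s; have M0 : 0 < M by lra.
have e1 : 0 < e / (2 * M) by rewrite divr_gt0// mulr_gt0.
have [d d0 hd] := gen_near hA dy e1; have [d' d'0 hd'] := sg_near0 T (A y) e1.
exists (Num.min d d'); first by rewrite lt_min d0.
move=> t t0; rewrite lt_min => /andP[td td'].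
have [st|ts] := leP s t.
  have q0 : 0 <= t - s by rewrite subr_ge0.
  rewrite [`|t - s|]ger0_norm// in td td' *.
  have -> : T t y = T s (T (t - s) y) by rewrite -sg_D// addrC subrK.
  rewrite -linearB/= -[(t - s)%:C *: _]linearZ -linearB/=.
  apply: (le_trans (hM _ _ s0 (lexx s))).
  apply: (le_trans (ler_wpM2l (ltW M0) (hd _ q0 (ltW td)))).
  rewrite (_ : M * (e / (2 * M) * (t - s)) = e / 2 * (t - s)); last by field; rewrite gt_eqF.
  rewrite ler_wpM2r//; lra.
have q0 : 0 <= s - t by rewrite subr_ge0 ltW.
rewrite distrC [`|s - t|]ger0_norm// in td td' *.
have -> : T t y - T s y - (t - s)%:C *: T s (A y) =
    T t ((s - t)%:C *: (T (s - t) (A y) - A y) - (T (s - t) y - y - (s - t)%:C *: A y)).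
  have e2 z : T s z = T t (T (s - t) z) by rewrite -sg_D// addrC subrK.
  have TB p q : T t (p - q) = T t p - T t q by rewrite linearB.
  have TZ c p : T t (c *: p) = c *: T t p by rewrite linearZ.
  rewrite TB TZ !TB TZ -!e2 scalerBr [in RHS]opprB addrA subrK opprB [RHS]addrC.
  by rewrite -[(t - s)%:C]opprK -rmorphN opprB scaleNr opprK.
apply: (le_trans (hM _ _ t0 (ltW ts))).
have h1 := hd _ q0 (ltW td); have h2 := hd' _ q0 (ltW td').
apply: (@le_trans _ _ (M * ((s - t) * (e / (2 * M)) + e / (2 * M) * (s - t)))).
  rewrite ler_wpM2l ?(ltW M0)//; apply: (le_trans (rnormB _ _)); rewrite lerD//.
  by rewrite rnormZr ger0_norm// ler_wpM2l// ltW.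
rewrite le_eqVlt; apply/orP; left; apply/eqP; field; by rewrite gt_eqF.
Qed.

(** Duhamel's formula for [w' = A w + f], [w 0 = 0], tested against [l]: the
    function [s |-> T s (w (t - s))] has derivative [- T s (f (t - s))]. *)
Lemma duhamel (w dw f : R -> X) (q : R -> R) (t : R) :
  (forall s, 0 <= s -> has_derivative w s (dw s)) ->
  (forall s, 0 <= s -> dom A (w s) /\ A (w s) = dw s - f s) ->
  w 0 = 0 -> 0 <= t -> continuous q ->
  (forall s, 0 <= s -> s <= t -> q s = l (T s (f (t - s)))) ->
  l (w t) = rint t q.
Proof.
move=> dew Aw w0 t0 cq qE; have [lD lZ [L L0 hL]] := hl.
have [M M1 hM] := sg_local_bound T t; have M0 : 0 < M by lra.
have cw := (within_half_lineP _).1 (has_derivative_continuous dew).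
pose F s := - l (T s (w (t - s))).
have -> : rint t q = F t - F 0.
  apply: rint_ftc => //; first exact: continuous_subspaceT.
    apply/subspace_continuousP => s; rewrite /= in_itv/= => /andP[s0 st].
    apply/cvgrPdist_lt => e e0.
    have ts0 : 0 <= t - s by rewrite subr_ge0.
    have L1 : 0 < (L + 1) * M by rewrite mulr_gt0//; lra.
    have e1 : 0 < e / 2 / ((L + 1) * M) by rewrite !divr_gt0.
    have [d d0 hd] := cw _ _ ts0 e1.
    have L2 : 0 < L + 1 by lra.
    have e2 : 0 < e / 4 / (L + 1) by rewrite !divr_gt0.
    have [d' d'0 hd'] := @ucont_orbit _ _ T t (w (t - s)) _ e2.
    rewrite near_withinE; exists (Num.min d d') => /=; first by rewrite lt_min d0.
    move=> r /=; rewrite lt_min => /andP[rd rd']; rewrite in_itv/= => /andP[r0 rt].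
    have tr0 : 0 <= t - r by rewrite subr_ge0.
    rewrite /F opprK addrC -(rfB hl).
    have -> : T r (w (t - r)) - T s (w (t - s)) =
        T r (w (t - r) - w (t - s)) + (T r (w (t - s)) - T s (w (t - s))).
      by rewrite linearB/= addrA subrK.
    have h1 : rnorm (T r (w (t - r) - w (t - s))) <= M * (e / 2 / ((L + 1) * M)).
      apply: (le_trans (hM _ _ r0 rt)); rewrite ler_wpM2l ?(ltW M0)//; apply/ltW/hd => //.
      by rewrite opprB addrC addrA subrK.
    have h2 : rnorm (T r (w (t - s)) - T s (w (t - s))) <= e / 4 / (L + 1).
      by apply: hd' => //; rewrite distrC ltW.
    apply: (le_lt_trans (hL _)).
    apply: (@le_lt_trans _ _ ((L + 1) * (M * (e / 2 / ((L + 1) * M)) + e / 4 / (L + 1)))).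
      apply: ler_pM => //; [exact: rnorm_ge0|lra|].
      by apply: (le_trans (rnormD _ _)); exact: lerD.
    rewrite (_ : (L + 1) * _ = e * (3 / 4)); last by field; rewrite !gt_eqF//; lra.
    by rewrite gtr_pMr//; lra.
  move=> s s0 st; rewrite (qE s (ltW s0) (ltW st)); apply: is_derive_eps => e e0.
  have ts0 : 0 <= t - s by rewrite subr_ge0 ltW.
  have [dws Aws] := Aw _ ts0.
  have N0 : 0 < (L + 1) * (M + 2) by rewrite mulr_gt0//; lra.
  have e1 : 0 < e / ((L + 1) * (M + 2)) by rewrite divr_gt0.
  have [d1 d10 hd1] := (has_derivativeP _ _ _).1 (dew _ ts0) _ e1.
  have [d2 d20 hd2] := (has_derivativeP _ _ _).1 (orbit_derive dws (ltW s0)) _ e1.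
  have [d3 d30 hd3] := @ucont_orbit _ _ T t (dw (t - s)) _ e1.
  exists (Num.min (Num.min d1 d2) (Num.min d3 (Num.min s (t - s)))).
    by rewrite !lt_min d10 d20 d30 s0 subr_gt0 st.
  move=> r; rewrite !lt_min => /andP[/andP[r1 r2] /and3P[r3 rs rts]].
  have r0 : 0 <= r.
    by have := le_lt_trans (ler_norm (s - r)) (_ : `|s - r| < s); rewrite distrC => /(_ rs); lra.
  have rt : r <= t by have := le_lt_trans (ler_norm (r - s)) rts; lra.
  have tr0 : 0 <= t - r by rewrite subr_ge0.
  set p := l (T s (f (t - s))).
  have -> : F r - F s - (r - s) * p = - l (T r (w (t - r)) - T s (w (t - s)) +
      (r - s)%:C *: T s (f (t - s))).
    by rewrite /F lD (rfB hl) lZ /p; ring.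
  have -> : T r (w (t - r)) - T s (w (t - s)) + (r - s)%:C *: T s (f (t - s)) =
    T r (w (t - r) - w (t - s) - ((t - r) - (t - s))%:C *: dw (t - s)) +
    (T r (w (t - s)) - T s (w (t - s)) - (r - s)%:C *: T s (A (w (t - s)))) -
    (r - s)%:C *: (T r (dw (t - s)) - T s (dw (t - s))).
    have -> : t - r - (t - s) = - (r - s) by ring.
    rewrite Aws; set c := (r - s)%:C.
    have TB p' q' z : T z (p' - q') = T z p' - T z q' by rewrite linearB.
    have TZ c' p' : T r (c' *: p') = c' *: T r p' by rewrite linearZ.
    rewrite !TB TZ rmorphN -/c scaleNr opprK !scalerBr.
    exact: duhamel_remainder.
  rewrite normrN; apply: (le_trans (hL _)).
  set e' := e / _ in e1 hd1 hd2 hd3.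
  have h1 : rnorm (T r (w (t - r) - w (t - s) - ((t - r) - (t - s))%:C *: dw (t - s)))
      <= M * (e' * `|r - s|).
    apply: (le_trans (hM _ _ r0 rt)); rewrite ler_wpM2l ?(ltW M0)//.
    have E : `|t - r - (t - s)| = `|r - s| by rewrite opprB addrC addrA subrK distrC.
    by rewrite -E; apply: hd1; rewrite ?E.
  have h2 : rnorm (T r (w (t - s)) - T s (w (t - s)) - (r - s)%:C *: T s (A (w (t - s))))
      <= e' * `|r - s| by exact: hd2.
  have h3 : rnorm ((r - s)%:C *: (T r (dw (t - s)) - T s (dw (t - s)))) <= e' * `|r - s|.
    by rewrite rnormZr mulrC ler_wpM2r//; apply: hd3 => //; exact: ltW.
  have h4 := le_trans (rnormB _ _) (lerD (le_trans (rnormD _ _) (lerD h1 h2)) h3).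
  apply: (le_trans (ler_wpM2l L0 h4)).
  apply: (@le_trans _ _ ((L + 1) * (M * (e' * `|r - s|) + e' * `|r - s| + e' * `|r - s|))).
    have S0 : 0 <= e' * `|r - s| by rewrite mulr_ge0// ltW.
    have S1 := mulr_ge0 (ltW M0) S0.
    by rewrite ler_wpM2r ?lerDl// !addr_ge0.
  rewrite le_eqVlt; apply/orP; left; apply/eqP; rewrite /e'; field.
  by rewrite !gt_eqF//; lra.
rewrite /F subrr subr0 w0 opprK.
have l0 : l (T t 0) = 0 by have := rfB hl 0 0; rewrite !subrr linear0.
by rewrite l0 oppr0 add0r sg_0.
Qed.

End Duhamel.

(** * The ramp response *)

Section Ramp.
Context {R : realType}.

(** The response to the input [t |-> t] from the state 0.  For real [s] its Laplace
    transform is [s^-2 * G(s)], where [G(s) = g - (s - b) * k 0 + (s - b) ^+ 2 * K(s)]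
    with [K] the transform of [k]; in particular [g = G(b)]. *)
Definition ramp (b g : R) (k : R -> R) (t : R) : R :=
  k t + - (2 * b) * prim k t + b ^+ 2 * prim (prim k) t + g * t + k 0 * (b * t - 1).

Lemma ramp0 b g k : ramp b g k 0 = 0.
Proof. by rewrite /ramp !prim0 !mulr0 sub0r mulrN1; ring. Qed.

Lemma ccont_id : continuous (fun t : R => t).
Proof. by move=> t; exact: cvg_id. Qed.

Lemma ccont_cst (c : R) : continuous (fun _ : R => c).
Proof. by move=> t; exact: cvg_cst. Qed.

Lemma continuous_ramp b g k : continuous k -> continuous (ramp b g k).
Proof.
move=> ck; have cp := continuous_prim ck; have cpp := continuous_prim cp.
have h1 := ccontD (ccontZ (a := b) ccont_id) (@ccont_cst (-1)).
have h2 := ccontD ck (ccontZ (a := - (2 * b)) cp).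
have h3 := ccontD h2 (ccontZ (a := b ^+ 2) cpp).
have h4 := ccontD h3 (ccontZ (a := g) ccont_id).
exact: (ccontD h4 (ccontZ (a := k 0) h1)).
Qed.

Lemma rint_ramp (b g : R) (k h : R -> R) (t : R) : continuous k -> continuous h ->
  rint t (fun s => h s * ramp b g k s) =
  rint t (fun s => h s * k s) - 2 * b * rint t (fun s => h s * prim k s)
  + b ^+ 2 * rint t (fun s => h s * prim (prim k) s)
  + (g + k 0 * b) * rint t (fun s => h s * s) - k 0 * rint t (fun s => h s * 1).
Proof.
move=> ck ch; have cp := continuous_prim ck; have cpp := continuous_prim cp.
have c1 := ccontM ch ck; have c2 := ccontM ch cp; have c3 := ccontM ch cpp.
have c4 := ccontM ch (@ccont_id); have c5 := ccontM ch (@ccont_cst 1).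
transitivity (rint t (fun s => h s * k s + (- (2 * b) * (h s * prim k s) +
  (b ^+ 2 * (h s * prim (prim k) s) + ((g + k 0 * b) * (h s * s) + - k 0 * (h s * 1)))))).
  by apply: eq_rint => s _ _; rewrite /ramp; ring.
have z (a : R) (f : R -> R) : continuous f -> continuous (fun s => a * f s) by exact: ccontZ.
have d2 := z (- (2 * b)) _ c2; have d3 := z (b ^+ 2) _ c3.
have d4 := z (g + k 0 * b) _ c4; have d5 := z (- k 0) _ c5.
have d45 := ccontD d4 d5; have d345 := ccontD d3 d45; have d2345 := ccontD d2 d345.
rewrite (rintD _ c1 d2345) (rintD _ d2 d345) (rintD _ d3 d45) (rintD _ d4 d5) !rintZ//.
do 5 (move: (rint _ _) => ?).
by ring.
Qed.

(** Two integrations by parts move the derivatives of [v] to the primitives of [k]. *)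
Lemma conv_ramp (b g : R) (k : R -> R) (v : nat -> R -> R) (t : R) :
  bump_chain v -> continuous k -> 0 <= t ->
  rint t (fun s => v 2%N (t - s) * ramp b g k s) =
  rint t (fun s => (b ^+ 2 * v 0%N (t - s) - 2 * b * v 1%N (t - s) + v 2%N (t - s)) * k s)
  + (b * v 0%N t - v 1%N t) * k 0 + v 0%N t * g.
Proof.
move=> bv ck t0; have cp := continuous_prim ck; have cpp := continuous_prim cp.
have cv n : continuous (fun s => v n (t - s)) by apply: ccont_rev; exact: bump_continuous.
have v0 n : v n 0 = 0 by exact: bump_neg.
have [dv _] := bv.
have dp f : continuous f -> forall s : R, - 2^-1 < s -> is_derive s (1 : R) (prim f) (f s).
  by move=> cf s; exact: is_derive_prim.
have move1 n (F a : R -> R) : (forall s : R, - 2^-1 < s -> is_derive s (1 : R) F (a s)) ->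
    continuous F -> continuous a -> F 0 = 0 ->
    rint t (fun s => v n.+1 (t - s) * F s) = rint t (fun s => v n (t - s) * a s).
  move=> dF cF ca F0; apply: rint_conv_parts => //; exact: bump_continuous.
rewrite rint_ramp// (move1 _ _ _ (dp _ ck) cp ck (prim0 _)).
rewrite (move1 _ _ _ (dp _ cp) cpp cp (prim0 _)) (move1 _ _ _ (dp _ ck) cp ck (prim0 _)).
have int1 n : rint t (fun s => v n.+1 (t - s) * 1) = v n t.
  apply: (etrans (@rint_ftc1 _ t _ (fun s => - v n (t - s)) t0 _ _)).
  - exact: (ccontM (cv n.+1) (@ccont_cst 1)).
  - move=> s _; have h1 := dv n (t - s).
    by apply: is_derive_eq; rewrite /GRing.scale /=; ring.
  - by rewrite subrr v0 subr0 oppr0 sub0r opprK.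
have -> : rint t (fun s => v 2%N (t - s) * s) = v 0%N t.
  rewrite (move1 1%N (fun s => s) (fun=> 1)) ?int1//; first exact: ccont_id.
  exact: ccont_cst.
rewrite int1.
have -> : rint t (fun s => (b ^+ 2 * v 0%N (t - s) - 2 * b * v 1%N (t - s) + v 2%N (t - s)) * k s)
  = rint t (fun s => v 2%N (t - s) * k s) - 2 * b * rint t (fun s => v 1%N (t - s) * k s)
    + b ^+ 2 * rint t (fun s => v 0%N (t - s) * k s).
  have c n := ccontM (cv n) ck.
  transitivity (rint t (fun s => v 2%N (t - s) * k s + (- (2 * b) * (v 1%N (t - s) * k s) +
    b ^+ 2 * (v 0%N (t - s) * k s)))).
    by apply: eq_rint => s _ _; ring.
  have d1 : continuous (fun s => - (2 * b) * (v 1%N (t - s) * k s)) by exact: ccontZ.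
  have d0 : continuous (fun s => b ^+ 2 * (v 0%N (t - s) * k s)) by exact: ccontZ.
  by rewrite (rintD _ (c 2%N) (ccontD d1 d0)) (rintD _ d1 d0) !rintZ//; ring.
ring.
Qed.

End Ramp.

Section SystemFunctional.
Context {R : realType} {U X Y : completeNormedModType R[i]} (S : system_node U X Y).
Context (b : R) (hb : (growth_bound (sn_T S) < b%:E)%E).
Context (eta : Y -> R) (heta : rfunctional eta).

Local Notation A := (sn_A S).
Local Notation T := (sn_T S).
Local Notation E := (sn_ext S).

Lemma half_b : half_plane (growth_bound T) b%:C.
Proof. exact: hb. Qed.

Definition rvec (e : U) : X := ext_resolvent (E := E) b%:C (sn_B S e).
Definition ell (x : X) : R := eta (sn_C S (resolvent A b%:C x)).
Definition kfun (e : U) (t : R) : R := ell (T (Num.max t 0) (rvec e)).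
Definition gfun (e : U) : R := eta (sn_G S b%:C e).
Definition pfun (e : U) : R -> R := ramp b (gfun e) (kfun e).

Lemma dom_lin (a : R[i]) x z : dom A x -> dom A z ->
  dom A (a *: x + z) /\ A (a *: x + z) = a *: A x + A z.
Proof. exact: gen_lin (sn_generates S) a x z. Qed.

Lemma resolvent_dom y : dom A y -> resolvent A b%:C (b%:C *: y - A y) = y.
Proof.
move=> dy; apply: xget_unique => [//|z /= [dz ez]].
have d : dom A (-1 *: y + z) by have [] := dom_lin (-1) dy dz.
have e : b%:C *: (-1 *: y + z) = A (-1 *: y + z).
  have [_ ->] := dom_lin (-1) dy dz; rewrite !scaleN1r scalerDr scalerN.
  by apply/eqP; rewrite -subr_eq0 opprD opprK addrACA ez [- _ + _]addrC -opprB addNr.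
have := gen_inj (sn_generates S) half_b d e.
by rewrite scaleN1r addrC => /eqP; rewrite subr_eq0 => /eqP.
Qed.

Lemma ell_dom y : dom A y -> ell (b%:C *: y - A y) = eta (sn_C S y).
Proof. by move=> dy; rewrite /ell resolvent_dom. Qed.

Lemma ell_rfunctional : rfunctional ell.
Proof.
have [Q [Qc Q1 Q2]] := sn_beta_resolvent S; have hA := sn_generates S.
have [etaD etaZ [K K0 hK]] := heta.
have [N N0 hN] := resolvent_half_plane_bound hA Qc Q1 Q2 half_b.
have [M hM] := sn_C_bounded S.
have lin (a : R[i]) x z : exists y1 y2, [/\ dom A y1, dom A y2, ell x = eta (sn_C S y1),
    ell z = eta (sn_C S y2) & ell (a *: x + z) = eta (a *: sn_C S y1 + sn_C S y2)].
  have [y1 [d1 e1 _]] := hN x; have [y2 [d2 e2 _]] := hN z.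
  have [d3 e3] := dom_lin a d1 d2.
  exists y1, y2; split => //; rewrite -?e1 -?e2 ?ell_dom//.
  rewrite -sn_C_linear// -ell_dom// e3; congr ell.
  by rewrite scalerBr scalerDr addrACA opprD !scalerA mulrC.
split.
- move=> x z; have [y1 [y2 [_ _ h1 h2]]] := lin 1 x z.
  by rewrite scale1r => ->; rewrite scale1r etaD h1 h2.
- move=> r x; have [y1 [y2 [_ _ h1 h2 h]]] := lin r%:C x 0.
  rewrite addr0 in h; rewrite h etaD etaZ -h1 -h2.
  have [z1 [z2 [_ _ g1 g2 g]]] := lin 1 0 0.
  by move: g; rewrite !scale1r addr0 etaD -g1 -g2 => g; lra.
exists (K * (`|M| * (1 + cabs (sn_beta S - b%:C) * N))).
  by rewrite !mulr_ge0// addr_ge0// mulr_ge0// cabs_ge0.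
move=> x; have [y [dy <- hy]] := hN x; rewrite ell_dom//.
apply: (le_trans (hK _)); rewrite -!mulrA ler_wpM2l//.
apply: (le_trans (hM _ dy)); apply: (le_trans (ler_wpM2r (rnorm_ge0 _) (ler_norm M))).
rewrite ler_wpM2l// mulrDl mul1r.
have -> : sn_beta S *: y - A y = (b%:C *: y - A y) + (sn_beta S - b%:C) *: y.
  by rewrite scalerBl [RHS]addrC addrA subrK.
apply: (le_trans (rnormD _ _)); rewrite lerD2l rnormZ -mulrA.
by rewrite ler_wpM2l ?cabs_ge0.
Qed.

End SystemFunctional.

Section SumsOfBumps.
Context {R : realType}.

Lemma ccont_sum (n : nat) (f : 'I_n -> R -> R) : (forall j, continuous (f j)) ->
  continuous (fun s => \sum_(j < n) f j s).
Proof.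
move=> cf; elim: n f cf => [|n ih] f cf.
  rewrite (_ : (fun _ => _) = fun=> 0); first exact: (@ccont_cst R 0).
  by apply/funext => s; rewrite big_ord0.
rewrite (_ : (fun _ => _) = fun s => \sum_(j < n) f (widen_ord (leqnSn n) j) s + f ord_max s).
  by apply: ccontD => //; apply: ih.
by apply/funext => s; rewrite big_ord_recr.
Qed.

Definition half_derive (F : R -> R) (t l : R) := forall e : R, 0 < e ->
  exists2 d : R, 0 < d & forall s, 0 <= s -> `|s - t| < d ->
    `|F s - F t - (s - t) * l| <= e * `|s - t|.

Lemma half_deriveD F G t l m : half_derive F t l -> half_derive G t m ->
  half_derive (fun s => F s + G s) t (l + m).
Proof.
move=> hF hG e e0; have e2 : 0 < e / 2 by lra.
have [d d0 hd] := hF _ e2; have [d' d'0 hd'] := hG _ e2.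
exists (Num.min d d'); first by rewrite lt_min d0.
move=> s s0; rewrite lt_min => /andP[h1 h2].
have -> : F s + G s - (F t + G t) - (s - t) * (l + m) =
    (F s - F t - (s - t) * l) + (G s - G t - (s - t) * m) by ring.
by apply: (le_trans (ler_normD _ _)); have := hd s s0 h1; have := hd' s s0 h2; lra.
Qed.

Lemma half_derive_sum (n : nat) (F : 'I_n -> R -> R) t (l : 'I_n -> R) :
  (forall j, half_derive (F j) t (l j)) ->
  half_derive (fun s => \sum_(j < n) F j s) t (\sum_(j < n) l j).
Proof.
elim: n F l => [|n ih] F l h.
  move=> e e0; exists 1 => // s _ _; rewrite !big_ord0 mulr0 !subrr normr0.
  by rewrite mulr_ge0// ltW.
rewrite big_ord_recr (_ : (fun _ => _) =
    fun s => \sum_(j < n) F (widen_ord (leqnSn n) j) s + F ord_max s).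
  by apply: half_deriveD => //; exact: ih.
by apply/funext => s; rewrite big_ord_recr.
Qed.

Lemma bump_opp (v : nat -> R -> R) : bump_chain v -> bump_chain (fun n t => - v n t).
Proof.
move=> [cv [eta [T0 [e0 h]]]]; split; last first.
  by exists eta, T0; split => // n t ht; rewrite h// oppr0.
by move=> n t; apply: (@is_deriveN _ _ _ (v n)).
Qed.

Lemma has_derivative_sum_bump (E : normedModType R[i]) (n m : nat)
    (v : 'I_n -> nat -> R -> R) (z : 'I_n -> E) t : (forall j, bump_chain (v j)) ->
  has_derivative (fun s => \sum_(j < n) (v j m s)%:C *: z j) t
    (\sum_(j < n) (v j m.+1 t)%:C *: z j).
Proof.
elim: n v z => [|n ih] v z bv.
  apply/has_derivativeP => e e0; exists 1 => // s _ _.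
  by rewrite !big_ord0 scaler0 !subrr rnorm0 mulr_ge0// ltW.
rewrite big_ord_recr (_ : (fun _ => _) =
    fun s => \sum_(j < n) (v (widen_ord (leqnSn n) j) m s)%:C *: z (widen_ord (leqnSn n) j)
      + (v ord_max m s)%:C *: z ord_max).
  apply: has_derivativeD; last exact: has_derivative_bump.
  exact: (ih (fun j => v (widen_ord (leqnSn n) j)) (fun j => z (widen_ord (leqnSn n) j))).
by apply/funext => s; rewrite big_ord_recr.
Qed.

Lemma rfunctional_sum (E : normedModType R[i]) (l : E -> R) (n : nat) (c : 'I_n -> R)
    (z : 'I_n -> E) : rfunctional l ->
  l (\sum_(j < n) (c j)%:C *: z j) = \sum_(j < n) c j * l (z j).
Proof.
move=> hl; have [lD lZ _] := hl.
elim/big_rec2: _ => [|j y1 y2 _ ih]; first by have := rfB hl 0 0; rewrite !subrr.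
by rewrite lD lZ ih.
Qed.

End SumsOfBumps.

Section FunctionalOrbit.
Context {R : realType} {X : completeNormedModType R[i]} (T : semigroup X).
Context (l : X -> R) (hl : rfunctional l).

Lemma continuous_functional_orbit x : continuous (fun t : R => l (T (Num.max t 0) x)).
Proof.
have [_ _ [K K0 hK]] := hl.
move=> t; apply/cvgrPdist_lt => eps eps0.
have K1 : 0 < K + 1 by lra.
have e1 : 0 < eps / 2 / (K + 1) by rewrite !divr_gt0.
have [d d0 hd] := @ucont_orbit _ _ T (`|t| + 1) x _ e1.
exists (Num.min d 1); first by rewrite /= lt_min d0 ltr01.
move=> s /=; rewrite lt_min => /andP[sd s1].
rewrite -(rfB hl); apply: (le_lt_trans (hK _)).
have t1 := ler_norm t; have a0 := normr_ge0 t.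
have s2 : s <= `|t| + 1.
  by have := ler_norm (s - t); rewrite distrC => h; have := le_lt_trans h s1; lra.
have m0 u : 0 <= Num.max u (0 : R) by rewrite le_max lexx orbT.
have mle u : u <= `|t| + 1 -> Num.max u (0 : R) <= `|t| + 1.
  by move=> h; rewrite ge_max h/=; lra.
have mlip : `|Num.max t (0 : R) - Num.max s 0| <= `|t - s|.
  case: (leP t 0) => h1; case: (leP s 0) => h2; rewrite ?subrr ?normr0 ?sub0r ?subr0 ?normrN//.
    by rewrite (distrC t) !ger0_norm; lra.
  by rewrite !ger0_norm; lra.
apply: (@le_lt_trans _ _ ((K + 1) * (eps / 2 / (K + 1)))); last first.
  by rewrite mulrC divfK ?gt_eqF//; lra.
apply: ler_pM => //; [exact: rnorm_ge0|lra|].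
apply: hd => //; try exact: mle; first by apply: mle; lra.
exact: le_trans mlip (ltW sd).
Qed.

Lemma functional_orbit_growth x (r : R) : (growth_bound T < r%:E)%E ->
  exists2 w : R, w < r & exists2 M : R, 0 <= M &
    forall t, 0 <= t -> `|l (T t x)| <= M * expR (w * t).
Proof.
move=> /growth_bound_exp[w wr [M M1 hM]].
have [_ _ [K K0 hK]] := hl.
exists w => //; exists (K * (M * rnorm x)).
  by rewrite !mulr_ge0 ?rnorm_ge0//; lra.
move=> t t0; apply: (le_trans (hK _)).
rewrite -!mulrA ler_wpM2l// (le_trans (hM _ _ t0))// -mulrA.
by rewrite ler_wpM2l ?[rnorm _ * _]mulrC//; lra.
Qed.

End FunctionalOrbit.

Section OutputFormula.
Context {R : realType} {U X Y : completeNormedModType R[i]} (S : system_node U X Y).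
Context (b : R) (hb : (growth_bound (sn_T S) < b%:E)%E).
Context (eta : Y -> R) (heta : rfunctional eta).

Local Notation A := (sn_A S).
Local Notation T := (sn_T S).
Local Notation E := (sn_ext S).
Local Notation rvec := (rvec S b).
Local Notation ell := (ell S b eta).
Local Notation kfun := (kfun S b eta).
Local Notation pfun := (pfun S b eta).

Lemma continuous_kfun e : continuous (kfun e).
Proof. exact: continuous_functional_orbit (ell_rfunctional hb heta) _. Qed.

(** Duhamel's formula yields the output in terms of [k] and of the first derivatives
    of the input; [conv_ramp] turns this into a convolution with one kernel. *)
Lemma output_formula (n : nat) (v : 'I_n -> nat -> R -> R) (e : 'I_n -> U)
    (u : R -> U) (x : R -> X) (y : R -> Y) :
  (forall j, bump_chain (v j)) ->
  (forall t, 0 <= t -> u t = \sum_(j < n) (v j 0%N t)%:C *: e j) ->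
  classical_solution S u x y -> x 0 = 0 ->
  forall t, 0 <= t -> eta (y t) = \sum_(j < n) rint t (fun s => v j 2%N (t - s) * pfun (e j) s).
Proof.
move=> bv uE [_ _ [dx [_ hdx _ hdE hy]]] x0.
have [Q [Qc Q1 Q2]] := sn_beta_resolvent S; have hA := sn_generates S.
have hl := ell_rfunctional hb heta; have [lD lZ [K K0 hK]] := hl.
have hb' := half_b hb.
have cr t : 0 <= t -> ext_resolvent (E := E) b%:C (sn_B S (u t)) = \sum_(j < n) (v j 0%N t)%:C *: rvec (e j).
  move=> t0; rewrite uE//.
  elim/big_rec2: _ => [|j y1 y2 _ ih].
    by apply: (ext_resolvent_unique hA Qc Q1 Q2) => //;
      rewrite [ext_emb _ 0]linear0 [ext_op _ 0]linear0 [sn_B S 0]linear0 scaler0 subrr.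
  by rewrite [sn_B S _]linearP (ext_resolvent_lin hA Qc Q1 Q2)// ih.
pose phi j := fun m t => b * v j m t - v j m.+1 t.
have bphi j : bump_chain (phi j) by exact: bump_shift.
pose w t := x t + \sum_(j < n) (- v j 0%N t)%:C *: rvec (e j).
pose dw t := dx t + \sum_(j < n) (- v j 1%N t)%:C *: rvec (e j).
pose f t := \sum_(j < n) (phi j 0%N t)%:C *: rvec (e j).
have dew t : 0 <= t -> has_derivative w t (dw t).
  move=> t0; apply: has_derivativeD; first exact: hdx.
  exact: (@has_derivative_sum_bump _ _ n 0 (fun j m t => - v j m t)
    (fun j => rvec (e j)) t (fun j => bump_opp (bv j))).
have Aw t : 0 <= t -> dom A (w t) /\ A (w t) = dw t - f t.
  move=> t0; pose rho := ext_resolvent (E := E) b%:C (sn_B S (u t)).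
  have wE : w t = x t - rho.
    rewrite /w /rho cr// -sumrN; congr (_ + _); apply: eq_bigr => j _.
    by rewrite rmorphN scaleNr.
  have -> : dw t - f t = dx t - b%:C *: rho.
    rewrite /dw /f /rho cr// -addrA; congr (_ + _).
    rewrite scaler_sumr -!sumrN -big_split; apply: eq_bigr => j _ /=.
    rewrite scalerA -scaleNr -[RHS]scaleNr -scalerDl; congr (_ *: _).
    by rewrite /phi !rmorphN !rmorphB/= !rmorphM/=; ring.
  apply: (ext_op_part hA Qc Q1 Q2 (E := E)).
  have rE := ext_resolventP hA Qc Q1 Q2 (E := E) (sn_B S (u t)) hb'.
  rewrite wE !linearB/= hdE// [ext_emb E (_ *: _)]linearZ/= -/rho in rE *.
  rewrite -rE -addrA [_ - _ - b%:C *: _]addrAC subrr add0r//.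
have w0 : w 0 = 0.
  rewrite /w x0 add0r big1// => j _; by rewrite (bump_neg 0 (bv j)) ?oppr0 ?scale0r.
have lw t : 0 <= t -> ell (w t) = \sum_(j < n) bconv (phi j) (kfun (e j)) 0 t.
  move=> t0.
  rewrite (@duhamel _ _ _ _ hA _ hl w dw f (fun s => \sum_(j < n) phi j 0%N (t - s) * kfun (e j) s))//.
  - by rewrite rint_sum// => j; apply: bconv_integrand => //; exact: continuous_kfun.
  - by apply: ccont_sum => j; apply: bconv_integrand => //; exact: continuous_kfun.
  - move=> s s0 st; rewrite /f linear_sum/=.
    rewrite (eq_bigr (fun j => (phi j 0%N (t - s))%:C *: T s (rvec (e j)))); last first.
      by move=> j _; rewrite linearZ.
    rewrite rfunctional_sum//; apply: eq_bigr => j _.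
    by rewrite /kfun (max_idPl s0).
have ldw t : 0 <= t -> ell (dw t) = \sum_(j < n) bconv (phi j) (kfun (e j)) 1 t.
  move=> t0; apply: (@deriv_unique _ (fun s => ell (w s)) t) => //.
    move=> eps eps0; have K1 : 0 < K + 1 by lra.
    have [d d0 hd] := (has_derivativeP _ _ _).1 (dew t t0) _ (divr_gt0 eps0 K1).
    exists d => // s s0 sd; rewrite -(rfB hl) -lZ -(rfB hl); apply: (le_trans (hK _)).
    apply: (@le_trans _ _ ((K + 1) * (eps / (K + 1) * `|s - t|))).
      by apply: ler_pM => //; [exact: rnorm_ge0|lra|exact: hd].
    by rewrite mulrA mulrCA mulfV ?mulr1// gt_eqF.
  have hs := half_derive_sum (fun j => bconv_deriv (bphi j) (@continuous_kfun (e j)) 0 t0).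
  move=> eps eps0; have [d d0 hd] := hs eps eps0; exists d => // s s0 sd.
  by rewrite !lw//; exact: hd.
move=> t t0.
rewrite (hy t t0 _ hb') /CD.
have [etaD etaZ _] := heta; rewrite etaD cr// uE// [sn_G S _ _]linear_sum/=.
rewrite (eq_bigr (fun j => (v j 0%N t)%:C *: sn_G S b%:C (e j))); last first.
  by move=> j _; rewrite linearZ.
rewrite [X in _ + X]rfunctional_sum//.
have [dwt Awt] := Aw t t0.
have -> : x t - \sum_(j < n) (v j 0%N t)%:C *: rvec (e j) = w t.
  rewrite /w -sumrN; congr (_ + _); apply: eq_bigr => j _; by rewrite rmorphN scaleNr.
rewrite -(ell_dom hb eta dwt) Awt !(rfB hl) lZ lw// ldw// /f rfunctional_sum//.
rewrite mulr_sumr -!sumrB -big_split /=; apply: eq_bigr => j _.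
rewrite (conv_ramp _ _ (bv j) (@continuous_kfun (e j)) t0).
have -> : rint t (fun s => (b ^+ 2 * v j 0%N (t - s) - 2 * b * v j 1%N (t - s) +
    v j 2%N (t - s)) * kfun (e j) s) =
    b * bconv (phi j) (kfun (e j)) 0 t - bconv (phi j) (kfun (e j)) 1 t.
  have ck := @continuous_kfun (e j).
  have c0 := @bconv_integrand _ _ (bphi j) _ ck 0 t.
  have c1 := @bconv_integrand _ _ (bphi j) _ ck 1 t.
  rewrite /bconv -mulN1r -!rintZ// -(rintD _ (ccontZ (a := b) c0) (ccontZ (a := -1) c1)).
  by apply: eq_rint => s _ _; rewrite /phi; ring.
rewrite /kfun (max_idPl (lexx 0)) sg_0 /gfun /phi.
move: (bconv _ _ 0 t) (bconv _ _ 1 t) (ell _) (eta _) => p q r g; ring.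
Qed.

End OutputFormula.

(** * The transfer function as a Laplace transform *)

Section ExponentialGrowth.
Context {R : realType}.

Definition exp_growth (w : R) (f : R -> R) := exists2 M : R, 0 <= M &
  forall t, 0 <= t -> `|f t| <= M * expR (w * t).

Lemma exp_growth_le w w' f : w <= w' -> exp_growth w f -> exp_growth w' f.
Proof.
move=> ww [M M0 hM]; exists M => // t t0; apply: (le_trans (hM t t0)).
by rewrite ler_wpM2l// ler_expR ler_wpM2r.
Qed.

Lemma exp_growth_prim w f : 0 < w -> continuous f -> exp_growth w f -> exp_growth w (prim f).
Proof.
move=> w0 cf [M M0 hM]; exists (M / w); first by rewrite divr_ge0// ltW.
move=> t t0; rewrite -rint_prim//.
have dE (s : R) : is_derive s (1 : R) (fun s => M / w * expR (w * s)) (M * expR (w * s)).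
  by apply: is_derive_eq; rewrite /GRing.scale /=; field; rewrite gt_eqF.
have cE : continuous (fun s : R => M * expR (w * s)).
  have dE' (s : R) : is_derive s (1 : R) (fun s => M * expR (w * s)) (M * (expR (w * s) * w)).
    by apply: is_derive_eq; rewrite /GRing.scale /=; ring.
  exact: is_derive_continuous dE'.
have upper : rint t (fun s => M * expR (w * s)) <= M / w * expR (w * t).
  rewrite (rint_ftc1 t0 cE (fun s _ => dE s)) gerBl.
  by rewrite mulr_ge0 ?expR_ge0// divr_ge0// ltW.
have cN : continuous (fun s : R => -1 * (M * expR (w * s))) by exact: ccontZ.
rewrite ler_norml; apply/andP; split.
  apply: (@le_trans _ _ (rint t (fun s => -1 * (M * expR (w * s))))).
    by rewrite rintZ// mulN1r lerN2.
  by apply: le_rint => // s s0 _; rewrite mulN1r; have := hM s s0; rewrite ler_norml => /andP[].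
apply: le_trans upper; apply: le_rint => // s s0 _.
by have := hM s s0; rewrite ler_norml => /andP[].
Qed.

Lemma exp_growth_id w : 0 < w -> exp_growth w (fun t => t).
Proof.
move=> w0; exists w^-1; first by rewrite invr_ge0 ltW.
move=> t t0; rewrite ger0_norm// mulrC ler_pdivlMr// mulrC.
by apply: le_trans (expR_ge1Dx _); rewrite lerDr.
Qed.

Lemma exp_growth_cst w c : 0 < w -> exp_growth w (fun=> c).
Proof.
move=> w0; exists `|c| => // t t0; by rewrite ler_peMr// -expR0 ler_expR mulr_ge0 ?(ltW w0).
Qed.

Lemma exp_decay_cvg (w sg : R) (c f : R -> R) : w < sg -> exp_growth (- sg) c -> exp_growth w f ->
  (fun n : nat => c n%:R * f n%:R) @ \oo --> (0 : R).
Proof.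
move=> ws [C C0 hC] [M M0 hM].
apply: norm_cvg0; apply: (@squeeze_cvgr _ _ _ _ (cst 0) (fun n : nat => C * M * expR (w - sg) ^+ n)).
- near=> n; rewrite normr_ge0/= normrM.
  have n0 : 0 <= (n%:R : R) by [].
  apply: (le_trans (ler_pM (normr_ge0 _) (normr_ge0 _) (hC _ n0) (hM _ n0))).
  rewrite mulrACA -expRD -expRM_natl ler_wpM2l ?mulr_ge0// ler_expR.
  by rewrite le_eqVlt; apply/orP; left; apply/eqP; ring.
- exact: cvg_cst.
- apply: cvg_geometric; rewrite ger0_norm ?expR_ge0// -expR0 ltr_expR; lra.
Unshelve. all: by end_near. Qed.

End ExponentialGrowth.

Section LaplaceDerivatives.
Context {R : realType} (s : R[i]).

(** Real and imaginary parts of the [m]-th derivative of [t |-> exp (- s t)]. *)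
Definition lre (m : nat) (t : R) : R := complex.Re ((- s) ^+ m * cexp s t).
Definition lim_ (m : nat) (t : R) : R := complex.Im ((- s) ^+ m * cexp s t).

Lemma is_cderive_pow m t : is_cderive (fun t => (- s) ^+ m * cexp s t) t ((- s) ^+ m.+1 * cexp s t).
Proof. by rewrite exprSr -mulrA; apply: is_cderiveZ; exact: is_cderive_cexp. Qed.

Lemma is_derive_lre m t : is_derive t (1 : R) (lre m) (lre m.+1 t).
Proof. exact: (proj1 (is_cderive_pow m t)). Qed.

Lemma is_derive_lim m t : is_derive t (1 : R) (lim_ m) (lim_ m.+1 t).
Proof. exact: (proj2 (is_cderive_pow m t)). Qed.

Lemma continuous_lim m : continuous (lim_ m).
Proof. exact: is_derive_continuous (is_derive_lim m). Qed.

Lemma exp_growth_lre m : exp_growth (- complex.Re s) (lre m).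
Proof.
exists (cabs ((- s) ^+ m)); first exact: cabs_ge0.
by move=> t _; apply: (le_trans (cabs_Re _)); rewrite cabsM cabs_cexp mulNr.
Qed.

Lemma exp_growth_lim m : exp_growth (- complex.Re s) (lim_ m).
Proof.
exists (cabs ((- s) ^+ m)); first exact: cabs_ge0.
by move=> t _; apply: (le_trans (cabs_Im _)); rewrite cabsM cabs_cexp mulNr.
Qed.

End LaplaceDerivatives.

Section LaplaceRamp.
Context {R : realType}.

(** Two integrations by parts; the boundary terms at infinity vanish. *)
Lemma laplace_ramp (b g w sg : R) (k : R -> R) (d : nat -> R -> R) :
  0 < w -> w < sg -> continuous k -> exp_growth w k ->
  (forall m t, is_derive t (1 : R) (d m) (d m.+1 t)) ->
  (forall m, exp_growth (- sg) (d m)) ->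
  (fun n : nat => rint n%:R (fun t => d 2%N t * ramp b g k t) -
     rint n%:R (fun t => (d 2%N t + 2 * b * d 1%N t + b ^+ 2 * d 0%N t) * k t)) @ \oo -->
  (g + k 0 * b) * d 0%N 0 + k 0 * d 1%N 0.
Proof.
move=> w0 ws ck gk dd gd.
have cd m : continuous (d m) := is_derive_continuous (dd m).
have cp := continuous_prim ck; have cpp := continuous_prim cp.
have gp := exp_growth_prim w0 ck gk; have gpp := exp_growth_prim w0 cp gp.
have dp f : continuous f -> forall t : R, - 2^-1 < t -> is_derive t (1 : R) (prim f) (f t).
  by move=> cf t; exact: is_derive_prim.
pose bd (t : R) := - (2 * b) * (d 1%N t * prim k t) + (b ^+ 2 * (d 1%N t * prim (prim k) t)
  + (- b ^+ 2 * (d 0%N t * prim k t) + ((g + k 0 * b) * (d 1%N t * t) +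
    (- (g + k 0 * b) * (d 0%N t * 1) + - k 0 * (d 1%N t * 1))))).
have -> : (fun n : nat => rint n%:R (fun t => d 2%N t * ramp b g k t) -
     rint n%:R (fun t => (d 2%N t + 2 * b * d 1%N t + b ^+ 2 * d 0%N t) * k t)) =
  (fun n : nat => bd n%:R + ((g + k 0 * b) * d 0%N 0 + k 0 * d 1%N 0)).
  apply/funext => n; have n0 : 0 <= (n%:R : R) by []; set t : R := n%:R in n0 *.
  rewrite rint_ramp//.
  have -> : rint t (fun s => d 2%N s * prim k s) =
      d 1%N t * prim k t - rint t (fun s => d 1%N s * k s).
    by apply: rint_parts => //; try exact: dp; exact: prim0.
  have -> : rint t (fun s => d 2%N s * prim (prim k) s) =
      d 1%N t * prim (prim k) t - rint t (fun s => d 1%N s * prim k s).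
    by apply: rint_parts => //; try exact: dp; exact: prim0.
  have -> : rint t (fun s => d 1%N s * prim k s) =
      d 0%N t * prim k t - rint t (fun s => d 0%N s * k s).
    by apply: rint_parts => //; try exact: dp; exact: prim0.
  have -> : rint t (fun s => d 2%N s * s) = d 1%N t * t - rint t (fun s => d 1%N s * 1).
    exact: (rint_parts n0 (dd 1%N) (cd 2%N) (fun s _ => is_derive_id s 1) ccont_id
      (@ccont_cst _ 1) erefl).
  have i1 m : rint t (fun s => d m.+1 s * 1) = d m t - d m 0.
    apply: (rint_ftc1 n0); first exact: (ccontM (cd m.+1) (@ccont_cst _ 1)).
    by move=> s _; rewrite mulr1.
  rewrite !i1.
  have -> : rint t (fun s => (d 2%N s + 2 * b * d 1%N s + b ^+ 2 * d 0%N s) * k s) =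
      rint t (fun s => d 2%N s * k s) + 2 * b * rint t (fun s => d 1%N s * k s) +
      b ^+ 2 * rint t (fun s => d 0%N s * k s).
    have c m := ccontM (cd m) ck.
    have c1 : continuous (fun s => 2 * b * (d 1%N s * k s)) by exact: ccontZ.
    have c0 : continuous (fun s => b ^+ 2 * (d 0%N s * k s)) by exact: ccontZ.
    transitivity (rint t (fun s => d 2%N s * k s + (2 * b * (d 1%N s * k s) +
      b ^+ 2 * (d 0%N s * k s)))); first by apply: eq_rint => s _ _; ring.
    by rewrite (rintD _ (c 2%N) (ccontD c1 c0)) (rintD _ c1 c0) !rintZ// addrA.
  rewrite /bd; do 3 (move: (rint _ _) => ?); move: (prim k t) (prim (prim k) t) => ? ?.
  move: (d 0%N t) (d 1%N t) (d 0%N 0) (d 1%N 0) (k 0) => ? ? ? ? ?; ring.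
rewrite -[X in _ --> X]add0r; apply: cvgD; last exact: cvg_cst.
have z m f (a : R) : exp_growth w f -> (fun n : nat => a * (d m n%:R * f n%:R)) @ \oo --> (0 : R).
  move=> gf; rewrite -[X in _ --> X](mulr0 a); apply: cvgM; first exact: cvg_cst.
  exact: (exp_decay_cvg ws (gd m) gf).
have gi := exp_growth_id w0; have g1 := exp_growth_cst 1 w0.
rewrite -[X in _ --> X](addr0 0); apply: cvgD; first exact: (z 1%N).
rewrite -[X in _ --> X](addr0 0); apply: cvgD; first exact: (z 1%N).
rewrite -[X in _ --> X](addr0 0); apply: cvgD; first exact: (z 0%N).
rewrite -[X in _ --> X](addr0 0); apply: cvgD; first exact: (z 1%N _ _ gi).
rewrite -[X in _ --> X](addr0 0); apply: cvgD; [exact: (z 0%N _ _ g1)|exact: (z 1%N _ _ g1)].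
Qed.

End LaplaceRamp.

Section FunctionalOrbitDerivative.
Context {R : realType} {X : completeNormedModType R[i]}.
Context {A : partial_operator X} {T : semigroup X} (hA : generates A T).

Lemma functional_orbit_derive (l : X -> R) (hl : rfunctional l) y (t : R) : dom A y -> 0 < t ->
  is_derive t (1 : R) (fun t => l (T (Num.max t 0) y)) (l (T t (A y))).
Proof.
move=> dy t0; have [lD lZ [K K0 hK]] := hl.
apply: is_derive_eps => e e0; have K1 : 0 < K + 1 by lra.
have [d d0 hd] := (has_derivativeP _ _ _).1 (orbit_derive hA dy (ltW t0)) _ (divr_gt0 e0 K1).
exists (Num.min d t); first by rewrite lt_min d0.
move=> s; rewrite lt_min => /andP[sd st].
have s0 : 0 <= s by have := ler_norm (t - s); rewrite distrC => h; have := le_lt_trans h st; lra.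
rewrite (max_idPl s0) (max_idPl (ltW t0)) -(rfB hl) -lZ -(rfB hl).
apply: (le_trans (hK _)).
apply: (@le_trans _ _ ((K + 1) * (e / (K + 1) * `|s - t|))).
  by apply: ler_pM => //; [exact: rnorm_ge0|lra|exact: hd].
by rewrite mulrA mulrCA mulfV ?mulr1// gt_eqF.
Qed.

Lemma scale_complex (c : R[i]) (x : X) :
  c *: x = (complex.Re c)%:C *: x + (complex.Im c)%:C *: ('i%C *: x).
Proof. by rewrite {1}[c]complexE scalerDl scalerA [_ * 'i%C]mulrC. Qed.

Lemma rfunctional_i (l : X -> R) : rfunctional l -> rfunctional (fun x => l ('i%C *: x)).
Proof.
move=> [lD lZ [K K0 hK]]; split.
- by move=> x y; rewrite scalerDr lD.
- by move=> r x; rewrite scalerA mulrC -scalerA lZ.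
- exists K => // x; apply: (le_trans (hK _)); rewrite rnormZ.
  have -> : cabs ('i%C : R[i]) = 1.
    by rewrite /cabs normc_def /= expr0n/= add0r expr1n sqrtr1.
  by rewrite mul1r.
Qed.

(** The Laplace transform of a functional of an orbit, by the fundamental
    theorem of calculus: [exp (- s t) T(t) x0] is a primitive of
    [- exp (- s t) T(t) (s x0 - A x0)]. *)
Lemma laplace_orbit (l : X -> R) (hl : rfunctional l) (c s : R[i]) (x0 r : X) :
  half_plane (growth_bound T) s -> dom A x0 -> s *: x0 - A x0 = r ->
  (fun n : nat =>
     rint n%:R (fun t => complex.Re (c * cexp s t) * l (T (Num.max t 0) r)) +
     rint n%:R (fun t => complex.Im (c * cexp s t) * l ('i%C *: T (Num.max t 0) r))) @ \oo
  --> l (c *: x0).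
Proof.
move=> hs dx hr; have hli := rfunctional_i hl; have [lD lZ _] := hl.
have TZ t (x : X) : 'i%C *: T t x = T t ('i%C *: x) by rewrite linearZ.
have dc t : is_cderive (fun t => c * cexp s t) t (c * (- s * cexp s t)).
  by apply: is_cderiveZ; exact: is_cderive_cexp.
have [cr ci] : continuous (fun t => complex.Re (c * cexp s t)) /\
               continuous (fun t => complex.Im (c * cexp s t)).
  by split; apply: is_derive_continuous => t; [exact: (proj1 (dc t))|exact: (proj2 (dc t))].
have co (m : X -> R) (hm : rfunctional m) x := @continuous_functional_orbit _ _ T m hm x.
pose F t := - (complex.Re (c * cexp s t) * l (T (Num.max t 0) x0) +
  complex.Im (c * cexp s t) * l ('i%C *: T (Num.max t 0) x0)).
pose f t := complex.Re (c * cexp s t) * l (T (Num.max t 0) r) +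
  complex.Im (c * cexp s t) * l ('i%C *: T (Num.max t 0) r).
have ca x := ccontM cr (co _ hl x); have cb x := ccontM ci (co _ hli x).
have cf : continuous f := ccontD (ca r) (cb r).
have cF : continuous F.
  by move=> t; apply: (@continuousN _ _ _ (fun t => _)); exact: (ccontD (ca x0) (cb x0) (x := t)).
have -> : (fun n : nat =>
     rint n%:R (fun t => complex.Re (c * cexp s t) * l (T (Num.max t 0) r)) +
     rint n%:R (fun t => complex.Im (c * cexp s t) * l ('i%C *: T (Num.max t 0) r))) =
   (fun n : nat => F n%:R - F 0).
  apply/funext => n; rewrite -(rintD _ (ca r) (cb r)).
  apply: rint_ftc => //; [exact: continuous_subspaceT|exact: continuous_subspaceT|].
  move=> t t0 _; have [d1 d2] := dc t.
  have d3 := functional_orbit_derive hl dx t0.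
  have d4 := functional_orbit_derive hli dx t0.
  rewrite /F; apply: is_derive_eq.
  rewrite /GRing.scale /= (max_idPl (ltW t0)).
  have lE z : complex.Re z * l (T t r) + complex.Im z * l ('i%C *: T t r) = l (z *: T t r).
    by rewrite [z *: _]scale_complex lD !lZ.
  have lE0 z : complex.Re z * l (T t x0) + complex.Im z * l ('i%C *: T t x0) = l (z *: T t x0).
    by rewrite [z *: _]scale_complex lD !lZ.
  have lE1 z : complex.Re z * l (T t (A x0)) + complex.Im z * l ('i%C *: T t (A x0)) =
    l (z *: T t (A x0)) by rewrite [z *: _]scale_complex lD !lZ.
  rewrite lE -hr linearB/= [T t (s *: x0)]linearZ/= scalerBr (rfB hl) scalerA -(lE0 (c * cexp s t * s)) -(lE1 (c * cexp s t)).
  have -> : c * (- s * cexp s t) = - (c * cexp s t * s) by ring.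
  rewrite !cReN !cImN; ring.
have F0 : F 0 = - l (c *: x0).
  by rewrite /F cexp0 mulr1 (max_idPl (lexx 0)) sg_0 [c *: _]scale_complex lD !lZ.
rewrite F0 opprK -[X in _ --> X]add0r; apply: cvgD; last exact: cvg_cst.
have hs' : (growth_bound T < (complex.Re s)%:E)%E by [].
have [w1 w1s g1] := functional_orbit_growth hl x0 hs'.
have [w2 w2s g2] := functional_orbit_growth hli x0 hs'.
have gm (m : X -> R) w : exp_growth w (fun t => m (T t x0)) ->
    exp_growth w (fun t => m (T (Num.max t 0) x0)).
  by move=> [M M0 hM]; exists M => // t t0; rewrite (max_idPl t0); exact: hM.
have gr : exp_growth (- complex.Re s) (fun t => complex.Re (c * cexp s t)).
  exists (cabs c); first exact: cabs_ge0.
  by move=> t _; apply: (le_trans (cabs_Re _)); rewrite cabsM cabs_cexp mulNr.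
have gi : exp_growth (- complex.Re s) (fun t => complex.Im (c * cexp s t)).
  exists (cabs c); first exact: cabs_ge0.
  by move=> t _; apply: (le_trans (cabs_Im _)); rewrite cabsM cabs_cexp mulNr.
rewrite -oppr0; apply: cvgN; rewrite -[X in _ --> X]addr0; apply: cvgD.
- exact: (exp_decay_cvg w1s gr (gm l _ g1)).
- exact: (exp_decay_cvg w2s gi (gm (fun x => l ('i%C *: x)) _ g2)).
Qed.

End FunctionalOrbitDerivative.

Lemma eq_cvg_seq {R : realType} (f g : nat -> R) (l : R) :
  f @ \oo --> l -> f =1 g -> g @ \oo --> l.
Proof. by move=> h fg; have <- : f = g by apply/funext. Qed.

Section Transfer.
Context {R : realType} {U X Y : completeNormedModType R[i]} (S : system_node U X Y).
Context (b : R) (hb : (growth_bound (sn_T S) < b%:E)%E).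
Context (eta : Y -> R) (heta : rfunctional eta).

Local Notation A := (sn_A S).
Local Notation T := (sn_T S).
Local Notation E := (sn_ext S).
Local Notation rvec := (rvec S b).
Local Notation ell := (ell S b eta).
Local Notation kfun := (kfun S b eta).
Local Notation gfun := (gfun S b eta).
Local Notation pfun := (pfun S b eta).

Lemma rvecZ c e : rvec (c *: e) = c *: rvec e.
Proof.
have [Q [Qc Q1 Q2]] := sn_beta_resolvent S; have hA := sn_generates S.
have := ext_resolvent_lin hA Qc Q1 Q2 (E := E) c (sn_B S e) 0 (half_b hb).
have -> : ext_resolvent (E := E) b%:C 0 = 0.
  apply: (ext_resolvent_unique hA Qc Q1 Q2) => //.
  by rewrite [ext_emb _ 0]linear0 [ext_op _ 0]linear0 scaler0 subrr.
by rewrite !addr0 /rvec [sn_B S (c *: e)]linearZ.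
Qed.

(** The Laplace transform of the ramp response, multiplied by [s^2].  A complex factor
    [s^2 exp (- s t)] in front of [e] is split into its real part in direction [e] and
    its imaginary part in direction [i e]. *)
Lemma transfer_formula (s : R[i]) (e : U) :
  half_plane (growth_bound T) s -> 0 < complex.Re s ->
  (fun n : nat => rint n%:R (fun t => lre s 2 t * pfun e t) +
     rint n%:R (fun t => lim_ s 2 t * pfun ('i%C *: e) t)) @ \oo --> eta (sn_G S s e).
Proof.
move=> hs s0; have hl := ell_rfunctional hb heta; have [lD lZ _] := hl.
have [Q [Qc Q1 Q2]] := sn_beta_resolvent S; have hA := sn_generates S.
have [x0 [dx hx sE]] := ext_resolvent_shift hA Qc Q1 Q2 (E := E) (sn_B S e) hs (half_b hb).
rewrite -/(rvec e) in hx sE.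
have ck e' : continuous (kfun e') := @continuous_kfun _ _ _ _ S b hb eta heta e'.
have [w [w0 ws gw]] : exists w : R, [/\ 0 < w, w < complex.Re s &
    exp_growth w (kfun e) /\ exp_growth w (kfun ('i%C *: e))].
  have hs' : (growth_bound T < (complex.Re s)%:E)%E by [].
  have [w1 w1s g1] := functional_orbit_growth hl (rvec e) hs'.
  have [w2 w2s g2] := functional_orbit_growth hl (rvec ('i%C *: e)) hs'.
  have gm e' w : exp_growth w (fun t => ell (T t (rvec e'))) -> exp_growth w (kfun e').
    by move=> [M M0 hM]; exists M => // t t0; rewrite /kfun (max_idPl t0); exact: hM.
  exists (Num.max (complex.Re s / 2) (Num.max w1 w2)); split.
  - by rewrite lt_max; apply/orP; left; lra.
  - by rewrite !gt_max w1s w2s !andbT; lra.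
  - split; apply: gm; [apply: (exp_growth_le _ g1)|apply: (exp_growth_le _ g2)].
      by rewrite !le_max lexx orbT.
    by rewrite !le_max lexx !orbT.
have l1 := laplace_ramp (b := b) (g := gfun e) w0 ws (ck e) gw.1
  (is_derive_lre s) (exp_growth_lre s).
have l2 := laplace_ramp (b := b) (g := gfun ('i%C *: e)) w0 ws (ck ('i%C *: e)) gw.2
  (is_derive_lim s) (exp_growth_lim s).
have l3 := laplace_orbit hA hl (c := (s - b%:C) ^+ 2) hs dx hx.
have h := cvgD (cvgD l1 l2) l3.
have key : (gfun e + kfun e 0 * b) * lre s 0 0 + kfun e 0 * lre s 1 0 +
    ((gfun ('i%C *: e) + kfun ('i%C *: e) 0 * b) * lim_ s 0 0 + kfun ('i%C *: e) 0 * lim_ s 1 0) +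
    ell ((s - b%:C) ^+ 2 *: x0) = eta (sn_G S s e).
  have sG : sn_G S s e = sn_G S b%:C e + sn_C S ((b%:C - s) *: x0).
    have := sn_GB e hs (half_b hb); rewrite -/(rvec e) sE [_ + (_ - s) *: x0 - _]addrAC subrr add0r.
    by move=> /eqP; rewrite subr_eq addrC => /eqP.
  have dz : dom A ((b%:C - s) *: x0).
    have d0 : dom A 0 by have := proj1 (Q1 0); rewrite linear0.
    by have [+ _] := dom_lin (b%:C - s) dx d0; rewrite addr0.
  have Az : A ((b%:C - s) *: x0) = (b%:C - s) *: A x0.
    have d0 : dom A 0 by have := proj1 (Q1 0); rewrite linear0.
    by have [_] := dom_lin (b%:C - s) dx d0; rewrite (A0 Q1) !addr0.
  have [etaD _ _] := heta.
  rewrite sG etaD -(ell_dom hb eta dz) Az -/(gfun e).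
  have -> : b%:C *: ((b%:C - s) *: x0) - (b%:C - s) *: A x0 =
      (b%:C - s) *: rvec e + (s - b%:C) ^+ 2 *: x0.
    rewrite scalerA mulrC -scalerA -scalerBr.
    have -> : b%:C *: x0 - A x0 = rvec e + (b%:C - s) *: x0.
      by rewrite -hx scalerBl [RHS]addrC addrA subrK.
    by rewrite scalerDr scalerA; congr (_ + _ *: _); ring.
  rewrite lD [RHS]addrA; congr (_ + _).
  have e1 : lre s 0 0 = 1 by rewrite /lre expr0 mul1r cexp0.
  have e2 : lim_ s 0 0 = 0 by rewrite /lim_ expr0 mul1r cexp0.
  have e3 : lre s 1 0 = - complex.Re s by rewrite /lre expr1 cexp0 mulr1 cReN.
  have e4 : lim_ s 1 0 = - complex.Im s by rewrite /lim_ expr1 cexp0 mulr1 cImN.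
  have k1 : kfun e 0 = ell (rvec e) by rewrite /kfun (max_idPl (lexx 0)) sg_0.
  have k2 : kfun ('i%C *: e) 0 = ell ('i%C *: rvec e).
    by rewrite /kfun (max_idPl (lexx 0)) sg_0 rvecZ.
  rewrite e1 e2 e3 e4 k1 k2 [(_ - s) *: _]scale_complex lD !lZ !cReD !cImD cReN cImN /=.
  move: (ell (rvec e)) (ell ('i%C *: rvec e)) (gfun e) (gfun ('i%C *: e)) => ? ? ? ?; ring.
rewrite key in h.
refine (@eq_cvg_seq R _ _ _ (h _ _) _) => n /=.
have f1 t : (lre s 2 t + 2 * b * lre s 1 t + b ^+ 2 * lre s 0 t) * kfun e t =
    complex.Re ((s - b%:C) ^+ 2 * cexp s t) * ell (T (Num.max t 0) (rvec e)).
  congr (_ * _); rewrite /lre !expr2 expr0 expr1 !cReM /= !cImM /= ?cReN ?cImN !cReD ?cImD ?cReN ?cImN /=; ring.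
have f2 t : (lim_ s 2 t + 2 * b * lim_ s 1 t + b ^+ 2 * lim_ s 0 t) * kfun ('i%C *: e) t =
    complex.Im ((s - b%:C) ^+ 2 * cexp s t) * ell ('i%C *: T (Num.max t 0) (rvec e)).
  rewrite /kfun rvecZ [T _ ('i%C *: _)]linearZ.
  congr (_ * _); rewrite /lim_ !expr2 expr0 expr1 !cImM /= !cReM /= ?cReN ?cImN !cReD ?cImD ?cReN ?cImN /=; ring.
have E1 : rint n%:R (fun t => (lre s 2 t + 2 * b * lre s 1 t + b ^+ 2 * lre s 0 t) * kfun e t) =
    rint n%:R (fun t => complex.Re ((s - b%:C) ^+ 2 * cexp s t) * ell (T (Num.max t 0) (rvec e))).
  by apply: eq_rint => t _ _; exact: f1.
have E2 : rint n%:R (fun t => (lim_ s 2 t + 2 * b * lim_ s 1 t + b ^+ 2 * lim_ s 0 t) *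
      kfun ('i%C *: e) t) =
    rint n%:R (fun t => complex.Im ((s - b%:C) ^+ 2 * cexp s t) *
      ell ('i%C *: T (Num.max t 0) (rvec e))).
  by apply: eq_rint => t _ _; exact: f2.
rewrite !fctE; rewrite E1 E2.
have aux (p q p' q' : R) : p - p' + (q - q') + (p' + q') = p + q by ring.
exact: aux.
Qed.

End Transfer.

(** * Smooth steps *)

Section MeanValue.
Context {R : realType}.

Lemma mean_value (F f : R -> R) (a b : R) : a < b ->
  (forall x, a <= x -> x <= b -> is_derive x (1 : R) F (f x)) ->
  exists c, [/\ a < c, c < b & F b - F a = f c * (b - a)].
Proof.
move=> ab dF.
have [||c] := @MVT R F f a b ab.
- by move=> x; rewrite in_itv /= => /andP[h1 h2]; apply: dF; exact: ltW.
- apply: continuous_in_subspaceT => x; rewrite inE /= in_itv /= => /andP[h1 h2].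
  exact: is_derive_for (dF x h1 h2).
- by rewrite in_itv /= => /andP[h1 h2] h; exists c.
Qed.

Lemma derive_ge0_le (F f : R -> R) (a b : R) : a <= b ->
  (forall x, a <= x -> x <= b -> is_derive x (1 : R) F (f x)) ->
  (forall x, a <= x -> x <= b -> 0 <= f x) -> F a <= F b.
Proof.
rewrite le_eqVlt => /orP[/eqP -> //|ab] dF f0.
have [c [ac cb h]] := mean_value ab dF.
by rewrite -subr_ge0 h mulr_ge0 ?subr_ge0 ?(ltW ab)// f0 ?ltW.
Qed.

End MeanValue.

Section FlatExponential.
Context {R : realType}.

(** [t^-n * exp (- 1 / t)], extended by zero, is flat at the origin. *)
Definition flat (n : nat) (t : R) : R := if 0 < t then t^-1 ^+ n * expR (- t^-1) else 0.

Lemma pow_le_expR n (x : R) : 0 <= x -> x ^+ n <= n%:R ^+ n * expR x.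
Proof.
move=> x0; case: n => [|n]; first by rewrite !expr0 mul1r -[leLHS]expR0 ler_expR.
have n0 : (n.+1%:R : R) != 0 by [].
have {1 2}-> : x = n.+1%:R * (x / n.+1%:R) by rewrite mulrC divfK.
rewrite expRM_natl exprMn ler_wpM2l ?exprn_ge0// lerXn2r ?nnegrE ?expR_ge0 ?divr_ge0//.
by apply: le_trans (expR_ge1Dx _); rewrite lerDr.
Qed.

(** This makes [flat n] differentiable at 0, with derivative 0. *)
Lemma flat_le n (t : R) : `|flat n t| <= n.+2%:R ^+ n.+2 * t ^+ 2.
Proof.
rewrite /flat; case: ifPn => [t0|_]; last by rewrite normr0 mulr_ge0// ?sqr_ge0// exprn_ge0.
have i0 : 0 <= t^-1 by rewrite invr_ge0 ltW.
rewrite ger0_norm ?mulr_ge0 ?exprn_ge0 ?expR_ge0// expRN ler_pdivrMr ?expR_gt0//.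
have := pow_le_expR n.+2 i0; rewrite -{1}addn2 exprD => h.
rewrite -(ler_pM2r (_ : 0 < t^-1 ^+ 2)) ?exprn_gt0 ?invr_gt0//.
apply: (le_trans h); rewrite le_eqVlt; apply/orP; left; apply/eqP.
by rewrite [RHS]mulrAC -[X in _ = X * _]mulrA -exprMn mulfV ?gt_eqF// expr1n mulr1.
Qed.

Lemma flat_ge0 n (t : R) : 0 <= flat n t.
Proof.
by rewrite /flat; case: ifP => // t0; rewrite mulr_ge0 ?expR_ge0// exprn_ge0// invr_ge0 ltW.
Qed.

Lemma flat_derive n (t : R) :
  is_derive t (1 : R) (flat n) (flat n.+2 t - n%:R * flat n.+1 t).
Proof.
have [t0|t0|<-] := ltgtP 0 t.
- pose g (s : R) := s^-1 ^+ n * expR (- s^-1).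
  apply: (@near_eq_is_derive _ _ _ g).
  + near=> s.
    have s0 : 0 < s by near: s; exact: lt_nbhsr.
    by rewrite /flat /g s0.
  + have tn : t != 0 by rewrite gt_eqF.
    have d1 : is_derive t (1 : R) (fun s : R => s^-1) (- t ^- 2 *: 1) :=
      @is_deriveV R id t 1 1 tn (is_derive_id t 1).
    have d2 := is_deriveX n d1.
    have d3 := @is_derive1_comp _ expR (fun s => - s^-1) t _ _ (is_derive_expR _) (is_deriveN d1).
    have -> : g = [eta GRing.inv] ^+ n * (expR \o (fun s : R => - s^-1)).
      by apply/funext => s; rewrite /g !fctE.
    have d4 := is_deriveM d2 d3.
    apply: (is_derive_eq d4).
    rewrite /flat t0 /GRing.scale !fctE /= -exprVn.
    by case: (n) => [|m] /=; rewrite ?exprS; move: (t^-1) (expR _) => z w; [rewrite expr0|]; ring.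
- apply: (@near_eq_is_derive _ _ _ (cst 0)).
  + near=> s.
    have s0 : s < 0 by near: s; exact: lt_nbhsl.
    by rewrite /flat ltNge (ltW s0).
  + by apply: is_derive_eq; rewrite /flat ltNge (ltW t0) /= mulr0 subr0.
- have f0 m : flat m 0 = 0 by rewrite /flat ltxx.
  apply: is_derive_eps => e e0; set C : R := n.+2%:R ^+ n.+2.
  have C0 : 0 <= C by rewrite exprn_ge0.
  have C1 : 0 < C + 1 by lra.
  exists (e / (C + 1)); first exact: divr_gt0.
  move=> s; rewrite !f0 !(mulr0, subr0) ltr_pdivlMr// => h.
  apply: (le_trans (flat_le n s)); rewrite -real_normK ?num_real// expr2 mulrA.
  rewrite ler_wpM2r//; apply: le_trans (ltW h); rewrite -/C [leLHS]mulrC ler_wpM2l//.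
  by rewrite lerDl.
Unshelve. all: by end_near. Qed.

End FlatExponential.

Section SmoothStep.
Context {R : realType}.

(** The list of terms [(c, m, n)] stands for the sum of the functions
    [c * flat m t * flat n (1 - t)]; such sums are closed under derivation. *)
Definition bump_eval (l : seq (R * nat * nat)) (t : R) : R :=
  \sum_(z <- l) z.1.1 * (flat z.1.2 t * flat z.2 (1 - t)).

Definition bump_der (l : seq (R * nat * nat)) : seq (R * nat * nat) :=
  flatten [seq [:: (z.1.1, z.1.2.+2, z.2); (- (z.1.1 * z.1.2%:R), z.1.2.+1, z.2);
                   (- z.1.1, z.1.2, z.2.+2); (z.1.1 * z.2%:R, z.1.2, z.2.+1)] | z <- l].

Lemma is_derive_bump_eval l t : is_derive t (1 : R) (bump_eval l) (bump_eval (bump_der l) t).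
Proof.
elim: l => [|[[c m] n] l ih].
  rewrite /bump_eval /=; under eq_fun do rewrite big_nil.
  by rewrite big_nil; exact: is_derive_cst.
have -> : bump_eval ((c, m, n) :: l) =
    (fun t => c * (flat m t * flat n (1 - t)) + bump_eval l t).
  by apply/funext => s; rewrite /bump_eval big_cons.
have -> : bump_eval (bump_der ((c, m, n) :: l)) t =
  c * ((flat m.+2 t - m%:R * flat m.+1 t) * flat n (1 - t) -
       flat m t * (flat n.+2 (1 - t) - n%:R * flat n.+1 (1 - t))) + bump_eval (bump_der l) t.
  rewrite /bump_eval /bump_der /= !big_cons /=.
  set S := \sum_(_ <- _) _; move: S => S; ring.
have d1 := flat_derive m t.
have d0 : is_derive t (1 : R) (fun s : R => 1 - s) (- 1).
  by apply: is_derive_eq; ring.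
have d2 := @is_derive1_comp _ (flat n) (fun s => 1 - s) t _ _ (flat_derive n (1 - t)) d0.
apply: (is_derive_eq (is_deriveD (is_deriveZ c (is_deriveM d1 d2)) ih)).
rewrite /GRing.scale /=; ring.
Qed.

Definition bump (n : nat) : R -> R := bump_eval (iter n bump_der [:: (1, 0%N, 0%N)]).

Lemma bump_chainS n t : is_derive t (1 : R) (bump n) (bump n.+1 t).
Proof. exact: is_derive_bump_eval. Qed.

Lemma bump_out n t : t <= 0 \/ 1 <= t -> bump n t = 0.
Proof.
move=> h; rewrite /bump /bump_eval big1// => z _.
have [t0|t1] := h; first by rewrite {1}/flat ltNge t0 /= mul0r mulr0.
by rewrite {2}/flat ltNge subr_le0 t1 /= mulr0 mulr0.
Qed.

Lemma bump0E t : bump 0 t = flat 0 t * flat 0 (1 - t).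
Proof. by rewrite /bump /bump_eval /= big_seq1 mul1r. Qed.

Lemma bump0_ge0 t : 0 <= bump 0 t.
Proof. by rewrite bump0E mulr_ge0 ?flat_ge0. Qed.

Lemma bump0_gt0 t : 0 < t -> t < 1 -> 0 < bump 0 t.
Proof. by move=> t0 t1; rewrite bump0E /flat t0 subr_gt0 t1 !expr0 !mul1r mulr_gt0 ?expR_gt0. Qed.

Definition bump_int (t : R) : R := if t <= - 4^-1 then 0 else prim (bump 0) t.

Lemma continuous_bump n : continuous (bump n).
Proof. exact: is_derive_continuous (bump_chainS n). Qed.

Lemma bump_int_derive t : is_derive t (1 : R) bump_int (bump 0 t).
Proof.
have vanish (a b : R) : b <= 0 -> \int[@lebesgue_measure R]_(s in `[a, b]) bump 0 s = 0.
  move=> b0; rewrite (@eq_Rintegral _ _ _ _ _ (cst 0)) ?Rintegral_cst//; first by rewrite mul0r.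
  move=> s; rewrite inE /= in_itv /= => /andP[_ sb]; apply: bump_out; left; exact: le_trans sb b0.
have [t1|t1] := ltP (- 2^-1) t.
  apply: (@near_eq_is_derive _ _ _ (prim (bump 0))).
    near=> s; rewrite /bump_int; case: ifP => // s4.
    rewrite /prim !vanish ?subrr//; rewrite ge_max; apply/andP; split; lra.
  exact: is_derive_prim (@continuous_bump 0) t1.
apply: (@near_eq_is_derive _ _ _ (cst 0)).
  near=> s; rewrite /bump_int ifT//; apply: ltW; near: s; apply: lt_nbhsl; lra.
by apply: is_derive_eq; rewrite bump_out//; left; lra.
Unshelve. all: by end_near. Qed.

Lemma bump_int_le (a b : R) : a <= b -> bump_int a <= bump_int b.
Proof.
move=> ab; apply: (derive_ge0_le ab) => x _ _; [exact: bump_int_derive|exact: bump0_ge0].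
Qed.

Lemma bump_int0 t : t <= 0 -> bump_int t = 0.
Proof.
have h0 : bump_int (- 4^-1) = 0 by rewrite /bump_int lexx.
move=> t0; have [h|h] := leP t (- 4^-1); first by rewrite /bump_int h.
have [c [c1 c2]] := mean_value h (fun x _ _ => bump_int_derive x).
by rewrite h0 subr0 bump_out ?mul0r//; left; lra.
Qed.

Lemma bump_int1_gt0 : 0 < bump_int 1.
Proof.
have h : (4^-1 : R) < 2^-1 by lra.
have [c [c1 c2 hc]] := mean_value h (fun x _ _ => bump_int_derive x).
have h1 : bump_int 0 <= bump_int 4^-1 by apply: bump_int_le; lra.
have h2 : bump_int 2^-1 <= bump_int 1 by apply: bump_int_le; lra.
rewrite bump_int0// in h1.
have : 0 < bump 0 c * (2^-1 - 4^-1) by rewrite mulr_gt0 ?subr_gt0// bump0_gt0; lra.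
lra.
Qed.

Definition step (n : nat) (t : R) : R :=
  (bump_int 1)^-1 * (if n is m.+1 then bump m t else bump_int t).

Lemma step_chain : smooth_chain step.
Proof.
by case=> [|n] t; [have d := bump_int_derive t|have d := bump_chainS n t];
  exact: (is_derive_eq (is_deriveZ (bump_int 1)^-1 d)).
Qed.

Lemma step_le s t : s <= t -> step 0 s <= step 0 t.
Proof. by move=> st; rewrite ler_wpM2l ?bump_int_le// invr_ge0 ltW// bump_int1_gt0. Qed.

Lemma step_neg n t : t <= 0 -> step n t = 0.
Proof.
case: n => [|n] t0; rewrite /step; first by rewrite (bump_int0 t0) mulr0.
by rewrite bump_out ?mulr0//; left.
Qed.

Lemma step1 t : 1 <= t -> step 0 t = 1.
Proof.
rewrite /step le_eqVlt => /orP[/eqP <-|t1]; first by rewrite mulVf// gt_eqF// bump_int1_gt0.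
have [c [c1 c2]] := mean_value t1 (fun x _ _ => bump_int_derive x).
rewrite bump_out ?mul0r; last by right; lra.
by move/eqP; rewrite subr_eq0 => /eqP ->; rewrite mulVf// gt_eqF// bump_int1_gt0.
Qed.

Lemma step_high n t : 1 <= t -> step n.+1 t = 0.
Proof. by move=> t1; rewrite /step bump_out ?mulr0//; right. Qed.

Lemma step_ge0 t : 0 <= step 0 t.
Proof.
have [t0|t0] := leP t 0; first by rewrite step_neg.
by rewrite -(step_neg 0 (lexx 0)) step_le// ltW.
Qed.

Lemma step_le1 t : step 0 t <= 1.
Proof.
have [t0|t0] := leP t 1; last by rewrite step1// ltW.
by rewrite -(step1 (lexx 1)) step_le.
Qed.

End SmoothStep.

(** * Uniqueness of the Laplace transform *)

Section Lerch.
Context {R : realType}.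

Lemma ccont_norm (f : R -> R) : continuous f -> continuous (fun t => `|f t|).
Proof. by move=> cf t; apply: cvg_norm; exact: cf. Qed.

Lemma ccont_expN (k : R) : continuous (fun t : R => expR (- (k * t))).
Proof.
have d (t : R) : is_derive t (1 : R) (fun t : R => expR (- (k * t))) (- k * expR (- (k * t))).
  by apply: is_derive_eq; rewrite /GRing.scale /=; ring.
exact: is_derive_continuous d.
Qed.

Lemma ccont_horner (q : {poly R}) (f : R -> R) : continuous f -> continuous (fun t => q.[f t]).
Proof. by move=> cf t; apply: continuous_comp; [exact: cf|exact: continuous_horner]. Qed.

Lemma bernoulli_le (x : R) n : 0 <= x -> 1 + n%:R * x <= (1 + x) ^+ n.
Proof.
move=> x0; elim: n => [|n ih]; first by rewrite mul0r addr0 expr0.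
rewrite exprS; apply: le_trans (ler_wpM2l _ ih); last lra.
rewrite -natr1; have : 0 <= n%:R * (x * x) by rewrite !mulr_ge0.
lra.
Qed.

Lemma cvg0_scale (a : R) (f : nat -> R) : f @ \oo --> (0 : R) -> (fun n => a * f n) @ \oo --> (0 : R).
Proof. by move=> h; rewrite -(mulr0 a); apply: cvgM; [exact: cvg_cst|exact: h]. Qed.

Lemma cvg0_add (f g : nat -> R) : f @ \oo --> (0 : R) -> g @ \oo --> (0 : R) ->
  (fun n => f n + g n) @ \oo --> (0 : R).
Proof. by move=> hf hg; rewrite -(addr0 0); apply: cvgD. Qed.

Lemma moments_cvg0 (Phi : R -> R) (q : {poly R}) : continuous Phi ->
  (forall k : nat, (fun n : nat => rint n%:R (fun t => expR (- (k.+1%:R * t)) * Phi t)) @ \oo --> (0 : R)) ->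
  (fun n : nat => rint n%:R (fun t => q.[expR (- (1 * t))] * (expR (- (1 * t)) * Phi t))) @ \oo --> (0 : R).
Proof.
move=> cP h.
have -> : (fun n : nat => rint n%:R (fun t => q.[expR (- (1 * t))] * (expR (- (1 * t)) * Phi t))) =
  (fun n : nat => \sum_(i < size q) q`_i * rint n%:R (fun t => expR (- (i.+1%:R * t)) * Phi t)).
  apply/funext => n.
  transitivity (rint n%:R (fun t => \sum_(i < size q) q`_i * (expR (- (i.+1%:R * t)) * Phi t))).
    apply: eq_rint => t _ _; rewrite horner_coef mulr_suml; apply: eq_bigr => i _.
    rewrite -!mulrA; congr (_ * _); rewrite mulrA; congr (_ * _).
    by rewrite -exprSr -expRM_natl mulrN mul1r.
  rewrite rint_sum; last first.
    by move=> i; apply: ccontZ; apply: ccontM => //; exact: ccont_expN.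
  by apply: eq_bigr => i _; rewrite rintZ//; apply: ccontM => //; exact: ccont_expN.
elim: (size q) => [|m ih].
  by under eq_fun do rewrite big_ord0; exact: cvg_cst.
under eq_fun do rewrite big_ord_recr /=.
by apply: cvg0_add; [exact: ih|apply: cvg0_scale; exact: h].
Qed.

Definition tent (t0 rho k t : R) : R :=
  k / rho / 2 * ((rho - `|t - t0|) + `|rho - `|t - t0| |).

Lemma continuous_tent (t0 rho k : R) : continuous (tent t0 rho k).
Proof.
have c1 : continuous (fun t : R => rho + -1 * `|t + - t0|).
  apply: ccontD; first exact: ccont_cst.
  apply: ccontZ; apply: ccont_norm; apply: ccontD; [exact: ccont_id|exact: ccont_cst].
have -> : tent t0 rho k = (fun t => k / rho / 2 * ((rho + -1 * `|t + - t0|) + `|rho + -1 * `|t + - t0| |)).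
  by apply/funext => t; rewrite /tent mulN1r.
by apply: ccontZ; apply: ccontD => //; exact: ccont_norm.
Qed.

Lemma tent_in (t0 rho k t : R) : `|t - t0| <= rho -> tent t0 rho k t = k / rho * (rho - `|t - t0|).
Proof. by move=> h; rewrite /tent [`|rho - _|]ger0_norm ?subr_ge0//; lra. Qed.

Lemma tent_out (t0 rho k t : R) : rho <= `|t - t0| -> tent t0 rho k t = 0.
Proof. by move=> h; rewrite /tent [`|rho - _|]ler0_norm ?subr_le0//; lra. Qed.

Lemma tent_ge0 (t0 rho k t : R) : 0 < rho -> 0 <= k -> 0 <= tent t0 rho k t.
Proof.
move=> r0 k0; have [h|h] := leP `|t - t0| rho; last by rewrite tent_out// ltW.
by rewrite tent_in// mulr_ge0 ?divr_ge0 ?subr_ge0// ltW.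
Qed.

Lemma tent_le (t0 rho k t : R) : 0 < rho -> 0 <= k -> tent t0 rho k t <= k.
Proof.
move=> r0 k0; have [h|h] := leP `|t - t0| rho; last by rewrite tent_out// ltW.
rewrite tent_in// -[leRHS](divfK (lt0r_neq0 r0)) ler_wpM2l ?divr_ge0 ?(ltW r0)//.
by rewrite gerBl.
Qed.

Lemma tent_mass (t0 rho k : R) : 0 <= t0 -> 0 < rho -> 0 < k ->
  exists2 c : R, 0 < c & forall t, t0 + rho <= t -> c <= rint t (tent t0 rho k).
Proof.
move=> t00 r0 k0; set m := tent _ _ _; have cm : continuous m := @continuous_tent t0 rho k.
have dm (x : R) : 0 <= x -> is_derive x (1 : R) (prim m) (m x).
  by move=> x0; apply: is_derive_prim => //; apply: lt_le_trans x0; lra.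
have m0 (x : R) : 0 <= m x by exact: tent_ge0 (ltW k0).
have ab : t0 < t0 + rho / 2 by rewrite ltrDl divr_gt0.
have [x [x1 x2 hx]] := mean_value ab (fun x h _ => dm x (le_trans t00 h)).
exists (k * rho / 4); first by rewrite !mulr_gt0// invr_gt0.
move=> t ht; have t_ge0 : 0 <= t by lra.
rewrite rint_prim//.
have h1 : prim m 0 <= prim m t0 by apply: derive_ge0_le => // y y0 _; exact: dm.
have h2 : prim m (t0 + rho / 2) <= prim m t.
  apply: derive_ge0_le => //; first by lra.
  by move=> y y0 _; apply: dm; lra.
rewrite prim0 in h1.
have xa : `|x - t0| = x - t0 by rewrite ger0_norm// subr_ge0 ltW.
have h3 : k / 2 <= m x.
  rewrite /m tent_in xa; last by lra.
  have -> : k / 2 = k / rho * (rho / 2) by field; rewrite gt_eqF.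
  by rewrite ler_wpM2l ?divr_ge0 ?ltW//; lra.
have h4 : k / 2 * (rho / 2) <= m x * (t0 + rho / 2 - t0).
  by rewrite addrAC subrr add0r ler_wpM2r// divr_ge0// ltW.
lra.
Qed.

(** Integrate [Phi] against [q (exp (- t)) ^+ N * exp (- t)], where the polynomial [q]
    exceeds 1 near [exp (- t0)] and takes values in [[0, 1]] away from it.  All these
    integrals vanish, but for [Phi t0 > 0] they would tend to infinity with [N]. *)
Lemma lerch_pos (Phi : R -> R) (B t0 : R) : continuous Phi ->
  (forall t, 0 <= t -> `|Phi t| <= B) ->
  (forall k : nat, (fun n : nat => rint n%:R (fun t => expR (- (k.+1%:R * t)) * Phi t)) @ \oo --> (0 : R)) ->
  0 <= t0 -> Phi t0 <= 0.
Proof.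
move=> cP hB hk t00; rewrite leNgt; apply/negP => P0.
have B0 : 0 <= B := le_trans (normr_ge0 _) (hB 0 (lexx 0)).
pose x (t : R) := expR (- (1 * t)); pose Psi t := x t * Phi t.
have cx : continuous x := @ccont_expN 1.
have cPsi : continuous Psi by exact: ccontM.
have Psi0 : 0 < Psi t0 by rewrite mulr_gt0 ?expR_gt0.
pose k := Psi t0 / 2; have k0 : 0 < k by exact: divr_gt0.
have x_lt s t : s < t -> x t < x s by move=> st; rewrite ltr_expR ltrN2 !mul1r.
have x01 t : 0 <= t -> 0 < x t /\ x t <= 1.
  by move=> t0'; split; [exact: expR_gt0|rewrite -expR0 ler_expR mul1r oppr_le0].
have near_lt (f : R -> R) (e : R) : continuous f -> 0 < e ->
    exists2 r : R, 0 < r & forall t, `|t - t0| < r -> `|f t - f t0| < e.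
  move=> cf e0; have := cf t0; move/cvgrPdist_lt => /(_ e e0)/nbhs_ballP[r /= r0 hr].
  by exists r => // t ht; rewrite distrC; apply: hr; rewrite /ball /= distrC.
have [r r0 hr] := near_lt Psi k cPsi k0.
have Psi_r t : `|t - t0| < r -> k <= Psi t.
  by move=> /hr; rewrite ltr_norml => /andP[h _]; rewrite /k in h *; lra.
pose d := Num.min (x t0 - x (t0 + r)) (x (t0 - r) - x t0).
have d0 : 0 < d by rewrite lt_min !subr_gt0 !x_lt//; lra.
have hd t : r <= `|t - t0| -> d <= `|x t - x t0|.
  move=> h; rewrite ge_min; have [tt|tt] := leP t0 t.
    have h2 : t0 + r <= t by move: h; rewrite ger0_norm ?subr_ge0//; lra.
    have : x t <= x (t0 + r) by rewrite ler_expR lerN2 !mul1r.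
    have := x_lt _ _ (_ : t0 < t0 + r) => /(_ ltac:(lra)) h3 h4.
    by rewrite ler0_norm; [apply/orP; left|]; lra.
  have h2 : t <= t0 - r by move: h; rewrite ltr0_norm ?subr_lt0//; lra.
  have : x (t0 - r) <= x t by rewrite ler_expR lerN2 !mul1r.
  have := x_lt _ _ (_ : t0 - r < t0) => /(_ ltac:(lra)) h3 h4.
  by rewrite ger0_norm; [apply/orP; right|]; lra.
pose e := d ^+ 2 / 2; have e0 : 0 < e by rewrite divr_gt0 ?exprn_gt0.
have d1 : 0 < Num.min d 1 / 2 by rewrite divr_gt0// lt_min d0 ltr01.
have [r1 r10 hr1] := near_lt x _ cx d1.
pose rho := Num.min r r1; have rho0 : 0 < rho by rewrite lt_min r0.
pose q : {poly R} := (1 + e)%:P - ('X - (x t0)%:P) ^+ 2.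
have qE z : q.[z] = 1 + e - (z - x t0) ^+ 2 by rewrite /q !hornerE.
have [c c0 hc] := tent_mass t00 rho0 k0.
have q_big t : `|t - t0| < rho -> 1 + e / 2 <= q.[x t].
  rewrite lt_min => /andP[_ /hr1 h]; rewrite qE.
  suff : (x t - x t0) ^+ 2 <= e / 2 by lra.
  rewrite -real_normK ?num_real//.
  have h' : `|x t - x t0| <= d / 2.
    apply: ltW; apply: lt_le_trans h _; rewrite ler_pM2r ?invr_gt0//; by rewrite ge_min lexx.
  have -> : e / 2 = (d / 2) ^+ 2 by rewrite /e; field.
  by rewrite lerXn2r ?nnegrE// divr_ge0// ltW.
have q_ge0 t : 0 <= t -> 0 <= q.[x t].
  move=> tt; rewrite qE; have [a1 a2] := x01 _ tt; have [b1 b2] := x01 _ t00.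
  suff : (x t - x t0) ^+ 2 <= 1 by lra.
  by rewrite -real_normK ?num_real// expr_le1// ler_norml; apply/andP; split; lra.
have q_le1 t : 0 <= t -> r <= `|t - t0| -> q.[x t] <= 1.
  move=> tt h; rewrite qE; suff : e <= (x t - x t0) ^+ 2 by lra.
  rewrite -[in leRHS]real_normK ?num_real//; apply: (@le_trans _ _ (d ^+ 2)).
    by rewrite /e; have := sqr_ge0 d; lra.
  by rewrite lerXn2r ?nnegrE ?(ltW d0)//; exact: hd.
have key N t : 0 <= t -> (1 + e / 2) ^+ N * tent t0 rho k t + - B * x t <= q.[x t] ^+ N * Psi t.
  move=> tt; have xt := (x01 t tt).1; have Bx : - B * x t <= 0 by rewrite mulNr oppr_le0 mulr_ge0// ltW.
  have [h|h] := ltP `|t - t0| rho.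
    have hrt : `|t - t0| < r by apply: lt_le_trans h _; rewrite ge_min lexx.
    rewrite -[leRHS]addr0; apply: lerD => //; apply: ler_pM.
    - by rewrite exprn_ge0//; lra.
    - exact: tent_ge0 (ltW k0).
    - rewrite lerXn2r ?nnegrE ?q_big//; last exact: q_ge0.
      lra.
    - exact: le_trans (tent_le t0 t rho0 (ltW k0)) (Psi_r _ hrt).
  rewrite tent_out// mulr0 add0r; have [hrt|hrt] := ltP `|t - t0| r.
    apply: (le_trans Bx); rewrite mulr_ge0 ?exprn_ge0 ?q_ge0//.
    exact: le_trans (ltW k0) (Psi_r _ hrt).
  have hP : `|q.[x t] ^+ N * Psi t| <= B * x t.
    rewrite normrM ger0_norm ?exprn_ge0 ?q_ge0// -[leRHS]mul1r ler_pM ?exprn_ge0 ?q_ge0//.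
      by rewrite exprn_ile1 ?q_ge0 ?q_le1.
    by rewrite /Psi normrM gtr0_norm// mulrC ler_wpM2r ?(ltW xt)// hB.
  by move: hP; rewrite ler_norml mulNr => /andP[].
have lower N : (1 + e / 2) ^+ N * c - B <= 0.
  have h := moments_cvg0 (q ^+ N) cP hk.
  rewrite leNgt; apply/negP => pos.
  have := h; move/cvgrPdist_lt => /(_ _ pos) [n0 _ hn].
  pose n := maxn n0 (Num.truncn (t0 + rho)).+1.
  have := hn n (leq_maxl _ _); rewrite sub0r normrN => h1.
  have nT : t0 + rho <= n%:R.
    apply: (@le_trans _ _ (Num.truncn (t0 + rho)).+1%:R); last by rewrite ler_nat leq_maxr.
    exact: ltW (truncnS_gt _).
  have low : (1 + e / 2) ^+ N * c - B <= rint n%:R (fun t => (q ^+ N).[x t] * Psi t).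
    have ct := @continuous_tent t0 rho k.
    have c1 : continuous (fun t => (1 + e / 2) ^+ N * tent t0 rho k t) by exact: ccontZ.
    have c2 : continuous (fun t => - B * x t) by exact: ccontZ.
    have c3 : continuous (fun t => (q ^+ N).[x t] * Psi t).
      by apply: ccontM => //; exact: ccont_horner.
    have n_ge0 : 0 <= (n%:R : R) by [].
    have : rint n%:R (fun t => (1 + e / 2) ^+ N * tent t0 rho k t + - B * x t) <=
        rint n%:R (fun t => (q ^+ N).[x t] * Psi t).
      apply: le_rint => //; first exact: ccontD.
      by move=> t tt _; rewrite horner_exp; exact: key.
    have ri1 : rint n%:R (fun t => (1 + e / 2) ^+ N * tent t0 rho k t) =
        (1 + e / 2) ^+ N * rint n%:R (tent t0 rho k) := rintZ _ _ ct.
    have ri2 : rint n%:R (fun t => - B * x t) = - B * rint n%:R x := rintZ _ _ cx.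
    apply: le_trans; rewrite (rintD _ c1 c2) ri1 ri2.
    have e1 : 0 <= (1 + e / 2) ^+ N by rewrite exprn_ge0//; lra.
    have hx1 : rint n%:R x <= 1.
      have dx (t : R) : - 2^-1 < t -> is_derive t (1 : R) (fun t => - x t) (x t).
        by move=> _; apply: is_derive_eq; rewrite /GRing.scale /= /x; ring.
      by rewrite (rint_ftc1 n_ge0 cx dx) opprK /x mulr0 oppr0 expR0 addrC gerBl expR_ge0.
    move: (ler_wpM2l e1 (hc _ nT)) (ler_wpM2l B0 hx1).
    move: ((1 + e / 2) ^+ N) (rint n%:R x) (rint n%:R (tent t0 rho k)) => a b1 b2; rewrite mulr1 mulNr.
    by move=> h2 h3; apply: lerD => //; rewrite lerN2.
  by have := lt_le_trans h1 low; rewrite ltNge ler_norm.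
have := lower (Num.truncn (B / (e / 2 * c))).+1.
set N := (Num.truncn _).+1 => hN.
have e2 : 0 < e / 2 * c by rewrite mulr_gt0// divr_gt0.
have hB' : B < N%:R * (e / 2 * c) by rewrite -ltr_pdivrMr//; exact: truncnS_gt.
have e20 : 0 <= e / 2 by rewrite divr_ge0// ltW.
have : (1 + N%:R * (e / 2)) * c <= (1 + e / 2) ^+ N * c.
  by rewrite ler_wpM2r ?(ltW c0)//; exact: bernoulli_le.
rewrite mulrDl mul1r -mulrA; move: hN hB'.
move: ((1 + e / 2) ^+ N * c) (N%:R * (e / 2 * c)) => x1 x2 h1 h2 h3.
clear -c0 h1 h2 h3; lra.
Qed.

(** Apply the one-sided statement to [Phi] and to its opposite. *)
Lemma lerch (Phi : R -> R) (B : R) : continuous Phi ->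
  (forall t, 0 <= t -> `|Phi t| <= B) ->
  (forall k : nat, (fun n : nat => rint n%:R (fun t => expR (- (k.+1%:R * t)) * Phi t)) @ \oo --> (0 : R)) ->
  forall t, 0 <= t -> Phi t = 0.
Proof.
move=> cP hB hk t t0; apply/eqP; rewrite eq_le (lerch_pos cP hB hk t0) /=.
have cN : continuous (fun t => -1 * Phi t) by exact: ccontZ.
have := @lerch_pos (fun t => -1 * Phi t) B t cN; rewrite mulN1r oppr_le0; apply => //.
  by move=> s s0; rewrite mulN1r normrN; exact: hB.
move=> k.
have -> : (fun n : nat => rint n%:R (fun t => expR (- (k.+1%:R * t)) * (-1 * Phi t))) =
    (fun n : nat => -1 * rint n%:R (fun t => expR (- (k.+1%:R * t)) * Phi t)).
  apply/funext => n; rewrite -rintZ; last by apply: ccontM => //; exact: ccont_expN.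
  by apply: eq_rint => s _ _; ring.
by apply: cvg0_scale; exact: hk.
Qed.

End Lerch.

(** * Kernels whose convolutions are bounded by the uniform norm *)

Section StepBumps.
Context {R : realType}.

(** [stp n] rises from 0 to 1 between [1 / n] and [2 / n]. *)
Definition stp (n m : nat) (s : R) : R := n%:R ^+ m * step m (n%:R * s - 1).

Lemma stp_derive n m s : is_derive s (1 : R) (stp n m) (stp n m.+1 s).
Proof.
have d0 : is_derive s (1 : R) (fun s : R => n%:R * s - 1) n%:R.
  by apply: is_derive_eq; rewrite /GRing.scale /=; ring.
have d1 := @is_derive1_comp _ (step m) (fun s => n%:R * s - 1) s _ _ (step_chain m _) d0.
apply: (is_derive_eq (is_deriveZ (n%:R ^+ m) d1)).
by rewrite /stp /GRing.scale /= exprS; ring.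
Qed.

Lemma stp_low n m s : n%:R * s <= 1 -> stp n m s = 0.
Proof. by move=> h; rewrite /stp step_neg ?mulr0// subr_le0. Qed.

Lemma stp_neg n m s : s <= 0 -> stp n m s = 0.
Proof. by move=> s0; apply: stp_low; apply: le_trans (ler01); rewrite mulr_ge0_le0. Qed.

Lemma stp_high n s : 2 <= n%:R * s -> stp n 0 s = 1.
Proof. by move=> h; rewrite /stp expr0 mul1r step1//; lra. Qed.

Lemma stp_high_der n m s : 2 <= n%:R * s -> stp n m.+1 s = 0.
Proof. by move=> h; rewrite /stp step_high ?mulr0//; lra. Qed.

Lemma stp_le n s t : s <= t -> stp n 0 s <= stp n 0 t.
Proof. by move=> st; rewrite /stp expr0 !mul1r step_le// lerB// ler_wpM2l. Qed.

Lemma stp_ge0 n s : 0 <= stp n 0 s.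
Proof. by rewrite /stp expr0 mul1r step_ge0. Qed.

Lemma stp_le1 n s : stp n 0 s <= 1.
Proof. by rewrite /stp expr0 mul1r step_le1. Qed.

Lemma stp_mono n s : stp n 0 s <= stp n.+1 0 s.
Proof.
have [s0|s0] := leP s 0; first by rewrite !stp_neg.
rewrite /stp !expr0 !mul1r step_le// lerB// ler_wpM2r ?(ltW s0)//.
by rewrite ler_nat.
Qed.

Lemma stp1_ge0 n s : 0 <= stp n 1 s.
Proof.
rewrite /stp expr1 mulr_ge0// /step mulr_ge0 ?bump0_ge0// invr_ge0.
exact: ltW bump_int1_gt0.
Qed.

Lemma continuous_stp n m : continuous (stp n m).
Proof. exact: is_derive_continuous (stp_derive n m). Qed.

Lemma stp_shift_derive n m a s : is_derive s (1 : R) (fun s => stp n m (s - a)) (stp n m.+1 (s - a)).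
Proof.
have d0 : is_derive s (1 : R) (fun s : R => s - a) 1 by apply: is_derive_eq; ring.
have d1 := @is_derive1_comp _ (stp n m) (fun s => s - a) s _ _ (stp_derive n m _) d0.
by apply: (is_derive_eq d1); rewrite mulr1.
Qed.

(** Finite combinations of shifted steps, brought back to zero after [tau]. *)
Definition steps (l : seq (R * nat * R)) (tau : R) (m : nat) (s : R) : R :=
  \sum_(z <- l) z.1.1 * stp z.1.2 m (s - z.2) - (\sum_(z <- l) z.1.1) * stp 1 m (s - tau).

Lemma steps_bump l tau : 0 <= tau ->
  (forall z, z \in l -> [/\ (0 < z.1.2)%N, 0 <= z.2 & z.2 + 2 <= tau]) -> bump_chain (steps l tau).
Proof.
move=> tau0 hl; split.
  move=> m t; apply: (is_derive_eq (is_deriveB _ (is_deriveZ (\sum_(z <- l) z.1.1)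
    (stp_shift_derive 1 m tau t)))); last by [].
  elim: (l) => [|z l' ih].
    under eq_fun do rewrite big_nil.
    by rewrite big_nil; exact: is_derive_cst.
  have -> : (fun s => \sum_(z <- z :: l') z.1.1 * stp z.1.2 m (s - z.2)) =
     (fun s => z.1.1 * stp z.1.2 m (s - z.2) + \sum_(z <- l') z.1.1 * stp z.1.2 m (s - z.2)).
    by apply/funext => s; rewrite big_cons.
  rewrite big_cons; exact: (is_deriveD (is_deriveZ z.1.1 (stp_shift_derive z.1.2 m z.2 t)) ih).
pose N := (\sum_(z <- l) z.1.2)%N.
exists (N.+1%:R^-1), (tau + 2); split; first by rewrite invr_gt0.
have NV : N.+1%:R^-1 <= (1 : R) by rewrite invf_le1// ler1n.
move=> n t [h|h]; rewrite /steps.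
- have t1 : t <= 1 := le_trans h NV.
  rewrite [X in _ - X](_ : _ = 0) ?subr0; last first.
    by rewrite stp_low ?mulr0//; rewrite mul1r; lra.
  rewrite big_seq big1// => z zl; have [z1 z2 z3] := hl z zl.
  rewrite stp_low ?mulr0//.
  have [t0|t0] := leP (t - z.2) 0; first by apply: le_trans ler01; rewrite mulr_ge0_le0.
  have zN : (z.1.2 <= N)%N by rewrite /N (big_rem z zl) leq_addr.
  apply: (@le_trans _ _ (N.+1%:R * N.+1%:R^-1)); last by rewrite mulfV.
  by apply: ler_pM => //; [exact: ltW|rewrite ler_nat leqW|apply: le_trans h; rewrite gerBl].
- have hz z : z \in l -> 2 <= z.1.2%:R * (t - z.2).
    move=> zl; have [z1 z2 z3] := hl z zl.
    have z1' : (1 : R) <= z.1.2%:R by rewrite ler1n.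
    have : 1 * 2 <= z.1.2%:R * (t - z.2) by apply: ler_pM => //; lra.
    by rewrite mul1r.
  have h1 : 2 <= 1%:R * (t - tau) by rewrite mul1r; lra.
  case: n => [|n].
    rewrite stp_high// mulr1 [X in X - _](_ : _ = \sum_(z <- l) z.1.1) ?subrr//.
    by rewrite big_seq [RHS]big_seq; apply: eq_bigr => z zl; rewrite stp_high ?mulr1 ?hz.
  by rewrite stp_high_der// mulr0 subr0 big_seq big1// => z zl; rewrite stp_high_der ?mulr0 ?hz.
Qed.

End StepBumps.

Section BoundedKernel.
Context {R : realType} (p : R -> R) (cp : continuous p) (p0 : p 0 = 0) (c : R).
Hypothesis H : forall v, bump_chain v -> (forall s, `|v 0%N s| <= 1) ->
  forall t, 0 <= t -> `|rint t (fun s => v 2%N (t - s) * p s)| <= c.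

Definition conv_stp (n m : nat) (t : R) : R := rint t (fun s => stp n m (t - s) * p s).

Definition stp_cut (tau : R) (n : nat) : nat -> R -> R := steps [:: (1, n, 0)] tau.
Local Notation u := stp_cut.

Lemma u_bump tau n : (0 < n)%N -> 2 <= tau -> bump_chain (u tau n).
Proof. by move=> n0 t2; apply: steps_bump; [lra|move=> z; rewrite inE => /eqP -> /=; split => //; lra]. Qed.

Lemma uE tau n m s : s <= tau -> u tau n m s = stp n m s.
Proof.
move=> h; rewrite /stp_cut /steps !big_seq1 /= !mul1r subr0 [stp 1 _ _]stp_neg ?subr0//.
by rewrite subr_le0.
Qed.

Lemma conv_stpE tau n m t : t <= tau -> conv_stp n m t = bconv (u tau n) p m t.
Proof. by move=> h; apply: eq_rint => s s0 st; rewrite uE//; lra. Qed.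

Lemma conv_stp_upto n m t tau : (0 < n)%N -> 0 <= t -> t <= tau ->
  conv_stp n m t = rint tau (fun s => stp n m (t - s) * p s).
Proof.
move=> n0 t0 h; rewrite (conv_stpE (tau := tau + 2)); last lra.
rewrite (bconvE (u_bump n0 _) cp _ t0 h); last lra.
by apply: eq_rint => s s0 st; rewrite uE//; lra.
Qed.

Lemma conv_stp_neg n m t : t <= 0 -> conv_stp n m t = 0.
Proof.
move=> t0; rewrite /conv_stp (@eq_rint _ _ _ (fun s => 0 * p s)) ?rintZ ?mul0r//.
by move=> s s0 st; rewrite stp_neg//; lra.
Qed.

Lemma conv_stp_derive n m t : (0 < n)%N -> is_derive t (1 : R) (conv_stp n m) (conv_stp n m.+1 t).
Proof.
move=> n0; have [t0|t0] := ltP 0 t.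
  have t3 : 2 <= t + 3 by lra.
  have ub := u_bump n0 t3.
  apply: is_derive_eps => e e0.
  have [d d0 hd] := bconv_deriv ub cp m (ltW t0) e0.
  exists (Num.min d (Num.min t 1)); first by rewrite !lt_min d0 t0 ltr01.
  move=> s; rewrite !lt_min => /and3P[sd st s1].
  have st' : s <= t + 3 by have := ler_norm (s - t); lra.
  have tt' : t <= t + 3 by lra.
  have s0 : 0 <= s by have := ler_norm (t - s); rewrite distrC; lra.
  by rewrite !(@conv_stpE (t + 3))//; exact: hd.
have n_gt0 : 0 < (n%:R : R) by rewrite ltr0n.
have vanish k s : s <= n%:R^-1 -> conv_stp n k s = 0.
  move=> h; rewrite /conv_stp (@eq_rint _ _ _ (fun s => 0 * p s)) ?rintZ ?mul0r//.
  move=> r r0 rs; rewrite stp_low//; apply: (@le_trans _ _ (n%:R * n%:R^-1)).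
    by rewrite ler_pM2l//; lra.
  by rewrite mulfV// gt_eqF.
have tn : t < n%:R^-1 by apply: le_lt_trans t0 _; rewrite invr_gt0.
apply: (@near_eq_is_derive _ _ _ (cst 0)).
  by near=> s; rewrite vanish//; apply: ltW; near: s; exact: lt_nbhsl.
by apply: is_derive_eq; rewrite vanish// ltW.
Unshelve. all: by end_near. Qed.

(** The reversed times [M - a] make the input at time [M] see all the values
    [conv_stp n 2 a] at once. *)
Lemma steps_le (l : seq (R * nat * R)) (M : R) : 0 <= M ->
  (forall z, z \in l -> [/\ (0 < z.1.2)%N, 0 <= z.2 & z.2 <= M]) ->
  (forall s, `|\sum_(z <- l) z.1.1 * stp z.1.2 0 (s - (M - z.2))| <= 1) ->
  `|\sum_(z <- l) z.1.1 * conv_stp z.1.2 2 z.2| <= c.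
Proof.
move=> M0 hl h1; pose l' := [seq (z.1.1, z.1.2, M - z.2) | z <- l].
have l'E m s : \sum_(z <- l') z.1.1 * stp z.1.2 m (s - z.2) =
    \sum_(z <- l) z.1.1 * stp z.1.2 m (s - (M - z.2)) by rewrite big_map.
have sE : \sum_(z <- l') z.1.1 = \sum_(z <- l) z.1.1 by rewrite big_map.
have bv : bump_chain (steps l' (M + 2)).
  apply: steps_bump; first lra.
  move=> z /mapP[y yl -> /=]; have [y1 y2 y3] := hl y yl; split => //; lra.
have hzz s z : M + 2 <= s -> z \in l -> 2 <= z.1.2%:R * (s - (M - z.2)).
  move=> hs zl; have [z1 z2 z3] := hl z zl.
  have z1' : (1 : R) <= z.1.2%:R by rewrite ler1n.
  have : 1 * 2 <= z.1.2%:R * (s - (M - z.2)) by apply: ler_pM => //; lra.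
  by rewrite mul1r.
have late s : M + 2 <= s ->
    \sum_(z <- l) z.1.1 * stp z.1.2 0 (s - (M - z.2)) = \sum_(z <- l) z.1.1.
  move=> hs; rewrite big_seq [RHS]big_seq; apply: eq_bigr => z zl.
  by rewrite stp_high ?mulr1 ?hzz.
have bd s : `|steps l' (M + 2) 0 s| <= 1.
  rewrite /steps l'E sE; have [hs|hs] := leP (M + 2) s.
    rewrite late// -{1}(mulr1 (\sum_(z <- l) z.1.1)) -mulrBr normrM.
    have := h1 (M + 2); rewrite late// => h2.
    rewrite -[leRHS]mulr1; apply: ler_pM => //.
    by rewrite ger0_norm ?subr_ge0 ?stp_le1// gerBl stp_ge0.
  by rewrite [stp 1 _ _]stp_neg ?mulr0 ?subr0//; lra.
have := H bv bd M0; congr (`|_| <= _).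
transitivity (rint M (fun s => \sum_(z <- l) z.1.1 * (stp z.1.2 2 (z.2 - s) * p s))).
  apply: eq_rint => s s0 sM; rewrite /steps l'E [stp 1 _ _]stp_neg ?mulr0 ?subr0; last lra.
  rewrite mulr_suml; apply: eq_bigr => z _; rewrite -mulrA; congr (_ * (stp _ _ _ * _)); ring.
have cz (z : R * nat * R) : continuous (fun s => stp z.1.2 2 (z.2 - s) * p s).
  by apply: ccontM => //; apply: (@ccont_rev _ (stp z.1.2 2)); exact: continuous_stp.
rewrite rint_sum; last by move=> z; exact: ccontZ.
rewrite big_seq [RHS]big_seq; apply: eq_bigr => z zl; have [z1 z2 z3] := hl z zl.
by rewrite rintZ// (conv_stp_upto 2 z1 z2 z3).
Qed.

Lemma sgM_norm (x : R) : Num.sg x * x = `|x|.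
Proof. by rewrite [RHS]normrEsg. Qed.

Lemma norm_sgM_le (a b : R) : 0 <= b -> `|Num.sg a * b| <= b.
Proof.
move=> b0; rewrite normrM normr_sg (ger0_norm b0).
by case: (a != 0); rewrite ?mul1r ?mul0r.
Qed.

(** The input [sum_k theta_k (stp (s - M + t_(k+1)) - stp (s - M + t_k))] with signs
    [theta_k] is bounded by one, since [stp] is monotone and the sum telescopes. *)
Lemma conv_stp_variation n (t : nat -> R) (N : nat) : (0 < n)%N -> 0 <= t 0%N ->
  (forall k, (k < N)%N -> t k <= t k.+1) ->
  \sum_(0 <= k < N) `|conv_stp n 2 (t k.+1) - conv_stp n 2 (t k)| <= c.
Proof.
move=> n0 t0 ht.
have tj k j : (k + j <= N)%N -> t k <= t (k + j)%N.
  elim: j => [|j ih]; first by rewrite addn0.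
  by rewrite addnS => h; exact: le_trans (ih (ltnW h)) (ht _ h).
have tm k : (k <= N)%N -> 0 <= t k /\ t k <= t N.
  move=> kN; split; first exact: le_trans t0 (tj 0%N k kN).
  by rewrite -[in leRHS](subnKC kN) tj// subnKC.
pose th k := Num.sg (conv_stp n 2 (t k.+1) - conv_stp n 2 (t k)).
pose l := [seq (th k, n, t k.+1) | k <- iota 0 N] ++ [seq (- th k, n, t k) | k <- iota 0 N].
have lE (f : R -> R) : \sum_(z <- l) z.1.1 * f z.2 =
    \sum_(0 <= k < N) th k * (f (t k.+1) - f (t k)).
  rewrite /l big_cat !big_map /= /index_iota subn0 -big_split /=.
  by apply: eq_bigr => k _; ring.
have ln z : z \in l -> z.1.2 = n.
  by rewrite mem_cat => /orP[] /mapP[k _ ->].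
have := @steps_le l (t N) (tm N (leqnn N)).1.
have -> : \sum_(z <- l) z.1.1 * conv_stp z.1.2 2 z.2 =
    \sum_(0 <= k < N) `|conv_stp n 2 (t k.+1) - conv_stp n 2 (t k)|.
  rewrite big_seq; under eq_bigr => z zl do rewrite (ln z zl).
  rewrite -big_seq (lE (conv_stp n 2)); apply: eq_bigr => k _; exact: sgM_norm.
rewrite ger0_norm; last by apply: sumr_ge0.
apply.
- move=> z zl; rewrite (ln z zl); split => //; move: zl; rewrite mem_cat => /orP[] /mapP[k];
    rewrite mem_iota add0n => /andP[_ kN] -> /=.
  + exact: (tm _ kN).1.
  + exact: (tm _ (ltnW kN)).1.
  + exact: (tm _ kN).2.
  + exact: (tm _ (ltnW kN)).2.
move=> s; rewrite big_seq; under eq_bigr => z zl do rewrite (ln z zl).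
rewrite -big_seq (lE (fun a => stp n 0 (s - (t N - a)))).
apply: (le_trans (ler_norm_sum _ _ _)).
apply: (@le_trans _ _ (\sum_(0 <= k < N) (stp n 0 (s - (t N - t k.+1)) - stp n 0 (s - (t N - t k))))).
  rewrite big_nat [leRHS]big_nat; apply: ler_sum => k /andP[_ kN]; apply: norm_sgM_le.
  by rewrite subr_ge0 stp_le//; have := ht k kN; lra.
rewrite telescope_sumr//; have := stp_le1 n (s - (t N - t N)); have := stp_ge0 n (s - (t N - t 0%N)); lra.
Qed.

(** Likewise [stp n] increases with [n], so that the increments in [n] are
    absolutely summable. *)
Lemma conv_stp_increments (t : R) (N : nat) : 0 <= t ->
  \sum_(0 <= k < N) `|conv_stp k.+2 2 t - conv_stp k.+1 2 t| <= c.
Proof.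
move=> t0.
pose th k := Num.sg (conv_stp k.+2 2 t - conv_stp k.+1 2 t).
pose l := [seq (th k, k.+2, t) | k <- iota 0 N] ++ [seq (- th k, k.+1, t) | k <- iota 0 N].
have lE (f : nat -> R) : \sum_(z <- l) z.1.1 * f z.1.2 =
    \sum_(0 <= k < N) th k * (f k.+2 - f k.+1).
  rewrite /l big_cat !big_map /= /index_iota subn0 -big_split /=.
  by apply: eq_bigr => k _; ring.
have ln z : z \in l -> z.2 = t.
  by rewrite mem_cat => /orP[] /mapP[k _ ->].
have := @steps_le l t t0.
have -> : \sum_(z <- l) z.1.1 * conv_stp z.1.2 2 z.2 =
    \sum_(0 <= k < N) `|conv_stp k.+2 2 t - conv_stp k.+1 2 t|.
  rewrite big_seq; under eq_bigr => z zl do rewrite (ln z zl).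
  rewrite -big_seq (lE (fun n => conv_stp n 2 t)); apply: eq_bigr => k _; exact: sgM_norm.
rewrite ger0_norm; last by apply: sumr_ge0.
apply.
- move=> z zl; rewrite (ln z zl); split => //; move: zl; rewrite mem_cat => /orP[] /mapP[k];
    by rewrite mem_iota add0n => /andP[_ kN] -> /=.
move=> s; rewrite big_seq; under eq_bigr => z zl do rewrite (ln z zl).
rewrite -big_seq subrr (lE (fun n => stp n 0 (s - 0))).
apply: (le_trans (ler_norm_sum _ _ _)).
apply: (@le_trans _ _ (\sum_(0 <= k < N) (stp k.+2 0 (s - 0) - stp k.+1 0 (s - 0)))).
  by apply: ler_sum => k _; apply: norm_sgM_le; rewrite subr_ge0 stp_mono.
rewrite (@telescope_sumr _ 0 N (fun k => stp k.+1 0 (s - 0)))//.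
have := stp_le1 N.+1 (s - 0); have := stp_ge0 1 (s - 0); lra.
Qed.

End BoundedKernel.

Section SlopeLimit.
Context {R : realType} (p : R -> R) (cp : continuous p) (p0 : p 0 = 0) (c : R).
Hypothesis H : forall v, bump_chain v -> (forall s, `|v 0%N s| <= 1) ->
  forall t, 0 <= t -> `|rint t (fun s => v 2%N (t - s) * p s)| <= c.

Local Notation mu := (@lebesgue_measure R).

(** The derivatives of the regularisations [(stp n)' * p] of [p]. *)
Definition slope_seq (k : nat) (t : R) : R := conv_stp p k.+1 2 t.

Lemma slope_seq_cvg t : cvgn (slope_seq ^~ t).
Proof.
have [t0|t0] := leP 0 t; last first.
  have -> : slope_seq ^~ t = cst 0.
    by apply/funext => k; rewrite /slope_seq (conv_stp_neg cp)// ltW.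
  exact: is_cvg_cst.
pose w k := slope_seq k.+1 t - slope_seq k t.
have cw : cvgn [normed series w].
  apply: nondecreasing_is_cvgn.
    by apply: nondecreasing_series => n _ _; exact: normr_ge0.
  exists c => _ [n _ <-]; exact: (conv_stp_increments cp H n t0).
have cs := normed_cvg cw.
have -> : slope_seq ^~ t = series w + cst (slope_seq 0 t).
  apply/funext => n; rewrite !fctE /series /= telescope_sumr// subrK.
  by [].
exact: is_cvgD cs (is_cvg_cst _).
Qed.

Definition slope (t : R) : R := limn (slope_seq ^~ t).

Lemma slope_cvg t : slope_seq ^~ t @ \oo --> slope t.
Proof. exact: slope_seq_cvg. Qed.

Lemma slope_neg t : t <= 0 -> slope t = 0.
Proof.
move=> t0; rewrite /slope.
have -> : slope_seq ^~ t = cst 0.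
  by apply/funext => k; rewrite /slope_seq (conv_stp_neg cp).
exact: lim_cst.
Qed.

Lemma slope_seq_bound k t : 0 <= t -> `|slope_seq k t| <= c.
Proof.
move=> t0; have := @conv_stp_variation _ _ cp _ H k.+1 (fun n => if n is 0%N then 0 else t) 1 erefl (lexx 0).
rewrite big_nat1 [conv_stp _ _ _ 0](conv_stp_neg cp)// subr0; apply.
by case.
Qed.

Lemma cvg_sum_nat (f : nat -> nat -> R) (l : nat -> R) N :
  (forall k, f k @ \oo --> l k) ->
  (fun n => \sum_(0 <= k < N) f k n) @ \oo --> \sum_(0 <= k < N) l k.
Proof.
move=> h; elim: N => [|N ih].
  by rewrite big_geq//; under eq_fun do rewrite big_geq//; exact: cvg_cst.
rewrite big_nat_recr//=; under eq_fun do rewrite big_nat_recr//=.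
exact: cvgD ih (h N).
Qed.

(** Variations over a fixed partition pass to pointwise limits. *)
Lemma slope_variation (t : nat -> R) (N : nat) : 0 <= t 0%N ->
  (forall k, (k < N)%N -> t k <= t k.+1) ->
  \sum_(0 <= k < N) `|slope (t k.+1) - slope (t k)| <= c.
Proof.
move=> t0 ht.
have h := @cvg_sum_nat (fun k n => `|slope_seq n (t k.+1) - slope_seq n (t k)|)
  (fun k => `|slope (t k.+1) - slope (t k)|) N
  (fun k => cvg_norm (cvgB (@slope_cvg (t k.+1)) (@slope_cvg (t k)))).
refine (@cvgr_to_le _ _ _ _ _ _ c (h _ _) _); apply: nearW => n.
exact: (@conv_stp_variation _ _ cp _ H n.+1 t N).
Qed.

Lemma slope_tv b : 0 <= b -> (total_variation 0 b slope <= c%:E)%E.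
Proof.
move=> b0; apply: ge_ereal_sup => _ [_ [s [ps ls] <-] <-]; rewrite lee_fin /variation.
apply: (@slope_variation (nth b (0 :: s))) => // k ks; apply: ltW.
by move/(pathP b): ps => /(_ k ks).
Qed.

Lemma slope_tv_fin b : 0 <= b -> total_variation 0 b slope \is a fin_num.
Proof.
by move=> b0; rewrite ge0_fin_numE ?total_variation_ge0// (le_lt_trans (slope_tv b0))// ltry.
Qed.

Definition slope_var (t : R) : R := fine (total_variation 0 t slope).
Local Notation V := slope_var.

Definition slope_up (t : R) : R := (V t + slope t) / 2.
Definition slope_down (t : R) : R := (V t - slope t) / 2.

Lemma slope_variation_le a b : 0 <= a -> a <= b -> `|slope b - slope a| <= V b - V a.
Proof.
move=> a0 ab; have b0 := le_trans a0 ab.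
have h := total_variation_ge slope ab.
have hD := total_variationD slope a0 ab.
have Ea : total_variation 0 a slope = (V a)%:E by rewrite /slope_var fineK// slope_tv_fin.
have Eb : total_variation 0 b slope = (V b)%:E by rewrite /slope_var fineK// slope_tv_fin.
rewrite Ea Eb in hD; move: hD h; move: (V a) (V b) (total_variation a b slope) => x y [z| |] //= [->].
by rewrite lee_fin; lra.
Qed.

Lemma slope_V0 : V 0 = 0.
Proof. by rewrite /slope_var total_variationxx. Qed.

Lemma slope_V_le t : 0 <= t -> V t <= c.
Proof.
move=> t0; rewrite -lee_fin /slope_var fineK; first exact: slope_tv.
exact: slope_tv_fin.
Qed.

Lemma slope_up_le a b : 0 <= a -> a <= b -> slope_up a <= slope_up b.
Proof.
move=> a0 ab; have := slope_variation_le a0 ab; rewrite /slope_up ler_norml.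
move: (V a) (V b) (slope a) (slope b) => va vb sa sb /andP[]; lra.
Qed.

Lemma slope_down_le a b : 0 <= a -> a <= b -> slope_down a <= slope_down b.
Proof.
move=> a0 ab; have := slope_variation_le a0 ab; rewrite /slope_down ler_norml.
move: (V a) (V b) (slope a) (slope b) => va vb sa sb /andP[]; lra.
Qed.

Lemma slope_up0 : slope_up 0 = 0.
Proof. by rewrite /slope_up slope_V0 slope_neg// addr0 mul0r. Qed.

Lemma slope_down0 : slope_down 0 = 0.
Proof. by rewrite /slope_down slope_V0 slope_neg// subr0 mul0r. Qed.

Lemma slope_bound t : 0 <= t -> `|slope t| <= V t.
Proof. by move=> t0; have := slope_variation_le (lexx 0) t0; rewrite slope_V0 (slope_neg (lexx 0)) !subr0. Qed.

Lemma slope_up_bound t : 0 <= t -> slope_up t <= c.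
Proof.
move=> t0; have := slope_bound t0; have := slope_V_le t0; rewrite /slope_up ler_norml.
by move: (V t) (slope t) => v s h /andP[]; lra.
Qed.

Lemma slope_down_bound t : 0 <= t -> slope_down t <= c.
Proof.
move=> t0; have := slope_bound t0; have := slope_V_le t0; rewrite /slope_down ler_norml.
by move: (V t) (slope t) => v s h /andP[]; lra.
Qed.

Lemma slopeE t : slope t = slope_up t - slope_down t.
Proof. by rewrite /slope_up /slope_down; move: (V t) (slope t) => v s; lra. Qed.

Lemma conv_stp_int k t : 0 <= t -> conv_stp p k.+1 1 t = rint t (slope_seq k).
Proof.
move=> t0; have d m s := conv_stp_derive cp m s (ltn0Sn k).
have cs : continuous (slope_seq k) := is_derive_continuous (d 2%N).
have z : conv_stp p k.+1 1 0 = 0 by exact: (conv_stp_neg cp).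
by rewrite (rint_ftc1 t0 cs (fun s _ => d 1%N s)) z subr0.
Qed.

(** [stp n 1] is nonnegative with integral 1 and lives between [1 / n] and [2 / n]. *)
Lemma conv_stp_id t : 0 <= t -> (fun k => conv_stp p k.+1 1 t) @ \oo --> p t.
Proof.
rewrite le_eqVlt => /orP[/eqP <-|t0].
  rewrite p0; have -> : (fun k => conv_stp p k.+1 1 0) = cst 0.
    by apply/funext => k; rewrite (conv_stp_neg cp).
  exact: cvg_cst.
apply/cvgrPdist_le => e e0.
have [d /= d0 hd] : exists2 d : R, 0 < d & forall s, `|t - s| < d -> `|p t - p s| < e.
  have := @cp t; move/cvgrPdist_lt => /(_ e e0)/nbhs_ballP[d /= d0 hd].
  by exists d => // s hs; apply: hd.
pose m := Num.min d t; have m0 : 0 < m by rewrite lt_min d0.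
near=> k.
have km : 2 < k.+1%:R * m.
  rewrite -ltr_pdivrMr//; apply: lt_trans (_ : k%:R < _); last by rewrite ltr_nat.
  near: k; exact: nbhs_infty_gtr.
have kt : 2 <= k.+1%:R * t.
  by apply: le_trans (ltW km) _; rewrite ler_wpM2l// ge_min lexx orbT.
have cst1 : continuous (fun s => stp k.+1 1 (t - s)).
  by apply: (@ccont_rev _ (stp k.+1 1)); exact: continuous_stp.
have i1 : rint t (fun s => stp k.+1 1 (t - s)) = 1.
  have dF (s : R) : - 2^-1 < s -> is_derive s (1 : R) (fun s => - stp k.+1 0 (t - s)) (stp k.+1 1 (t - s)).
    move=> _; have d0' : is_derive s (1 : R) (fun s : R => t - s) (- 1) by apply: is_derive_eq; ring.
    have d1 := @is_derive1_comp _ (stp k.+1 0) (fun s => t - s) s _ _ (stp_derive k.+1 0 _) d0'.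
    by apply: (is_derive_eq (is_deriveN d1)); ring.
  have a1 : stp k.+1 0 (t - t) = 0 by rewrite subrr stp_neg.
  have a2 : stp k.+1 0 (t - 0) = 1 by rewrite subr0 stp_high.
  by rewrite (rint_ftc1 (ltW t0) cst1 dF) a1 a2 oppr0 opprK add0r.
have cstp : continuous (fun s => stp k.+1 1 (t - s) * p s) by exact: ccontM.
have cc a : continuous (fun s => a * stp k.+1 1 (t - s)) by exact: ccontZ.
have hs s : 0 <= s -> s <= t ->
    `|stp k.+1 1 (t - s) * p s - p t * stp k.+1 1 (t - s)| <= e * stp k.+1 1 (t - s).
  move=> s0 st; have sp := stp1_ge0 k.+1 (t - s).
  have [h|h] := ltP `|t - s| d.
    rewrite mulrC -mulrBl normrM (ger0_norm sp) ler_wpM2r// distrC; exact: ltW (hd _ h).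
  rewrite stp_high_der ?mul0r ?mulr0 ?subrr ?normr0//.
  apply: le_trans (ltW km) _; rewrite ler_wpM2l//.
  by rewrite ge_min -(ger0_norm (_ : 0 <= t - s)) ?h// subr_ge0.
have up : conv_stp p k.+1 1 t <= (p t + e) * 1.
  rewrite -i1 -(rintZ _ _ cst1); apply: le_rint => // s s0 st; have := hs s s0 st.
  rewrite ler_norml mulrDl => /andP[_].
  by move: (stp _ _ _ * p s) (p t * _) (e * _) => *; lra.
have low : (p t - e) * 1 <= conv_stp p k.+1 1 t.
  rewrite -i1 -(rintZ _ _ cst1); apply: le_rint => // s s0 st; have := hs s s0 st.
  rewrite ler_norml mulrBl => /andP[+ _].
  by move: (stp _ _ _ * p s) (p t * _) (e * _) => *; lra.
by move: up low; move: (conv_stp _ _ _ _) (p t) => x y up low; rewrite ler_norml; apply/andP; split; lra.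
Unshelve. all: by end_near. Qed.

(** [p] is the limit of its regularisations, and dominated convergence applies to
    their derivatives. *)
Lemma slope_integral t : 0 <= t ->
  mu.-integrable `[0, t] (EFin \o slope) /\ p t = \int[mu]_(s in `[0, t]) slope s.
Proof.
move=> t0; pose D : set R := `[0, t]%classic.
have mD : measurable (D : set (measurableTypeR R)) by exact: measurable_itv.
have ms k : measurable_fun (D : set (measurableTypeR R)) (slope_seq k).
  apply: measurable_funTS; apply: continuous_measurable_fun.
  exact: is_derive_continuous (fun s => conv_stp_derive cp 2 s (ltn0Sn k)).
have mS : measurable_fun (D : set (measurableTypeR R)) slope.
  by apply: (measurable_fun_cvg ms) => x _; exact: slope_cvg.
have ff : {ae mu, forall x, D x -> (fun k => (slope_seq k x)%:E) @ \oo --> (slope x)%:E}.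
  by apply: aeW => x _; have h := @slope_cvg x; apply: cvg_EFin; [exact: nearW|exact: h].
have fg : {ae mu, forall x n, D x -> (`|(slope_seq n x)%:E| <= c%:E)%E}.
  apply: aeW => x n; rewrite /D /= in_itv /= => /andP[x0 _].
  by rewrite lee_fin slope_seq_bound.
have ig : mu.-integrable D (EFin \o cst c) := @ccont_integrable _ _ 0 t (@ccont_cst _ c).
have mEs k : measurable_fun (D : set (measurableTypeR R)) (EFin \o slope_seq k).
  by apply/measurable_EFinP; exact: ms.
have mES : measurable_fun (D : set (measurableTypeR R)) (EFin \o slope).
  by apply/measurable_EFinP.
have [i1 _ i2] := @dominated_convergence _ _ _ mu D mD (fun k => EFin \o slope_seq k)
  (EFin \o slope) (EFin \o cst c) mEs mES ff ig fg.
split => //.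
have i3 : (fun k => rint t (slope_seq k)) @ \oo --> \int[mu]_(s in D) slope s.
  by apply: fine_cvg; rewrite fineK; [exact: i2|exact: integrable_fin_num i1].
have i4 := conv_stp_id t0.
have E : (fun k => conv_stp p k.+1 1 t) = (fun k => rint t (slope_seq k)).
  by apply/funext => k; exact: conv_stp_int.
rewrite E in i4.
exact: (cvg_unique (@Rhausdorff R) i4 i3).
Qed.

(** Between [a] and [b] the slope lies between the bounds that its monotone parts
    give, and [p] is the integral of the slope. *)
Lemma slope_increment a b : 0 <= a -> a <= b ->
  (b - a) * (slope_up a - slope_down b) <= p b - p a /\
  p b - p a <= (b - a) * (slope_up b - slope_down a).
Proof.
move=> a0 ab; have b0 := le_trans a0 ab.
have [ib ->] := slope_integral b0; have [_ ->] := slope_integral a0.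
rewrite (Rintegral_itvB ib) ?bnd_simp//.
pose I : set (measurableTypeR R) := `]a, b]%classic.
have mI : measurable I by exact: measurable_itv.
have iI : mu.-integrable I (EFin \o slope).
  apply: (integrableS _ _ _ ib) => //.
  by move=> x; rewrite /I /= !in_itv /= => /andP[ax ->]; rewrite andbT (le_trans a0)// ltW.
have lI : fine (mu I) = b - a.
  rewrite lebesgue_measure_itv /= lte_fin; case: ifPn => [//|].
  by rewrite -leNgt => ba; rewrite (le_anti (introT andP (conj ab ba))) subrr.
have icst K : mu.-integrable I (EFin \o cst K).
  apply: (integrableS _ _ _ (@ccont_integrable _ _ 0 b (@ccont_cst _ K))) => //.
  by move=> x; rewrite /I /= !in_itv /= => /andP[ax ->]; rewrite andbT (le_trans a0)// ltW.
have bd s : I s -> slope_up a - slope_down b <= slope s /\ slope s <= slope_up b - slope_down a.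
  rewrite /I /= in_itv /= => /andP[as_ sb]; have s0 : 0 <= s := le_trans a0 (ltW as_).
  have := slope_up_le a0 (ltW as_); have := slope_down_le a0 (ltW as_).
  have := slope_up_le s0 sb; have := slope_down_le s0 sb.
  rewrite slopeE; move: (slope_up _) (slope_up _) (slope_up _) (slope_down _) (slope_down _) (slope_down _).
  by move=> *; split; lra.
split; rewrite mulrC -lI -(Rintegral_cst mu mI).
  by apply: le_Rintegral; [exact: mI|exact: icst|exact: iI|move=> s Is; have [] := bd s Is].
by apply: le_Rintegral; [exact: mI|exact: iI|exact: icst|move=> s Is; have [] := bd s Is].
Qed.

End SlopeLimit.

(** Add up the increments over [n] equal steps: the sum of the right-hand sides is
    [t / n] times a telescoping sum. *)
Lemma zero_of_increments (R : realType) (f G : R -> R) (t : R) : 0 <= t -> f 0 = 0 ->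
  (forall a b, 0 <= a -> a <= b -> `|f b - f a| <= (b - a) * (G b - G a)) -> f t = 0.
Proof.
move=> t0 f0 h; apply/eqP; rewrite -normr_eq0; apply/negP => /negP fn0.
have fp : 0 < `|f t| by rewrite lt_neqAle eq_sym fn0 normr_ge0.
have main n : `|f t| <= t / n.+1%:R * (G t - G 0).
  pose x (k : nat) := t / n.+1%:R * k%:R.
  have dt : 0 <= t / n.+1%:R by rewrite divr_ge0.
  have x0 : x 0%N = 0 by rewrite /x mulr0.
  have xn : x n.+1 = t by rewrite /x divfK.
  have -> : f t = \sum_(0 <= k < n.+1) (f (x k.+1) - f (x k)).
    by rewrite (telescope_sumr (fun k => f (x k)))// x0 xn f0 subr0.
  apply: (le_trans (ler_norm_sum _ _ _)).
  apply: (@le_trans _ _ (\sum_(0 <= k < n.+1) t / n.+1%:R * (G (x k.+1) - G (x k)))).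
    apply: ler_sum => k _.
    have xd : x k.+1 - x k = t / n.+1%:R by rewrite /x -mulrBr -[k.+1%:R]natr1 addrAC subrr add0r mulr1.
    rewrite -xd; apply: h; first by rewrite mulr_ge0.
    by rewrite -subr_ge0 xd.
  by rewrite -mulr_sumr (telescope_sumr (fun k => G (x k)))// x0 xn.
have M0 : 0 <= t * (G t - G 0).
  by have := h 0 t (lexx 0) t0; rewrite subr0; apply: le_trans.
have := main (Num.truncn (t * (G t - G 0) / `|f t|)); set n := Num.truncn _.
have hn : t * (G t - G 0) / `|f t| < n.+1%:R by exact: truncnS_gt.
rewrite mulrAC ler_pdivlMr// => hh.
by move: hn; rewrite ltr_pdivrMr// [_ * `|f t|]mulrC ltNge hh.
Qed.

(** * The measure of a monotone function *)

Section MonotoneMeasure.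
Context {R : realType} (g : R -> R) (c : R).
Hypothesis g_ge0 : forall t, 0 <= t -> 0 <= g t.
Hypothesis g_le : forall t, 0 <= t -> g t <= c.
Hypothesis g_mono : forall s t, 0 <= s -> s <= t -> g s <= g t.

Local Notation lam := (@lebesgue_measure R).

Definition levels : set (measurableTypeR R) := [set y : R | 0 < y /\ exists2 s, 0 <= s & y <= g s].

(** The generalised inverse of [g]: the first time at which [g] reaches [y]. *)
Definition hitting (y : measurableTypeR R) : measurableTypeR R := inf [set s : R | 0 <= s /\ y <= g s].

Lemma levels_interval : is_interval levels.
Proof.
move=> x y [x0 _] [_ [s s0 ys]] z /andP[xz zy]; split; first exact: lt_le_trans xz.
by exists s => //; exact: le_trans ys.
Qed.

Lemma measurable_levels : measurable levels.
Proof. by apply: is_interval_measurable; exact: levels_interval. Qed.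

Lemma hitting_ge0 (y : R) : levels y -> 0 <= hitting y.
Proof. by move=> [_ [s s0 ys]]; apply: lb_le_inf; [exists s|move=> r [r0 _]]. Qed.

Lemma hitting_le (y s : R) : 0 <= s -> y <= g s -> hitting y <= s.
Proof. by move=> s0 ys; apply: ge_inf => //; exists 0 => r [r0 _]. Qed.

Lemma hitting_lt (y b : R) : levels y -> hitting y < b -> y <= g b.
Proof.
move=> [_ [s s0 ys]] h; have ne : [set s : R | 0 <= s /\ y <= g s] !=set0 by exists s.
have [r [r0 yr] rb] := inf_lt ne h.
by apply: (le_trans yr); exact: g_mono (ltW rb).
Qed.

Lemma measurable_hitting : measurable_fun levels hitting.
Proof.
move=> mD; apply: (measurability (@RGenCInfty.G R) (@RGenCInfty.measurableE R)) => //= _ [_] [r] -> <-.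
apply: is_interval_measurable => x y [lx hx] [ly hy] z /andP[xz zy].
have lz : levels z by apply: (levels_interval lx ly); rewrite xz zy.
split => //; move: hx; rewrite /= !in_itv /= !andbT => hx; apply: (le_trans hx).
have [_ [s s0 zs]] := lz; apply: lb_le_inf; first by exists s.
by move=> q [q0 zq]; apply: hitting_le => //; exact: le_trans zq.
Qed.

(** The image of the Lebesgue measure on the levels reached by [g] under the hitting
    time. *)
Definition monotone_measure (A : set (measurableTypeR R)) : \bar R := lam (levels `&` hitting @^-1` A).

Let monotone_measure0 : monotone_measure set0 = 0%E.
Proof. by rewrite /monotone_measure preimage_set0 setI0 measure0. Qed.

Let monotone_measure_ge0 A : (0 <= monotone_measure A)%E.
Proof. exact: measure_ge0. Qed.

Let mpre A : measurable A -> measurable (levels `&` hitting @^-1` A).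
Proof. by move=> mA; apply: measurable_hitting => //; exact: measurable_levels. Qed.

Let monotone_measure_sigma_additive : semi_sigma_additive monotone_measure.
Proof.
move=> F mF tF mUF; rewrite /monotone_measure preimage_bigcup setI_bigcupr.
apply: measure_semi_sigma_additive.
- by move=> n; exact: mpre.
- apply/trivIsetP => /= i j _ _ ij; rewrite setIACA setIid -preimage_setI.
  by move/trivIsetP : tF => /(_ _ _ _ _ ij) ->//; rewrite preimage_set0 setI0.
- by rewrite -setI_bigcupr -preimage_bigcup; exact: mpre.
Qed.

HB.instance Definition _ := isMeasure.Build _ _ _ monotone_measure
  monotone_measure0 monotone_measure_ge0 monotone_measure_sigma_additive.

Lemma levels_le (A : set (measurableTypeR R)) (b : R) : measurable A -> 0 <= b ->
  (forall y, levels y -> A (hitting y) -> y <= b) -> (monotone_measure A <= b%:E)%E.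
Proof.
move=> mA b0 h; rewrite /monotone_measure; apply: (@le_trans _ _ (lam `]0, b]%classic)).
  apply: le_measure; rewrite ?inE; [exact: mpre|exact: measurable_itv|].
  move=> y [ly Ay]; rewrite /= in_itv /= h// andbT; exact: ly.1.
by rewrite lebesgue_measure_itv /= lte_fin; case: ifP => // _; rewrite oppr0 adde0.
Qed.

Let monotone_measure_finite : fin_num_fun monotone_measure.
Proof.
move=> A mA; rewrite ge0_fin_numE//.
have c0 : 0 <= c := le_trans (g_ge0 (lexx 0)) (g_le (lexx 0)).
apply: le_lt_trans (levels_le mA c0 _) (ltry _).
by move=> y [_ [s s0 ys]] _; exact: le_trans (g_le s0).
Qed.

HB.instance Definition _ := Measure_isFinite.Build _ _ _ monotone_measure monotone_measure_finite.

End MonotoneMeasure.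

(** The two bounds enclose [g] at its jumps, where the measure of [[0, a]] may exceed
    [g a]. *)
Lemma monotone_measure_exists (R : realType) (g : R -> R) (c : R) :
  (forall t, 0 <= t -> 0 <= g t) -> (forall t, 0 <= t -> g t <= c) ->
  (forall s t, 0 <= s -> s <= t -> g s <= g t) ->
  exists mu : {finite_measure set (measurableTypeR R) -> \bar R},
  [/\ forall a : R, 0 <= a -> ((g a)%:E <= mu `[0%R, a]%classic)%E,
      forall b : R, 0 <= b -> (mu `[0%R, b[%classic <= (g b)%:E)%E &
      forall A : set (measurableTypeR R), measurable A -> A `<=` `]-oo, 0%R[%classic -> mu A = 0%E].
Proof.
move=> g0 gc gm.
pose mu : {finite_measure set (measurableTypeR R) -> \bar R} := monotone_measure g.
exists (mu c g0 gc); split.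
- move=> a a0; have -> : (g a)%:E = @lebesgue_measure R `]0, g a]%classic.
    rewrite lebesgue_measure_itv /= lte_fin; case: ifPn => [_|]; first by rewrite oppr0 adde0.
    by rewrite -leNgt => h; congr (_%:E); apply/eqP; rewrite eq_le h g0.
  have mA : measurable (`[0, a]%classic : set (measurableTypeR R)) by exact: measurable_itv.
  apply: le_measure; rewrite ?inE; first exact: measurable_itv.
    by apply: (@measurable_hitting R g) => //; exact: measurable_levels.
  move=> y; rewrite /= in_itv /= => /andP[y0 ya].
  have ly : levels g y by split => //; exists a.
  by split => //; rewrite /= in_itv /= (hitting_ge0 ly) (hitting_le a0 ya).
- move=> b b0; apply: levels_le; [exact: measurable_itv|exact: g0|].
  by move=> y ly /=; rewrite in_itv /= => /andP[_ h]; exact: (hitting_lt gm ly h).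
- move=> A mA A0; rewrite /mu /= /monotone_measure.
  rewrite (_ : _ `&` _ = set0) ?measure0//; apply/seteqP; split => // y [ly] /A0 /=.
  by rewrite in_itv /= ltNge (hitting_ge0 ly).
Qed.

Section FiniteMeasureIntegral.
Context {R : realType} (mu : {finite_measure set (measurableTypeR R) -> \bar R}).

Local Notation D := (`[0%R, +oo[%classic : set (measurableTypeR R)).

Definition mint (f : R -> R) : R := \int[mu]_(r in D) f r.

Definition half_bounded (f : R -> R) := measurable_fun [set: measurableTypeR R] f /\
  exists K : R, forall r, 0 <= r -> `|f r| <= K.

Lemma mD : measurable D.
Proof. exact: measurable_itv. Qed.

Lemma half_bounded_integrable f : half_bounded f -> mu.-integrable D (EFin \o f).
Proof.
move=> [mf [K hK]]; apply: measurable_bounded_integrable.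
- exact: mD.
- by rewrite ltey_eq fin_num_measure//; exact: mD.
- exact: measurable_funTS.
- exists K; split; first exact: num_real.
  move=> M KM r /=; rewrite in_itv /= andbT => r0; exact: le_trans (hK r r0) (ltW KM).
Qed.

Lemma half_boundedD f g : half_bounded f -> half_bounded g -> half_bounded (fun r => f r + g r).
Proof.
move=> [mf [K hK]] [mg [M hM]]; split; first exact: measurable_funD.
by exists (K + M) => r r0; apply: (le_trans (ler_normD _ _)); apply: lerD; [exact: hK|exact: hM].
Qed.

Lemma half_boundedZ a f : half_bounded f -> half_bounded (fun r => a * f r).
Proof.
move=> [mf [K hK]]; split; first by apply: measurable_funM => //; exact: measurable_cst.
by exists (`|a| * K) => r r0; rewrite normrM ler_wpM2l// hK.
Qed.

Lemma half_bounded_cst a : half_bounded (fun=> a).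
Proof. by split; [exact: measurable_cst|exists `|a|]. Qed.

Lemma mintZ a f : half_bounded f -> mint (fun r => a * f r) = a * mint f.
Proof. by move=> bf; apply: RintegralZl; [exact: mD|exact: half_bounded_integrable]. Qed.

Lemma mintB f g : half_bounded f -> half_bounded g -> mint (fun r => f r - g r) = mint f - mint g.
Proof. by move=> bf bg; apply: RintegralB; [exact: mD|exact: half_bounded_integrable..]. Qed.

Lemma le_mint f g : half_bounded f -> half_bounded g ->
  (forall r, 0 <= r -> f r <= g r) -> mint f <= mint g.
Proof.
move=> bf bg fg; apply: le_Rintegral; [exact: mD|exact: half_bounded_integrable..|].
by move=> r /=; rewrite in_itv /= andbT; exact: fg.
Qed.

Lemma eq_mint f g : (forall r, 0 <= r -> f r = g r) -> mint f = mint g.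
Proof.
by move=> fg; apply: eq_Rintegral => r; rewrite inE /= in_itv /= andbT; exact: fg.
Qed.

Definition mass : R := mint (fun=> 1).

Lemma mint_cst a : mint (fun=> a) = a * mass.
Proof.
by rewrite /mass -mintZ; [apply: eq_mint => r _; rewrite mulr1|exact: half_bounded_cst].
Qed.

Lemma mass_ge0 : 0 <= mass.
Proof. by apply: Rintegral_ge0. Qed.

Lemma mint_norm_le f K : half_bounded f -> (forall r, 0 <= r -> `|f r| <= K) -> `|mint f| <= K * mass.
Proof.
move=> bf hK; rewrite ler_norml -mulNr -!mint_cst; apply/andP; split.
  apply: le_mint => //; first exact: half_bounded_cst.
  by move=> r r0; have := hK r r0; rewrite ler_norml => /andP[].
apply: le_mint => //; first exact: half_bounded_cst.
by move=> r r0; have := hK r r0; rewrite ler_norml => /andP[].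
Qed.

Lemma mint_indic (A : set (measurableTypeR R)) : measurable A -> A `<=` D ->
  half_bounded (\1_A : R -> R) /\ mint \1_A = fine (mu A).
Proof.
move=> mA AD; split; first split.
- exact: measurable_indic.
- by exists 1 => r _; rewrite indicE; case: (_ \in _); rewrite ?normr1 ?normr0.
- by rewrite /mint /Rintegral integral_indic ?setIidl//; exact: mD.
Qed.

Lemma half_bounded_cvg (f : nat -> R -> R) (l : R -> R) (K : R) :
  (forall n, half_bounded (f n)) -> (forall n r, 0 <= r -> `|f n r| <= K) ->
  (forall r, 0 <= r -> f ^~ r @ \oo --> l r) -> half_bounded l ->
  (fun n => mint (f n)) @ \oo --> mint l.
Proof.
move=> bf hK fl bl.
have mEf n : measurable_fun D (EFin \o f n).
  by apply/measurable_EFinP; apply: measurable_funTS; exact: (bf n).1.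
have mEl : measurable_fun D (EFin \o l).
  by apply/measurable_EFinP; apply: measurable_funTS; exact: bl.1.
have D0 r : D r -> 0 <= r by rewrite /= in_itv /= andbT.
have ff : {ae mu, forall r, D r -> (fun n => (f n r)%:E) @ \oo --> (l r)%:E}.
  by apply: aeW => r Dr; have h := fl r (D0 r Dr); apply: cvg_EFin; [exact: nearW|exact: h].
have fg : {ae mu, forall r n, D r -> (`|(f n r)%:E| <= K%:E)%E}.
  by apply: aeW => r n Dr; rewrite lee_fin hK// D0.
have ig : mu.-integrable D (EFin \o (fun=> K)) := half_bounded_integrable (half_bounded_cst K).
have [il _ h] := @dominated_convergence _ _ _ mu D mD (fun n => EFin \o f n) (EFin \o l)
  (EFin \o (fun=> K)) mEf mEl ff ig fg.
by apply: fine_cvg; rewrite fineK; [exact: h|exact: integrable_fin_num il].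
Qed.

(** As a function of [t], the second primitive of the unit mass at [r]; hence the
    second derivative of [hinge_int] is [mu]. *)
Definition hinge (t r : R) : R := Num.max (t - r) 0.
Definition hinge_int (t : R) : R := mint (hinge t).

Lemma hinge_lipschitz s t r : `|hinge s r - hinge t r| <= `|s - t|.
Proof.
rewrite /hinge; have e : s - r - (t - r) = s - t by ring.
case: (leP (s - r) 0) => h1; case: (leP (t - r) 0) => h2.
- by rewrite subrr normr0.
- rewrite sub0r normrN gtr0_norm// ler0_norm; lra.
- rewrite subr0 gtr0_norm// ger0_norm; lra.
- by rewrite e.
Qed.

Lemma half_bounded_hinge t : half_bounded (hinge t).
Proof.
split.
  apply: measurable_maxr; last exact: measurable_cst.
  by apply: measurable_funB; [exact: measurable_cst|exact: measurable_id].
exists `|t| => r r0; rewrite /hinge; case: (leP (t - r) 0) => h; first by rewrite normr0.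
rewrite gtr0_norm//; have := ler_norm t; lra.
Qed.

Lemma hinge_int_lipschitz s t : `|hinge_int s - hinge_int t| <= `|s - t| * mass.
Proof.
rewrite /hinge_int -mintB; try exact: half_bounded_hinge.
apply: mint_norm_le => [|r _]; last exact: hinge_lipschitz.
have -> : (fun r => hinge s r - hinge t r) = (fun r => hinge s r + -1 * hinge t r).
  by apply/funext => r; rewrite mulN1r.
by apply: half_boundedD; [|apply: half_boundedZ]; exact: half_bounded_hinge.
Qed.

Lemma continuous_hinge_int : continuous hinge_int.
Proof.
move=> t; apply/cvgrPdist_le => e e0.
have m1 : 0 < mass + 1 by rewrite ltr_wpDl// mass_ge0.
near=> s; rewrite -/(hinge_int _); apply: (le_trans (hinge_int_lipschitz _ _)).
have h : `|t - s| <= e / (mass + 1).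
  near: s; apply/nbhs_ballP; exists (e / (mass + 1)) => [|y]; first exact: divr_gt0.
  by rewrite /ball /= => /ltW.
apply: (@le_trans _ _ (e / (mass + 1) * (mass + 1))); last by rewrite divfK// gt_eqF.
by apply: ler_pM => //; [exact: mass_ge0|rewrite lerDl].
Unshelve. all: by end_near. Qed.

Lemma hinge_int0 : hinge_int 0 = 0.
Proof.
rewrite /hinge_int (@eq_mint _ (fun=> 0)) ?mint_cst ?mul0r// => r r0.
by rewrite /hinge sub0r; apply/max_idPr; rewrite oppr_le0.
Qed.

(** [hinge b r - hinge a r] equals [b - a] for [r] below [a], vanishes for [r] above
    [b], and lies in between otherwise. *)
Lemma hinge_slope a b : 0 <= a -> a <= b ->
  (b - a) * fine (mu `[0%R, a]%classic) <= hinge_int b - hinge_int a /\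
  hinge_int b - hinge_int a <= (b - a) * fine (mu `[0%R, b[%classic).
Proof.
move=> a0 ab; have ba : 0 <= b - a by rewrite subr_ge0.
have hh t := half_bounded_hinge t.
have hB : half_bounded (fun r => hinge b r - hinge a r).
  have -> : (fun r => hinge b r - hinge a r) = (fun r => hinge b r + -1 * hinge a r).
    by apply/funext => r; rewrite mulN1r.
  by apply: half_boundedD => //; exact: half_boundedZ.
rewrite /hinge_int -mintB//; split.
- have [bi <-] := @mint_indic `[0, a]%classic (measurable_itv _) (fun r => ltac:(by rewrite /= !in_itv /= andbT => /andP[])).
  rewrite -mintZ//; apply: le_mint => //; first exact: half_boundedZ.
  move=> r r0; rewrite indicE mem_setE in_itv /= r0 /= /hinge.
  case: (leP r a) => ra; case: (leP (b - r) 0) => h1; case: (leP (a - r) 0) => h2 /=; lra.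
- have [bi <-] := @mint_indic `[0, b[%classic (measurable_itv _) (fun r => ltac:(by rewrite /= !in_itv /= andbT => /andP[])).
  rewrite -mintZ//; apply: le_mint => //; first exact: half_boundedZ.
  move=> r r0; rewrite indicE mem_setE in_itv /= r0 /= /hinge.
  case: (ltP r b) => ra; case: (leP (b - r) 0) => h1; case: (leP (a - r) 0) => h2 /=; lra.
Qed.

End FiniteMeasureIntegral.

(** * Integration by parts against a measure *)

Section HingeKernel.
Context {R : realType} (mu : {finite_measure set (measurableTypeR R) -> \bar R}).
Context (Q Q1 q q1 : R -> R).
Hypothesis dQ : forall t, is_derive t (1 : R) Q (Q1 t).
Hypothesis dQ1 : forall t, is_derive t (1 : R) Q1 (q t).
Hypothesis dq : forall t, is_derive t (1 : R) q (q1 t).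
Hypothesis cq1 : continuous q1.

Let cQ : continuous Q. Proof. exact: is_derive_continuous dQ. Qed.
Let cq : continuous q. Proof. exact: is_derive_continuous dq. Qed.

(** As a function of [t], the primitive of [q t * hinge t r] that vanishes for
    [t <= r]. *)
Definition hinge_kernel (t r : R) : R := (t - Num.min r t) * Q1 t - Q t + Q (Num.min r t).

Let J (r t : R) := (t - r) * Q1 t - Q t + Q r.

Lemma J_derive (r t : R) : is_derive t (1 : R) (J r) (q t * (t - r)).
Proof.
have d0 : is_derive t (1 : R) (fun s : R => s - r) 1 by apply: is_derive_eq; ring.
have d := is_deriveD (is_deriveB (is_deriveM d0 (dQ1 t)) (dQ t)) (is_derive_cst (Q r) t 1).
by apply: (is_derive_eq d); rewrite /GRing.scale /=; ring.
Qed.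

Lemma hinge_kernel_late r t : r <= t -> hinge_kernel t r = J r t.
Proof. by move=> rt; rewrite /hinge_kernel (min_idPl rt). Qed.

Lemma hinge_kernel_early r t : t <= r -> hinge_kernel t r = 0.
Proof. by move=> rt; rewrite /hinge_kernel (min_idPr rt) subrr mul0r sub0r addNr. Qed.

Lemma hinge_kernel_derive (r t : R) :
  is_derive t (1 : R) (hinge_kernel ^~ r) (q t * hinge t r).
Proof.
rewrite /hinge; have [rt|tr|<-] := ltgtP r t.
- rewrite (max_idPl (_ : 0 <= t - r)); last by rewrite subr_ge0 ltW.
  apply: (@near_eq_is_derive _ _ _ (J r)); last exact: J_derive.
  near=> s.
  have h : r < s by near: s; exact: lt_nbhsr.
  by rewrite hinge_kernel_late// ltW.
- rewrite (max_idPr (_ : t - r <= 0)); last by rewrite subr_le0 ltW.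
  apply: (@near_eq_is_derive _ _ _ (cst 0)); last by apply: is_derive_eq; rewrite mulr0.
  near=> s.
  have h : s < r by near: s; exact: lt_nbhsl.
  by rewrite hinge_kernel_early// ltW.
- have [M M0 hM] := @continuous_bounded _ q r (r + 1) (continuous_subspaceT cq).
  rewrite subrr (max_idPl (lexx 0)) mulr0.
  apply: is_derive_eps => e e0; have M1 : 0 < M + 1 by lra.
  exists (Num.min 1 (e / (M + 1))); first by rewrite lt_min ltr01 divr_gt0.
  move=> s; rewrite lt_min => /andP[s1 se].
  rewrite (hinge_kernel_early (lexx r)) mulr0 !subr0.
  have [sr|rs] := leP s r; first by rewrite hinge_kernel_early// normr0 mulr_ge0// ltW.
  rewrite hinge_kernel_late ?(ltW rs)//.
  have [x [x1 x2 hx]] := mean_value rs (fun y _ _ => J_derive r y).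
  have J0 : J r r = 0 by rewrite /J subrr mul0r sub0r addNr.
  rewrite J0 subr0 in hx; rewrite hx !normrM ler_wpM2r//.
  have sr : `|s - r| = s - r by rewrite ger0_norm// subr_ge0 ltW.
  rewrite sr in s1 se.
  have xr : `|x - r| <= e / (M + 1) by rewrite ger0_norm; lra.
  have qx : `|q x| <= M by apply: hM; lra.
  apply: (@le_trans _ _ ((M + 1) * (e / (M + 1)))); last by rewrite mulrC divfK// gt_eqF.
  by apply: ler_pM => //; lra.
Unshelve. all: by end_near. Qed.

(** Uniformity in [r] allows to differentiate the integral of the kernel with respect
    to [mu]; the kink at [t = r] is harmless because [hinge] is Lipschitz. *)
Lemma hinge_kernel_taylor (tau : R) : 0 <= tau -> exists2 C : R, 0 <= C &
  forall s t r, -1 <= s -> s <= tau -> -1 <= t -> t <= tau -> 0 <= r ->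
  `|hinge_kernel s r - hinge_kernel t r - (s - t) * (q t * hinge t r)| <= C * (s - t) ^+ 2.
Proof.
move=> tau0.
have [M M0 hM] := @continuous_bounded _ q (-1) tau (continuous_subspaceT cq).
have [L L0 hL] := @continuous_bounded _ q1 (-1) tau (continuous_subspaceT cq1).
have hinge_le t r : t <= tau -> 0 <= r -> `|hinge t r| <= tau.
  move=> tt r0; rewrite /hinge; case: (leP (t - r) 0) => h; first by rewrite normr0.
  by rewrite gtr0_norm//; lra.
have qL s t : -1 <= s -> s <= tau -> -1 <= t -> t <= tau -> `|q s - q t| <= L * `|s - t|.
  wlog st : s t / t < s.
    move=> w s1 s2 t1 t2; have [h|h|->] := ltgtP t s; first exact: w.
      by rewrite distrC [`|s - t|]distrC; exact: w.
    by rewrite !subrr normr0 mulr0.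
  move=> s1 s2 t1 t2; have [x [x1 x2 ->]] := mean_value st (fun y _ _ => dq y).
  by rewrite normrM ler_wpM2r// hL//; lra.
exists (M + tau * L); first by rewrite addr_ge0// mulr_ge0.
move=> s t r s1 s2 t1 t2 r0.
have phi x : -1 <= x -> x <= tau -> `|x - t| <= `|s - t| ->
    `|q x * hinge x r - q t * hinge t r| <= (M + tau * L) * `|s - t|.
  move=> x1 x2 xs.
  have -> : q x * hinge x r - q t * hinge t r =
    q x * (hinge x r - hinge t r) + hinge t r * (q x - q t) by ring.
  apply: (le_trans (ler_normD _ _)); rewrite !normrM [leRHS]mulrDl.
  apply: lerD; first apply: ler_pM => //; first exact: hM.
    exact: le_trans (hinge_lipschitz _ _ _) xs.
  rewrite -mulrA; apply: ler_pM => //; first exact: hinge_le.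
  by apply: (le_trans (qL _ _ x1 x2 t1 t2)); rewrite ler_wpM2l.
have fin x : `|x - t| <= `|s - t| -> -1 <= x -> x <= tau ->
    hinge_kernel s r - hinge_kernel t r = q x * hinge x r * (s - t) ->
    `|hinge_kernel s r - hinge_kernel t r - (s - t) * (q t * hinge t r)| <= (M + tau * L) * (s - t) ^+ 2.
  move=> xs x1 x2 ->; rewrite mulrC -mulrBr normrM mulrC -[(s - t) ^+ 2]real_normK ?num_real//.
  by rewrite expr2 mulrA ler_wpM2r// phi.
have [h|h|E] := ltgtP t s.
- have [x [x1 x2 hx]] := mean_value h (fun y _ _ => hinge_kernel_derive r y).
  by apply: (fin x) => //; [rewrite !ger0_norm|..]; lra.
- have [x [x1 x2 hx]] := mean_value h (fun y _ _ => hinge_kernel_derive r y).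
  apply: (fin x) => //; [rewrite !ler0_norm; lra|lra|lra|].
  by rewrite -[LHS]opprB hx -mulrN opprB.
- by rewrite E !subrr mul0r subrr normr0 expr2 mulr0 mulr0.
Qed.

Lemma half_bounded_hinge_kernel t : 0 <= t -> half_bounded (hinge_kernel t).
Proof.
move=> t0; split.
  apply: continuous_measurable_fun.
  have cm : continuous (fun r : R => Num.min r t).
    move=> x; apply: (@continuous_min _ R (fun r : R => r) (fun=> t)).
      exact: (@ccont_id R x).
    exact: (@ccont_cst R t x).
  have cQm : continuous (fun r => Q (Num.min r t)).
    by move=> x; apply: continuous_comp; [exact: cm|exact: cQ].
  have -> : hinge_kernel t = (fun r => (- Q1 t) * Num.min r t + (Q (Num.min r t) + (t * Q1 t - Q t))).
    by apply/funext => r; rewrite /hinge_kernel; ring.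
  apply: ccontD; first exact: ccontZ.
  by apply: ccontD => //; exact: ccont_cst.
have [M M0 hM] := @continuous_bounded _ Q 0 t (continuous_subspaceT cQ).
exists (t * `|Q1 t| + M + M) => r r0; rewrite /hinge_kernel.
have m0 : 0 <= Num.min r t by rewrite le_min r0.
have mt : Num.min r t <= t by rewrite ge_min lexx orbT.
apply: (le_trans (ler_normD _ _)); apply: lerD; last exact: hM.
apply: (le_trans (ler_normB _ _)); apply: lerD; last exact: hM.
by rewrite normrM ler_wpM2r// ger0_norm; lra.
Qed.

Lemma hinge_kernel_neg t r : t <= 0 -> 0 <= r -> hinge_kernel t r = 0.
Proof. by move=> t0 r0; rewrite hinge_kernel_early//; exact: le_trans r0. Qed.

(** Both sides have the same derivative in [t] and vanish at 0. *)
Lemma rint_hinge t : 0 <= t ->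
  rint t (fun s => q s * hinge_int mu s) = mint mu (hinge_kernel t).
Proof.
move=> t0; have cqh := ccontM cq (@continuous_hinge_int R mu).
have hbk s : half_bounded (fun r => hinge_kernel (Num.max s 0) r).
  by apply: half_bounded_hinge_kernel; rewrite le_max lexx orbT.
have kE s : mint mu (hinge_kernel s) = mint mu (hinge_kernel (Num.max s 0)).
  have [s0|s0] := leP 0 s; first by [].
  apply: eq_mint => r r0; rewrite !hinge_kernel_neg//; exact: ltW.
have dL (x : R) : - 2^-1 < x -> is_derive x (1 : R) (fun s => mint mu (hinge_kernel s)) (q x * hinge_int mu x).
  move=> x1; have x_tau : 0 <= `|x| + 1 by rewrite addr_ge0.
  have [C C0 hC] := hinge_kernel_taylor x_tau.
  have mm := mass_ge0 mu.
  apply: is_derive_eps => e e0.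
  have CM : 0 < C * mass mu + 1 by rewrite ltr_wpDl// mulr_ge0.
  exists (Num.min 2^-1 (e / (C * mass mu + 1))); first by rewrite lt_min divr_gt0// andbT invr_gt0.
  move=> s; rewrite lt_min => /andP[s1 s2].
  have s1' := s1; move: s1'; rewrite ltr_norml => /andP[s3 s4].
  have xn := ler_norm x.
  have key : `|mint mu (hinge_kernel s) - mint mu (hinge_kernel x) - (s - x) * (q x * hinge_int mu x)| <=
      C * (s - x) ^+ 2 * mass mu.
    rewrite /hinge_int (kE s) (kE x) -mintB// mulrA -mintZ; last exact: half_bounded_hinge.
    have hb1 : half_bounded (fun r => hinge_kernel (Num.max s 0) r - hinge_kernel (Num.max x 0) r).
      have -> : (fun r => hinge_kernel (Num.max s 0) r - hinge_kernel (Num.max x 0) r) =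
        (fun r => hinge_kernel (Num.max s 0) r + -1 * hinge_kernel (Num.max x 0) r).
        by apply/funext => r; rewrite mulN1r.
      by apply: half_boundedD => //; exact: half_boundedZ.
    have hb2 : half_bounded (fun r => (s - x) * q x * hinge x r).
      by apply: half_boundedZ; exact: half_bounded_hinge.
    rewrite -mintB//; apply: mint_norm_le.
      have -> : (fun r => hinge_kernel (Num.max s 0) r - hinge_kernel (Num.max x 0) r - (s - x) * q x * hinge x r) =
        (fun r => (hinge_kernel (Num.max s 0) r - hinge_kernel (Num.max x 0) r) + -1 * ((s - x) * q x * hinge x r)).
        by apply/funext => r; rewrite mulN1r.
      by apply: half_boundedD => //; exact: half_boundedZ.
    move=> r r0.
    have kr y : hinge_kernel (Num.max y 0) r = hinge_kernel y r.
      by have [y0|y0] := leP 0 y => //; rewrite !hinge_kernel_neg// ltW.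
    by rewrite !kr -mulrA; apply: hC => //; lra.
  apply: (le_trans key); rewrite -[(s - x) ^+ 2]real_normK ?num_real// expr2.
  have -> : C * (`|s - x| * `|s - x|) * mass mu = (C * mass mu * `|s - x|) * `|s - x| by ring.
  rewrite ler_wpM2r//; rewrite ltr_pdivlMr// in s2; apply: le_trans (ltW s2).
  by rewrite mulrC ler_wpM2l// lerDl.
rewrite (rint_ftc1 t0 cqh dL).
have -> : mint mu (hinge_kernel 0) = 0.
  rewrite (@eq_mint _ _ _ (fun=> 0)) ?mint_cst ?mul0r// => r r0; exact: hinge_kernel_neg.
by rewrite subr0.
Qed.

End HingeKernel.

Section HingeConsequences.
Context {R : realType} (mu : {finite_measure set (measurableTypeR R) -> \bar R}).

(** With [Q s = v 0 (t - s)] the boundary terms of [hinge_kernel] vanish, and what is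
    left is the convolution of [v 0] with [mu]. *)
Lemma hinge_conv_bound (v : nat -> R -> R) (B t : R) : bump_chain v -> 0 <= t ->
  (forall s, 0 <= s -> `|v 0%N s| <= B) ->
  `|rint t (fun s => v 2%N (t - s) * hinge_int mu s)| <= B * mass mu.
Proof.
move=> bv t0 hB; have [sv _] := bv.
have dr (f f1 : R -> R) : (forall x, is_derive x (1 : R) f (f1 x)) ->
    forall s : R, is_derive s (1 : R) (fun s => f (t - s)) (- f1 (t - s)).
  move=> df s; have d0 : is_derive s (1 : R) (fun s : R => t - s) (- 1) by apply: is_derive_eq; ring.
  have d1 := @is_derive1_comp _ f (fun s => t - s) s _ _ (df (t - s)) d0.
  by apply: (is_derive_eq d1); ring.
have d0 := dr _ _ (sv 0%N).
have d1 (s : R) : is_derive s (1 : R) (fun s => - v 1%N (t - s)) (v 2%N (t - s)).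
  by apply: (is_derive_eq (is_deriveN (dr _ _ (sv 1%N) s))); rewrite opprK.
have d2 := dr _ _ (sv 2%N).
have c3 : continuous (fun s => - v 3%N (t - s)).
  have d3 (s : R) : is_derive s (1 : R) (fun s => - v 3%N (t - s)) (v 4%N (t - s)).
    by apply: (is_derive_eq (is_deriveN (dr _ _ (sv 3%N) s))); rewrite opprK.
  exact: is_derive_continuous d3.
rewrite (rint_hinge mu d0 d1 d2 c3 t0); apply: mint_norm_le.
  by apply: half_bounded_hinge_kernel => //; exact: d0.
have z n : v n 0 = 0 := @bump_neg R v n 0 bv (lexx 0).
move=> r r0; rewrite /hinge_kernel /= [t - t]subrr !z !(oppr0, mulr0, add0r, addr0).
by apply: hB; rewrite subr_ge0 ge_min lexx orbT.
Qed.

(** The boundary terms of [hinge_kernel] decay, and dominated convergence applies. *)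
Lemma hinge_laplace (sg : R) (d : nat -> R -> R) : 0 < sg ->
  (forall m t, is_derive t (1 : R) (d m) (d m.+1 t)) ->
  (forall m, exp_growth (- sg) (d m)) ->
  (fun n : nat => rint n%:R (fun t => d 2%N t * hinge_int mu t)) @ \oo --> mint mu (d 0%N).
Proof.
move=> s0 dd gd; have cd m : continuous (d m) := is_derive_continuous (dd m).
have -> : (fun n : nat => rint n%:R (fun t => d 2%N t * hinge_int mu t)) =
    (fun n : nat => mint mu (hinge_kernel (d 0%N) (d 1%N) n%:R)).
  by apply/funext => n; exact: (rint_hinge mu (dd 0%N) (dd 1%N) (dd 2%N) (@cd 3%N)).
have [M0 M00 hM0] := gd 0%N; have [M1 M10 hM1] := gd 1%N.
have d0b r : 0 <= r -> `|d 0%N r| <= M0.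
  move=> r0; apply: (le_trans (hM0 r r0)); rewrite ler_piMr// -expR0 ler_expR mulNr oppr_le0.
  by rewrite mulr_ge0// ltW.
have tb (t : R) : 0 <= t -> t * `|d 1%N t| <= M1 / sg.
  move=> t0; apply: (@le_trans _ _ (t * (M1 * expR (- sg * t)))); first by rewrite ler_wpM2l// hM1.
  rewrite mulrCA ler_wpM2l// mulNr expRN ler_pdivrMr ?expR_gt0// mulrC ler_pdivlMr//.
  by rewrite mulrC; apply: le_trans (expR_ge1Dx _); rewrite lerDr.
apply: (@half_bounded_cvg _ mu _ _ (M1 / sg + M0 + M0)).
- by move=> n; apply: half_bounded_hinge_kernel => //; exact: dd.
- move=> n r r0; rewrite /hinge_kernel.
  have m0 : 0 <= Num.min r n%:R by rewrite le_min r0 ler0n.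
  have mt : Num.min r n%:R <= n%:R by rewrite ge_min lexx orbT.
  apply: (le_trans (ler_normD _ _)); apply: lerD; last exact: d0b.
  apply: (le_trans (ler_normB _ _)); apply: lerD; last exact: d0b.
  apply: le_trans (tb n%:R _) => //; rewrite normrM ler_wpM2r// ger0_norm; lra.
- move=> r r0.
  have sg2 : sg / 2 < sg by lra.
  have sg20 : 0 < sg / 2 by lra.
  have c1 := exp_decay_cvg sg2 (gd 1%N) (exp_growth_id sg20).
  have c2 := exp_decay_cvg sg2 (gd 1%N) (exp_growth_cst (- r) sg20).
  have c3 := exp_decay_cvg sg2 (gd 0%N) (exp_growth_cst (-1) sg20).
  have c4 : (fun n : nat => d 1%N n%:R * n%:R + d 1%N n%:R * (- r) + d 0%N n%:R * (-1) + d 0%N r) @ \oo --> d 0%N r.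
    rewrite -[X in _ --> X]add0r; apply: cvgD; last exact: cvg_cst.
    by apply: cvg0_add => //; exact: cvg0_add.
  apply: cvg_trans c4; apply: near_eq_cvg; near=> n.
  have rn : r <= n%:R by near: n; exact: nbhs_infty_ger.
  by rewrite /hinge_kernel (min_idPl rn); ring.
- split; first by apply: continuous_measurable_fun; exact: cd.
  by exists M0.
Unshelve. all: by end_near. Qed.

End HingeConsequences.

(** * Representing measures *)

Section Representation.
Context {R : realType}.
Local Notation D := (`[0%R, +oo[%classic : set (measurableTypeR R)).

(** The kernel minus its candidate satisfies the hypothesis of [zero_of_increments]
    with [G] the sum of the monotone parts of the slope. *)
Lemma hinge_representation (p : R -> R) (c : R) : continuous p -> p 0 = 0 ->
  (forall v, bump_chain v -> (forall s, `|v 0%N s| <= 1) ->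
     forall t, 0 <= t -> `|rint t (fun s => v 2%N (t - s) * p s)| <= c) ->
  exists mu1 mu2 : {finite_measure set (measurableTypeR R) -> \bar R},
  [/\ forall t, 0 <= t -> p t = hinge_int mu1 t - hinge_int mu2 t,
      forall A : set (measurableTypeR R), measurable A -> A `<=` `]-oo, 0%R[%classic -> mu1 A = 0%E &
      forall A : set (measurableTypeR R), measurable A -> A `<=` `]-oo, 0%R[%classic -> mu2 A = 0%E].
Proof.
move=> cp p0 H.
have ule a b := @slope_up_le R p cp c H a b.
have dle a b := @slope_down_le R p cp c H a b.
have u0 := @slope_up0 R p cp; have d0 := @slope_down0 R p cp.
have [||s t s0 st|mu1 [hi1 lo1 n1]] := @monotone_measure_exists R (slope_up p) c.
- by move=> t t0; rewrite -u0; exact: ule.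
- by move=> t t0; exact: slope_up_bound.
- exact: ule.
have [||s t s0 st|mu2 [hi2 lo2 n2]] := @monotone_measure_exists R (slope_down p) c.
- by move=> t t0; rewrite -d0; exact: dle.
- by move=> t t0; exact: slope_down_bound.
- exact: dle.
exists mu1, mu2; split => // t t0.
pose f t := p t - (hinge_int mu1 t - hinge_int mu2 t).
pose G t := slope_up p t + slope_down p t.
suff : f t = 0 by move/eqP; rewrite subr_eq0 => /eqP.
apply: (@zero_of_increments R f G t t0); first by rewrite /f p0 !hinge_int0 !subr0.
move=> a b a0 ab; have b0 := le_trans a0 ab.
have ba : 0 <= b - a by rewrite subr_ge0.
have [i1 i2] := slope_increment cp p0 H a0 ab.
have [h1 h2] := hinge_slope mu1 a0 ab; have [h3 h4] := hinge_slope mu2 a0 ab.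
have fl (mu : {finite_measure set (measurableTypeR R) -> \bar R}) (I : set (measurableTypeR R)) x :
    measurable I -> (x%:E <= mu I)%E -> x <= fine (mu I).
  by move=> mI h; rewrite -lee_fin fineK// fin_num_measure.
have fu (mu : {finite_measure set (measurableTypeR R) -> \bar R}) (I : set (measurableTypeR R)) x :
    measurable I -> (mu I <= x%:E)%E -> fine (mu I) <= x.
  by move=> mI h; rewrite -lee_fin fineK// fin_num_measure.
have h1' := le_trans (ler_wpM2l ba (fl _ _ _ (measurable_itv _) (hi1 a a0))) h1.
have h3' := le_trans (ler_wpM2l ba (fl _ _ _ (measurable_itv _) (hi2 a a0))) h3.
have h2' := le_trans h2 (ler_wpM2l ba (fu _ _ _ (measurable_itv _) (lo1 b b0))).
have h4' := le_trans h4 (ler_wpM2l ba (fu _ _ _ (measurable_itv _) (lo2 b b0))).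
move: i1 i2 h1' h2' h3' h4'; rewrite /f /G.
move: (slope_up p a) (slope_up p b) (slope_down p a) (slope_down p b) (p a) (p b) => ua ub da db pa pb.
move: (hinge_int mu1 a) (hinge_int mu1 b) (hinge_int mu2 a) (hinge_int mu2 b) (b - a) => x1 x2 y1 y2 z.
rewrite !mulrBr !mulrDr => *; rewrite ler_norml; apply/andP; split; lra.
Qed.

(** The integral against a signed measure can be computed from any decomposition
    into finite measures. *)
Lemma mint_unique (m1 m2 m3 m4 : {finite_measure set (measurableTypeR R) -> \bar R}) (f : R -> R) :
  (forall A, measurable A -> (m1 A + m4 A = m3 A + m2 A)%E) -> half_bounded f ->
  mint m1 f - mint m2 f = mint m3 f - mint m4 f.
Proof.
move=> h bf; have i m := half_bounded_integrable m bf.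
have mf : measurable_fun D (EFin \o f) by apply/measurable_EFinP; apply: measurable_funTS; exact: bf.1.
have E : (\int[m1]_(x in D) (EFin \o f) x + \int[m4]_(x in D) (EFin \o f) x =
          \int[m3]_(x in D) (EFin \o f) x + \int[m2]_(x in D) (EFin \o f) x)%E.
  rewrite -(integral_measure_add mD (i m1) (i m4)) -(integral_measure_add mD (i m3) (i m2)).
  apply: eq_measure_integral => A mA _; transitivity (m1 A + m4 A)%E; first exact: measure_addE.
  by rewrite h//; symmetry; exact: measure_addE.
have fn (m : {finite_measure set (measurableTypeR R) -> \bar R}) : (\int[m]_(x in D) (EFin \o f) x)%E \is a fin_num := integrable_fin_num mD (i m).
have : mint m1 f + mint m4 f = mint m3 f + mint m2 f.
  by rewrite /mint /Rintegral -(fineD (fn m1) (fn m4)) -(fineD (fn m3) (fn m2)); congr fine.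
by move: (mint m1 f) (mint m2 f) (mint m3 f) (mint m4 f) => *; lra.
Qed.

Lemma charge_jordan (nu : {charge set (measurableTypeR R) -> \bar R}) :
  exists mu1 mu2 : {finite_measure set (measurableTypeR R) -> \bar R},
  (forall A, measurable A -> nu A = (mu1 A - mu2 A)%E) /\
  forall f, charge_integral nu D f = mint mu1 f - mint mu2 f.
Proof.
rewrite /charge_integral; set hP := cid _; set hN := cid _.
exists (jordan_pos (projT2 hN)), (jordan_neg (projT2 hN)); split => // A mA.
by rewrite (jordan_decomp (projT2 hN))//= /cadd /= /cscale /= mulN1e.
Qed.

Lemma charge_integral_diff (nu : {charge set (measurableTypeR R) -> \bar R})
    (mu1 mu2 : {finite_measure set (measurableTypeR R) -> \bar R}) (f : R -> R) :
  (forall A, measurable A -> nu A = (mu1 A - mu2 A)%E) -> half_bounded f ->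
  charge_integral nu D f = mint mu1 f - mint mu2 f.
Proof.
move=> h bf; have [m1 [m2 [h' ->]]] := charge_jordan nu.
apply: mint_unique => // A mA; have := h A mA; rewrite (h' A mA).
have fin (m : {finite_measure set (measurableTypeR R) -> \bar R}) : m A = (fine (m A))%:E.
  by rewrite fineK// fin_num_measure.
rewrite (fin m1) (fin m2) (fin mu1) (fin mu2) => -[E]; congr (_%:E); lra.
Qed.

Lemma charge_of_diff (mu1 mu2 : {finite_measure set (measurableTypeR R) -> \bar R}) :
  exists nu : {charge set (measurableTypeR R) -> \bar R}, forall A, nu A = (mu1 A - mu2 A)%E.
Proof.
by exists (cadd (charge_of_finite_measure mu1) (copp (charge_of_finite_measure mu2))).
Qed.

End Representation.

(** * Finite-dimensional spaces, uniform norms and test functions *)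

Section FiniteDimension.
Context {R : realType}.

Lemma row_entry_le (n : nat) (v : 'rV[R]_n) (j : 'I_n) : `|v ord0 j| <= `|v|.
Proof.
by rewrite [leRHS]/Num.norm /= mx_normrE; exact: (le_bigmax _ (fun ij => `|v ij.1 ij.2|) (ord0, j)).
Qed.

(** Linearly independent vectors have bounded coordinates, by compactness of
    the unit sphere of the space of coordinates. *)
Lemma coordinates_bounded (E : normedModType R[i]) (d : nat) (e : 'I_d -> E) :
  (forall c : 'I_d -> R[i], \sum_(i < d) c i *: e i = 0 -> forall i, c i = 0) ->
  exists2 K : R, 0 <= K & forall (c : 'I_d -> R[i]) i, cabs (c i) <= K * rnorm (\sum_(j < d) c j *: e j).
Proof.
move=> indep; have [d0|d0] := posnP d.
  by exists 0 => // c [i id]; exfalso; rewrite d0 in id.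
pose V := 'rV[R]_(d + d).
pose co (v : V) (i : 'I_d) : R[i] := v ord0 (lshift d i) +i* v ord0 (rshift d i).
pose g (v : V) : E := \sum_(i < d) co v i *: e i; pose f v := rnorm (g v).
have gB v w : g v - g w = g (v - w).
  rewrite /g -sumrB; apply: eq_bigr => i _; rewrite -scalerBl; congr (_ *: _).
  by rewrite /co !mxE.
have gZ (a : R) v : g (a *: v) = a%:C *: g v.
  rewrite /g scaler_sumr; apply: eq_bigr => i _; rewrite scalerA; congr (_ *: _).
  by rewrite /co !mxE; apply/eqP; rewrite eq_complex /= !mul0r subr0 addr0 !eqxx.
pose C := \sum_(i < d) 2 * rnorm (e i).
have C0 : 0 <= C by apply: sumr_ge0 => i _; rewrite mulr_ge0// rnorm_ge0.
have fle v : f v <= C * `|v|.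
  apply: (le_trans (rnorm_sum _ _ _)); rewrite /C mulr_suml; apply: ler_sum => i _.
  rewrite rnormZ mulrAC ler_wpM2r ?rnorm_ge0//; apply: (le_trans (cabs_le _)).
  by have := row_entry_le v (lshift d i); have := row_entry_le v (rshift d i); rewrite /co /=; lra.
have cf : continuous f.
  move=> v; have FF := nbhs_filter v; apply/cvgrPdist_le => h h0; have C1 : 0 < C + 1 by lra.
  have nb := @nbhsx_ballx R _ (v : 'rV[R]_(d + d)) (h / (C + 1)) (divr_gt0 h0 C1).
  apply: filterS nb => w; rewrite -ball_normE /= => /ltW hw.
  have fvw : `|f v - f w| <= f (v - w).
    rewrite /f -gB ler_norml; apply/andP; split.
      by have := rnorm_distD 0 (g w) (g v) ; rewrite !subr0; have := rnormD (g v - g w) (g w);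
        have := rnormD (g w - g v) (g v); rewrite !subrK rnormC; lra.
    by have := rnormD (g v - g w) (g w); rewrite subrK; lra.
  apply: (le_trans fvw); apply: (le_trans (fle _)).
  apply: (@le_trans _ _ ((C + 1) * (h / (C + 1)))); last by rewrite mulrC divfK// gt_eqF.
  by apply: ler_pM => //; lra.
pose S : set V := [set v | `|v| = 1].
pose w : V := const_mx 1.
have w0 : 0 < `|w|.
  by apply: lt_le_trans (row_entry_le w (lshift d (Ordinal d0))); rewrite mxE normr1.
have S0 : S !=set0.
  by exists (`|w|^-1 *: w); rewrite /S /= normrZ ger0_norm ?invr_ge0// mulVf// gt_eqF.
have cS : compact S.
  apply: bounded_closed_compact.
    by exists 1; split; [exact: num_real|move=> M M1 v /= ->; exact: ltW].
  have -> : S = (fun v : V => `|v|) @^-1` [set 1] by [].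
  have cn : continuous (fun v : 'rV[R]_(d + d) => `|v|) by exact: norm_continuous.
  by apply: preimage_closed; [move=> v _; exact: cn|exact: closed_eq].
have [v0 Sv0 hmin] := EVT_min_rV S0 cS (continuous_subspaceT cf).
have {}Sv0 : `|v0| = 1 by move: Sv0; rewrite inE.
have fpos : 0 < f v0.
  rewrite lt_neqAle rnorm_ge0 andbT eq_sym; apply/negP => /eqP /rnorm_eq0 gv.
  have z := indep _ gv.
  have v00 : v0 = 0.
    apply/rowP => j; rewrite [RHS]mxE; case: (splitP j) => k jk.
      have -> : j = lshift d k by apply/val_inj.
      by have := congr1 (@complex.Re R) (z k).
    have -> : j = rshift d k by apply/val_inj.
    by have := congr1 (@complex.Im R) (z k).
  by move: Sv0; rewrite v00 normr0 => /eqP; rewrite eq_sym oner_eq0.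
exists (2 / f v0); first by rewrite divr_ge0// ltW.
move=> c i; pose v : V := row_mx (\row_j complex.Re (c j)) (\row_j complex.Im (c j)).
have cv j : co v j = c j by rewrite /co /v row_mxEl row_mxEr !mxE; case: (c j).
have gv : \sum_(j < d) c j *: e j = g v by apply: eq_bigr => j _; rewrite cv.
rewrite gv -/(f v) -(cv i).
have lower : f v0 * `|v| <= f v.
  have [->|vn] := eqVneq v 0; first by rewrite normr0 mulr0 rnorm_ge0.
  have vp : 0 < `|v| by rewrite normr_gt0.
  have := hmin (`|v|^-1 *: v); rewrite inE /S /= normrZ ger0_norm ?invr_ge0// mulVf ?gt_eqF//.
  move=> /(_ erefl); rewrite {2}/f gZ rnormZr ger0_norm ?invr_ge0// -/(f v).
  by rewrite mulrC ler_pdivlMr.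
apply: (@le_trans _ _ (2 * `|v|)).
  apply: (le_trans (cabs_le _)).
  by have := row_entry_le v (lshift d i); have := row_entry_le v (rshift d i); rewrite /co /=; lra.
by rewrite -mulrA ler_wpM2l// mulrC ler_pdivlMr// mulrC.
Qed.

(** Coordinates with respect to a basis are bounded functionals, whatever the norm. *)
Lemma finite_basis (E : normedModType R[i]) (d : nat) (iE : {linear E -> 'cV[R[i]]_d}) :
  bijective iE ->
  exists e : 'I_d -> E, [/\ forall i, iE (e i) = delta_mx i ord0,
    forall y, y = \sum_(i < d) (iE y) i ord0 *: e i &
    exists2 K : R, 0 <= K & forall y i, cabs ((iE y) i ord0) <= K * rnorm y].
Proof.
move=> [jE iK jK]; pose e i := jE (delta_mx i ord0).
have eE i : iE (e i) = delta_mx i ord0 by rewrite /e jK.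
have sumE (c : 'I_d -> R[i]) k : (iE (\sum_(i < d) c i *: e i)) k ord0 = c k.
  rewrite linear_sum summxE (bigD1 k)//= big1 ?addr0; last first.
    move=> i ik; rewrite [iE (_ *: _)]linearZ /= eE !mxE.
    by rewrite eq_sym (negbTE ik) mulr0.
  by rewrite [iE (_ *: _)]linearZ /= eE !mxE !eqxx mulr1.
have yE y : y = \sum_(i < d) (iE y) i ord0 *: e i.
  apply: (can_inj iK); apply/colP => k; by rewrite sumE.
have indep (c : 'I_d -> R[i]) : \sum_(i < d) c i *: e i = 0 -> forall i, c i = 0.
  by move=> h i; rewrite -(sumE c i) h linear0 mxE.
have [K K0 hK] := coordinates_bounded indep.
exists e; split => //; exists K => // y i.
by rewrite {2}(yE y); exact: (hK (fun i => (iE y) i ord0)).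
Qed.

End FiniteDimension.

Section UniformNorm.
Context {R : realType} {E : normedModType R[i]}.
Local Notation lam := (@lebesgue_measure R).

Lemma Linfty_le (f : R -> E) (K : R) : (forall t, 0 <= t -> rnorm (f t) <= K) ->
  (Linfty_norm f <= K%:E)%E.
Proof.
move=> h; apply/ess_supP; exists (`]-oo, 0%R[%classic : set (measurableTypeR R)); split.
- exact: measurable_itv.
- change (lam (`]-oo, 0%R[%classic `&` `[0%R, +oo[%classic) = 0%E).
  rewrite (_ : _ `&` _ = set0) ?measure0//.
  by apply/seteqP; split => // x [] /=; rewrite !in_itv /= andbT => /lt_geF ->.
- move=> x /= hx; rewrite in_itv /= ltNge; apply/negP => x0; apply: hx.
  by rewrite lee_fin; exact: h.
Qed.

(** An interval of positive length starting at [t] contains points at which the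
    essential supremum is a bound; let it shrink to [t]. *)
Lemma Linfty_ge (f : R -> E) (t : R) : {within @half_line R, continuous f} -> 0 <= t ->
  ((rnorm (f t))%:E <= Linfty_norm f)%E.
Proof.
move=> /within_half_lineP cf t0; set L := Linfty_norm f.
have pick (d : R) : 0 < d -> exists s, [/\ t <= s, s < t + d & ((rnorm (f s))%:E <= L)%E].
  move=> d0; apply: contrapT => no.
  have [N [mN N0 hN]] := ess_sup_ge (mrestr lam (@half_line_measurable R)) (fun t => (rnorm (f t))%:E).
  have sub : `[t, t + d[%classic `<=` N `&` `[0%R, +oo[%classic.
    move=> s /=; rewrite in_itv /= => /andP[ts sd]; split; last by rewrite /= in_itv /= andbT (le_trans t0).
    by apply: hN => /= hs; apply: no; exists s.
  have : (lam `[t, (t + d)%R[%classic <= lam (N `&` `[0%R, +oo[%classic))%E.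
    apply: le_measure => //; rewrite inE; first exact: measurable_itv.
    by apply: measurableI => //; exact: measurable_itv.
  have -> : lam (N `&` `[0%R, +oo[%classic) = 0%E by exact: N0.
  rewrite lebesgue_measure_itv /= lte_fin ltrDl d0 -EFinD lee_fin; lra.
case EL : L => [r| |].
- rewrite lee_fin; apply/ler_addgt0Pr => h h0.
  have [d d0 hd] := cf t h t0 h0; have [s [ts sd hs]] := pick d d0.
  rewrite EL lee_fin in hs.
  have := hd s (le_trans t0 ts); rewrite ger0_norm ?subr_ge0// => /(_ ltac:(lra)) h1.
  have := rnormD (f t - f s) (f s); rewrite subrK rnormC; lra.
- exact: leey.
- by have [s [_ _]] := pick 1 ltr01; rewrite EL.
Qed.

End UniformNorm.

Section TestFunctions.
Context {R : realType} {E : normedModType R[i]}.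

Lemma has_derivative_locally0 (f : R -> E) (a b t : R) (l : E) : 0 <= a -> a < t -> t < b ->
  (forall s, a < s -> s < b -> f s = 0) -> has_derivative f t l -> l = 0.
Proof.
move=> a0 at_ tb f0 /has_derivativeP h; apply: rnorm_eq0; apply/eqP; rewrite eq_le rnorm_ge0 andbT.
apply/ler_addgt0Pr => e e0; rewrite add0r; have [d d0 hd] := h e e0.
pose r := Num.min d (b - t) / 2.
have m0 : 0 < Num.min d (b - t) by rewrite lt_min d0 subr_gt0.
have r0 : 0 < r by rewrite divr_gt0.
have rd : r < d.
  have : Num.min d (b - t) <= d by rewrite ge_min lexx.
  by rewrite /r; lra.
have rb : r < b - t.
  have : Num.min d (b - t) <= b - t by rewrite ge_min lexx orbT.
  by rewrite /r; lra.
have rr : `|t + r - t| = r by rewrite addrAC subrr add0r gtr0_norm.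
have := hd (t + r); rewrite rr => /(_ ltac:(lra) rd).
rewrite !f0//; try lra.
have -> : t + r - t = r by lra.
rewrite subrr sub0r rnormN rnormZr gtr0_norm// mulrC ler_pM2r//.
Qed.

(** By uniqueness of derivatives, all derivatives of a test function vanish close to
    0 and far out, so that the extension by zero is smooth. *)
Lemma test_function_bump (u : R -> E) (l : E -> R) : test_function u -> rfunctional l ->
  exists2 v, bump_chain v & forall t, 0 <= t -> v 0%N t = l (u t).
Proof.
move=> [[F F0 hF] cs sub] hl; have [lD lZ [K K0 hK]] := hl.
have l0 : l 0 = 0 by have := rfB hl 0 0; rewrite subrr subrr.
set supp := closure _ in cs sub.
have clS : closed supp by exact: closed_closure.
have [a a0 ha] : exists2 a : R, 0 < a & forall t, supp t -> a <= t.
  have n0 : ~ supp 0 by move=> /sub /=; rewrite ltxx.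
  have : nbhs (0 : R) (~` supp) by apply: open_nbhs_nbhs; split => //; exact: closed_openC.
  move=> /nbhs_ballP[a /= a0 h]; exists a => // t st; rewrite leNgt; apply/negP => ta.
  have t0 : 0 < t by exact: sub.
  by apply: (h t) => //; rewrite /ball /= sub0r normrN gtr0_norm.
have [b hb] : exists b : R, forall t, supp t -> t <= b.
  have [M [_ hM]] := compact_bounded cs.
  exists (M + 1) => t /(hM (M + 1) ltac:(lra)) /=; apply: le_trans; exact: ler_norm.
have u0 t : 0 <= t -> t < a \/ b < t -> u t = 0.
  move=> t0 h; apply: contrapT => ut.
  have st : supp t by apply: subset_closure; split.
  by case: h => h; [have := ha t st|have := hb t st]; rewrite leNgt h.
have Fz n t : 0 < t -> t < a \/ b < t -> F n t = 0.
  elim: n t => [|n ih] t t0; first by rewrite F0; apply: u0; exact: ltW.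
  move=> [h|h].
    apply: (@has_derivative_locally0 (F n) 0 a t) => //; last exact: hF.
    by move=> s s0 sa; apply: ih => //; left.
  apply: (@has_derivative_locally0 (F n) (Num.max b 0) (t + 1) t).
  - by rewrite le_max lexx orbT.
  - by rewrite gt_max h.
  - lra.
  - by move=> s; rewrite gt_max => /andP[s1 s2] _; apply: ih => //; right.
  - exact: hF.
pose v n t := if 0 < t then l (F n t) else 0.
have vz n t : t < a \/ b < t -> v n t = 0.
  by move=> h; rewrite /v; case: ifP => // t0; rewrite Fz.
exists v; last first.
  move=> t; rewrite le_eqVlt => /orP[/eqP <-|t0]; last by rewrite /v t0 F0.
  by rewrite vz ?u0//; left.
split.
  move=> n t; have [t0|t0] := ltP 0 t; last first.
    apply: (@near_eq_is_derive _ _ _ (cst 0)).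
      near=> s.
      have sa : s < a by near: s; apply: lt_nbhsl; exact: le_lt_trans a0.
      by rewrite vz//; left.
    by apply: is_derive_eq; rewrite vz//; left; exact: le_lt_trans a0.
  apply: is_derive_eps => e e0; have K1 : 0 < K + 1 by lra.
  have [d d0 hd] := (has_derivativeP _ _ _).1 (hF n t t0) _ (divr_gt0 e0 K1).
  exists (Num.min d t); first by rewrite lt_min d0.
  move=> s; rewrite lt_min => /andP[sd st].
  have s0 : 0 < s by have := ler_norm (t - s); rewrite distrC => h; have := le_lt_trans h st; lra.
  rewrite /v s0 t0 -(rfB hl) -lZ -(rfB hl); apply: (le_trans (hK _)).
  apply: (@le_trans _ _ ((K + 1) * (e / (K + 1) * `|s - t|))).
    by apply: ler_pM => //; [exact: rnorm_ge0|lra|apply: hd => //; exact: ltW].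
  by rewrite mulrA mulrCA mulfV ?mulr1// gt_eqF.
exists (a / 2), (b + 1); split; first by rewrite divr_gt0.
move=> n t h; apply: vz; case: h => h; [left|right]; lra.
Unshelve. all: by end_near. Qed.

End TestFunctions.

(** * Kernels of functionals of the output *)

Section Growth.
Context {R : realType}.

Lemma exp_growth_add (w : R) f g : exp_growth w f -> exp_growth w g -> exp_growth w (fun t => f t + g t).
Proof.
move=> [M M0 hM] [N N0 hN]; exists (M + N); first exact: addr_ge0.
move=> t t0; rewrite mulrDl; apply: (le_trans (ler_normD _ _)); apply: lerD; [exact: hM|exact: hN].
Qed.

Lemma exp_growth_scale (w a : R) f : exp_growth w f -> exp_growth w (fun t => a * f t).
Proof.
move=> [M M0 hM]; exists (`|a| * M); first by rewrite mulr_ge0.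
by move=> t t0; rewrite normrM -mulrA ler_wpM2l// hM.
Qed.

Lemma exp_growth_ramp (b g w : R) k : 0 < w -> continuous k -> exp_growth w k ->
  exp_growth w (ramp b g k).
Proof.
move=> w0 ck gk; have cp := continuous_prim ck.
have gp := exp_growth_prim w0 ck gk; have gpp := exp_growth_prim w0 cp gp.
have gi := exp_growth_id w0; have gc := exp_growth_cst (- k 0) w0.
have -> : ramp b g k = (fun t => k t + (- (2 * b) * prim k t + (b ^+ 2 * prim (prim k) t +
   ((g + k 0 * b) * t + - k 0)))) by apply/funext => t; rewrite /ramp; ring.
apply: exp_growth_add => //.
apply: exp_growth_add; first exact: exp_growth_scale.
apply: exp_growth_add; first exact: exp_growth_scale.
by apply: exp_growth_add => //; exact: exp_growth_scale.
Qed.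

Lemma exp_growth_hinge (mu : {finite_measure set (measurableTypeR R) -> \bar R}) (w : R) :
  0 < w -> exp_growth w (hinge_int mu).
Proof.
move=> w0; have [M M0 hM] := exp_growth_scale (mass mu) (exp_growth_id w0).
exists M => // t t0; apply: le_trans (hM t t0).
have := hinge_int_lipschitz mu t 0; rewrite hinge_int0 !subr0 => /le_trans; apply.
by rewrite mulrC normrM (ger0_norm (mass_ge0 mu)).
Qed.

(** The case of exponential growth reduces to bounded functions by a factor
    [exp (- w t)]. *)
Lemma lerch_exp (Psi : R -> R) (w : R) : continuous Psi -> exp_growth w Psi ->
  (forall s : R, w < s -> (fun n : nat => rint n%:R (fun t => expR (- (s * t)) * Psi t)) @ \oo --> (0 : R)) ->
  forall t, 0 <= t -> Psi t = 0.
Proof.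
move=> cP [M M0 hM] h t t0.
have cPhi : continuous (fun t => expR (- (w * t)) * Psi t).
  by apply: ccontM => //; exact: ccont_expN.
have := @lerch R _ M cPhi _ _ t t0.
have z : expR (- (w * t)) != 0 by rewrite gt_eqF ?expR_gt0.
suff e : expR (- (w * t)) * Psi t = 0 by move/eqP: e; rewrite mulf_eq0 (negbTE z) => /eqP.
apply: (@lerch R _ M cPhi) => //.
  move=> s s0; rewrite normrM ger0_norm ?expR_ge0// expRN mulrC ler_pdivrMr ?expR_gt0//.
  exact: hM.
move=> k; have -> : (fun n : nat => rint n%:R (fun t => expR (- (k.+1%:R * t)) * (expR (- (w * t)) * Psi t))) =
    (fun n : nat => rint n%:R (fun t => expR (- ((w + k.+1%:R) * t)) * Psi t)).
  apply/funext => n; apply: eq_rint => s _ _; rewrite mulrA -expRD; congr (expR _ * _); ring.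
by apply: h; rewrite ltrDl.
Qed.

Local Notation D := (`[0%R, +oo[%classic : set (measurableTypeR R)).

(** Only the Laplace integrals of the kernel enter the formula for the transfer
    function. *)
Lemma measure_of_kernel (p : R -> R) (c : R) : continuous p -> p 0 = 0 ->
  (forall v, bump_chain v -> (forall s, `|v 0%N s| <= 1) ->
     forall t, 0 <= t -> `|rint t (fun s => v 2%N (t - s) * p s)| <= c) ->
  exists nu : {charge set (measurableTypeR R) -> \bar R},
    (forall A : set (measurableTypeR R), measurable A -> A `<=` `]-oo, 0%R[%classic -> nu A = 0%E) /\
    forall (sg : R) (d : nat -> R -> R), 0 < sg ->
      (forall m t, is_derive t (1 : R) (d m) (d m.+1 t)) ->
      (forall m, exp_growth (- sg) (d m)) ->
      (fun n : nat => rint n%:R (fun t => d 2%N t * p t)) @ \oo --> charge_integral nu D (d 0%N).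
Proof.
move=> cp p0 H; have [m1 [m2 [hp n1 n2]]] := hinge_representation cp p0 H.
have [nu nuE] := charge_of_diff m1 m2; exists nu; split.
  by move=> A mA An; rewrite nuE n1// n2// sube0.
move=> sg d sg0 dd gd; have cd m : continuous (d m) := is_derive_continuous (dd m).
have bd : half_bounded (d 0%N).
  split; first exact: continuous_measurable_fun.
  have [M M0 hM] := gd 0%N; exists M => r r0; apply: (le_trans (hM r r0)).
  by rewrite ler_piMr// -expR0 ler_expR mulNr oppr_le0 mulr_ge0// ltW.
rewrite (charge_integral_diff (fun A _ => nuE A) bd).
have -> : (fun n : nat => rint n%:R (fun t => d 2%N t * p t)) =
  (fun n : nat => rint n%:R (fun t => d 2%N t * hinge_int m1 t) - rint n%:R (fun t => d 2%N t * hinge_int m2 t)).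
  apply/funext => n.
  have c1 := ccontM (cd 2%N) (@continuous_hinge_int R m1).
  have c2 := ccontM (cd 2%N) (@continuous_hinge_int R m2).
  have c2' : continuous (fun t => -1 * (d 2%N t * hinge_int m2 t)) by exact: ccontZ.
  rewrite -mulN1r -(rintZ _ _ c2) -(rintD _ c1 c2'); apply: eq_rint => s s0 _.
  by rewrite hp//; ring.
have h := cvgB (@hinge_laplace R m1 sg d sg0 dd gd) (@hinge_laplace R m2 sg d sg0 dd gd).
exact: h.
Qed.

Definition kernel_bounded (p : R -> R) := exists2 C : R, 0 <= C & forall v B t,
  bump_chain v -> 0 <= t -> (forall s, 0 <= s -> `|v 0%N s| <= B) ->
  `|rint t (fun s => v 2%N (t - s) * p s)| <= C * B.

Lemma kernel_bounded_hinge (p : R -> R) (m1 m2 : {finite_measure set (measurableTypeR R) -> \bar R}) :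
  (forall t, 0 <= t -> p t = hinge_int m1 t - hinge_int m2 t) -> kernel_bounded p.
Proof.
move=> hp; exists (mass m1 + mass m2); first by rewrite addr_ge0// mass_ge0.
move=> v B t bv t0 hB.
have cv : continuous (fun s => v 2%N (t - s)).
  by apply: (@ccont_rev _ (v 2%N)); exact: bump_continuous.
have c1 := ccontM cv (@continuous_hinge_int R m1).
have c2 := ccontM cv (@continuous_hinge_int R m2).
have c2' : continuous (fun s => -1 * (v 2%N (t - s) * hinge_int m2 s)) by exact: ccontZ.
have -> : rint t (fun s => v 2%N (t - s) * p s) =
    rint t (fun s => v 2%N (t - s) * hinge_int m1 s) - rint t (fun s => v 2%N (t - s) * hinge_int m2 s).
  rewrite -mulN1r -(rintZ _ _ c2) -(rintD _ c1 c2'); apply: eq_rint => s s0 _.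
  by rewrite hp//; ring.
apply: (le_trans (ler_normB _ _)); rewrite mulrDl; apply: lerD; rewrite mulrC;
  exact: hinge_conv_bound.
Qed.

Lemma kernel_bounded_scale (a : R) (p q : R -> R) : continuous p ->
  (forall t, 0 <= t -> q t = a * p t) -> kernel_bounded p -> kernel_bounded q.
Proof.
move=> cp pq [C C0 hC]; exists (`|a| * C); first by rewrite mulr_ge0.
move=> v B t bv t0 hB.
have -> : rint t (fun s => v 2%N (t - s) * q s) = a * rint t (fun s => v 2%N (t - s) * p s).
  rewrite -rintZ; last by apply: ccontM => //; apply: (@ccont_rev _ (v 2%N)); exact: bump_continuous.
  by apply: eq_rint => s s0 _; rewrite pq//; ring.
by rewrite normrM -mulrA ler_wpM2l// hC.
Qed.

End Growth.

Section SystemKernel.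
Context {R : realType} {U X Y : completeNormedModType R[i]} (S : system_node U X Y).
Context (b : R) (hb : (growth_bound (sn_T S) < b%:E)%E).
Context (eta : Y -> R) (heta : rfunctional eta).
Local Notation D := (`[0%R, +oo[%classic : set (measurableTypeR R)).

Local Notation A := (sn_A S).
Local Notation T := (sn_T S).
Local Notation pfun := (pfun S b).

Lemma continuous_pfun e : continuous (pfun eta e).
Proof. by apply: continuous_ramp; exact: (@continuous_kfun _ _ _ _ S b hb eta heta e). Qed.

Lemma pfun0 e : pfun eta e 0 = 0.
Proof. exact: ramp0. Qed.

Lemma ell_i (a : R) (eta2 : Y -> R) x : (forall y, eta ('i%C *: y) = a * eta2 y) ->
  ell S b eta ('i%C *: x) = a * ell S b eta2 x.
Proof.
move=> h; have hA := sn_generates S.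
have [Q [Qc Q1 Q2]] := sn_beta_resolvent S.
have d0 : dom A 0 by have := proj1 (Q1 0); rewrite linear0.
have [z dz hz] := resolvent_half_plane hA Qc Q1 Q2 x (half_b hb).
have [dzi Azi] := dom_lin 'i%C dz d0; rewrite (A0 Q1) !addr0 in dzi Azi.
have C0 : sn_C S 0 = 0.
  by have := @sn_C_linear _ _ _ _ S 1 _ _ d0 d0; rewrite !scale1r addr0 => /eqP; rewrite -subr_eq subrr => /eqP.
have xi : 'i%C *: x = b%:C *: ('i%C *: z) - A ('i%C *: z).
  by rewrite Azi -hz scalerBr !scalerA mulrC.
rewrite /ell xi (resolvent_dom hb dzi) -hz (resolvent_dom hb dz) -h; congr eta.
by have := @sn_C_linear _ _ _ _ S 'i%C _ _ dz d0; rewrite C0 !addr0.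
Qed.

(** Multiplication of the input direction by [i] passes through the system, and acts
    on the real and imaginary parts of a coordinate by exchanging them up to a sign. *)
Lemma pfun_i (a : R) (eta2 : Y -> R) (h2 : rfunctional eta2) e t :
  (forall y, eta ('i%C *: y) = a * eta2 y) -> 0 <= t ->
  pfun eta ('i%C *: e) t = a * pfun eta2 e t.
Proof.
move=> h t0.
have kE s : kfun S b eta ('i%C *: e) s = a * kfun S b eta2 e s.
  rewrite /kfun (rvecZ hb) -(ell_i _ h); congr (ell _ _ _ _).
  by rewrite [T _ (_ *: _)]linearZ.
have gE : gfun S b eta ('i%C *: e) = a * gfun S b eta2 e.
  by rewrite /gfun [sn_G S _ ('i%C *: e)]linearZ; exact: h.
have ck2 : continuous (kfun S b eta2 e) := @continuous_kfun _ _ _ _ S b hb eta2 h2 e.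
have ck1 : continuous (kfun S b eta ('i%C *: e)) := @continuous_kfun _ _ _ _ S b hb eta heta _.
have p1 s : 0 <= s -> prim (kfun S b eta ('i%C *: e)) s = a * prim (kfun S b eta2 e) s.
  move=> s0; rewrite -!rint_prim// -rintZ//.
  by apply: eq_rint => r _ _; exact: kE.
have p2 : prim (prim (kfun S b eta ('i%C *: e))) t = a * prim (prim (kfun S b eta2 e)) t.
  have cp := continuous_prim ck2.
  rewrite -(rint_prim t0 (continuous_prim ck1)) -(rint_prim t0 cp) -rintZ//.
  by apply: eq_rint => r r0 _; rewrite p1.
rewrite /pfun /ramp p2 (p1 t t0) gE !kE; ring.
Qed.

(** The kernel and the [hinge_int] of the measure have the same Laplace transform at
    large real points, hence agree. *)
Lemma pfun_hinge (e : U) (nu : {charge set (measurableTypeR R) -> \bar R}) (s0 : R) :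
  (forall s : R, s0 < s -> half_plane (growth_bound T) s%:C -> 0 < s ->
     eta (sn_G S s%:C e) = charge_integral nu D (laplace_re s%:C)) ->
  kernel_bounded (pfun eta e).
Proof.
move=> hG; have [m1 [m2 [nuE hnu]]] := charge_jordan nu.
have ck : continuous (kfun S b eta e) := @continuous_kfun _ _ _ _ S b hb eta heta e.
have [w [w0 ws wb gw]] : exists w : R, [/\ 0 < w, s0 <= w, b <= w & exp_growth w (pfun eta e)].
  have [w1 w1b g1] := functional_orbit_growth (ell_rfunctional hb heta) (rvec S b e) hb.
  exists (Num.max 1 (Num.max s0 b)); split.
  - by rewrite lt_max ltr01.
  - by rewrite !le_max lexx orbT.
  - by rewrite !le_max lexx !orbT.
  - apply: exp_growth_ramp => //; first by rewrite lt_max ltr01.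
    apply: (@exp_growth_le _ w1); first by rewrite !le_max (ltW w1b) !orbT.
    have [M M0 hM] := g1; exists M => // t t0; rewrite /kfun (max_idPl t0); exact: hM.
pose Psi t := pfun eta e t + -1 * (hinge_int m1 t + -1 * hinge_int m2 t).
have ch m := @continuous_hinge_int R m.
have cPsi : continuous Psi.
  apply: ccontD; first exact: continuous_pfun.
  by apply: ccontZ; apply: ccontD => //; exact: ccontZ.
have gPsi : exp_growth w Psi.
  apply: exp_growth_add => //; apply: exp_growth_scale; apply: exp_growth_add.
    exact: exp_growth_hinge.
  by apply: exp_growth_scale; exact: exp_growth_hinge.
suff Psi0 : forall t, 0 <= t -> Psi t = 0.
  by apply: (@kernel_bounded_hinge _ _ m1 m2) => t t0; have := Psi0 t t0; rewrite /Psi; lra.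
apply: (lerch_exp cPsi gPsi) => s wlts.
have sp : 0 < s := lt_trans w0 wlts.
have hs : half_plane (growth_bound T) s%:C.
  rewrite /half_plane /=; apply: lt_trans hb _; rewrite lte_fin; exact: le_lt_trans wlts.
have gl m : exp_growth (- s) (lre s%:C m) := exp_growth_lre s%:C m.
have cE t : cexp s%:C t = (expR (- (s * t)))%:C.
  by rewrite /cexp /laplace_re /laplace_im /= mul0r cos0 sin0 mulr1 mulr0 oppr0.
have sqE t : (- s%:C) ^+ 2 * cexp s%:C t = (s ^+ 2 * expR (- (s * t)))%:C.
  rewrite cE sqrrN expr2; apply/eqP; rewrite eq_complex /=.
  by apply/andP; split; apply/eqP; ring.
have l2 t : lre s%:C 2 t = s ^+ 2 * expR (- (s * t)) by rewrite /lre sqE.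
have li2 t : lim_ s%:C 2 t = 0 by rewrite /lim_ sqE.
have l0 : lre s%:C 0 = laplace_re s%:C by apply/funext => t; rewrite /lre expr0 mul1r.
have h1 := @hinge_laplace R m1 s _ sp (is_derive_lre s%:C) gl.
have h2 := @hinge_laplace R m2 s _ sp (is_derive_lre s%:C) gl.
have h3 := transfer_formula hb heta (e := e) hs sp.
have sws : s0 < s := le_lt_trans ws wlts.
rewrite (hG s sws hs sp) hnu -l0 in h3.
have h4 := cvgB h3 (cvgB h1 h2); rewrite subrr in h4.
refine (@eq_cvg_seq R _ _ _ _ _); first by apply: (@cvg0_scale R (s ^- 2)); exact: h4.
move=> n; rewrite !fctE.
have cl : continuous (fun t => expR (- (s * t))) by exact: ccont_expN.
have E1 (p : R -> R) : continuous p -> rint n%:R (fun t => lre s%:C 2 t * p t) =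
    s ^+ 2 * rint n%:R (fun t => expR (- (s * t)) * p t).
  move=> cp; rewrite -rintZ; last exact: ccontM.
  by apply: eq_rint => t _ _; rewrite l2 mulrA.
have E2 : rint n%:R (fun t => lim_ s%:C 2 t * pfun eta ('i%C *: e) t) = 0.
  rewrite (@eq_rint _ _ _ (fun t => 0 * 0)); last by move=> t _ _; rewrite li2 !mul0r.
  by rewrite (@rintZ _ _ 0 (fun=> 0)) ?mul0r//; exact: ccont_cst.
have cp := @continuous_pfun e.
rewrite E2 addr0 !E1//.
have E3 : rint n%:R (fun t => expR (- (s * t)) * Psi t) =
    rint n%:R (fun t => expR (- (s * t)) * pfun eta e t) +
    -1 * (rint n%:R (fun t => expR (- (s * t)) * hinge_int m1 t) +
          -1 * rint n%:R (fun t => expR (- (s * t)) * hinge_int m2 t)).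
  have c0 := ccontM cl cp; have c1 := ccontM cl (ch m1); have c2 := ccontM cl (ch m2).
  have c2' : continuous (fun t => -1 * (expR (- (s * t)) * hinge_int m2 t)) by exact: ccontZ.
  have c12 := ccontD c1 c2'.
  have c12' : continuous (fun t => -1 * (expR (- (s * t)) * hinge_int m1 t + -1 * (expR (- (s * t)) * hinge_int m2 t))).
    exact: ccontZ.
  rewrite -(rintZ _ _ c2) -(rintD _ c1 c2') -(rintZ _ _ c12) -(rintD _ c0 c12').
  by apply: eq_rint => t _ _; rewrite /Psi; ring.
rewrite E3; do 3 (move: (rint _ _) => ?); field; rewrite gt_eqF//.
Qed.

End SystemKernel.

(** * Stability and representing measures *)

Section MatrixMeasures.
Context {R : realType}.
Local Notation D := (`[0%R, +oo[%classic : set (measurableTypeR R)).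

Lemma finite_measure_partition (m : {finite_measure set (measurableTypeR R) -> \bar R}) N
    (E : 'I_N -> set (measurableTypeR R)) :
  (forall k, measurable (E k)) -> trivIset setT E ->
  \sum_(k < N) fine (m (E k)) <= fine (m setT).
Proof.
move=> mE tE; have fin A : measurable A -> m A = (fine (m A))%:E.
  by move=> mA; rewrite fineK// fin_num_measure.
have mU : measurable (\big[setU/set0]_(k < N) E k) by apply: bigsetU_measurable.
rewrite -lee_fin -(fin setT measurableT) -sumEFin.
under eq_bigr => k _ do rewrite -(fin _ (mE k)).
rewrite -(measure_semi_additive_ord _ mE tE mU).
by apply: le_measure; rewrite ?inE.
Qed.

(** In terms of the Jordan decomposition, both parts have finite mass. *)
Lemma charge_variation_bounded (nu : {charge set (measurableTypeR R) -> \bar R}) :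
  exists K : R, forall N (E : 'I_N -> set (measurableTypeR R)),
    (forall k, measurable (E k)) -> trivIset setT E -> \sum_(k < N) `|fine (nu (E k))| <= K.
Proof.
have [m1 [m2 [nuE _]]] := charge_jordan nu.
exists (fine (m1 setT) + fine (m2 setT)) => N E mE tE.
apply: le_trans (lerD (finite_measure_partition m1 mE tE) (finite_measure_partition m2 mE tE)).
rewrite -big_split /=; apply: ler_sum => k _; rewrite nuE// fineB ?fin_num_measure//.
by apply: (le_trans (ler_normB _ _)); rewrite !ger0_norm// fine_ge0.
Qed.

(** The norm of a nonzero matrix is the modulus of one of its entries. *)
Lemma Re_mx_norm_le (m n : nat) (M : 'M[R[i]]_(m, n)) :
  complex.Re (mx_norm M) <= \sum_(i < m) \sum_(j < n) (`|complex.Re (M i j)| + `|complex.Im (M i j)|).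
Proof.
have s0 i j : 0 <= `|complex.Re (M i j)| + `|complex.Im (M i j)| by rewrite addr_ge0.
have [->|/mx_norm_neq0[[i j] /= ->]] := eqVneq (mx_norm M) 0.
  by apply: sumr_ge0 => i _; apply: sumr_ge0.
apply: (@le_trans _ _ (`|complex.Re (M i j)| + `|complex.Im (M i j)|)); first exact: cabs_le.
rewrite (bigD1 i)//= (bigD1 j)//= -addrA lerDl addr_ge0//; first exact: sumr_ge0.
by apply: sumr_ge0 => k _; apply: sumr_ge0.
Qed.

Lemma mm_total_variation_finite (m n : nat) (h : matrix_measure R m n) : (mm_total_variation h < +oo)%E.
Proof.
have [Kr hr] := choice (fun ij : 'I_m * 'I_n => charge_variation_bounded (mm_re h ij.1 ij.2)).
have [Ki hi] := choice (fun ij : 'I_m * 'I_n => charge_variation_bounded (mm_im h ij.1 ij.2)).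
apply: (@le_lt_trans _ _ (\sum_(i < m) \sum_(j < n) (Kr (i, j) + Ki (i, j)))%:E); last exact: ltry.
apply: ge_ereal_sup => _ [N [E [mE tE ->]]]; rewrite lee_fin.
apply: (@le_trans _ _ (\sum_(k < N) \sum_(i < m) \sum_(j < n)
    (`|fine (mm_re h i j (E k))| + `|fine (mm_im h i j (E k))|))).
  apply: ler_sum => k _; apply: (le_trans (Re_mx_norm_le _)).
  by apply: ler_sum => i _; apply: ler_sum => j _; rewrite !mxE.
rewrite exchange_big /=; apply: ler_sum => i _; rewrite exchange_big /=; apply: ler_sum => j _.
by rewrite big_split /=; apply: lerD; [exact: (hr (i, j))|exact: (hi (i, j))].
Qed.

Lemma charge_integral0 (nu : {charge set (measurableTypeR R) -> \bar R}) :
  charge_integral nu D (fun=> 0) = 0.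
Proof. by have [m1 [m2 [_ ->]]] := charge_jordan nu; rewrite !mint_cst !mul0r subrr. Qed.

End MatrixMeasures.

Section Coordinates.
Context {R : realType} {E : normedModType R[i]} {d : nat} (iE : {linear E -> 'cV[R[i]]_d}).

Definition coord_re (i : 'I_d) (y : E) : R := complex.Re ((iE y) i ord0).
Definition coord_im (i : 'I_d) (y : E) : R := complex.Im ((iE y) i ord0).

Context (K : R) (K0 : 0 <= K) (hK : forall y i, cabs ((iE y) i ord0) <= K * rnorm y).

Lemma coordD x y i : (iE (x + y)) i ord0 = (iE x) i ord0 + (iE y) i ord0.
Proof. by rewrite [iE (x + y)]linearD mxE. Qed.

Lemma coordZ c x i : (iE (c *: x)) i ord0 = c * (iE x) i ord0.
Proof. by rewrite [iE (c *: x)]linearZ /= mxE. Qed.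

Lemma coord_re_rfunctional i : rfunctional (coord_re i).
Proof.
split.
- by move=> x y; rewrite /coord_re coordD cReD.
- by move=> r x; rewrite /coord_re coordZ cReM /= mul0r subr0.
- by exists K => // x; apply: le_trans (hK x i); exact: cabs_Re.
Qed.

Lemma coord_im_rfunctional i : rfunctional (coord_im i).
Proof.
split.
- by move=> x y; rewrite /coord_im coordD cImD.
- by move=> r x; rewrite /coord_im coordZ cImM /= mul0r addr0.
- by exists K => // x; apply: le_trans (hK x i); exact: cabs_Im.
Qed.

Lemma coord_re_i i y : coord_re i ('i%C *: y) = -1 * coord_im i y.
Proof. by rewrite /coord_re /coord_im coordZ cReM /=; ring. Qed.

Lemma coord_im_i i y : coord_im i ('i%C *: y) = 1 * coord_re i y.
Proof. by rewrite /coord_re /coord_im coordZ cImM /=; ring. Qed.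

End Coordinates.

Section Equivalence.
Context {R : realType} {dU dY : nat} {U X Y : completeNormedModType R[i]}.
Context (iU : {linear U -> 'cV[R[i]]_dU}) (iY : {linear Y -> 'cV[R[i]]_dY}).
Context (S : system_node U X Y).
Context (b : R) (hb : (growth_bound (sn_T S) < b%:E)%E).
Context (eU : 'I_dU -> U) (eU1 : forall j, iU (eU j) = delta_mx j ord0).
Context (eU2 : forall u, u = \sum_(j < dU) (iU u) j ord0 *: eU j).
Context (KU : R) (KU0 : 0 <= KU) (hKU : forall u j, cabs ((iU u) j ord0) <= KU * rnorm u).
Context (eY : 'I_dY -> Y) (eY2 : forall y, y = \sum_(i < dY) (iY y) i ord0 *: eY i).
Context (KY : R) (KY0 : 0 <= KY) (hKY : forall y i, cabs ((iY y) i ord0) <= KY * rnorm y).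

Local Notation D := (`[0%R, +oo[%classic : set (measurableTypeR R)).
Local Notation re := (coord_re iY).
Local Notation im := (coord_im iY).
Local Notation pfun := (pfun S b).

Let fre i : rfunctional (re i) := coord_re_rfunctional KY0 hKY i.
Let fim i : rfunctional (im i) := coord_im_rfunctional KY0 hKY i.

(** By the output formula, stability for the inputs [v 0 *: e] bounds the convolution
    of [v 2] with the kernel by the uniform norm of [v 0]. *)
Lemma kernel_of_BIBO (c : R) (eta : Y -> R) (e : U) : 0 < c -> rfunctional eta ->
  (forall u x y, classical_solution S u x y -> x 0 = 0 -> test_function u ->
    [/\ {within @half_line R, continuous y},
        exists M : R, forall t, 0 <= t -> rnorm (y t) <= M &
        (Linfty_norm y <= c%:E * Linfty_norm u)%E]) ->
  exists nu : {charge set (measurableTypeR R) -> \bar R},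
    (forall A : set (measurableTypeR R), measurable A -> A `<=` `]-oo, 0%R[%classic -> nu A = 0%E) /\
    forall (sg : R) (d : nat -> R -> R), 0 < sg ->
      (forall m t, is_derive t (1 : R) (d m) (d m.+1 t)) ->
      (forall m, exp_growth (- sg) (d m)) ->
      (fun n : nat => rint n%:R (fun t => d 2%N t * pfun eta e t)) @ \oo --> charge_integral nu D (d 0%N).
Proof.
move=> c0 heta hbibo; have [_ _ [K K0 hK]] := heta.
apply: (@measure_of_kernel R (pfun eta e) (K * (c * rnorm e))).
- exact: (continuous_pfun hb heta).
- exact: pfun0.
move=> v bv v1 t t0.
have [x [y [hs x0]]] := classical_solution_exists S e bv.
have [yc _ hL] := hbibo _ _ _ hs x0 (bump_test_function e bv).
have hu : (Linfty_norm (fun t => (v 0%N t)%:C *: e) <= (rnorm e)%:E)%E.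
  by apply: Linfty_le => s _; rewrite rnormZr -[leRHS]mul1r ler_wpM2r// rnorm_ge0.
have hy : rnorm (y t) <= c * rnorm e.
  rewrite -lee_fin EFinM; apply: (le_trans (Linfty_ge yc t0)); apply: (le_trans hL).
  by apply: lee_wpmul2l => //; rewrite lee_fin ltW.
have := @output_formula _ _ _ _ S b hb eta heta 1 (fun=> v) (fun=> e) _ x y (fun=> bv) _ hs x0 t t0.
rewrite big_ord1 => <-; last by move=> s _; rewrite big_ord1.
by apply: (le_trans (hK _)); rewrite ler_wpM2l.
Qed.

(** The real and imaginary parts of an entry of [h] represent the kernels of the real
    and of the imaginary part of that output coordinate; [pfun_i] combines them as the
    complex product requires. *)
Lemma laplace_of_BIBO : BIBO_stable S ->
  exists h : matrix_measure R dY dU, (mm_total_variation h < +oo)%E /\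
    forall s : R[i], half_plane 0%E s -> half_plane (growth_bound (sn_T S)) s ->
      forall u : U, iY (sn_G S s u) = laplace h s *m iU u.
Proof.
move=> [c c0 hbibo].
have [nr hr] := choice (fun ij : 'I_dY * 'I_dU => kernel_of_BIBO (eU ij.2) c0 (fre ij.1) hbibo).
have [ni hi] := choice (fun ij : 'I_dY * 'I_dU => kernel_of_BIBO (eU ij.2) c0 (fim ij.1) hbibo).
have hl i j (A : set (measurableTypeR R)) : measurable A -> A `<=` `]-oo, 0%R[%classic ->
    nr (i, j) A = 0%E /\ ni (i, j) A = 0%E.
  by move=> mA An; split; [exact: (hr (i, j)).1|exact: (hi (i, j)).1].
pose h := @Build_matrix_measure R dY dU (fun i j => nr (i, j)) (fun i j => ni (i, j)) hl.
exists h; split; first exact: mm_total_variation_finite.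
move=> s s0 hs u; have sp : 0 < complex.Re s by move: s0; rewrite /half_plane /= lte_fin.
suff key i j : (iY (sn_G S s (eU j))) i ord0 = laplace h s i j.
  apply/colP => i; rewrite {1}(eU2 u) [sn_G S s _]linear_sum [iY _]linear_sum summxE mxE.
  apply: eq_bigr => j _; rewrite [sn_G S s (_ *: _)]linearZ coordZ key mulrC.
  by [].
have rE : lre s 0 = laplace_re s by apply/funext => t; rewrite /lre expr0 mul1r.
have iE : lim_ s 0 = laplace_im s by apply/funext => t; rewrite /lim_ expr0 mul1r.
have r1 := (hr (i, j)).2 _ _ sp (is_derive_lre s) (exp_growth_lre s).
have r2 := (hr (i, j)).2 _ _ sp (is_derive_lim s) (exp_growth_lim s).
have i1 := (hi (i, j)).2 _ _ sp (is_derive_lre s) (exp_growth_lre s).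
have i2 := (hi (i, j)).2 _ _ sp (is_derive_lim s) (exp_growth_lim s).
rewrite /= rE iE in r1 r2 i1 i2.
have t1 := transfer_formula hb (fre i) (e := eU j) hs sp.
have t2 := transfer_formula hb (fim i) (e := eU j) hs sp.
have cint m (p : R -> R) : continuous p -> continuous (fun t => lim_ s m t * p t).
  by move=> cp; apply: ccontM => //; exact: continuous_lim.
have cr := continuous_pfun hb (fre i) (e := eU j); have ci := continuous_pfun hb (fim i) (e := eU j).
have Er (n : nat) : rint n%:R (fun t => lim_ s 2 t * pfun (re i) ('i%C *: eU j) t) =
    -1 * rint n%:R (fun t => lim_ s 2 t * pfun (im i) (eU j) t).
  rewrite -rintZ; last exact: cint.
  apply: eq_rint => t t0 _.
  by rewrite (pfun_i hb (fre i) (fim i) (eU j) (coord_re_i iY i) t0); ring.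
have Ei (n : nat) : rint n%:R (fun t => lim_ s 2 t * pfun (im i) ('i%C *: eU j) t) =
    1 * rint n%:R (fun t => lim_ s 2 t * pfun (re i) (eU j) t).
  rewrite -rintZ; last exact: cint.
  apply: eq_rint => t t0 _.
  by rewrite (pfun_i hb (fim i) (fre i) (eU j) (coord_im_i iY i) t0); ring.
have u1 := cvgB r1 i2; have u2 := cvgD i1 r2.
have e1 : coord_re iY i (sn_G S s (eU j)) =
    charge_integral (nr (i, j)) D (laplace_re s) - charge_integral (ni (i, j)) D (laplace_im s).
  apply: (cvg_unique (@Rhausdorff R) t1); refine (@eq_cvg_seq R _ _ _ _ _); first exact: u1.
  by move=> n; rewrite !fctE Er mulN1r.
have e2 : coord_im iY i (sn_G S s (eU j)) =
    charge_integral (ni (i, j)) D (laplace_re s) + charge_integral (nr (i, j)) D (laplace_im s).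
  apply: (cvg_unique (@Rhausdorff R) t2); refine (@eq_cvg_seq R _ _ _ _ _); first exact: u2.
  by move=> n; rewrite !fctE Ei mul1r.
rewrite mxE; apply/eqP; rewrite eq_complex /=.
by apply/andP; split; apply/eqP; [exact: e1|rewrite addrC; exact: e2].
Qed.

(** Scalar inputs are real; complex directions are covered by a basis of [U] together
    with its multiples by [i]. *)
Definition real_basis (k : 'I_(dU + dU)) : U :=
  match fintype.split k with inl j => eU j | inr j => 'i%C *: eU j end.
Definition real_coord (k : 'I_(dU + dU)) : U -> R :=
  match fintype.split k with inl j => coord_re iU j | inr j => coord_im iU j end.

Lemma real_coord_sum u : u = \sum_k (real_coord k u)%:C *: real_basis k.
Proof.
rewrite {1}(eU2 u) big_split_ord /= -big_split /=; apply: eq_bigr => j _.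
have s1 : fintype.split (lshift dU j) = inl j := unsplitK (inl j : 'I_dU + 'I_dU).
have s2 : fintype.split (rshift dU j) = inr j := unsplitK (inr j : 'I_dU + 'I_dU).
by rewrite /real_coord /real_basis s1 s2 scale_complex.
Qed.

Lemma real_coord_rfunctional k : rfunctional (real_coord k).
Proof.
rewrite /real_coord; case: (fintype.split k) => j.
  exact: coord_re_rfunctional KU0 hKU j.
exact: coord_im_rfunctional KU0 hKU j.
Qed.

Lemma real_coord_le k u : `|real_coord k u| <= KU * rnorm u.
Proof.
rewrite /real_coord; case: (fintype.split k) => j; apply: le_trans (hKU u j); [exact: cabs_Re|exact: cabs_Im].
Qed.

(** The kernels are those of the entries of [h], and the output is a finite sum of
    convolutions with them. *)
Lemma BIBO_of_laplace (h : matrix_measure R dY dU) :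
  (forall s : R[i], half_plane 0%E s -> half_plane (growth_bound (sn_T S)) s ->
      forall u : U, iY (sn_G S s u) = laplace h s *m iU u) -> BIBO_stable S.
Proof.
move=> hL.
have ent (s : R) i j : 0 < s -> half_plane (growth_bound (sn_T S)) s%:C ->
    (iY (sn_G S s%:C (eU j))) i ord0 = laplace h s%:C i j.
  move=> s0 hs; have s0' : half_plane 0%E s%:C by rewrite /half_plane /= lte_fin.
  rewrite (hL _ s0' hs) eU1 mxE (bigD1 j)//= big1 ?addr0.
    by rewrite [X in _ * X]mxE !eqxx mulr1.
  by move=> k kj; rewrite [X in _ * X]mxE (negbTE kj) mulr0.
have im0 (s : R) : laplace_im s%:C = (fun=> 0).
  by apply/funext => t; rewrite /laplace_im /= mul0r sin0 mulr0 oppr0.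
have kr i j : kernel_bounded (pfun (re i) (eU j)).
  apply: (@pfun_hinge _ _ _ _ S b hb _ (fre i) (eU j) (mm_re h i j) 0) => s _ hs s0.
  by rewrite /coord_re (ent s i j s0 hs) mxE /= im0 charge_integral0 subr0.
have ki i j : kernel_bounded (pfun (im i) (eU j)).
  apply: (@pfun_hinge _ _ _ _ S b hb _ (fim i) (eU j) (mm_im h i j) 0) => s _ hs s0.
  by rewrite /coord_im (ent s i j s0 hs) mxE /= im0 charge_integral0 add0r.
have cr i j := continuous_pfun hb (fre i) (e := eU j); have ci i j := continuous_pfun hb (fim i) (e := eU j).
have krz i k : kernel_bounded (pfun (re i) (real_basis k)).
  rewrite /real_basis; case: (fintype.split k) => j; first exact: kr.
  by apply: (kernel_bounded_scale (ci i j) _ (ki i j)) => t;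
    exact: (pfun_i hb (fre i) (fim i) (eU j) (coord_re_i iY i)).
have kiz i k : kernel_bounded (pfun (im i) (real_basis k)).
  rewrite /real_basis; case: (fintype.split k) => j; first exact: ki.
  by apply: (kernel_bounded_scale (cr i j) _ (kr i j)) => t;
    exact: (pfun_i hb (fim i) (fre i) (eU j) (coord_im_i iY i)).
have ex (p : R -> R) : kernel_bounded p -> exists C : R, 0 <= C /\ forall v B t,
    bump_chain v -> 0 <= t -> (forall s, 0 <= s -> `|v 0%N s| <= B) ->
    `|rint t (fun s => v 2%N (t - s) * p s)| <= C * B by move=> [C C0 hC]; exists C.
have [Cr hCr] := choice (fun ik : 'I_dY * 'I_(dU + dU) => ex _ (krz ik.1 ik.2)).
have [Ci hCi] := choice (fun ik : 'I_dY * 'I_(dU + dU) => ex _ (kiz ik.1 ik.2)).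
pose c0 := \sum_(i < dY) (\sum_k (Cr (i, k) + Ci (i, k)) * KU) * rnorm (eY i).
have c00 : 0 <= c0.
  apply: sumr_ge0 => i _; rewrite mulr_ge0 ?rnorm_ge0//; apply: sumr_ge0 => k _.
  by rewrite mulr_ge0// addr_ge0 ?(hCr (i, k)).1 ?(hCi (i, k)).1.
have chain u : test_function u -> exists v : 'I_(dU + dU) -> nat -> R -> R,
    (forall k, bump_chain (v k)) /\ forall k t, 0 <= t -> v k 0%N t = real_coord k (u t).
  move=> ut; have [v hv] := choice (fun k => let: ex_intro2 v h1 h2 :=
    test_function_bump ut (real_coord_rfunctional k) in
    ex_intro (fun v => bump_chain v /\ forall t, 0 <= t -> v 0%N t = real_coord k (u t)) v (conj h1 h2)).
  by exists v; split=> k; have [] := hv k.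
have bound u x y B : classical_solution S u x y -> x 0 = 0 -> test_function u ->
    (forall t, 0 <= t -> rnorm (u t) <= B) -> forall t, 0 <= t -> rnorm (y t) <= c0 * B.
  move=> hs x0 ut hB t t0; have [v [bv vE]] := chain u ut.
  have uE s : 0 <= s -> u s = \sum_k (v k 0%N s)%:C *: real_basis k.
    by move=> s0; rewrite {1}(real_coord_sum (u s)); apply: eq_bigr => k _; rewrite vE.
  have vB k s : 0 <= s -> `|v k 0%N s| <= KU * B.
    by move=> s0; rewrite vE//; apply: (le_trans (real_coord_le _ _)); rewrite ler_wpM2l// hB.
  have oB (eta : Y -> R) (heta : rfunctional eta) (C : 'I_(dU + dU) -> R) :
      (forall k, `|rint t (fun s => v k 2%N (t - s) * pfun eta (real_basis k) s)| <= C k * (KU * B)) ->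
      `|eta (y t)| <= \sum_k C k * (KU * B).
    move=> hC; rewrite (output_formula hb heta bv uE hs x0 t0).
    by apply: (le_trans (ler_norm_sum _ _ _)); apply: ler_sum => k _; exact: hC.
  rewrite {1}(eY2 (y t)); apply: (le_trans (rnorm_sum _ _ _)).
  rewrite /c0 mulr_suml; apply: ler_sum => i _; rewrite rnormZ mulrAC ler_wpM2r ?rnorm_ge0//.
  apply: (le_trans (cabs_le _)).
  have h1 := oB _ (fre i) _ (fun k => (hCr (i, k)).2 _ _ _ (bv k) t0 (vB k)).
  have h2 := oB _ (fim i) _ (fun k => (hCi (i, k)).2 _ _ _ (bv k) t0 (vB k)).
  apply: (le_trans (lerD h1 h2)); rewrite -big_split /= mulr_suml.
  by apply: ler_sum => k _; rewrite -mulrDl mulrA.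
exists (c0 + 1); first by rewrite ltr_wpDl.
move=> u x y hs x0 ut; have [uc yc _] := hs; split => //.
  have [v [bv vE]] := chain u ut.
  have [B hB] := choice (fun k => let: ex_intro2 B h1 h2 := bump_bounded 0%N (bv k) in
    ex_intro (fun B : R => forall t, `|v k 0%N t| <= B) B h2).
  exists (c0 * \sum_k B k * rnorm (real_basis k)); apply: (bound u x y _ hs x0 ut) => t t0.
  rewrite {1}(real_coord_sum (u t)); apply: (le_trans (rnorm_sum _ _ _)); apply: ler_sum => k _.
  by rewrite rnormZr ler_wpM2r ?rnorm_ge0// -vE.
have c1 : 0 < c0 + 1 by rewrite ltr_wpDl.
case EL : (Linfty_norm u) => [r| |].
- have ur t : 0 <= t -> rnorm (u t) <= r.
    by move=> t0; rewrite -lee_fin -EL; exact: Linfty_ge.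
  have r0 : 0 <= r := le_trans (rnorm_ge0 (u 0)) (ur 0 (lexx 0)).
  rewrite -EFinM; apply: Linfty_le => t t0; apply: (le_trans (bound u x y r hs x0 ut ur t t0)).
  by rewrite ler_wpM2r// lerDl.
- by rewrite gt0_muley ?lte_fin// leey.
- by have := Linfty_ge uc (lexx 0); rewrite EL.
Qed.

End Equivalence.

Theorem theorem3p4 (R : realType) (dU dY : nat)
    (U X Y : completeNormedModType R[i])
    (iU : {linear U -> 'cV[R[i]]_dU}) (iY : {linear Y -> 'cV[R[i]]_dY})
    (iU_bij : bijective iU) (iY_bij : bijective iY)
    (S : system_node U X Y) :
  BIBO_stable S <->
  exists h : matrix_measure R dY dU, (mm_total_variation h < +oo)%E /\
    forall s : R[i],
      half_plane 0%E s -> half_plane (growth_bound (sn_T S)) s ->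
      forall u : U, iY (sn_G S s u) = laplace h s *m iU u.
Proof.
have [b hb] := growth_bound_lty (sn_T S).
have [eU [eU1 eU2 [KU KU0 hKU]]] := finite_basis iU_bij.
have [eY [eY1 eY2 [KY KY0 hKY]]] := finite_basis iY_bij.
split; first exact: (laplace_of_BIBO hb eU2 KY0 hKY).
move=> [h [_ hL]]; exact: (BIBO_of_laplace hb eU1 eU2 KU0 hKU eY2 KY0 hKY hL).
Qed.
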